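(* Let $\tau\in\mathbb{C}$ with $|\arg\tau|<\pi/2$, $q=e^{-2\pi\tau}$, $\hat q=e^{-2\pi/\tau}$. Let $\alpha,\beta,\mu,\nu$ be real and $k$ an integer, and suppose $\alpha,\beta\notin\mathbb{Z}$ if $k=1$. Then $$e(\alpha\mu)\bigl\{\delta(\beta)\psi(k,-\mu,\alpha)+\mathcal{S}_k(\beta,-\mu;\nu,\alpha;q)+(-1)^{k-1}\mathcal{S}_k(-\beta,\mu;-\nu,-\alpha;q)\bigr\}-(-2\pi)^k\sum_{j=0}^{k+1}\frac{(-i)^j\mathcal{C}_j(\langle\alpha\rangle,\widetilde{e}(\mu))\mathcal{C}_{k+1-j}(\langle\beta\rangle,\widetilde{e}(\nu))}{j!(k+1-j)!}\tau^{k-j}$$ $$=e(\beta\nu)(-i\tau)^{k-1}\bigl\{\delta(\alpha)\psi(k,\nu,-\beta)+\mathcal{S}_k(\alpha,\nu;\mu,-\beta;\hat q)+(-1)^{k-1}\mathcal{S}_k(-\alpha,-\nu;-\mu,\beta;\hat q)\bigr\},$$ and equivalently $$e(\beta\nu)\bigl\{\delta(\alpha)\psi(k,\nu,-\beta)+\mathcal{S}_k(\alpha,\nu;\mu,-\beta;q)+(-1)^{k-1}\mathcal{S}_k(-\alpha,-\nu;-\mu,\beta;q)\bigr\}-(-2\pi)^k\sum_{j=0}^{k+1}\frac{i^j\mathcal{C}_j(\langle\beta\rangle,\widetilde{e}(\nu))\mathcal{C}_{k+1-j}(\langle\alpha\rangle,\widetilde{e}(\mu))}{j!(k+1-j)!}\tau^{k-j}$$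 $$=e(\alpha\mu)(i\tau)^{k-1}\bigl\{\delta(\beta)\psi(k,-\mu,\alpha)+\mathcal{S}_k(\beta,-\mu;\nu,\alpha;\hat q)+(-1)^{k-1}\mathcal{S}_k(-\beta,\mu;-\nu,-\alpha;\hat q)\bigr\}.$$ (Sums $\sum_{j=0}^{k+1}$ with $k+1<0$ are empty.)
   Context: Notation: $e(x)=e^{2\pi ix}$; for real $x$, $\delta(x)=1$ if $x\in\mathbb{Z}$, else $0$; $\langle x\rangle=x-\lfloor x\rfloor$. $\psi(r,\gamma,\kappa)=\sum_{n\in\mathbb{Z},\,n>-\gamma}e\{(\gamma+n)\kappa\}(\gamma+n)^{-r}$ for $\operatorname{Re}r>1$, meromorphically continued to $\mathbb{C}$ (values at integers $r=k$ are those of the continuation). The numbers $\mathcal{C}_j(X,\widetilde{e}(\kappa))$ ($X\in\mathbb{C}$, $\kappa$ real, $j\ge0$) are defined by $\frac{Ze(X\kappa)e^{XZ}}{e(\kappa)e^Z-1}=\sum_{j\ge0}\mathcal{C}_j(X,\widetilde{e}(\kappa))Z^j/j!$ near $Z=0$. For $Q=e^{-2\pi T}$ with $\operatorname{Re}T>0$ (and $Q^x:=e^{-2\pi Tx}$), $\mathcal{S}_r(\gamma,\delta;\kappa,\lambda;Q)=\sum_{m>-\gamma,\,l>-\delta}e\{(\gamma+m)\kappa+(\delta+l)\lambda\}(\delta+l)^{-r}Q^{(\gamma+m)(\delta+l)}$ ($m,l\in\mathbb{Z}$). *)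

(* Defs.v *)
(* Stdlib reals with Coquelicot's complex numbers. *)
From Stdlib Require Import Reals ZArith ClassicalEpsilon.
From Coquelicot Require Import Coquelicot.

Open Scope C_scope.

Definition Cexp (z : C) : C :=
  (exp (Re z) * cos (Im z), exp (Re z) * sin (Im z))%R.

Definition e (x : C) : C := Cexp (2 * PI * Ci * x).

(* Principal argument, with values in (-PI, PI]; meaningful for z <> 0 only. *)
Definition Carg (z : C) : R :=
  if Rlt_dec (Im z) 0 then (- acos (Re z / Cmod z))%R
  else acos (Re z / Cmod z).

Definition Czpow (z : C) (k : Z) : C :=
  match k with
  | Z0 => 1
  | Zpos p => z ^ Pos.to_nat p
  | Zneg p => / z ^ Pos.to_nat p
  end.

(* x ^ r for real x > 0 and complex r. *)
Definition Rcpow (x : R) (r : C) : C := Cexp (r * ln x).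

Definition delta (x : R) : C :=
  if excluded_middle_informative (exists n : Z, x = IZR n) then 1 else 0.

Definition CSeries (a : nat -> C) : C :=
  (Series (fun n => Re (a n)), Series (fun n => Im (a n))).

(* The sum of F (gamma + n) over the integers n > - gamma, in increasing order:
   [up x] is the least integer strictly greater than x. *)
Definition shifted_sum (gamma : R) (F : R -> C) : C :=
  CSeries (fun i => F (gamma + IZR (up (- gamma) + Z.of_nat i))%R).

(* The sum of a j over 0 <= j <= K, empty when K < 0. *)
Definition sum_upto (K : Z) (a : nat -> C) : C :=
  if Z_lt_dec K 0 then 0 else @sum_n C_AbelianMonoid a (Z.to_nat K).

(* f has a Laurent expansion with finite principal part at every point.
   Removable singularities are excluded: f takes the right value wherever it
   has no pole (N = 0), and is unconstrained at its poles (N <> 0). *)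
Definition meromorphic (f : C -> C) : Prop :=
  forall z0 : C, exists (N : nat) (c : nat -> C) (rho : posreal),
    (forall z : C, (0 < Cmod (z - z0) < rho)%R ->
       @is_pseries C_AbsRing C_NormedModule c (z - z0) ((z - z0) ^ N * f z)) /\
    (N = 0%nat -> f z0 = c 0%nat) /\
    (N <> 0%nat -> c 0%nat <> 0).

Definition is_psi_continuation (gamma kappa : R) (f : C -> C) : Prop :=
  meromorphic f /\
  forall r : C, (1 < Re r)%R ->
    f r = shifted_sum gamma (fun x => e (x * kappa) * Rcpow x (- r)).

(* Such an f exists and is unique away from its poles. *)
Definition psi (r : C) (gamma kappa : R) : C :=
  epsilon (inhabits (fun _ : C => RtoC 0)) (is_psi_continuation gamma kappa) r.

Definition is_Ccoef (X : C) (kappa : R) (c : nat -> C) : Prop :=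
  exists rho : posreal, forall z : C, (0 < Cmod z < rho)%R ->
    @is_pseries C_AbsRing C_NormedModule (fun j => c j / INR (fact j)) z
      (z * e (X * kappa) * Cexp (X * z) / (e kappa * Cexp z - 1)).

(* The numbers C_j (X, e~ (kappa)). *)
Definition Ccoef (j : nat) (X : C) (kappa : R) : C :=
  epsilon (inhabits (fun _ : nat => RtoC 0)) (is_Ccoef X kappa) j.

(* S_r (gamma, delta; kappa, lambda; Q) for Q = exp (-2 PI T). The argument is
   T, which fixes the branch Q ^ x = exp (-2 PI T x). For Re T > 0 the double
   series converges absolutely, so it may be summed iteratively; x stands for
   gamma + m and y for delta + l. *)
Definition lambert (r : C) (gamma dlt kappa lambda : R) (T : C) : C :=
  shifted_sum dlt (fun y =>
    shifted_sum gamma (fun x =>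
      e (x * kappa + y * lambda) * Rcpow y (- r)
      * Cexp (- (2 * PI) * T * (x * y)))).

(* Main.v *)
Require Import Defs.
From Stdlib Require Import Reals ZArith Lra Lia List Permutation.
From Stdlib Require Import ClassicalEpsilon FunctionalExtensionality.
From Coquelicot Require Import Coquelicot.
Open Scope C_scope.

(* Put t = i tau and let gen X kappa be the generating function of the numbers
   C_j (X, e~ (kappa)) / j!, divided by z. Summing the inner geometric series turns the two
   Lambert series (and, when it is present, a convergent psi series) into one sum over the
   nonzero y in Z - mu of - e(y alpha) y^(-k) gen <beta> nu (2 pi i t y).

   For k >= 2 expand gen on both sides in partial fractions, which are limits of the elementary
   partial fractions of u^j / (u^N - 1). Both sides become iterated sums over the same pair of
   lattices, whose general terms agree, again by partial fractions, up to finitely many products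
   of a function of each lattice point; the latter sum up to the coefficients C_j. The double
   sums converge absolutely because the two lattices lie on different lines.

   For alpha, beta in (0,1), Taylor expansion in alpha of the case k = 2 gives the cases
   k = 1 and k = 0. The latter is an identity in w = alpha + t beta, of Kronecker type;
   expanding it along w = <alpha> + t <beta> + h (1 + t), h -> 0+, and comparing the
   coefficients of the powers of z = h (1 + t) gives the cases k = -K <= 0 for all real
   alpha, beta: the values psi(-K, gamma, kappa) are the Taylor coefficients of
   e(a (kappa + z)) / (1 - e(kappa + z)), a the least positive element of gamma + Z, and the
   poles of the two sides at z = 0, present when alpha and beta are integers, cancel.

   The continuation of psi comes from the binomial series, which expresses the Dirichlet
   series F(s) through F(s + 1), F(s + 2), ...; the same functional equation determines the
   values at s = -K by the recurrence that defines the coefficients of gen. The second formula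
   is the first one at 1 / tau. *)

(** * Unconditional sums *)

(** All series are treated as unconditional sums over arbitrary index types, so that reversing [Z],
    splitting it at [mu] and exchanging double sums are changes of index. The obstacle is
    convergence. The partial fractions of [gen] converge absolutely only after subtraction at a base
    point, and the exchange of sums leaves just enough decay when [k >= 2]; lower [k] must be
    reached through power series in an auxiliary displacement. These need exponential decay, which
    holds only when both fractional parts are nonzero. Displacing both of them by the same [h > 0]
    moves every point of the half-open square into the open one, so a single direction serves
    integral and non-integral parameters alike. Holomorphy enters only through power series whose
    coefficients have a bounded weighted norm. In place of analytic continuation, coefficients are
    compared whenever two such series agree at points tending to 0. The convention [/ 0 = 0] removes
    the lattice point 0 from sums of inverse powers. *)

Fixpoint fsum {I : Type} (f : I -> C) (L : list I) : C :=
  match L with nil => 0 | cons i L' => f i + fsum f L' end.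

Fixpoint nsum {I : Type} (f : I -> C) (L : list I) : R :=
  match L with nil => 0%R | cons i L' => (Cmod (f i) + nsum f L')%R end.

(** The bound is explicit because it later acts as a norm: for coefficients of power series it adds
    under sums and multiplies under products. *)
Definition asum {I : Type} (f : I -> C) (M : R) : Prop :=
  forall L, NoDup L -> (nsum f L <= M)%R.

Definition summable {I : Type} (f : I -> C) : Prop := exists M, asum f M.

Definition has_sum {I : Type} (f : I -> C) (s : C) : Prop :=
  forall eps : R, (0 < eps)%R -> exists L0 : list I,
    forall L, NoDup L -> incl L0 L -> (Cmod (fsum f L - s) < eps)%R.

Definition tsum {I : Type} (f : I -> C) : C :=
  epsilon (inhabits (RtoC 0)) (has_sum f).

Section Lists.
Context {I : Type}.
Implicit Types (f g : I -> C) (L : list I).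

Lemma fsum_app f L1 L2 : fsum f (L1 ++ L2) = fsum f L1 + fsum f L2.
Proof. induction L1 as [|i L1 IH]; simpl; [|rewrite IH]; ring. Qed.

Lemma nsum_app f L1 L2 : (nsum f (L1 ++ L2) = nsum f L1 + nsum f L2)%R.
Proof. induction L1 as [|i L1 IH]; simpl; [|rewrite IH]; ring. Qed.

Lemma nsum_ge0 f L : (0 <= nsum f L)%R.
Proof.
  induction L as [|i L IH]; simpl; [lra|].
  generalize (Cmod_ge_0 (f i)); lra.
Qed.

Lemma fsum_perm f L1 L2 : Permutation L1 L2 -> fsum f L1 = fsum f L2.
Proof. induction 1; simpl; try congruence; ring. Qed.

Lemma nsum_perm f L1 L2 : Permutation L1 L2 -> nsum f L1 = nsum f L2.
Proof. induction 1; simpl; try congruence; ring. Qed.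

Lemma fsum_le_nsum f L : (Cmod (fsum f L) <= nsum f L)%R.
Proof.
  induction L as [|i L IH]; simpl; [rewrite Cmod_0; lra|].
  eapply Rle_trans; [apply Cmod_triangle|lra].
Qed.

Lemma fsum_plus f g L : fsum (fun i => f i + g i) L = fsum f L + fsum g L.
Proof. induction L as [|i L IH]; simpl; [|rewrite IH]; ring. Qed.

Lemma fsum_scal (c : C) f L : fsum (fun i => c * f i) L = c * fsum f L.
Proof. induction L as [|i L IH]; simpl; [|rewrite IH]; ring. Qed.

Lemma nsum_le f g L :
  (forall i, In i L -> (Cmod (f i) <= Cmod (g i))%R) -> (nsum f L <= nsum g L)%R.
Proof.
  induction L as [|i L IH]; simpl; intros H; [lra|].
  apply Rplus_le_compat; auto.
Qed.

Lemma fsum_ext f g L : (forall i, In i L -> f i = g i) -> fsum f L = fsum g L.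
Proof.
  induction L as [|i L IH]; simpl; intros H; [easy|].
  rewrite H, IH; auto.
Qed.

Lemma nodup_incl_split L0 L :
  NoDup L0 -> incl L0 L -> exists L', Permutation L (L0 ++ L').
Proof.
  revert L; induction L0 as [|a L0 IH]; intros L H0 H; [now exists L|].
  destruct (in_split a L) as (l1 & l2 & ->); [apply H; simpl; auto|].
  inversion H0; subst.
  destruct (IH (l1 ++ l2)) as [L' HL']; auto.
  - intros b Hb. specialize (H b (or_intror Hb)).
    apply in_app_iff in H; simpl in H; apply in_app_iff.
    destruct H as [H|[H|H]]; auto; subst; easy.
  - exists L'. simpl.
    eapply perm_trans; [apply Permutation_sym, Permutation_middle|].
    now apply perm_skip.
Qed.

Lemma nodup_exists L : exists L', NoDup L' /\ forall i, In i L' <-> In i L.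
Proof.
  exists (nodup (fun x y => excluded_middle_informative (x = y)) L).
  split; [apply NoDup_nodup|intros; apply nodup_In].
Qed.

Lemma nodup_app L1 L2 :
  NoDup L1 -> NoDup L2 -> (forall i, In i L1 -> ~ In i L2) -> NoDup (L1 ++ L2).
Proof.
  induction L1 as [|a L1 IH]; simpl; intros H1 H2 H; auto.
  inversion H1; subst. constructor; [|apply IH; auto].
  rewrite in_app_iff. intros [?|?]; [easy|]. exact (H a (or_introl eq_refl) H0).
Qed.

Lemma nodup_app_inv L1 L2 :
  NoDup (L1 ++ L2) -> NoDup L1 /\ NoDup L2 /\ forall i, In i L1 -> ~ In i L2.
Proof.
  induction L1 as [|a L1 IH]; simpl; intros H.
  - repeat split; auto; constructor.
  - inversion H as [|? ? Ha Hd]; subst. destruct (IH Hd) as (h1 & h2 & h3).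
    rewrite in_app_iff in Ha.
    repeat split; auto; [constructor; auto|].
    intros i [->|Hi]; auto.
Qed.

End Lists.

Section Sums.
Context {I : Type}.
Implicit Types (f g : I -> C) (L : list I).

Lemma has_sum_unique f s1 s2 : has_sum f s1 -> has_sum f s2 -> s1 = s2.
Proof.
  intros H1 H2. apply NNPP; intros H.
  assert (Hp : (0 < Cmod (s1 - s2))%R) by (apply Cmod_gt_0, Cminus_eq_contra, H).
  destruct (H1 (Cmod (s1 - s2) / 2)%R) as [L1 h1]; [lra|].
  destruct (H2 (Cmod (s1 - s2) / 2)%R) as [L2 h2]; [lra|].
  destruct (nodup_exists (L1 ++ L2)) as (L & HL & HI).
  specialize (h1 L HL (fun i Hi => proj2 (HI i) (proj2 (in_app_iff _ _ _) (or_introl Hi)))).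
  specialize (h2 L HL (fun i Hi => proj2 (HI i) (proj2 (in_app_iff _ _ _) (or_intror Hi)))).
  assert (Cmod (s1 - s2) <= Cmod (fsum f L - s2) + Cmod (fsum f L - s1))%R; [|lra].
  rewrite <- (Cmod_opp (fsum f L - s1)).
  replace (s1 - s2) with ((fsum f L - s2) + - (fsum f L - s1)) by ring.
  apply Cmod_triangle.
Qed.

Lemma has_sum_tsum f s : has_sum f s -> tsum f = s.
Proof.
  intros H. apply (has_sum_unique f); auto.
  unfold tsum. apply epsilon_spec. now exists s.
Qed.

Lemma has_sum_ext f g s : (forall i, f i = g i) -> has_sum f s -> has_sum g s.
Proof.
  intros H. replace g with f; auto. now apply functional_extensionality.
Qed.

Lemma has_sum_plus f g s1 s2 :
  has_sum f s1 -> has_sum g s2 -> has_sum (fun i => f i + g i) (s1 + s2).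
Proof.
  intros H1 H2 eps Heps.
  destruct (H1 (eps / 2)%R) as [L1 h1]; [lra|].
  destruct (H2 (eps / 2)%R) as [L2 h2]; [lra|].
  exists (L1 ++ L2). intros L HL HI.
  specialize (h1 L HL (fun i Hi => HI i (proj2 (in_app_iff _ _ _) (or_introl Hi)))).
  specialize (h2 L HL (fun i Hi => HI i (proj2 (in_app_iff _ _ _) (or_intror Hi)))).
  rewrite fsum_plus.
  replace (fsum f L + fsum g L - (s1 + s2)) with ((fsum f L - s1) + (fsum g L - s2)) by ring.
  eapply Rle_lt_trans; [apply Cmod_triangle|lra].
Qed.

Lemma has_sum_scal (c : C) f s : has_sum f s -> has_sum (fun i => c * f i) (c * s).
Proof.
  intros H eps Heps.
  assert (Hc := Cmod_ge_0 c).
  destruct (H (eps / (Cmod c + 1))%R) as [L0 h]; [apply Rdiv_lt_0_compat; lra|].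
  exists L0; intros L HL HI. rewrite fsum_scal.
  replace (c * fsum f L - c * s) with (c * (fsum f L - s)) by ring.
  rewrite Cmod_mult. specialize (h L HL HI).
  apply Rle_lt_trans with ((Cmod c) * (eps / (Cmod c + 1)))%R.
  - apply Rmult_le_compat_l; lra.
  - apply Rmult_lt_reg_r with (Cmod c + 1)%R; [lra|]. field_simplify; [nra|lra].
Qed.

Lemma asum_ge0 f M : asum f M -> (0 <= M)%R.
Proof. intros H. apply (H nil). constructor. Qed.

Lemma asum_le f g M :
  (forall i, (Cmod (f i) <= Cmod (g i))%R) -> asum g M -> asum f M.
Proof.
  intros H Hg L HL. eapply Rle_trans; [|apply (Hg L HL)]. now apply nsum_le.
Qed.

Lemma asum_weaken f M M' : asum f M -> (M <= M')%R -> asum f M'.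
Proof. intros H HM L HL. eapply Rle_trans; eauto. Qed.

Lemma summable_le f g :
  (forall i, (Cmod (f i) <= Cmod (g i))%R) -> summable g -> summable f.
Proof. intros H [M HM]. exists M. eapply asum_le; eauto. Qed.

Lemma asum_plus f g M1 M2 :
  asum f M1 -> asum g M2 -> asum (fun i => f i + g i) (M1 + M2).
Proof.
  intros H1 H2 L HL.
  apply Rle_trans with (nsum f L + nsum g L)%R; [|apply Rplus_le_compat; auto].
  clear HL. induction L as [|i L IH]; simpl; [lra|].
  generalize (Cmod_triangle (f i) (g i)); lra.
Qed.

Lemma asum_scal (c : C) f M : asum f M -> asum (fun i => c * f i) (Cmod c * M).
Proof.
  intros H L HL.
  replace (nsum (fun i => c * f i) L) with (Cmod c * nsum f L)%R.
  - apply Rmult_le_compat_l; [apply Cmod_ge_0|auto].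
  - clear HL. induction L as [|i L IH]; simpl; [ring|]. rewrite <- IH, Cmod_mult. ring.
Qed.

Lemma summable_plus f g : summable f -> summable g -> summable (fun i => f i + g i).
Proof. intros [M1 H1] [M2 H2]. eexists. apply asum_plus; eauto. Qed.

Lemma summable_scal (c : C) f : summable f -> summable (fun i => c * f i).
Proof. intros [M H]. eexists. apply asum_scal; eauto. Qed.

Lemma summable_ext f g : (forall i, f i = g i) -> summable f -> summable g.
Proof. intros H. apply summable_le. intros i; rewrite H; lra. Qed.

Lemma summable_dom f (b : I -> R) :
  (forall i, (Cmod (f i) <= b i)%R) -> summable (fun i => RtoC (b i)) -> summable f.
Proof.
  intros H. apply summable_le. intros i. rewrite Cmod_R.
  eapply Rle_trans; [apply H|apply Rle_abs].
Qed.

Lemma asum_norm f M : asum f M -> asum (fun i => RtoC (Cmod (f i))) M.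
Proof.
  apply asum_le. intros i. rewrite Cmod_R, Rabs_pos_eq; [lra|apply Cmod_ge_0].
Qed.

(** The finite norm sums have a least upper bound; a list that comes within [eps] of it leaves at
    most [eps] to any list disjoint from it. *)
Lemma asum_tail f : summable f -> forall eps, (0 < eps)%R ->
  exists L0, NoDup L0 /\ forall L, NoDup L -> (forall i, In i L -> ~ In i L0) ->
    (nsum f L <= eps)%R.
Proof.
  intros [M HM] eps Heps.
  destruct (completeness (fun x => exists L, NoDup L /\ x = nsum f L)) as [S [HS1 HS2]].
  - exists M. intros x (L & HL & ->). auto.
  - exists 0%R, nil. split; [constructor|reflexivity].
  - destruct (classic (exists L, NoDup L /\ (nsum f L > S - eps)%R)) as [(L0 & HL0 & H)|H].
    + exists L0; split; auto. intros L HL Hd.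
      assert (nsum f (L0 ++ L) <= S)%R.
      { apply HS1. exists (L0 ++ L). split; auto. apply nodup_app; auto.
        intros i Hi Hi'. exact (Hd i Hi' Hi). }
      rewrite nsum_app in H0. lra.
    + exfalso. assert (S <= S - eps)%R; [|lra].
      apply HS2. intros x (L & HL & ->).
      apply Rnot_lt_le. intros Hlt. apply H. exists L. split; auto.
Qed.

Lemma nonneg_has_sum (p : I -> R) : (forall i, (0 <= p i)%R) ->
  summable (fun i => RtoC (p i)) -> exists s : R, has_sum (fun i => RtoC (p i)) s.
Proof.
  intros Hp HM.
  assert (E : forall L, fsum (fun i => RtoC (p i)) L = RtoC (nsum (fun i => RtoC (p i)) L)).
  { induction L as [|i L IH]; cbn [fsum nsum]; [easy|].
    rewrite IH, Cmod_R, (Rabs_pos_eq _ (Hp i)), RtoC_plus. easy. }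
  destruct HM as [M HM].
  set (f := fun i => RtoC (p i)) in *.
  destruct (completeness (fun x => exists L, NoDup L /\ x = nsum f L)) as [S [HS1 HS2]].
  - exists M. intros x (L & HL & ->). auto.
  - exists 0%R, nil. split; [constructor|reflexivity].
  - exists S. intros eps Heps.
    destruct (classic (exists L, NoDup L /\ (nsum f L > S - eps)%R)) as [(L0 & HL0 & H)|H].
    + exists L0. intros L HL HI.
      destruct (nodup_incl_split L0 L HL0 HI) as [L' HL'].
      assert (h1 : (nsum f L <= S)%R) by (apply HS1; eauto).
      assert (h2 : (nsum f L >= nsum f L0)%R).
      { rewrite (nsum_perm f _ _ HL'), nsum_app. generalize (nsum_ge0 f L'); lra. }
      rewrite E, <- RtoC_minus, Cmod_R. apply Rabs_def1; lra.
    + exfalso. assert (S <= S - eps)%R; [|lra].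
      apply HS2. intros x (L & HL & ->).
      apply Rnot_lt_le. intros Hlt. apply H. exists L. split; auto.
Qed.

(** Real and imaginary parts are treated separately. A real family [p] with [|p| <= |f|] is the
    difference of the nonnegative families [|f| + p] and [|f|], whose sums are suprema. *)
Lemma summable_has_sum f : summable f -> has_sum f (tsum f).
Proof.
  intros [M HM].
  assert (HN : summable (fun i => RtoC (Cmod (f i)))) by (exists M; now apply asum_norm).
  destruct (nonneg_has_sum (fun i => Cmod (f i)) (fun i => Cmod_ge_0 _) HN) as [s0 h0].
  assert (K : forall p : I -> R, (forall i, (Rabs (p i) <= Cmod (f i))%R) ->
    exists s : C, has_sum (fun i => RtoC (p i)) s).
  { intros p Hp.
    destruct (nonneg_has_sum (fun i => Cmod (f i) + p i)%R) as [s1 h1].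
    - intros i. specialize (Hp i). apply Rabs_le_between in Hp. lra.
    - destruct HN as [N HN']. exists (N + N)%R.
      eapply asum_le; [|apply (asum_plus _ _ _ _ HN' HN')].
      intros i. cbv beta. rewrite <- RtoC_plus, !Cmod_R.
      specialize (Hp i). apply Rabs_le_between in Hp.
      rewrite !Rabs_pos_eq; lra.
    - exists (s1 + (-1) * s0).
      eapply has_sum_ext; [|apply (has_sum_plus _ _ _ _ h1 (has_sum_scal (-1) _ _ h0))].
      intros i. cbv beta. rewrite RtoC_plus. ring. }
  destruct (K (fun i => Re (f i))) as [s1 h1].
  { intros i. apply re_le_Cmod. }
  destruct (K (fun i => Im (f i))) as [s2 h2].
  { intros i. eapply Rle_trans; [|apply Rmax_Cmod]. apply Rmax_r. }
  assert (H : has_sum f (s1 + Ci * s2)).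
  { eapply has_sum_ext; [|apply (has_sum_plus _ _ _ _ h1 (has_sum_scal Ci _ _ h2))].
    intros i. cbv beta. destruct (f i) as [x y]. unfold Ci, Cplus, Cmult, RtoC; simpl.
    f_equal; ring. }
  unfold tsum. apply epsilon_spec. eauto.
Qed.

Lemma tsum_ext f g : (forall i, f i = g i) -> tsum f = tsum g.
Proof. intros H. f_equal. now apply functional_extensionality. Qed.

Lemma tsum_plus f g : summable f -> summable g ->
  tsum (fun i => f i + g i) = tsum f + tsum g.
Proof.
  intros Hf Hg. apply has_sum_tsum, has_sum_plus; now apply summable_has_sum.
Qed.

Lemma tsum_scal (c : C) f : summable f -> tsum (fun i => c * f i) = c * tsum f.
Proof. intros Hf. apply has_sum_tsum, has_sum_scal. now apply summable_has_sum. Qed.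

Lemma summable_opp f : summable f -> summable (fun i => - f i).
Proof. apply summable_le. intros i; rewrite Cmod_opp; lra. Qed.

Lemma tsum_opp f : summable f -> tsum (fun i => - f i) = - tsum f.
Proof.
  intros H. replace (- tsum f) with ((-1) * tsum f) by ring.
  rewrite <- tsum_scal; auto. apply tsum_ext; intros; ring.
Qed.

Lemma summable_minus f g : summable f -> summable g -> summable (fun i => f i - g i).
Proof. intros Hf Hg. apply summable_plus; auto. now apply summable_opp. Qed.

Lemma tsum_minus f g : summable f -> summable g ->
  tsum (fun i => f i - g i) = tsum f - tsum g.
Proof.
  intros Hf Hg. unfold Cminus. rewrite tsum_plus, tsum_opp; auto. now apply summable_opp.
Qed.

Lemma asum_tsum f M : asum f M -> (Cmod (tsum f) <= M)%R.
Proof.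
  intros H. apply Rnot_lt_le; intros Hlt.
  assert (HS := summable_has_sum f (ex_intro _ M H)).
  destruct (HS (Cmod (tsum f) - M)%R) as [L0 h0]; [lra|].
  destruct (nodup_exists L0) as (L & HL & HI).
  specialize (h0 L HL (fun i Hi => proj2 (HI i) Hi)).
  specialize (H L HL). assert (h1 := fsum_le_nsum f L).
  assert (Cmod (tsum f) <= Cmod (fsum f L) + Cmod (fsum f L - tsum f))%R; [|lra].
  rewrite <- (Cmod_opp (fsum f L - tsum f)).
  replace (tsum f) with (fsum f L + - (fsum f L - tsum f)) at 1 by ring.
  apply Cmod_triangle.
Qed.

(** This is the least possible bound. The sum of the moduli is a complex number here, and the outer
    [Cmod] only reads it as a real. *)
Lemma asum_tsum_norm f : summable f ->
  asum f (Cmod (tsum (fun i => RtoC (Cmod (f i))))).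
Proof.
  intros [M HM] L HL.
  set (p := fun i => RtoC (Cmod (f i))).
  assert (HS : summable p) by (exists M; now apply asum_norm).
  apply Rnot_lt_le; intros Hlt.
  destruct (summable_has_sum p HS (nsum f L - Cmod (tsum p))%R) as [L0 h0]; [lra|].
  assert (E : forall L, fsum p L = RtoC (nsum f L)).
  { induction L1 as [|i L1 IH]; cbn [fsum nsum]; [easy|]. rewrite IH, RtoC_plus. easy. }
  destruct (nodup_exists (L ++ L0)) as (L1 & HL1 & HI1).
  destruct (nodup_incl_split L L1) as [L' HL']; auto.
  { intros i Hi. apply HI1, in_app_iff; auto. }
  specialize (h0 L1 HL1).
  assert (incl L0 L1) by (intros i Hi; apply HI1, in_app_iff; auto).
  specialize (h0 H). rewrite E in h0.
  assert (h2 : (nsum f L1 >= nsum f L)%R).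
  { rewrite (nsum_perm f _ _ HL'), nsum_app. generalize (nsum_ge0 f L'); lra. }
  assert (Cmod (RtoC (nsum f L1)) <= Cmod (RtoC (nsum f L1) - tsum p) + Cmod (tsum p))%R.
  { replace (RtoC (nsum f L1)) with ((RtoC (nsum f L1) - tsum p) + tsum p) at 1 by ring.
    apply Cmod_triangle. }
  rewrite Cmod_R, Rabs_pos_eq in H0; [lra|apply nsum_ge0].
Qed.

Lemma asum_zero f : (forall i, f i = 0) -> asum f 0.
Proof.
  intros H L _. induction L as [|i L IH]; cbn [nsum]; [lra|]. rewrite H, Cmod_0. lra.
Qed.

Lemma has_sum_0 : has_sum (fun _ : I => RtoC 0) 0.
Proof.
  intros eps Heps. exists nil. intros L _ _.
  replace (fsum (fun _ : I => RtoC 0) L) with (RtoC 0).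
  - replace (0 - 0) with (RtoC 0) by ring. now rewrite Cmod_0.
  - induction L as [|i L IH]; simpl; [|rewrite <- IH]; ring.
Qed.

End Sums.

Lemma nsum_map {I J : Type} (phi : J -> I) (f : I -> C) L :
  nsum f (map phi L) = nsum (fun j => f (phi j)) L.
Proof. induction L as [|j L IH]; simpl; [easy|]. now rewrite IH. Qed.

Lemma fsum_map {I J : Type} (phi : J -> I) (f : I -> C) L :
  fsum f (map phi L) = fsum (fun j => f (phi j)) L.
Proof. induction L as [|j L IH]; simpl; [easy|]. now rewrite IH. Qed.

Section Injection.
Context {I J : Type} (phi : J -> I) (phi_inj : forall j j', phi j = phi j' -> j = j').

Lemma nodup_map_inj L : NoDup L -> NoDup (map phi L).
Proof.
  induction 1; simpl; constructor; auto.
  rewrite in_map_iff. intros (y & Hy & Hin). apply phi_inj in Hy; now subst.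
Qed.

Lemma asum_inj (f : I -> C) M : asum f M -> asum (fun j => f (phi j)) M.
Proof. intros H L HL. rewrite <- nsum_map. now apply H, nodup_map_inj. Qed.

Lemma summable_inj (f : I -> C) : summable f -> summable (fun j => f (phi j)).
Proof. intros [M HM]. exists M. now apply asum_inj. Qed.

(** Entries outside the range of [phi] contribute 0 and are dropped; the others are pulled back. All
    changes of index rest on this. *)
Lemma preimage_list (f : I -> C) (Hf : forall i, f i <> 0 -> exists j, phi j = i) L :
  NoDup L -> exists L', NoDup L' /\ (forall j, In j L' <-> In (phi j) L) /\
    fsum f L = fsum (fun j => f (phi j)) L' /\ nsum f L = nsum (fun j => f (phi j)) L'.
Proof.
  induction 1 as [|i L Hi HL IH].
  - exists nil. repeat split; simpl; auto; constructor.
  - destruct IH as (L' & h1 & h2 & h3 & h4).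
    destruct (classic (exists j, phi j = i)) as [[j Hj]|Hj].
    + exists (cons j L'). repeat split; simpl.
      * constructor; auto. rewrite h2, Hj. auto.
      * intros [<-|H]; [auto|right; now apply h2].
      * intros [H|H]; [left; apply phi_inj; congruence|right; now apply h2].
      * now rewrite Hj, h3.
      * now rewrite Hj, h4.
    + exists L'. assert (E : f i = 0).
      { apply NNPP; intros H. now apply Hj, Hf. }
      repeat split; auto; simpl.
      * intros H. right. now apply h2.
      * intros [H|H]; [exfalso; eauto|now apply h2].
      * rewrite E, h3. ring.
      * rewrite E, h4, Cmod_0. ring.
Qed.

Lemma asum_inj_inv (f : I -> C) M : (forall i, f i <> 0 -> exists j, phi j = i) ->
  asum (fun j => f (phi j)) M -> asum f M.
Proof.
  intros Hf H L HL. destruct (preimage_list f Hf L HL) as (L' & h1 & _ & _ & ->). auto.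
Qed.

Lemma summable_inj_inv (f : I -> C) : (forall i, f i <> 0 -> exists j, phi j = i) ->
  summable (fun j => f (phi j)) -> summable f.
Proof. intros Hf [M H]. exists M. now apply asum_inj_inv. Qed.

Lemma tsum_inj (f : I -> C) : (forall i, f i <> 0 -> exists j, phi j = i) ->
  summable f -> tsum f = tsum (fun j => f (phi j)).
Proof.
  intros Hf HS. apply has_sum_tsum. intros eps Heps.
  destruct (summable_has_sum _ (summable_inj f HS) eps Heps) as [L0 h0].
  exists (map phi L0). intros L HL HI.
  destruct (preimage_list f Hf L HL) as (L' & h1 & h2 & -> & _).
  apply h0; auto. intros j Hj. apply h2, HI. now apply in_map.
Qed.

End Injection.

Lemma fsum_fin {I : Type} (f : I -> C) (L L1 : list I) : NoDup L ->
  (forall i, ~ In i L -> f i = 0) -> NoDup L1 -> incl L L1 ->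
  fsum f L1 = fsum f L /\ nsum f L1 = nsum f L.
Proof.
  intros HL Hf H1 HI. destruct (nodup_incl_split L L1 HL HI) as [L' HL'].
  assert (H := Permutation_NoDup HL' H1).
  apply nodup_app_inv in H. destruct H as (_ & _ & Hd).
  rewrite (fsum_perm f _ _ HL'), (nsum_perm f _ _ HL'), fsum_app, nsum_app.
  assert (Z : forall L2, (forall i, In i L2 -> ~ In i L) -> fsum f L2 = 0 /\ nsum f L2 = 0%R).
  { induction L2 as [|a L2 IH]; simpl; intros Hx; [auto|].
    destruct IH as [-> ->]; auto. rewrite Hf, Cmod_0; auto. split; ring. }
  destruct (Z L') as [-> ->].
  - intros i Hi Hi'. exact (Hd i Hi' Hi).
  - split; ring.
Qed.

Lemma asum_fin {I : Type} (f : I -> C) (L : list I) : NoDup L ->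
  (forall i, ~ In i L -> f i = 0) -> asum f (nsum f L).
Proof.
  intros HL Hf L1 H1.
  destruct (nodup_exists (L1 ++ L)) as (L2 & H2 & HI2).
  destruct (fsum_fin f L L2 HL Hf H2) as [_ <-].
  { intros i Hi. apply HI2, in_app_iff; auto. }
  destruct (nodup_incl_split L1 L2 H1) as [L' HL'].
  { intros i Hi. apply HI2, in_app_iff; auto. }
  rewrite (nsum_perm f _ _ HL'), nsum_app. generalize (nsum_ge0 f L'); lra.
Qed.

Lemma tsum_fin {I : Type} (f : I -> C) (L : list I) : NoDup L ->
  (forall i, ~ In i L -> f i = 0) -> summable f /\ tsum f = fsum f L.
Proof.
  intros HL Hf. split; [exists (nsum f L); now apply asum_fin|].
  apply has_sum_tsum. intros eps Heps. exists L. intros L1 H1 HI.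
  destruct (fsum_fin f L L1 HL Hf H1 HI) as [-> _].
  replace (fsum f L - fsum f L) with (RtoC 0) by ring. now rewrite Cmod_0.
Qed.

Lemma tsum_single {I : Type} (f : I -> C) (i0 : I) :
  (forall i, i <> i0 -> f i = 0) -> summable f /\ tsum f = f i0.
Proof.
  intros H. destruct (tsum_fin f (cons i0 nil)) as [h1 h2].
  - constructor; [auto|constructor].
  - intros i Hi. apply H. intros ->. apply Hi; simpl; auto.
  - split; auto. rewrite h2. simpl. ring.
Qed.

Definition indic (P : Prop) : C := if excluded_middle_informative P then 1 else 0.

Lemma indic_true P : P -> indic P = 1.
Proof. intros H. unfold indic. now destruct excluded_middle_informative. Qed.

Lemma indic_false P : ~ P -> indic P = 0.
Proof. intros H. unfold indic. now destruct excluded_middle_informative. Qed.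

Lemma Cmod_indic_le P c : (Cmod (indic P * c) <= Cmod c)%R.
Proof.
  rewrite Cmod_mult. unfold indic. destruct excluded_middle_informative.
  - rewrite Cmod_1; lra.
  - rewrite Cmod_0. generalize (Cmod_ge_0 c); lra.
Qed.

Lemma tsum_indic_list {I : Type} (d : I -> C) (A : list I) : NoDup A ->
  summable (fun i => indic (In i A) * d i) /\ tsum (fun i => indic (In i A) * d i) = fsum d A.
Proof.
  intros HA. destruct (tsum_fin (fun i => indic (In i A) * d i) A HA) as [h1 h2].
  - intros i Hi. rewrite indic_false; [ring|exact Hi].
  - split; auto. rewrite h2. apply fsum_ext. intros i Hi. rewrite indic_true; auto; ring.
Qed.

Section Product.
Context {I J : Type}.
Implicit Types (f : I * J -> C).

Lemma pair_inj_l (i : I) (j j' : J) : (i, j) = (i, j') -> j = j'.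
Proof. congruence. Qed.

Lemma summable_slice f i : summable f -> summable (fun j => f (i, j)).
Proof. apply (summable_inj (fun j => (i, j)) (pair_inj_l i)). Qed.

(** By induction on [A], the sum of the moduli over the strips with first index in [A] dominates the
    norm sum of the slice sums, and it is itself at most [M]. *)
Lemma asum_outer f M : asum f M -> asum (fun i => tsum (fun j => f (i, j))) M.
Proof.
  intros HM A HA.
  set (g := fun i => tsum (fun j => f (i, j))).
  assert (B : asum (fun p : I * J => RtoC (Cmod (f p))) M) by now apply asum_norm.
  set (q := fun p : I * J => RtoC (Cmod (f p))) in *.
  assert (N : forall A, NoDup A ->
    asum (fun p : I * J => indic (In (fst p) A) * q p) M) by
    (intros A' _; eapply asum_le; [|apply B]; intros p; apply Cmod_indic_le).
  assert (E : forall A, NoDup A -> (nsum g A <= Cmod (tsum (fun p => (indic (In (fst p) A) * q p)%C)))%R).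
  { clear A HA.
    assert (E' : forall A, NoDup A -> exists r : R, tsum (fun p => indic (In (fst p) A) * q p) = RtoC r
       /\ (nsum g A <= r)%R).
    { induction 1 as [|i A Hi HA (r & IH1 & IH2)].
      - exists 0%R. split; [|simpl; lra].
        rewrite <- (has_sum_tsum _ _ (@has_sum_0 (I * J))). apply tsum_ext.
        intros p. rewrite indic_false; [ring|auto].
      - assert (Sq : summable q) by (exists M; auto).
        assert (Sf : summable f) by (exists M; auto).
        destruct (nonneg_has_sum (fun j => Cmod (f (i, j))) (fun j => Cmod_ge_0 _)) as [s Hs].
        { apply (summable_slice q i Sq). }
        exists (s + r)%R. split.
        + rewrite RtoC_plus, <- IH1.
          assert (T : tsum (fun p : I * J => indic (fst p = i) * q p) = s).
          { rewrite (tsum_inj (fun j => (i, j)) (pair_inj_l i)).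
            - apply has_sum_tsum. eapply has_sum_ext; [|apply Hs].
              intros j. cbn [fst]. rewrite indic_true; auto. unfold q. ring.
            - intros [i' j] H. exists j. cbn [fst] in H.
              apply NNPP; intros Hne. apply H. rewrite indic_false; [ring|congruence].
            - eapply summable_le; [|apply Sq]. intros p; apply Cmod_indic_le. }
          rewrite <- T, <- tsum_plus.
          * apply tsum_ext. intros p. simpl In.
            destruct (classic (fst p = i)) as [->|Hne].
            -- rewrite !(indic_true (_ = _)), indic_true, indic_false; auto. ring.
            -- rewrite (indic_false (fst p = i)); auto.
               destruct (classic (In (fst p) A)).
               ++ rewrite !indic_true; auto. ring.
               ++ rewrite !indic_false; auto; [ring|]. intros [H1|H1]; auto.
          * eapply summable_le; [|apply Sq]. intros p; apply Cmod_indic_le.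
          * exists M. auto.
        + simpl. apply Rplus_le_compat; auto. unfold g.
          assert (Hsn : (0 <= s)%R).
          { apply Rnot_lt_le; intros Hlt.
            destruct (Hs (- s)%R) as [L0 hL0]; [lra|].
            destruct (nodup_exists L0) as (L & HL & HI).
            specialize (hL0 L HL (fun j Hj => proj2 (HI j) Hj)).
            assert (EE : fsum (fun j => RtoC (Cmod (f (i, j)))) L = RtoC (nsum (fun j => f (i, j)) L)).
            { clear. induction L as [|j L IH]; cbn [fsum nsum]; [easy|]. rewrite IH, RtoC_plus. easy. }
            rewrite EE, <- RtoC_minus, Cmod_R in hL0.
            apply Rabs_lt_between in hL0.
            generalize (nsum_ge0 (fun j => f (i, j)) L). lra. }
          apply asum_tsum. 
          replace s with (Cmod (tsum (fun j => RtoC (Cmod (f (i, j)))))).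
          * apply asum_tsum_norm, summable_slice, Sf.
          * rewrite (has_sum_tsum _ _ Hs), Cmod_R. now apply Rabs_pos_eq. }
    intros A HA. destruct (E' A HA) as (r & -> & Hr). rewrite Cmod_R.
    eapply Rle_trans; [apply Hr|apply Rle_abs]. }
  eapply Rle_trans; [apply E, HA|]. apply asum_tsum. auto.
Qed.

(** Off a finite list [L0] the family has norm at most [eps / 2]. As soon as [A] contains the first
    coordinates of [L0], the sum over the strips above [A] differs from the full sum only by terms
    off [L0]. *)
Lemma tsum_prod f : summable f ->
  summable (fun i => tsum (fun j => f (i, j))) /\
  tsum f = tsum (fun i => tsum (fun j => f (i, j))).
Proof.
  intros HS.
  set (g := fun i => tsum (fun j => f (i, j))).
  assert (Hslice : forall i, summable (fun p : I * J => indic (fst p = i) * f p) /\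
      tsum (fun p => indic (fst p = i) * f p) = g i).
  { intros i.
    assert (h : summable (fun p : I * J => indic (fst p = i) * f p)).
    { eapply summable_le; [|apply HS]. intros p; apply Cmod_indic_le. }
    split; auto.
    rewrite (tsum_inj (fun j => (i, j)) (pair_inj_l i)); auto.
    - apply tsum_ext. intros j. cbn [fst]. rewrite indic_true; auto. ring.
    - intros [i' j] H. exists j. cbn [fst] in H.
      apply NNPP; intros Hne. apply H. rewrite indic_false; [ring|congruence]. }
  assert (Hg : forall A, NoDup A ->
    summable (fun p : I * J => indic (In (fst p) A) * f p) /\
    tsum (fun p => indic (In (fst p) A) * f p) = fsum g A).
  { induction 1 as [|i A Hi HA [IH1 IH2]].
    - simpl. split.
      + eapply summable_le; [|apply HS]. intros p; apply Cmod_indic_le.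
      + rewrite <- (has_sum_tsum _ _ (@has_sum_0 (I * J))). apply tsum_ext.
        intros p. rewrite indic_false; [ring|auto].
    - split.
      + eapply summable_le; [|apply HS]. intros p; apply Cmod_indic_le.
      + simpl fsum. destruct (Hslice i) as [h1 <-]. rewrite <- IH2, <- tsum_plus; auto.
        apply tsum_ext. intros p. simpl In.
        destruct (classic (fst p = i)) as [->|Hne].
        * rewrite !(indic_true (_ = _)), indic_true, indic_false; auto. ring.
        * rewrite (indic_false (fst p = i)); auto.
          destruct (classic (In (fst p) A)).
          -- rewrite !indic_true; auto. ring.
          -- rewrite !indic_false; auto; [ring|]. intros [H1|H1]; auto. }
  assert (HG : has_sum g (tsum f)).
  { intros eps Heps.
    destruct (asum_tail f HS (eps / 2)%R) as (L0 & h0 & h1); [lra|].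
    exists (map fst L0). intros A HA HI. destruct (Hg A HA) as [k1 <-].
    rewrite <- tsum_minus; auto.
    apply Rle_lt_trans with (eps / 2)%R; [|lra].
    apply asum_tsum. intros L HL.
    set (h := fun p : I * J => indic (In (fst p) A) * f p - f p).
    assert (Hh : forall p, In p L0 -> h p = 0).
    { intros p Hp. unfold h. rewrite indic_true; [ring|]. apply HI, in_map, Hp. }
    assert (Hle : forall p, (Cmod (h p) <= Cmod (f p))%R).
    { intros p. unfold h. destruct (classic (In (fst p) A)).
      - rewrite indic_true; auto. replace (1 * f p - f p) with (RtoC 0) by ring.
        rewrite Cmod_0. apply Cmod_ge_0.
      - rewrite indic_false; auto. replace (0 * f p - f p) with (- f p) by ring.
        rewrite Cmod_opp; lra. }
    apply Rle_trans with
      (nsum f (filter (fun p => if excluded_middle_informative (In p L0) then false else true) L)).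
    - clear HL. induction L as [|p L IH]; simpl; [lra|].
      destruct excluded_middle_informative as [Hin|Hin].
      + rewrite Hh, Cmod_0; auto. lra.
      + simpl. specialize (Hle p). unfold h in *. lra.
    - apply h1; [now apply NoDup_filter|].
      intros p Hp. apply filter_In in Hp. destruct Hp as [_ Hp].
      now destruct excluded_middle_informative. }
  split; [|symmetry; now apply has_sum_tsum].
  destruct HS as [M HM]. exists M. now apply asum_outer.
Qed.

(** A list of pairs is split by first coordinate; each fibre is a duplicate-free list of second
    coordinates, hence bounded by [M i]. *)
Lemma asum_prod f (M : I -> R) B :
  (forall i, asum (fun j => f (i, j)) (M i)) -> asum (fun i => RtoC (M i)) B -> asum f B.
Proof.
  intros HM HB L HL.
  destruct (nodup_exists (map fst L)) as (A & HA & HI).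
  apply Rle_trans with (nsum (fun i => RtoC (M i)) A); [|auto].
  assert (HIL : forall p, In p L -> In (fst p) A) by (intros p Hp; apply HI, in_map, Hp).
  clear HI HB. revert L HL HIL. induction HA as [|i A Hi HA IH]; intros L HL HIL.
  - destruct L as [|p L]; simpl; [lra|]. destruct (HIL p); simpl; auto.
  - set (P := fun p : I * J => if excluded_middle_informative (fst p = i) then true else false).
    assert (E : forall L, (nsum f L = nsum f (filter P L) + nsum f (filter (fun p => negb (P p)) L))%R).
    { clear. induction L as [|p L IH]; simpl; [ring|].
      rewrite IH. destruct (P p); simpl; ring. }
    rewrite E. simpl. apply Rplus_le_compat.
    + rewrite Cmod_R, Rabs_pos_eq by apply (asum_ge0 _ _ (HM i)).
      assert (Hall : forall p, In p (filter P L) -> fst p = i).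
      { intros p Hp. apply filter_In in Hp. destruct Hp as [_ Hp]. unfold P in Hp.
        now destruct excluded_middle_informative. }
      assert (Hn : NoDup (filter P L)) by now apply NoDup_filter.
      revert Hall Hn. generalize (filter P L). intros K Hall Hn.
      replace (nsum f K) with (nsum (fun j => f (i, j)) (map snd K)).
      * apply HM. clear -Hall Hn. induction Hn as [|[i' j] K Hx Hn IH]; simpl; constructor.
        -- rewrite in_map_iff. intros ([i'' j'] & Hj & Hin). simpl in Hj. subst.
           assert (i'' = i) by (apply (Hall (i'', j)); simpl; auto).
           assert (i' = i) by (apply (Hall (i', j)); simpl; auto). now subst.
        -- apply IH. intros p Hp. apply Hall. simpl; auto.
      * clear -Hall. induction K as [|[i' j] K IH]; simpl; [easy|].
        rewrite IH; [|intros p Hp; apply Hall; simpl; auto].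
        replace i' with i; [easy|]. symmetry. apply (Hall (i', j)). simpl; auto.
    + apply IH; [now apply NoDup_filter|].
      intros p Hp. apply filter_In in Hp. destruct Hp as [Hp Hn].
      destruct (HIL p Hp) as [H|H]; auto. subst i. unfold P in Hn.
      destruct excluded_middle_informative; [discriminate|easy].
Qed.

End Product.

Lemma tsum_swap {I J : Type} (f : I -> J -> C) :
  summable (fun p : I * J => f (fst p) (snd p)) ->
  tsum (fun i => tsum (fun j => f i j)) = tsum (fun j => tsum (fun i => f i j)).
Proof.
  intros HS.
  set (F := fun p : I * J => f (fst p) (snd p)) in *.
  set (sw := fun q : J * I => (snd q, fst q)).
  assert (Hi : forall q q', sw q = sw q' -> q = q').
  { intros [a b] [c d]. unfold sw; simpl. congruence. }
  assert (HS' : summable (fun q => F (sw q))) by now apply summable_inj.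
  transitivity (tsum F). { symmetry. apply (tsum_prod F HS). }
  transitivity (tsum (fun q => F (sw q))).
  - apply tsum_inj; auto. intros [i j] _. now exists (j, i).
  - apply (tsum_prod _ HS').
Qed.

Lemma summable_prod_mult {I J : Type} (f : I -> C) (g : J -> C) :
  summable f -> summable g -> summable (fun p : I * J => f (fst p) * g (snd p)).
Proof.
  intros [M HM] [N HN]. exists (M * N)%R.
  apply (asum_prod _ (fun i => (Cmod (f i) * N)%R)).
  - intros i. cbn [fst snd]. apply asum_scal, HN.
  - apply asum_le with (fun i => RtoC N * f i).
    + intros i. rewrite Cmod_mult, !Cmod_R, Rabs_mult.
      rewrite (Rabs_pos_eq (Cmod (f i))) by apply Cmod_ge_0. lra.
    + replace (M * N)%R with (Cmod N * M)%R.
      * now apply asum_scal.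
      * rewrite Cmod_R, (Rabs_pos_eq N) by apply (asum_ge0 _ _ HN). ring.
Qed.

(** * Unconditional sums over the naturals and ordinary series *)

Lemma is_series_C (f : nat -> C) (s : C) :
  (forall eps : R, (0 < eps)%R -> exists N, forall n, (N <= n)%nat ->
    (Cmod (sum_n f n - s) < eps)%R) ->
  @is_series C_AbsRing C_NormedModule f s.
Proof.
  intros H. unfold is_series.
  apply (filterlim_locally (F := eventually) (U := C_UniformSpace)).
  intros eps. destruct (H eps (cond_pos eps)) as [N HN].
  exists N. intros n Hn. apply C_NormedModule_mixin_compat1. now apply HN.
Qed.

Lemma is_series_C_inv (f : nat -> C) (s : C) :
  @is_series C_AbsRing C_NormedModule f s ->
  forall eps : R, (0 < eps)%R -> exists N, forall n, (N <= n)%nat ->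
    (Cmod (sum_n f n - s) < eps)%R.
Proof.
  intros H eps Heps.
  (* Balls of the uniform structure on [C] are taken coordinate by coordinate; [sqrt 2] is the cost
     of returning to the modulus. *)
  assert (H2 : (0 < eps / sqrt 2)%R).
  { apply Rdiv_lt_0_compat; auto. apply sqrt_lt_R0; lra. }
  assert (HL := proj1 (filterlim_locally (F := eventually) (U := C_UniformSpace) _ _) H
    (mkposreal _ H2)).
  destruct HL as [N HN]. exists N. intros n Hn. specialize (HN n Hn).
  apply (C_NormedModule_mixin_compat2 _ _ _) in HN. simpl in HN.
  eapply Rlt_le_trans; [exact HN|]. right. field.
  apply Rgt_not_eq, sqrt_lt_R0; lra.
Qed.

Lemma sum_n_fsum (f : nat -> C) n : sum_n f n = fsum f (seq 0 (S n)).
Proof.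
  induction n as [|n IH].
  - rewrite sum_O. simpl. ring.
  - rewrite sum_Sn, IH, (seq_S (S n)), fsum_app. simpl. unfold plus; simpl. ring.
Qed.

Lemma tsum_is_series (f : nat -> C) : summable f ->
  @is_series C_AbsRing C_NormedModule f (tsum f).
Proof.
  intros H. apply is_series_C. intros eps Heps.
  destruct (summable_has_sum f H eps Heps) as [L0 HL].
  exists (list_max L0). intros n Hn. rewrite sum_n_fsum.
  apply HL; [apply seq_NoDup|].
  intros i Hi. apply in_seq. split; [lia|].
  assert (h := proj1 (list_max_le L0 _) (le_n _)).
  rewrite Forall_forall in h. specialize (h i Hi). lia.
Qed.

Lemma is_series_C_parts (f : nat -> C) (s : C) :
  @is_series C_AbsRing C_NormedModule f s ->
  is_series (fun n => Re (f n)) (Re s) /\ is_series (fun n => Im (f n)) (Im s).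
Proof.
  intros H.
  assert (E : forall n, sum_n (fun n => Re (f n)) n = Re (sum_n f n) /\
                        sum_n (fun n => Im (f n)) n = Im (sum_n f n)).
  { induction n as [|n [IH1 IH2]]; [now rewrite !sum_O|].
    rewrite !sum_Sn, IH1, IH2. now split. }
  assert (HI := is_series_C_inv f s H).
  split; apply (filterlim_locally (F := eventually)); intros eps;
    destruct (HI eps (cond_pos eps)) as [N HN]; exists N; intros n Hn;
    destruct (E n) as [E1 E2]; specialize (HN n Hn).
  - change (Rabs (sum_n (fun n => Re (f n)) n - Re s) < eps)%R. rewrite E1. eapply Rle_lt_trans; [|apply HN]. apply (re_le_Cmod (sum_n f n - s)).
  - change (Rabs (sum_n (fun n => Im (f n)) n - Im s) < eps)%R. rewrite E2.
    eapply Rle_lt_trans; [|apply HN].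
    eapply Rle_trans; [|apply (Rmax_Cmod (sum_n f n - s))]. apply Rmax_r.
Qed.

Lemma is_series_C_unique (f : nat -> C) (s1 s2 : C) :
  @is_series C_AbsRing C_NormedModule f s1 ->
  @is_series C_AbsRing C_NormedModule f s2 -> s1 = s2.
Proof.
  intros H1 H2. apply is_series_C_parts in H1, H2.
  destruct s1, s2. simpl in *. f_equal.
  - rewrite <- (is_series_unique _ _ (proj1 H1)). now apply is_series_unique.
  - rewrite <- (is_series_unique _ _ (proj2 H1)). now apply is_series_unique.
Qed.

(** The bridge from the iterated series in the definitions of [psi] and [lambert] to unconditional
    sums. *)
Lemma CSeries_tsum (f : nat -> C) : summable f -> CSeries f = tsum f.
Proof.
  intros H. destruct (is_series_C_parts _ _ (tsum_is_series f H)) as [h1 h2].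
  unfold CSeries. rewrite (is_series_unique _ _ h1), (is_series_unique _ _ h2).
  now destruct (tsum f).
Qed.

Lemma nsum_seq (p : nat -> R) : (forall n, (0 <= p n)%R) -> forall n,
  sum_n p n = nsum (fun n => RtoC (p n)) (seq 0 (S n)).
Proof.
  intros Hp. induction n as [|n IH].
  - rewrite sum_O. simpl. rewrite Cmod_R, Rabs_pos_eq; auto. ring.
  - rewrite sum_Sn, IH, (seq_S (S n)), nsum_app.
    cbn [nsum]. rewrite Cmod_R, Rabs_pos_eq; auto. unfold plus; simpl. ring.
Qed.

Lemma asum_nat_bound (f : nat -> C) M : (forall n, (nsum f (seq 0 (S n)) <= M)%R) -> asum f M.
Proof.
  intros H L HL. eapply Rle_trans; [|apply (H (list_max L))].
  destruct (nodup_incl_split L (seq 0 (S (list_max L)))) as [L' HL']; auto.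
  - intros i Hi. apply in_seq. split; [lia|].
    assert (h := proj1 (list_max_le L _) (le_n _)).
    rewrite Forall_forall in h. specialize (h i Hi). lia.
  - rewrite (nsum_perm f _ _ HL'), nsum_app. generalize (nsum_ge0 f L'); lra.
Qed.

Lemma summable_nat_bound (p : nat -> R) M : (forall n, (0 <= p n)%R) ->
  (forall n, (sum_n p n <= M)%R) -> asum (fun n => RtoC (p n)) M.
Proof. intros Hp H. apply asum_nat_bound. intros n. rewrite <- nsum_seq; auto. Qed.

Lemma ex_series_summable (p : nat -> R) : (forall n, (0 <= p n)%R) ->
  ex_series p -> summable (fun n => RtoC (p n)).
Proof.
  intros Hp [l Hl]. exists l. apply summable_nat_bound; auto.
  intros n. apply (is_lim_seq_incr_compare (sum_n p) l).
  - exact Hl.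
  - intros m. rewrite sum_Sn. unfold plus; simpl. specialize (Hp (S m)); lra.
Qed.

Definition Clim (u : nat -> C) (l : C) : Prop :=
  forall eps : R, (0 < eps)%R -> exists N, forall n, (N <= n)%nat -> (Cmod (u n - l) < eps)%R.

(** Tannery's theorem. Domination is required only from [N0] on and off the finite list [L0],
    because the majorant used for the partial fractions fails at the poles of small index. *)
Lemma tsum_dominated {I : Type} (F : nat -> I -> C) (f : I -> C) (g : I -> R) (L0 : list I) (N0 : nat) :
  summable (fun i => RtoC (g i)) ->
  (forall n, summable (F n)) ->
  (forall i, Clim (fun n => F n i) (f i)) ->
  (forall n i, (N0 <= n)%nat -> ~ In i L0 -> (Cmod (F n i) <= g i)%R) ->
  summable f /\ Clim (fun n => tsum (F n)) (tsum f).
Proof.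
  intros Hg HF Hlim Hdom.
  assert (Hf : forall i, ~ In i L0 -> (Cmod (f i) <= g i)%R).
  { intros i Hi. apply Rnot_lt_le; intros Hlt.
    destruct (Hlim i (Cmod (f i) - g i)%R) as [N HN]; [lra|].
    specialize (HN (max N N0) (Nat.le_max_l _ _)).
    specialize (Hdom (max N N0) i (Nat.le_max_r _ _) Hi).
    assert (Cmod (f i) <= Cmod (F (max N N0) i) + Cmod (F (max N N0) i - f i))%R; [|lra].
    rewrite <- (Cmod_opp (_ - f i)).
    replace (f i) with (F (max N N0) i + - (F (max N N0) i - f i)) at 1 by ring.
    apply Cmod_triangle. }
  destruct (nodup_exists L0) as (L1 & HL1 & HI1).
  assert (Sf : summable f).
  { apply summable_ext with (fun i => indic (In i L0) * f i + indic (~ In i L0) * f i).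
    { intros i. destruct (classic (In i L0)).
      - rewrite indic_true, indic_false; auto; ring.
      - rewrite indic_false, indic_true; auto; ring. }
    apply summable_plus.
    - apply summable_ext with (fun i => indic (In i L1) * f i); [|now apply tsum_indic_list].
      intros i. f_equal. destruct (classic (In i L0)).
      + rewrite !indic_true; auto. now apply HI1.
      + rewrite !indic_false; auto. now rewrite HI1.
    - eapply summable_le; [|apply Hg]. intros i. cbv beta. rewrite Cmod_R.
      destruct (classic (In i L0)) as [Hi|Hi].
      + rewrite indic_false; auto. replace (0 * f i) with (RtoC 0) by ring. rewrite Cmod_0.
        apply Rabs_pos.
      + rewrite indic_true, Cmult_1_l; auto. eapply Rle_trans; [apply Hf, Hi|apply Rle_abs]. }
  split; auto. intros eps Heps.
  (* Off [A] the difference is at most [2 g], so the tail costs [2 (eps / 4)]; the finite part costs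
     another [eps / 4]. *)
  destruct (asum_tail _ Hg (eps / 4)%R) as (T0 & hT0 & hT); [lra|].
  destruct (nodup_exists (L0 ++ T0)) as (A & HA & HIA).
  assert (Hfin : forall B : list I, exists N, forall n, (N <= n)%nat ->
    (Cmod (fsum (fun i => (F n i - f i)%C) B) < eps / 4)%R).
  { clear -Hlim Heps. assert (forall B : list I, forall d, (0 < d)%R -> exists N, forall n, (N <= n)%nat ->
    (Cmod (fsum (fun i => (F n i - f i)%C) B) < d)%R); [|intros; apply H; lra].
    induction B as [|b B IH]; intros d Hd.
    - exists 0%nat. intros n _. simpl. now rewrite Cmod_0.
    - destruct (IH (d / 2)%R) as [N1 h1]; [lra|].
      destruct (Hlim b (d / 2)%R) as [N2 h2]; [lra|].
      exists (max N1 N2). intros n Hn. simpl.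
      specialize (h1 n ltac:(lia)). specialize (h2 n ltac:(lia)).
      eapply Rle_lt_trans; [apply Cmod_triangle|lra]. }
  destruct (Hfin A) as [N1 HN1].
  exists (max N0 N1). intros n Hn.
  rewrite <- tsum_minus; auto.
  set (d := fun i => F n i - f i).
  assert (Sd : summable d) by now apply summable_minus.
  assert (S1 := tsum_indic_list d A HA).
  assert (S2 : asum (fun i => indic (~ In i A) * d i) (2 * (eps / 4))%R).
  { intros L HL.
    set (L' := filter (fun i => if excluded_middle_informative (In i A) then false else true) L).
    apply Rle_trans with (2 * nsum (fun i => RtoC (g i)) L')%R.
    - assert (forall i, ~ In i A -> (Cmod (d i) <= 2 * Cmod (g i))%R).
      { intros i Hi.
        assert (~ In i L0) by (intros h; apply Hi, HIA, in_app_iff; auto).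
        unfold d, Cminus. eapply Rle_trans; [apply Cmod_triangle|]. rewrite Cmod_opp, Cmod_R.
        specialize (Hf i H). specialize (Hdom n i ltac:(lia) H).
        generalize (Rle_abs (g i)); lra. }
      unfold L'. clear HL L'. induction L as [|i L IH]; simpl; [lra|].
      destruct excluded_middle_informative as [Hi|Hi].
      + rewrite indic_false; auto. replace (0 * d i) with (RtoC 0) by ring. rewrite Cmod_0. lra.
      + rewrite indic_true, Cmult_1_l; auto. specialize (H i Hi). simpl. lra.
    - apply Rmult_le_compat_l; [lra|]. apply hT.
      + now apply NoDup_filter.
      + intros i Hi. apply filter_In in Hi. destruct Hi as [_ Hi].
        destruct excluded_middle_informative as [h|h]; [discriminate|].
        intros h'. apply h, HIA, in_app_iff; auto. }
  rewrite (tsum_ext d (fun i => indic (In i A) * d i + indic (~ In i A) * d i)).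
  2:{ intros i. destruct (classic (In i A)).
      - rewrite indic_true, indic_false; auto; ring.
      - rewrite indic_false, indic_true; auto; ring. }
  rewrite tsum_plus; [|apply S1|now eexists; apply S2].
  eapply Rle_lt_trans; [apply Cmod_triangle|].
  apply asum_tsum in S2. destruct S1 as [_ ->].
  specialize (HN1 n ltac:(lia)). unfold d in *. lra.
Qed.

(** * The exponential function *)

Lemma C_ext (z w : C) : Re z = Re w -> Im z = Im w -> z = w.
Proof. destruct z, w; simpl; intros; now f_equal. Qed.

Lemma Re_plus z w : Re (z + w) = (Re z + Re w)%R. Proof. reflexivity. Qed.
Lemma Im_plus z w : Im (z + w) = (Im z + Im w)%R. Proof. reflexivity. Qed.
Lemma Re_mult z w : Re (z * w) = (Re z * Re w - Im z * Im w)%R. Proof. reflexivity. Qed.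
Lemma Im_mult z w : Im (z * w) = (Re z * Im w + Im z * Re w)%R. Proof. reflexivity. Qed.
Lemma Re_opp z : Re (- z) = (- Re z)%R. Proof. reflexivity. Qed.
Lemma Im_opp z : Im (- z) = (- Im z)%R. Proof. reflexivity. Qed.
Lemma Re_RtoC x : Re (RtoC x) = x. Proof. reflexivity. Qed.
Lemma Im_RtoC x : Im (RtoC x) = 0%R. Proof. reflexivity. Qed.
Lemma Re_Ci : Re Ci = 0%R. Proof. reflexivity. Qed.
Lemma Im_Ci : Im Ci = 1%R. Proof. reflexivity. Qed.

Ltac reim := unfold Cminus; rewrite ?Re_plus, ?Im_plus, ?Re_mult, ?Im_mult, ?Re_opp, ?Im_opp,
  ?Re_RtoC, ?Im_RtoC, ?Re_Ci, ?Im_Ci;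
  rewrite ?Re_plus, ?Im_plus, ?Re_mult, ?Im_mult, ?Re_opp, ?Im_opp,
  ?Re_RtoC, ?Im_RtoC, ?Re_Ci, ?Im_Ci.

Lemma Ci2 : Ci * Ci = -1.
Proof. apply C_ext; reim; ring. Qed.

Lemma RtoC_neq0 (x : R) : x <> 0%R -> RtoC x <> 0.
Proof. intros H E. apply H. now apply RtoC_inj. Qed.

Lemma Cexp_plus z w : Cexp (z + w) = Cexp z * Cexp w.
Proof.
  unfold Cexp. rewrite Re_plus, Im_plus, exp_plus, cos_plus, sin_plus.
  apply C_ext; rewrite ?Re_mult, ?Im_mult; simpl; ring.
Qed.

Lemma Cexp_0 : Cexp 0 = 1.
Proof. unfold Cexp; simpl. rewrite exp_0, cos_0, sin_0. apply C_ext; simpl; ring. Qed.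

Lemma Cexp_neq0 z : Cexp z <> 0.
Proof.
  intros H. apply C1_nz. rewrite <- Cexp_0. replace (RtoC 0) with (z + - z) by ring.
  rewrite Cexp_plus, H. ring.
Qed.

Lemma Cexp_opp z : Cexp (- z) = / Cexp z.
Proof.
  assert (H := Cexp_neq0 z).
  assert (Cexp z * Cexp (- z) = 1).
  { rewrite <- Cexp_plus. replace (z + - z) with (RtoC 0) by ring. apply Cexp_0. }
  replace (Cexp (- z)) with (/ Cexp z * (Cexp z * Cexp (- z))) by (field; auto).
  rewrite H0. ring.
Qed.

Lemma Cmod_Cexp z : Cmod (Cexp z) = exp (Re z).
Proof.
  unfold Cexp, Cmod; simpl.
  replace (_ + _)%R with (exp (Re z) * exp (Re z))%R.
  - apply sqrt_square. left; apply exp_pos.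
  - generalize (sin2_cos2 (Im z)); unfold Rsqr; intros H.
    transitivity (exp (Re z) * exp (Re z) *
      (sin (Im z) * sin (Im z) + cos (Im z) * cos (Im z)))%R; [rewrite H|]; ring.
Qed.

Lemma Cexp_RtoC (x : R) : Cexp (RtoC x) = RtoC (exp x).
Proof. unfold Cexp; simpl. rewrite cos_0, sin_0. apply C_ext; simpl; ring. Qed.

Lemma Cexp_nat_mult z n : Cexp (INR n * z) = Cexp z ^ n.
Proof.
  induction n as [|n IH].
  - simpl. rewrite <- Cexp_0. f_equal. ring.
  - rewrite S_INR, RtoC_plus. simpl Cpow. rewrite <- IH, <- Cexp_plus. f_equal. ring.
Qed.

Lemma e_plus x y : e (x + y) = e x * e y.
Proof. unfold e. rewrite <- Cexp_plus. f_equal. ring. Qed.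

Lemma e_0 : e 0 = 1.
Proof. unfold e. rewrite <- Cexp_0. f_equal. ring. Qed.

Lemma e_neq0 x : e x <> 0.
Proof. apply Cexp_neq0. Qed.

Lemma e_opp x : e (- x) = / e x.
Proof. unfold e. rewrite <- Cexp_opp. f_equal. ring. Qed.

Lemma e_real (x : R) : e x = (cos (2 * PI * x), sin (2 * PI * x)).
Proof.
  unfold e, Cexp.
  replace (Re (2 * PI * Ci * x)) with 0%R by (reim; ring).
  replace (Im (2 * PI * Ci * x)) with (2 * PI * x)%R by (reim; ring).
  rewrite exp_0. f_equal; ring.
Qed.

Lemma Cmod_e (x : R) : Cmod (e x) = 1%R.
Proof.
  unfold e. rewrite Cmod_Cexp.
  replace (Re _) with 0%R by (reim; ring). apply exp_0.
Qed.

Lemma e_nat (n : nat) : e (INR n) = 1.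
Proof.
  induction n as [|n IH]; [apply e_0|].
  rewrite S_INR, RtoC_plus, e_plus, IH, e_real, Rmult_1_r, cos_2PI, sin_2PI.
  apply C_ext; reim; simpl; ring.
Qed.

Lemma e_IZR (n : Z) : e (IZR n) = 1.
Proof.
  destruct (Z_le_dec 0 n) as [H|H].
  - rewrite <- (Z2Nat.id n H), <- INR_IZR_INZ. apply e_nat.
  - replace (IZR n) with (- IZR (- n))%R by (rewrite opp_IZR; ring).
    rewrite RtoC_opp, e_opp, <- (Z2Nat.id (- n)), <- INR_IZR_INZ, e_nat by lia. field.
Qed.

Lemma cos_eq_1 (t : R) : cos t = 1%R -> exists n : Z, t = (2 * PI * IZR n)%R.
Proof.
  intros H.
  assert (Hs : sin (t / 2) = 0%R).
  { replace t with (2 * (t / 2))%R in H by field. rewrite cos_2a_sin in H. nra. }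
  destruct (sin_eq_0_0 _ Hs) as [n Hn]. exists n. lra.
Qed.

Lemma e_eq_1 (x : R) : e x = 1 -> exists n : Z, x = IZR n.
Proof.
  rewrite e_real. intros H. injection H as H _.
  destruct (cos_eq_1 _ H) as [n Hn]. exists n.
  assert (hp := PI_RGT_0). apply Rmult_eq_reg_l with (2 * PI)%R; lra.
Qed.

Lemma Cexp_eq_1 z : Cexp z = 1 -> exists n : Z, z = 2 * PI * Ci * IZR n.
Proof.
  intros H.
  assert (hr : exp (Re z) = 1%R) by now rewrite <- Cmod_Cexp, H, Cmod_1.
  assert (hr' : Re z = 0%R) by (apply exp_inv; now rewrite exp_0).
  unfold Cexp in H. rewrite hr in H. injection H as H _.
  destruct (cos_eq_1 (Im z)) as [n Hn]; [lra|].
  exists n. apply C_ext; reim; rewrite ?hr', ?Hn; ring.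
Qed.

(** * Cauchy products and the exponential series *)

Definition csum (f : nat -> C) (n : nat) : C := fsum f (seq 0 n).

Lemma csum_S f n : csum f (S n) = csum f n + f n.
Proof. unfold csum. rewrite seq_S, fsum_app. simpl. ring. Qed.

Lemma csum_Sl f n : csum f (S n) = f 0%nat + csum (fun i => f (S i)) n.
Proof. unfold csum. simpl. now rewrite <- seq_shift, fsum_map. Qed.

Lemma csum_ext f g n : (forall i, (i < n)%nat -> f i = g i) -> csum f n = csum g n.
Proof. intros H. apply fsum_ext. intros i Hi. apply in_seq in Hi. apply H. lia. Qed.

Lemma csum_plus f g n : csum (fun i => f i + g i) n = csum f n + csum g n.
Proof. apply fsum_plus. Qed.

Lemma csum_scal c f n : csum (fun i => c * f i) n = c * csum f n.
Proof. apply fsum_scal. Qed.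

Lemma csum_0 (f : nat -> C) n : (forall i, (i < n)%nat -> f i = 0) -> csum f n = 0.
Proof.
  intros H. rewrite (csum_ext f (fun i => 0 * f i)).
  - rewrite csum_scal. ring.
  - intros i Hi. rewrite H; auto. ring.
Qed.

Lemma tsum_csum (f : nat -> C) N : (forall n, (N <= n)%nat -> f n = 0) ->
  summable f /\ tsum f = csum f N.
Proof.
  intros H. apply tsum_fin; [apply seq_NoDup|].
  intros i Hi. apply H. rewrite in_seq in Hi. lia.
Qed.

Definition conv (f g : nat -> C) (n : nat) : C := csum (fun i => f i * g (n - i)%nat) (S n).

(** The pair [(i, j)] is reindexed as [(i + j, i)]; summing over the second entry first then
    produces the convolution. *)
Lemma tsum_conv (f g : nat -> C) : summable f -> summable g ->
  summable (conv f g) /\ tsum (conv f g) = tsum f * tsum g.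
Proof.
  intros Hf Hg.
  set (G := fun p : nat * nat =>
    if le_dec (snd p) (fst p) then f (snd p) * g (fst p - snd p)%nat else 0).
  set (phi := fun p : nat * nat => (fst p + snd p, fst p)%nat).
  assert (phi_inj : forall p q, phi p = phi q -> p = q).
  { intros [a b] [c d]. unfold phi; simpl. intros H. injection H as H1 H2. f_equal; lia. }
  assert (Hr : forall i, G i <> 0 -> exists j, phi j = i).
  { intros [n i] H. unfold G in H; simpl in H. destruct le_dec as [Hl|]; [|easy].
    exists (i, n - i)%nat. unfold phi; simpl. f_equal; lia. }
  assert (HE : forall p, f (fst p) * g (snd p) = G (phi p)).
  { intros [i j]. unfold G, phi; simpl. destruct le_dec; [|lia]. do 2 f_equal. lia. }
  assert (HP := summable_prod_mult f g Hf Hg).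
  assert (HG : summable G).
  { apply (summable_inj_inv phi phi_inj); auto. eapply summable_ext; [apply HE|auto]. }
  assert (Hfin : forall n, tsum (fun i => G (n, i)) = conv f g n).
  { intros n. destruct (tsum_csum (fun i => G (n, i)) (S n)) as [_ ->].
    - intros i Hi. unfold G; simpl. destruct le_dec; [lia|easy].
    - apply csum_ext. intros i Hi. unfold G; simpl. destruct le_dec; [easy|lia]. }
  destruct (tsum_prod G HG) as [h1 h2].
  split.
  - eapply summable_ext; [apply Hfin|apply h1].
  - rewrite <- (tsum_ext _ _ Hfin), <- h2.
    rewrite (tsum_inj phi phi_inj); auto.
    rewrite <- (tsum_ext _ _ HE), (proj2 (tsum_prod _ HP)). cbn [fst snd].
    rewrite Cmult_comm, <- tsum_scal; auto.
    apply tsum_ext. intros i. rewrite tsum_scal; auto. ring.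
Qed.

Lemma csum_abs_le f n : (Cmod (csum f n) <= Cmod (csum (fun i => RtoC (Cmod (f i))) n))%R.
Proof.
  assert (E : forall L : list nat, fsum (fun i => RtoC (Cmod (f i))) L = RtoC (nsum f L)).
  { induction L as [|i L IH]; cbn [fsum nsum]; [easy|]. rewrite IH, RtoC_plus. easy. }
  unfold csum. rewrite E, Cmod_R. eapply Rle_trans; [apply fsum_le_nsum|apply Rle_abs].
Qed.

(** For the moduli the convolution is real and nonnegative, so its norm sum is its sum, which is the
    product of the two sums by [tsum_conv]. *)
Lemma asum_conv (f g : nat -> C) M N : asum f M -> asum g N -> asum (conv f g) (M * N).
Proof.
  intros Hf Hg.
  set (f' := fun n => RtoC (Cmod (f n))). set (g' := fun n => RtoC (Cmod (g n))).
  assert (Hf' : asum f' M) by now apply asum_norm.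
  assert (Hg' : asum g' N) by now apply asum_norm.
  destruct (tsum_conv f' g') as [h1 h2]; [now exists M|now exists N|].
  apply asum_le with (conv f' g').
  - intros n. unfold conv. eapply Rle_trans; [apply csum_abs_le|].
    right. f_equal. apply csum_ext. intros i _. unfold f', g'.
    now rewrite Cmod_mult, RtoC_mult.
  - assert (E : forall n, conv f' g' n = RtoC (Cmod (conv f' g' n))).
    { assert (P : forall n, exists r : R, (0 <= r)%R /\ conv f' g' n = RtoC r).
      { intros n. unfold conv. generalize (S n) as m.
        induction m as [|m (r & Hr & IH)]; [exists 0%R; split; [lra|easy]|].
        exists (r + Cmod (f m) * Cmod (g (n - m)%nat))%R. split.
        - generalize (Cmod_ge_0 (f m)) (Cmod_ge_0 (g (n - m)%nat)). nra.
        - rewrite csum_S, IH. unfold f', g'. now rewrite RtoC_plus, RtoC_mult. }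
      intros n. destruct (P n) as (r & Hr & ->). now rewrite Cmod_R, Rabs_pos_eq. }
    eapply asum_weaken.
    + apply asum_tsum_norm, h1.
    + rewrite <- (tsum_ext _ _ E), h2, Cmod_mult.
      apply Rmult_le_compat; try apply Cmod_ge_0; now apply asum_tsum.
Qed.

Definition pw (z : C) (n : nat) : C := z ^ n / INR (fact n).

Lemma INR_fact_neq0 n : RtoC (INR (fact n)) <> 0.
Proof. apply RtoC_neq0, INR_fact_neq_0. Qed.

Lemma RtoC_S_neq0 n : RtoC (INR (S n)) <> 0.
Proof. apply RtoC_neq0, not_0_INR. lia. Qed.

Lemma pw_S z n : INR (S n) * pw z (S n) = z * pw z n.
Proof.
  unfold pw. rewrite fact_simpl, mult_INR, RtoC_mult. simpl Cpow. field.
  split; [apply INR_fact_neq0|apply RtoC_S_neq0].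
Qed.

Lemma pw_0 z : pw z 0 = 1.
Proof. unfold pw. simpl. field. Qed.

(** The binomial theorem in divided powers. After multiplication by [n + 1], this factor is split as
    [i + (n + 1 - i)], and [pw_S] turns the two parts into [z] and [w] times the sum of order
    [n]. *)
Lemma pw_plus z w n : pw (z + w) n = conv (pw z) (pw w) n.
Proof.
  induction n as [|n IH].
  - unfold conv. rewrite csum_S. unfold csum; simpl. rewrite !pw_0. ring.
  - assert (H : INR (S n) * pw (z + w) (S n) = INR (S n) * conv (pw z) (pw w) (S n)).
    { rewrite pw_S, IH. unfold conv. rewrite <- (csum_scal (INR (S n))).
      rewrite (csum_ext (fun i => INR (S n) * (pw z i * pw w (S n - i)%nat))
        (fun i => (INR i * pw z i) * pw w (S n - i)%nat
                  + pw z i * (INR (S n - i) * pw w (S n - i)%nat))).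
      2:{ intros i Hi. rewrite minus_INR, RtoC_minus by lia. ring. }
      rewrite csum_plus. rewrite (csum_Sl _ (S n)).
      rewrite (csum_S (fun i => pw z i * (INR (S n - i) * pw w (S n - i)%nat))).
      rewrite Nat.sub_diag. simpl (INR 0).
      rewrite (csum_ext (fun i => INR (S i) * pw z (S i) * pw w (S n - S i)%nat)
        (fun i => z * (pw z i * pw w (n - i)%nat))).
      2:{ intros i Hi. rewrite pw_S. simpl (S n - S i)%nat. ring. }
      rewrite (csum_ext (fun i => pw z i * (INR (S n - i) * pw w (S n - i)%nat))
        (fun i => w * (pw z i * pw w (n - i)%nat))).
      2:{ intros i Hi. replace (S n - i)%nat with (S (n - i)) by lia. rewrite pw_S. ring. }
      rewrite !csum_scal. ring. }
    assert (Hn := RtoC_S_neq0 n).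
    replace (pw (z + w) (S n)) with (/ INR (S n) * (INR (S n) * pw (z + w) (S n)))
      by (field; auto).
    rewrite H. field; auto.
Qed.

Lemma asum_pw z : asum (pw z) (exp (Cmod z)).
Proof.
  apply asum_le with (fun n => RtoC (/ INR (fact n) * Cmod z ^ n)).
  - intros n. unfold pw. rewrite Cmod_div, Cmod_pow, !Cmod_R by apply INR_fact_neq0.
    rewrite Rabs_pos_eq by apply pos_INR. eapply Rle_trans; [|apply Rle_abs].
    right. field. apply INR_fact_neq_0.
  - apply summable_nat_bound.
    + intros n. apply Rmult_le_pos.
      * left. apply Rinv_0_lt_compat, INR_fact_lt_0.
      * apply pow_le, Cmod_ge_0.
    + intros n. assert (H := is_exp_Reals (Cmod z)). apply is_pseries_R in H.
      apply (is_lim_seq_incr_compare (sum_n (fun n => (/ INR (fact n) * Cmod z ^ n)%R))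
        (exp (Cmod z))); [exact H|].
      intros m. rewrite sum_Sn. unfold plus; simpl.
      assert (0 <= / INR (fact (S m)) * Cmod z ^ S m)%R; [|simpl in *; lra].
      apply Rmult_le_pos.
      * left. apply Rinv_0_lt_compat, INR_fact_lt_0.
      * apply pow_le, Cmod_ge_0.
Qed.

Lemma summable_pw z : summable (pw z).
Proof. eexists; apply asum_pw. Qed.

Lemma is_series_real_tsum (p : nat -> R) (l : R) :
  summable (fun n => RtoC (p n)) -> is_series p l -> tsum (fun n => RtoC (p n)) = RtoC l.
Proof.
  intros HS Hl. destruct (is_series_C_parts _ _ (tsum_is_series _ HS)) as [h1 h2].
  apply C_ext.
  - rewrite <- (is_series_unique _ _ h1). simpl. now apply is_series_unique.
  - rewrite <- (is_series_unique _ _ h2). simpl.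
    apply is_series_unique. apply (filterlim_ext (fun _ => 0%R)).
    + intros n. induction n as [|n IH]; [now rewrite sum_O|].
      rewrite sum_Sn, <- IH. unfold plus; simpl. ring.
    + apply filterlim_const.
Qed.

Lemma summable_even_odd (f : nat -> C) : summable f ->
  tsum f = tsum (fun n => f (2 * n)%nat) + tsum (fun n => f (2 * n + 1)%nat).
Proof.
  intros H.
  assert (i1 : forall j j', (2 * j = 2 * j')%nat -> j = j') by (intros; lia).
  assert (i2 : forall j j', (2 * j + 1 = 2 * j' + 1)%nat -> j = j') by (intros; lia).
  set (f1 := fun n => if Nat.even n then f n else 0).
  set (f2 := fun n => if Nat.even n then RtoC 0 else f n).
  assert (S1 : summable f1).
  { eapply summable_le; [|apply H]. intros n. unfold f1. destruct Nat.even; [lra|].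
    rewrite Cmod_0. apply Cmod_ge_0. }
  assert (S2 : summable f2).
  { eapply summable_le; [|apply H]. intros n. unfold f2. destruct Nat.even; [|lra].
    rewrite Cmod_0. apply Cmod_ge_0. }
  rewrite (tsum_ext f (fun n => f1 n + f2 n)).
  2:{ intros n. unfold f1, f2. destruct Nat.even; ring. }
  rewrite tsum_plus; auto. f_equal.
  - rewrite (tsum_inj (fun n => 2 * n)%nat i1); auto.
    + apply tsum_ext. intros n. unfold f1. now rewrite Nat.even_mul.
    + intros n Hn. unfold f1 in Hn. destruct (Nat.even n) eqn:E; [|easy].
      apply Nat.even_spec in E. destruct E as [m ->]. now exists m.
  - rewrite (tsum_inj (fun n => 2 * n + 1)%nat i2); auto.
    + apply tsum_ext. intros n. unfold f2. now rewrite Nat.even_odd.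
    + intros n Hn. unfold f2 in Hn. destruct (Nat.even n) eqn:E; [easy|].
      assert (E' : Nat.odd n = true) by (unfold Nat.odd; now rewrite E).
      apply Nat.odd_spec in E'. destruct E' as [m ->]. now exists m.
Qed.

Lemma Ci_pow_even n : Ci ^ (2 * n) = RtoC ((-1) ^ n).
Proof.
  induction n as [|n IH]; [easy|].
  replace (2 * S n)%nat with (S (S (2 * n))) by lia.
  cbn [Cpow pow]. rewrite IH, RtoC_mult, Cmult_assoc, Ci2. easy.
Qed.

(** [cos] and [sin] come from power series in [y^2]: the even terms give the former, and the odd
    terms are [i y] times the series behind the latter. Dividing by [i y] singles out [y = 0]. *)
Lemma Cexp_Im_series (y : R) : tsum (pw (Ci * y)) = (cos y, sin y).
Proof.
  rewrite summable_even_odd by apply summable_pw.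
  assert (E1 : forall n, pw (Ci * y) (2 * n) = RtoC (cos_n n * Rsqr y ^ n)).
  { intros n. unfold pw, cos_n. rewrite Cpow_mult_l, Ci_pow_even, <- RtoC_pow, <- RtoC_mult.
    rewrite <- RtoC_div by apply INR_fact_neq_0. f_equal.
    rewrite pow_mult. unfold Rsqr. simpl (y ^ 2)%R. rewrite Rmult_1_r.
    field. apply INR_fact_neq_0. }
  assert (E2 : forall n, pw (Ci * y) (2 * n + 1) = (Ci * y) * RtoC (sin_n n * Rsqr y ^ n)).
  { intros n. unfold pw, sin_n. rewrite Cpow_add_r, !Cpow_mult_l, Ci_pow_even, <- !RtoC_pow.
    simpl (Ci ^ 1). rewrite (Rdiv_def), !RtoC_mult, RtoC_inv by apply INR_fact_neq_0.
    unfold Cdiv. rewrite pow_mult. unfold Rsqr. simpl (y ^ 2)%R. simpl (y ^ 1)%R.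
    rewrite !Rmult_1_r. ring. }
  assert (i1 : forall j j', (2 * j = 2 * j')%nat -> j = j') by (intros; lia).
  assert (i2 : forall j j', (2 * j + 1 = 2 * j' + 1)%nat -> j = j') by (intros; lia).
  assert (S1 := summable_inj (fun n => 2 * n)%nat i1 _ (summable_pw (Ci * y))).
  assert (S2 := summable_inj (fun n => 2 * n + 1)%nat i2 _ (summable_pw (Ci * y))).
  cbv beta in S1, S2.
  rewrite (tsum_ext _ _ E1).
  assert (S1' := summable_ext _ _ E1 S1).
  destruct (exist_cos (Rsqr y)) as [l Hl] eqn:El.
  assert (Hc : cos y = l) by (unfold cos; now rewrite El).
  clear El; apply (proj2 (is_series_Reals (fun n => (cos_n n * Rsqr y ^ n)%R) l)) in Hl.
  rewrite (is_series_real_tsum _ _ S1' Hl), <- Hc.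
  destruct (Req_dec y 0) as [->|Hy].
  - rewrite (tsum_ext _ _ E2).
    rewrite (tsum_ext _ (fun _ => 0)) by (intros; ring).
    rewrite (has_sum_tsum _ _ has_sum_0), sin_0. apply C_ext; simpl; ring.
  - destruct (exist_sin (Rsqr y)) as [l' Hl'] eqn:El'.
    assert (Hs : sin y = (y * l')%R) by (unfold sin; now rewrite El').
    clear El'; apply (proj2 (is_series_Reals (fun n => (sin_n n * Rsqr y ^ n)%R) l')) in Hl'.
    assert (Hy' : Ci * y <> 0).
    { apply Cmult_neq_0; [apply Ci_nz|now apply RtoC_neq0]. }
    assert (S2' : summable (fun n => RtoC (sin_n n * Rsqr y ^ n))).
    { eapply summable_ext; [|apply (summable_scal (/ (Ci * y)) _ S2)].
      intros n. cbv beta. rewrite E2. field. split; [now apply RtoC_neq0|apply Ci_nz]. }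
    rewrite (tsum_ext _ _ E2), tsum_scal by auto.
    rewrite (is_series_real_tsum _ _ S2' Hl'), Hs. apply C_ext; reim; simpl; ring.
Qed.

(** [Cexp] is assembled from real functions, so the series is computed on the real and on the
    imaginary axis, and the two are multiplied by means of [pw_plus]. *)
Lemma tsum_pw z : tsum (pw z) = Cexp z.
Proof.
  assert (Hz : z = RtoC (Re z) + Ci * Im z) by (apply C_ext; reim; ring).
  rewrite Hz at 1.
  rewrite (tsum_ext _ _ (pw_plus (Re z) (Ci * Im z))).
  rewrite (proj2 (tsum_conv _ _ (summable_pw _) (summable_pw _))), Cexp_Im_series.
  assert (Er : tsum (pw (Re z)) = RtoC (exp (Re z))).
  { assert (E : forall n, pw (RtoC (Re z)) n = RtoC (/ INR (fact n) * Re z ^ n)).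
    { intros n. unfold pw. rewrite <- RtoC_pow, <- RtoC_div by apply INR_fact_neq_0.
      f_equal. field. apply INR_fact_neq_0. }
    rewrite (tsum_ext _ _ E). apply is_series_real_tsum.
    - eapply summable_ext; [apply E|apply summable_pw].
    - apply is_pseries_R, is_exp_Reals. }
  rewrite Er. unfold Cexp. apply C_ext; reim; simpl; ring.
Qed.

(** * Power series *)

(** A weighted [l^1] norm of the coefficients at radius [r]. It gives absolute convergence on the
    whole closed disc and is stable under sums and Cauchy products with explicit bounds. *)
Definition psum (c : nat -> C) (r M : R) : Prop := asum (fun n => c n * RtoC r ^ n) M.

Definition ps (c : nat -> C) (z : C) : C := tsum (fun n => c n * z ^ n).

Lemma Cmod_pow_le z r n : (Cmod z <= r)%R -> (Cmod (z ^ n) <= Cmod (RtoC r ^ n))%R.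
Proof.
  intros H. rewrite !Cmod_pow, Cmod_R. apply pow_incr.
  split; [apply Cmod_ge_0|]. eapply Rle_trans; [exact H|apply Rle_abs].
Qed.

Lemma psum_asum c r M z : psum c r M -> (Cmod z <= r)%R -> asum (fun n => c n * z ^ n) M.
Proof.
  intros H Hz. eapply asum_le; [|apply H]. intros n. rewrite !Cmod_mult.
  apply Rmult_le_compat_l; [apply Cmod_ge_0|now apply Cmod_pow_le].
Qed.

Lemma psum_summable c r M z : psum c r M -> (Cmod z <= r)%R -> summable (fun n => c n * z ^ n).
Proof. intros H Hz. exists M. eapply psum_asum; eauto. Qed.

Lemma psum_shrink c r r' M : psum c r M -> (0 <= r' <= r)%R -> psum c r' M.
Proof. intros H Hr. apply (psum_asum _ r); auto. rewrite Cmod_R, Rabs_pos_eq; lra. Qed.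

Lemma ps_bound c r M z : psum c r M -> (Cmod z <= r)%R -> (Cmod (ps c z) <= M)%R.
Proof. intros H Hz. apply asum_tsum. eapply psum_asum; eauto. Qed.

Lemma ps_plus c d r M N z : psum c r M -> psum d r N -> (Cmod z <= r)%R ->
  ps (fun n => c n + d n) z = ps c z + ps d z.
Proof.
  intros Hc Hd Hz. unfold ps. rewrite <- tsum_plus; try (eapply psum_summable; eauto).
  apply tsum_ext; intros; ring.
Qed.

Lemma psum_plus c d r M N : psum c r M -> psum d r N -> psum (fun n => c n + d n) r (M + N).
Proof.
  intros Hc Hd. eapply asum_le; [|apply (asum_plus _ _ _ _ Hc Hd)].
  intros n. right. f_equal. ring.
Qed.

Lemma psum_scal a c r M : psum c r M -> psum (fun n => a * c n) r (Cmod a * M).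
Proof.
  intros Hc. eapply asum_le; [|apply (asum_scal a _ _ Hc)].
  intros n. right. f_equal. ring.
Qed.

Lemma ps_scal a c r M z : psum c r M -> (Cmod z <= r)%R ->
  ps (fun n => a * c n) z = a * ps c z.
Proof.
  intros Hc Hz. unfold ps. rewrite <- tsum_scal; try (eapply psum_summable; eauto).
  apply tsum_ext; intros; ring.
Qed.

Lemma conv_pow c d z n :
  conv c d n * z ^ n = conv (fun i => c i * z ^ i) (fun j => d j * z ^ j) n.
Proof.
  unfold conv. rewrite Cmult_comm, <- csum_scal. apply csum_ext. intros i Hi.
  replace n with (i + (n - i))%nat at 1 by lia. rewrite Cpow_add_r. ring.
Qed.

Lemma psum_conv c d r M N : psum c r M -> psum d r N -> psum (conv c d) r (M * N).
Proof.
  intros Hc Hd. eapply asum_le; [|apply (asum_conv _ _ _ _ Hc Hd)].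
  intros n. right. f_equal. apply conv_pow.
Qed.

Lemma ps_conv c d r M N z : psum c r M -> psum d r N -> (Cmod z <= r)%R ->
  ps (conv c d) z = ps c z * ps d z.
Proof.
  intros Hc Hd Hz. unfold ps.
  rewrite (tsum_ext _ _ (conv_pow c d z)).
  apply tsum_conv; eapply psum_summable; eauto.
Qed.

Lemma ps_is_pseries c r M z : psum c r M -> (Cmod z <= r)%R ->
  @is_pseries C_AbsRing C_NormedModule c z (ps c z).
Proof.
  intros H Hz.
  change (@is_series C_AbsRing C_NormedModule
    (fun k => pow_n (K := C_AbsRing) z k * c k) (ps c z)).
  replace (fun k => pow_n (K := C_AbsRing) z k * c k) with (fun k => c k * z ^ k).
  - apply (tsum_is_series (fun k => c k * z ^ k)). eapply psum_summable; eauto.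
  - apply functional_extensionality; intros k. apply Cmult_comm.
Qed.

Lemma sum_geom_bound (x : R) : (0 <= x < 1)%R -> forall n, (sum_n (fun n => x ^ n)%R n <= / (1 - x))%R.
Proof.
  intros Hx n. assert (H := is_series_geom x). 
  rewrite Rabs_pos_eq in H by lra. specialize (H (proj2 Hx)).
  apply (is_lim_seq_incr_compare _ _ H). intros m. rewrite sum_Sn. unfold plus; simpl.
  assert (0 <= x * x ^ m)%R by (apply Rmult_le_pos; [lra|apply pow_le; lra]). lra.
Qed.

Lemma asum_geom (x : R) : (0 <= x < 1)%R -> asum (fun n => RtoC (x ^ n)) (/ (1 - x)).
Proof.
  intros Hx. apply summable_nat_bound; [intros; apply pow_le; lra|].
  now apply sum_geom_bound.
Qed.

(** Abel's argument: the terms at [z0] are bounded, so at a smaller radius they are dominated by a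
    geometric series of ratio [r / |z0|]. *)
Lemma is_pseries_psum c z0 l r :
  @is_pseries C_AbsRing C_NormedModule c z0 l -> (0 <= r < Cmod z0)%R ->
  exists M, psum c r M.
Proof.
  intros H Hr.
  change (@is_series C_AbsRing C_NormedModule
    (fun k => pow_n (K := C_AbsRing) z0 k * c k) l) in H.
  replace (fun k => pow_n (K := C_AbsRing) z0 k * c k) with (fun k => c k * z0 ^ k) in H
    by (apply functional_extensionality; intros k; apply Cmult_comm).
  destruct (is_series_C_inv _ _ H 1 Rlt_0_1) as [N HN].
  assert (B : exists B, (0 <= B)%R /\ forall n, (Cmod (c n * z0 ^ n) <= B)%R).
  { assert (B1 : forall m, exists B, (0 <= B)%R /\ forall n, (n <= m)%nat -> (Cmod (c n * z0 ^ n) <= B)%R).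
    { induction m as [|m (B & HB0 & HB)].
      - exists (Cmod (c 0%nat * z0 ^ 0)). split; [apply Cmod_ge_0|].
        intros n Hn. replace n with 0%nat by lia. lra.
      - exists (Rmax B (Cmod (c (S m) * z0 ^ S m))). split.
        + eapply Rle_trans; [apply HB0|apply Rmax_l].
        + intros n Hn. destruct (Nat.eq_dec n (S m)) as [->|Hne]; [apply Rmax_r|].
          eapply Rle_trans; [apply HB; lia|apply Rmax_l]. }
    (* Beyond index [S N] two consecutive partial sums are within 1 of the limit, so their
       difference, a single term, is at most 2. *)
    destruct (B1 (S N)) as (B & HB0 & HB). exists (Rmax B 2). split.
    - eapply Rle_trans; [apply HB0|apply Rmax_l].
    - intros n. destruct (le_dec n (S N)) as [Hn|Hn].
      + eapply Rle_trans; [apply HB; auto|apply Rmax_l].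
      + eapply Rle_trans; [|apply Rmax_r].
        destruct n as [|n]; [lia|].
        assert (h1 := HN n ltac:(lia)). assert (h2 := HN (S n) ltac:(lia)).
        rewrite sum_Sn in h2. change (plus (sum_n (fun k => c k * z0 ^ k) n) (c (S n) * z0 ^ S n))
          with (sum_n (fun k => c k * z0 ^ k) n + c (S n) * z0 ^ S n) in h2.
        set (s := sum_n (fun k => c k * z0 ^ k) n) in *.
        replace (c (S n) * z0 ^ S n) with ((s + c (S n) * z0 ^ S n - l) + - (s - l)) by ring.
        eapply Rle_trans; [apply Cmod_triangle|]. rewrite Cmod_opp. lra. }
  destruct B as (B & HB0 & HB).
  set (x := (r / Cmod z0)%R).
  assert (Hx : (0 <= x < 1)%R).
  { unfold x. split.
    - apply Rdiv_le_0_compat; lra.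
    - apply Rmult_lt_reg_r with (Cmod z0); [lra|]. field_simplify; lra. }
  exists (Cmod B * / (1 - x))%R.
  eapply asum_le; [|apply (asum_scal B), (asum_geom x Hx)].
  intros n. rewrite !Cmod_mult, Cmod_pow, !Cmod_R.
  rewrite (Rabs_pos_eq B HB0), (Rabs_pos_eq r), (Rabs_pos_eq (x ^ n)) by (try apply pow_le; lra).
  replace r with (Cmod z0 * x)%R by (unfold x; field; lra).
  rewrite Rpow_mult_distr, <- Rmult_assoc. apply Rmult_le_compat_r; [apply pow_le; lra|].
  specialize (HB n). now rewrite Cmod_mult, Cmod_pow in HB.
Qed.

Lemma is_pseries_ps c r M z l : psum c r M -> (Cmod z <= r)%R ->
  @is_pseries C_AbsRing C_NormedModule c z l -> l = ps c z.
Proof.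
  intros H Hz Hl. eapply is_series_C_unique; [apply Hl|].
  eapply ps_is_pseries; eauto.
Qed.

Lemma ps_Sl c r M z : psum c r M -> (0 < r)%R -> (Cmod z <= r)%R ->
  psum (fun n => c (S n)) r (M / r) /\ ps c z = c 0%nat + z * ps (fun n => c (S n)) z.
Proof.
  intros H Hr Hz.
  assert (Hs : psum (fun n => c (S n)) r (M / r)).
  { assert (h := asum_inj S (fun a b => eq_add_S a b) _ _ H). cbv beta in h.
    eapply asum_weaken; [eapply asum_le; [|apply (asum_scal (/ r) _ _ h)]|].
    - intros n. right. f_equal. simpl. field. apply RtoC_neq0; lra.
    - rewrite Cmod_inv, Cmod_R, Rabs_pos_eq by (try apply RtoC_neq0; lra).
      right. field. lra. }
  split; auto.
  assert (HS := psum_summable _ _ _ _ H Hz).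
  assert (HS' := psum_summable _ _ _ _ Hs Hz).
  unfold ps. 
  rewrite (tsum_ext (fun n => c n * z ^ n)
    (fun n => (match n with 0 => c 0%nat | _ => 0 end)
              + match n with 0 => 0 | S m => c (S m) * z ^ S m end)).
  2:{ intros [|n]; simpl; ring. }
  destruct (tsum_single (fun n => match n with 0 => c 0%nat | _ => RtoC 0 end) 0%nat) as [h1 h2].
  { intros [|n] Hn; [easy|reflexivity]. }
  set (f := fun n => match n with 0 => RtoC 0 | S m => c (S m) * z ^ S m end).
  assert (Sf : summable f).
  { eapply summable_le; [|apply HS]. intros [|n]; unfold f; [|lra].
    rewrite Cmod_0. apply Cmod_ge_0. }
  rewrite tsum_plus; auto. rewrite h2. f_equal.
  rewrite (tsum_inj S (fun a b => eq_add_S a b)); auto.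
  - rewrite <- tsum_scal; auto. apply tsum_ext. intros n. unfold f. simpl. ring.
  - intros [|n] Hn; [easy|now exists n].
Qed.

Lemma ps_at_0 c : ps c 0 = c 0%nat.
Proof.
  unfold ps. destruct (tsum_single (fun n => c n * 0 ^ n) 0%nat) as [_ ->].
  - intros [|n] Hn; [easy|]. simpl. ring.
  - simpl. ring.
Qed.

(** Zeros are isolated: if [c 0] is not 0, it outweighs the rest of the series, which is at most
    [|z| M / r], near 0. Once [c 0 = 0], the series is divided by [z] and the argument repeats. *)
Lemma ps_zero_of_zeros c r M : psum c r M -> (0 < r)%R ->
  (forall eps, (0 < eps)%R -> exists z, (0 < Cmod z < eps)%R /\ ps c z = 0) ->
  forall n, c n = 0.
Proof.
  intros H Hr Hz n. revert c M H Hz. induction n as [|n IH]; intros c M H Hz.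
  - apply NNPP; intros Hc.
    assert (Hp : (0 < Cmod (c 0%nat))%R) by now apply Cmod_gt_0.
    assert (HM : (0 <= M / r)%R).
    { apply Rdiv_le_0_compat; auto. apply (asum_ge0 _ _ H). }
    destruct (Hz (Rmin r (Cmod (c 0%nat) / (M / r + 1)))%R) as (z & [h1 h2] & h3).
    { apply Rmin_glb_lt; auto. apply Rdiv_lt_0_compat; lra. }
    assert (h4 : (Cmod z <= r)%R) by (eapply Rlt_le, Rlt_le_trans; [apply h2|apply Rmin_l]).
    assert (h5 : (Cmod z < Cmod (c 0%nat) / (M / r + 1))%R)
      by (eapply Rlt_le_trans; [apply h2|apply Rmin_r]).
    destruct (ps_Sl c r M z H Hr h4) as [k1 k2].
    assert (k3 := ps_bound _ _ _ _ k1 h4).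
    rewrite h3 in k2.
    assert (E : c 0%nat = - (z * ps (fun n => c (S n)) z)).
    { replace (c 0%nat) with (c 0%nat + z * ps (fun n => c (S n)) z - z * ps (fun n => c (S n)) z)
        by ring. rewrite <- k2. ring. }
    assert (k4 : (Cmod (c 0%nat) <= Cmod z * (M / r))%R).
    { rewrite E, Cmod_opp, Cmod_mult. apply Rmult_le_compat_l; lra. }
    assert (k5 : (Cmod z * (M / r + 1) < Cmod (c 0%nat))%R).
    { apply Rlt_div_r in h5; lra. }
    lra.
  - assert (h0 : forall z, (Cmod z <= r)%R -> psum (fun n => c (S n)) r (M / r) /\
        ps c z = c 0%nat + z * ps (fun n => c (S n)) z).
    { intros z Hzr. eapply ps_Sl; eauto. }
    assert (c0 : c 0%nat = 0).
    { apply NNPP; intros Hc.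
      assert (Hp : (0 < Cmod (c 0%nat))%R) by now apply Cmod_gt_0.
      assert (HM : (0 <= M / r)%R).
      { apply Rdiv_le_0_compat; auto. apply (asum_ge0 _ _ H). }
      destruct (Hz (Rmin r (Cmod (c 0%nat) / (M / r + 1)))%R) as (z & [h1 h2] & h3).
      { apply Rmin_glb_lt; auto. apply Rdiv_lt_0_compat; lra. }
      assert (h4 : (Cmod z <= r)%R) by (eapply Rlt_le, Rlt_le_trans; [apply h2|apply Rmin_l]).
      assert (h5 : (Cmod z < Cmod (c 0%nat) / (M / r + 1))%R)
        by (eapply Rlt_le_trans; [apply h2|apply Rmin_r]).
      destruct (h0 z h4) as [k1 k2].
      assert (k3 := ps_bound _ _ _ _ k1 h4).
      rewrite h3 in k2.
      assert (E : c 0%nat = - (z * ps (fun n => c (S n)) z)).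
      { replace (c 0%nat) with (c 0%nat + z * ps (fun n => c (S n)) z - z * ps (fun n => c (S n)) z)
          by ring. rewrite <- k2. ring. }
      assert (k4 : (Cmod (c 0%nat) <= Cmod z * (M / r))%R).
      { rewrite E, Cmod_opp, Cmod_mult. apply Rmult_le_compat_l; lra. }
      assert (k5 : (Cmod z * (M / r + 1) < Cmod (c 0%nat))%R).
      { apply Rlt_div_r in h5; lra. }
      lra. }
    apply (IH (fun n => c (S n)) (M / r)%R).
    + apply (proj1 (h0 0 ltac:(rewrite Cmod_0; lra))).
    + intros eps Heps. destruct (Hz (Rmin r eps)) as (z & [h1 h2] & h3).
      { apply Rmin_glb_lt; auto. }
      assert (h4 : (Cmod z <= r)%R) by (eapply Rlt_le, Rlt_le_trans; [apply h2|apply Rmin_l]).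
      exists z. split.
      * split; auto. eapply Rlt_le_trans; [apply h2|apply Rmin_r].
      * destruct (h0 z h4) as [_ k2]. rewrite h3, c0 in k2.
        assert (hz : z <> 0) by now apply Cmod_gt_0.
        replace (ps (fun n => c (S n)) z) with ((0 + z * ps (fun n => c (S n)) z) / z)
          by (field; auto). rewrite <- k2. field; auto.
Qed.

(** The identity theorem in the form used everywhere below. Agreement is needed only at some points
    tending to 0, for instance on a ray. *)
Lemma ps_unique c d r M N : psum c r M -> psum d r N -> (0 < r)%R ->
  (forall eps, (0 < eps)%R -> exists z, (0 < Cmod z < eps)%R /\ ps c z = ps d z) ->
  forall n, c n = d n.
Proof.
  intros Hc Hd Hr Hz n.
  assert (Hm := psum_scal (-1) _ _ _ Hd).
  assert (E : c n + (-1) * d n = 0).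
  { apply (ps_zero_of_zeros (fun n => c n + (-1) * d n) r _ (psum_plus _ _ _ _ _ Hc Hm) Hr).
    intros eps Heps. destruct (Hz (Rmin eps r)) as (z & [h1 h2] & h3); [now apply Rmin_glb_lt|].
    assert (h4 : (Cmod z <= r)%R) by (eapply Rlt_le, Rlt_le_trans; [apply h2|apply Rmin_r]).
    exists z. split; [split; auto; eapply Rlt_le_trans; [apply h2|apply Rmin_l]|].
    rewrite (ps_plus _ _ _ _ _ _ Hc Hm h4), (ps_scal _ _ _ _ _ Hd h4), h3. ring. }
  replace (c n) with (c n + (-1) * d n + d n) by ring. rewrite E. ring.
Qed.

(** Weierstrass's double series theorem: the norms bound the family indexed by [(i, n)], and the two
    summations may be exchanged. *)
Lemma ps_tsum {I : Type} (c : I -> nat -> C) (r : R) (M : I -> R) B :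
  (0 <= r)%R -> (forall i, psum (c i) r (M i)) -> asum (fun i => RtoC (M i)) B ->
  psum (fun n => tsum (fun i => c i n)) r B /\
  (forall z, (Cmod z <= r)%R -> summable (fun i => ps (c i) z) /\
     tsum (fun i => ps (c i) z) = ps (fun n => tsum (fun i => c i n)) z) /\
  ((0 < r)%R -> forall n, summable (fun i => c i n)).
Proof.
  intros Hr HM HB.
  assert (HP : forall z, (Cmod z <= r)%R ->
    asum (fun p : I * nat => c (fst p) (snd p) * z ^ snd p) B).
  { intros z Hz. apply (asum_prod _ M); auto. intros i. cbn [fst snd].
    apply (psum_asum _ _ _ _ (HM i) Hz). }
  set (sw := fun q : nat * I => (snd q, fst q)).
  assert (Hi : forall q q', sw q = sw q' -> q = q').
  { intros [a b] [a' b']. unfold sw; simpl. congruence. }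
  assert (Hsum : forall n, (0 < r)%R -> summable (fun i => c i n)).
  { intros n Hr0. 
    assert (h := summable_inj (fun i : I => (i, n)) ltac:(intros ? ?; congruence) _
      (ex_intro _ B (HP (RtoC r) ltac:(rewrite Cmod_R, Rabs_pos_eq; lra)))).
    cbn [fst snd] in h. 
    eapply summable_ext; [|apply (summable_scal (/ (RtoC r ^ n)) _ h)].
    intros i. cbv beta. field. apply Cpow_nz, RtoC_neq0. lra. }
  split; [|split; [|auto]].
  - assert (hr : (Cmod (RtoC r) <= r)%R) by (rewrite Cmod_R, Rabs_pos_eq; lra).
    assert (h := asum_inj sw Hi _ _ (HP (RtoC r) hr)). cbn [sw fst snd] in h.
    apply asum_outer in h. cbn [fst snd] in h.
    eapply asum_le; [|apply h]. intros n. cbv beta. right. f_equal.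
    destruct (Req_dec r 0) as [->|Hr0].
    + destruct n as [|n]; cbn [Cpow].
      * rewrite Cmult_1_r. apply tsum_ext; intros; apply eq_sym, Cmult_1_r.
      * rewrite (tsum_ext (fun i => c i (S n) * (RtoC 0 * RtoC 0 ^ n)) (fun i => 0)) by (intros; ring).
        rewrite (has_sum_tsum _ _ has_sum_0). ring.
    + rewrite Cmult_comm, <- tsum_scal by (apply Hsum; lra).
      apply tsum_ext; intros; ring.
  - intros z Hz.
    assert (hS : summable (fun p : I * nat => c (fst p) (snd p) * z ^ snd p))
      by (exists B; auto).
    destruct (tsum_prod _ hS) as [h1 h2]. cbn [fst snd] in h1, h2.
    split; [exact h1|].
    unfold ps. rewrite (tsum_swap (fun i n => c i n * z ^ n) hS).
    apply tsum_ext. intros n.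
    destruct (Req_dec r 0) as [->|Hr0].
    + assert (z = 0) by (apply Cmod_eq_0; generalize (Cmod_ge_0 z); lra). subst z.
      destruct n as [|n].
      * cbn [Cpow]. rewrite Cmult_1_r. apply tsum_ext; intros; apply Cmult_1_r.
      * cbn [Cpow]. rewrite (tsum_ext (fun i => c i (S n) * (RtoC 0 * RtoC 0 ^ n)) (fun i => 0)) by (intros; ring).
        rewrite (has_sum_tsum _ _ has_sum_0). ring.
    + rewrite Cmult_comm, <- tsum_scal by (apply Hsum; lra).
      apply tsum_ext; intros; ring.
Qed.

Lemma psum_Cexp (lam : C) r : (0 <= r)%R -> psum (pw lam) r (exp (r * Cmod lam)).
Proof.
  intros Hr. unfold psum.
  replace (fun n => pw lam n * RtoC r ^ n) with (pw (lam * r)).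
  - replace (r * Cmod lam)%R with (Cmod (lam * r)); [apply asum_pw|].
    rewrite Cmod_mult, Cmod_R, Rabs_pos_eq; auto. ring.
  - apply functional_extensionality; intros n. unfold pw. rewrite Cpow_mult_l. field.
    apply INR_fact_neq0.
Qed.

Lemma ps_Cexp (lam z : C) : ps (pw lam) z = Cexp (lam * z).
Proof.
  rewrite <- tsum_pw. apply tsum_ext. intros n. unfold pw. rewrite Cpow_mult_l. field.
  apply INR_fact_neq0.
Qed.

(** Expanding each exponential gives a power series whose coefficients are the moments of [c] with
    respect to [lam], divided by factorials. Passing from a function of the displacement to its
    moments is how the exponent [k] gets lowered. *)
Lemma exp_sum {I : Type} (c lam : I -> C) (r B : R) : (0 < r)%R ->
  asum (fun i => c i * RtoC (exp (r * Cmod (lam i)))) B ->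
  psum (fun n => tsum (fun i => c i * pw (lam i) n)) r B /\
  (forall z, (Cmod z <= r)%R -> summable (fun i => c i * Cexp (lam i * z)) /\
     tsum (fun i => c i * Cexp (lam i * z)) = ps (fun n => tsum (fun i => c i * pw (lam i) n)) z) /\
  (forall n, summable (fun i => c i * pw (lam i) n)).
Proof.
  intros Hr HB.
  destruct (ps_tsum (fun i n => c i * pw (lam i) n) r
    (fun i => (Cmod (c i) * exp (r * Cmod (lam i)))%R) B) as (h1 & h2 & h3).
  - lra.
  - intros i. apply psum_scal, psum_Cexp; lra.
  - eapply asum_le; [|apply HB]. intros i. cbv beta. rewrite Cmod_mult, !Cmod_R, Rabs_mult.
    rewrite (Rabs_pos_eq (Cmod (c i))) by apply Cmod_ge_0. lra.
  - split; auto. split; auto.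
    intros z Hz. destruct (h2 z Hz) as [k1 k2].
    assert (E : forall i, ps (fun n => c i * pw (lam i) n) z = c i * Cexp (lam i * z)).
    { intros i. rewrite (ps_scal _ _ r _ _ (psum_Cexp (lam i) r (Rlt_le _ _ Hr)) Hz).
      now rewrite ps_Cexp. }
    split; [eapply summable_ext; [apply E|apply k1]|].
    now rewrite <- (tsum_ext _ _ E).
Qed.

(** [exp 1] is the norm of the exponential series at radius 1, and removing leading terms and
    dividing by the variable does not increase that norm. *)
Lemma Cexp_approx d : (Cmod d <= 1)%R ->
  (Cmod (Cexp d - 1) <= exp 1 * Cmod d)%R /\
  (Cmod (Cexp d - 1 - d) <= exp 1 * (Cmod d * Cmod d))%R.
Proof.
  intros Hd.
  assert (H : psum (pw 1) 1 (exp 1)).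
  { replace (exp 1) with (exp (1 * Cmod 1)) by (rewrite Cmod_1; f_equal; ring).
    apply psum_Cexp; lra. }
  assert (E : Cexp d = ps (pw 1) d) by (rewrite ps_Cexp; f_equal; ring).
  destruct (ps_Sl _ _ _ d H Rlt_0_1 Hd) as [h1 h2].
  destruct (ps_Sl _ _ _ d h1 Rlt_0_1 Hd) as [h3 h4].
  rewrite pw_0 in h2.
  assert (E1 : pw 1 1 = 1) by (unfold pw; simpl; field).
  rewrite E1 in h4.
  assert (b1 := ps_bound _ _ _ _ h1 Hd). assert (b2 := ps_bound _ _ _ _ h3 Hd).
  rewrite Rdiv_1_r in b1. rewrite !Rdiv_1_r in b2.
  split.
  - rewrite E, h2. replace (1 + d * ps (fun n => pw 1 (S n)) d - 1)
      with (d * ps (fun n => pw 1 (S n)) d) by ring.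
    rewrite Cmod_mult, Rmult_comm. apply Rmult_le_compat_r; auto. apply Cmod_ge_0.
  - rewrite E, h2, h4. match goal with |- (Cmod ?a <= _)%R =>
      replace a with (d * d * ps (fun n => pw 1 (S (S n))) d) by ring end.
    rewrite !Cmod_mult, (Rmult_comm (exp 1)). apply Rmult_le_compat_l; auto.
    apply Rmult_le_pos; apply Cmod_ge_0.
Qed.

(** * Limits of complex sequences *)

Lemma Clim_ext u v l : (forall n, u n = v n) -> Clim u l -> Clim v l.
Proof. intros E H eps Heps. destruct (H eps Heps) as [N HN]. exists N. intros n Hn. rewrite <- E; auto. Qed.

Lemma Clim_const l : Clim (fun _ => l) l.
Proof.
  intros eps Heps. exists 0%nat. intros n _. replace (l - l) with (RtoC 0) by ring.
  now rewrite Cmod_0.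
Qed.

Lemma Clim_plus u v l m : Clim u l -> Clim v m -> Clim (fun n => u n + v n) (l + m).
Proof.
  intros Hu Hv eps Heps.
  destruct (Hu (eps / 2)%R) as [N1 H1]; [lra|]. destruct (Hv (eps / 2)%R) as [N2 H2]; [lra|].
  exists (max N1 N2). intros n Hn.
  specialize (H1 n ltac:(lia)). specialize (H2 n ltac:(lia)).
  replace (u n + v n - (l + m)) with ((u n - l) + (v n - m)) by ring.
  eapply Rle_lt_trans; [apply Cmod_triangle|lra].
Qed.

Lemma Clim_scal a u l : Clim u l -> Clim (fun n => a * u n) (a * l).
Proof.
  intros Hu eps Heps. assert (Ha := Cmod_ge_0 a).
  destruct (Hu (eps / (Cmod a + 1))%R) as [N H]; [apply Rdiv_lt_0_compat; lra|].
  exists N. intros n Hn. specialize (H n Hn).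
  replace (a * u n - a * l) with (a * (u n - l)) by ring. rewrite Cmod_mult.
  apply Rlt_div_r in H; [|lra]. generalize (Cmod_ge_0 (u n - l)); nra.
Qed.

Lemma Clim_bound u l : Clim u l -> exists N, forall n, (N <= n)%nat -> (Cmod (u n) <= Cmod l + 1)%R.
Proof.
  intros H. destruct (H 1%R Rlt_0_1) as [N HN]. exists N. intros n Hn. specialize (HN n Hn).
  replace (u n) with (l + (u n - l)) by ring. eapply Rle_trans; [apply Cmod_triangle|lra].
Qed.

Lemma Clim_0_mult u v K : Clim u 0 -> (exists N, forall n, (N <= n)%nat -> (Cmod (v n) <= K)%R) ->
  Clim (fun n => u n * v n) 0.
Proof.
  intros Hu [N0 H0] eps Heps.
  assert (HK : (0 <= K)%R) by (generalize (H0 N0 (le_n _)) (Cmod_ge_0 (v N0)); lra).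
  destruct (Hu (eps / (K + 1))%R) as [N H]; [apply Rdiv_lt_0_compat; lra|].
  exists (max N N0). intros n Hn. specialize (H n ltac:(lia)). specialize (H0 n ltac:(lia)).
  replace (u n - 0) with (u n) in H by ring.
  replace (u n * v n - 0) with (u n * v n) by ring. rewrite Cmod_mult.
  apply Rlt_div_r in H; [|lra]. generalize (Cmod_ge_0 (u n)) (Cmod_ge_0 (v n)); nra.
Qed.

Lemma Clim_shift u l : Clim u l <-> Clim (fun n => u n - l) 0.
Proof.
  split; intros H eps Heps; destruct (H eps Heps) as [N HN]; exists N; intros n Hn;
    specialize (HN n Hn).
  - now replace (u n - l - 0) with (u n - l) by ring.
  - now replace (u n - l - 0) with (u n - l) in HN by ring.
Qed.

Lemma Clim_mult u v l m : Clim u l -> Clim v m -> Clim (fun n => u n * v n) (l * m).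
Proof.
  intros Hu Hv. apply (proj2 (Clim_shift (fun n => u n * v n) (l * m))).
  apply Clim_ext with (fun n => (u n - l) * v n + l * (v n - m)); [intros; ring|].
  replace (RtoC 0) with (0 + l * 0) by ring. apply Clim_plus.
  - eapply Clim_0_mult; [apply (proj1 (Clim_shift u l)), Hu|]. apply Clim_bound, Hv.
  - apply Clim_scal. apply (proj1 (Clim_shift v m)), Hv.
Qed.

Lemma Clim_inv u (l : C) : l <> 0 -> Clim u l -> Clim (fun n => / u n) (/ l).
Proof.
  intros Hl Hu. assert (Hp : (0 < Cmod l)%R) by now apply Cmod_gt_0.
  destruct (Hu (Cmod l / 2)%R) as [N HN]; [lra|].
  assert (Hlow : forall n, (N <= n)%nat -> (Cmod l / 2 <= Cmod (u n))%R).
  { intros n Hn. specialize (HN n Hn).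
    assert (Cmod l <= Cmod (u n) + Cmod (u n - l))%R; [|lra].
    rewrite <- (Cmod_opp (u n - l)). replace l with (u n + - (u n - l)) at 1 by ring.
    apply Cmod_triangle. }
  intros eps Heps.
  destruct (Hu (eps * (Cmod l / 2) * Cmod l)%R) as [N2 HN2].
  { repeat apply Rmult_lt_0_compat; lra. }
  exists (max N N2). intros n Hn.
  specialize (Hlow n ltac:(lia)). specialize (HN2 n ltac:(lia)).
  assert (hu : u n <> 0) by (apply Cmod_gt_0; lra).
  replace (/ u n - / l) with (- (u n - l) / (u n * l)) by (field; auto).
  rewrite Cmod_div, Cmod_opp, Cmod_mult by (apply Cmult_neq_0; auto).
  assert (0 < Cmod (u n) * Cmod l)%R by (apply Rmult_lt_0_compat; lra).
  apply Rlt_div_l; auto.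
  eapply Rlt_le_trans; [apply HN2|]. rewrite Rmult_assoc. apply Rmult_le_compat_l; [lra|].
  apply Rmult_le_compat_r; lra.
Qed.

Lemma Clim_unique u l m : Clim u l -> Clim u m -> l = m.
Proof.
  intros Hl Hm. apply NNPP; intros H.
  assert (Hp : (0 < Cmod (l - m))%R) by (apply Cmod_gt_0, Cminus_eq_contra, H).
  destruct (Hl (Cmod (l - m) / 2)%R) as [N1 H1]; [lra|].
  destruct (Hm (Cmod (l - m) / 2)%R) as [N2 H2]; [lra|].
  specialize (H1 (max N1 N2) ltac:(lia)). specialize (H2 (max N1 N2) ltac:(lia)).
  assert (Cmod (l - m) <= Cmod (u (max N1 N2) - m) + Cmod (u (max N1 N2) - l))%R; [|lra].
  rewrite <- (Cmod_opp (_ - l)).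
  replace (l - m) with ((u (max N1 N2) - m) + - (u (max N1 N2) - l)) by ring.
  apply Cmod_triangle.
Qed.

Lemma Clim_squeeze u l (b : nat -> R) : (forall n, (Cmod (u n - l) <= b n)%R) ->
  is_lim_seq b 0 -> Clim u l.
Proof.
  intros H Hb eps Heps. apply is_lim_seq_spec in Hb.
  destruct (Hb (mkposreal eps Heps)) as [N HN]. exists N. intros n Hn.
  specialize (HN n Hn). simpl in HN. rewrite Rminus_0_r in HN.
  eapply Rle_lt_trans; [apply H|]. eapply Rle_lt_trans; [apply Rle_abs|auto].
Qed.

Lemma Clim_Cexp u l : Clim u l -> Clim (fun n => Cexp (u n)) (Cexp l).
Proof.
  intros Hu.
  assert (H : Clim (fun n => Cexp (u n - l) - 1) 0).
  { intros eps Heps. assert (hp := exp_pos 1).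
    destruct (Hu (Rmin 1 (eps / exp 1))%R) as [N HN].
    { apply Rmin_glb_lt; [lra|]. apply Rdiv_lt_0_compat; lra. }
    exists N. intros n Hn. specialize (HN n Hn).
    assert (h1 : (Cmod (u n - l) < 1)%R) by (eapply Rlt_le_trans; [apply HN|apply Rmin_l]).
    assert (h2 : (Cmod (u n - l) < eps / exp 1)%R) by (eapply Rlt_le_trans; [apply HN|apply Rmin_r]).
    replace (Cexp (u n - l) - 1 - 0) with (Cexp (u n - l) - 1) by ring.
    eapply Rle_lt_trans; [apply Cexp_approx; lra|].
    apply Rlt_div_r in h2; auto. lra. }
  apply Clim_ext with (fun n => Cexp l + Cexp l * (Cexp (u n - l) - 1)).
  { intros n. replace (Cexp (u n)) with (Cexp l * Cexp (u n - l)); [ring|].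
    rewrite <- Cexp_plus. f_equal. ring. }
  replace (Cexp l) with (Cexp l + Cexp l * 0) at 1 by ring.
  apply Clim_plus; [apply Clim_const|]. now apply Clim_scal.
Qed.

(** * Summability of powers over [nat] and [Z] *)

Lemma Rpower_pos x y : (0 < Rpower x y)%R.
Proof. apply exp_pos. Qed.

(* Telescoping: [x^(1-s) - (x+1)^(1-s) >= (s-1) (x+1)^(-s)], by [exp u >= 1 + u]. *)
Lemma asum_Rpower (a s : R) : (0 < a)%R -> (1 < s)%R ->
  asum (fun n => RtoC (Rpower (a + INR n) (- s)))
    (Rpower a (- s) + Rpower a (1 - s) / (s - 1)).
Proof.
  intros Ha Hs.
  assert (Hstep : forall x, (0 < x)%R ->
    (Rpower (x + 1) (- s) <= (Rpower x (1 - s) - Rpower (x + 1) (1 - s)) / (s - 1))%R).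
  { intros x Hx. apply Rle_div_r; [lra|].
    assert (Hl : (/ (x + 1) <= ln (x + 1) - ln x)%R).
    { assert (h := exp_ineq1_le (ln x + - ln (x + 1))).
      rewrite exp_plus, exp_Ropp, !exp_ln in h by lra.
      assert (x * / (x + 1) = 1 - / (x + 1))%R by (field; lra). lra. }
    assert (E1 : Rpower x (1 - s) = (Rpower (x + 1) (1 - s) * exp ((s - 1) * (ln (x + 1) - ln x)))%R).
    { unfold Rpower. rewrite <- exp_plus. f_equal. ring. }
    assert (E2 : Rpower (x + 1) (1 - s) = (Rpower (x + 1) (- s) * (x + 1))%R).
    { replace (1 - s)%R with (- s + 1)%R by ring. rewrite Rpower_plus, Rpower_1; lra. }
    assert (h := exp_ineq1_le ((s - 1) * (ln (x + 1) - ln x))).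
    assert (hp := Rpower_pos (x + 1) (1 - s)). assert (hp2 := Rpower_pos (x + 1) (- s)).
    rewrite E1.
    assert (h2 : ((s - 1) * / (x + 1) <= (s - 1) * (ln (x + 1) - ln x))%R)
      by (apply Rmult_le_compat_l; lra).
    apply Rle_trans with (Rpower (x + 1) (1 - s) * ((s - 1) * / (x + 1)))%R.
    - rewrite E2. right. field. lra.
    - assert (Rpower (x + 1) (1 - s) * (1 + (s - 1) * / (x + 1)) <=
              Rpower (x + 1) (1 - s) * exp ((s - 1) * (ln (x + 1) - ln x)))%R; [|lra].
      apply Rmult_le_compat_l; lra. }
  apply summable_nat_bound.
  - intros n. left. apply Rpower_pos.
  - intros n.
    assert (H : (sum_n (fun n => Rpower (a + INR n) (- s)) n <=
      Rpower a (- s) + (Rpower a (1 - s) - Rpower (a + INR n) (1 - s)) / (s - 1))%R).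
    { induction n as [|n IH].
      - rewrite sum_O. simpl. rewrite Rplus_0_r. unfold Rdiv. lra.
      - rewrite sum_Sn.
        change (sum_n (fun n => Rpower (a + INR n) (- s)) n + Rpower (a + INR (S n)) (- s) <=
          Rpower a (- s) + (Rpower a (1 - s) - Rpower (a + INR (S n)) (1 - s)) / (s - 1))%R.
        revert IH. generalize (sum_n (fun n => Rpower (a + INR n) (- s)) n : R). intros x IH.
        rewrite S_INR. assert (hn := pos_INR n).
        assert (h := Hstep (a + INR n)%R ltac:(lra)).
        replace (a + (INR n + 1))%R with (a + INR n + 1)%R by ring.
        unfold Rdiv in *. lra. }
    eapply Rle_trans; [apply H|]. apply Rplus_le_compat_l.
    apply Rmult_le_compat_r; [left; apply Rinv_0_lt_compat; lra|].
    generalize (Rpower_pos (a + INR n) (1 - s)). lra.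
Qed.

Lemma Z_shift_inj n0 (i j : nat) : (n0 + Z.of_nat i = n0 + Z.of_nat j)%Z -> i = j.
Proof. lia. Qed.

Lemma Z_shift_inj' n0 (i j : nat) : (n0 - 1 - Z.of_nat i = n0 - 1 - Z.of_nat j)%Z -> i = j.
Proof. lia. Qed.

Section ZSplit.
Context (f : Z -> C) (n0 : Z).
Let f1 n := if Z_le_dec n0 n then f n else 0.
Let f2 n := if Z_le_dec n0 n then RtoC 0 else f n.

Let f12 n : f1 n + f2 n = f n.
Proof. unfold f1, f2. destruct Z_le_dec; ring. Qed.

Let f1_range n : f1 n <> 0 -> exists i : nat, (n0 + Z.of_nat i)%Z = n.
Proof. unfold f1. destruct Z_le_dec; [|easy]. intros _. exists (Z.to_nat (n - n0)). lia. Qed.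

Let f2_range n : f2 n <> 0 -> exists i : nat, (n0 - 1 - Z.of_nat i)%Z = n.
Proof. unfold f2. destruct Z_le_dec; [easy|]. intros _. exists (Z.to_nat (n0 - 1 - n)). lia. Qed.

Let f1_val i : f1 (n0 + Z.of_nat i) = f (n0 + Z.of_nat i)%Z.
Proof. unfold f1. destruct Z_le_dec; [easy|lia]. Qed.

Let f2_val i : f2 (n0 - 1 - Z.of_nat i) = f (n0 - 1 - Z.of_nat i)%Z.
Proof. unfold f2. destruct Z_le_dec; [lia|easy]. Qed.

Lemma summable_Z_split : summable (fun i : nat => f (n0 + Z.of_nat i)%Z) ->
  summable (fun i : nat => f (n0 - 1 - Z.of_nat i)%Z) -> summable f.
Proof.
  intros H1 H2. apply (summable_ext _ _ f12). apply summable_plus.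
  - apply (summable_inj_inv _ (Z_shift_inj n0) f1 f1_range).
    eapply summable_ext; [|apply H1]. intros i. now rewrite f1_val.
  - apply (summable_inj_inv _ (Z_shift_inj' n0) f2 f2_range).
    eapply summable_ext; [|apply H2]. intros i. now rewrite f2_val.
Qed.

Lemma tsum_Z_split : summable f ->
  tsum f = tsum (fun i : nat => f (n0 + Z.of_nat i)%Z) + tsum (fun i : nat => f (n0 - 1 - Z.of_nat i)%Z).
Proof.
  intros H.
  assert (S1 : summable f1).
  { eapply summable_le; [|apply H]. intros n. unfold f1. destruct Z_le_dec; [lra|].
    rewrite Cmod_0. apply Cmod_ge_0. }
  assert (S2 : summable f2).
  { eapply summable_le; [|apply H]. intros n. unfold f2. destruct Z_le_dec; [|lra].
    rewrite Cmod_0. apply Cmod_ge_0. }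
  rewrite <- (tsum_ext _ _ f12), tsum_plus; auto. f_equal.
  - rewrite (tsum_inj _ (Z_shift_inj n0) f1 f1_range S1). apply tsum_ext, f1_val.
  - rewrite (tsum_inj _ (Z_shift_inj' n0) f2 f2_range S2). apply tsum_ext, f2_val.
Qed.

End ZSplit.

(** 3/2 is the exponent that the geometric mean in [separation] leaves to each lattice; larger
    exponents follow by comparison. *)
Lemma summable_Z_32 : summable (fun n : Z => RtoC (Rpower (1 + Rabs (IZR n)) (- (3 / 2)))).
Proof.
  apply (summable_Z_split _ 0).
  - assert (h0 := asum_Rpower 1 (3 / 2) ltac:(lra) ltac:(lra)).
    eapply summable_ext; [|eexists; apply h0].
    intros i. cbv beta. rewrite Z.add_0_l, <- INR_IZR_INZ, Rabs_pos_eq by apply pos_INR.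
    reflexivity.
  - assert (h0 := asum_Rpower 2 (3 / 2) ltac:(lra) ltac:(lra)).
    eapply summable_ext; [|eexists; apply h0].
    intros i. cbv beta. rewrite minus_IZR, <- INR_IZR_INZ.
    assert (h := pos_INR i). simpl (0 - 1)%Z. rewrite Rabs_left by lra.
    do 2 f_equal. ring.
Qed.

Lemma summable_Z_sq K : (0 <= K)%R ->
  summable (fun n : Z => RtoC (K * / (IZR n * IZR n))).
Proof.
  intros HK. eapply summable_le; [|apply (summable_scal (RtoC (4 * K)) _ summable_Z_32)].
  intros n. cbv beta. rewrite Cmod_mult, !Cmod_R.
  rewrite (Rabs_pos_eq (Rpower _ _)) by (left; apply Rpower_pos).
  rewrite (Rabs_pos_eq (4 * K)) by lra.
  destruct (Z.eq_dec n 0) as [->|Hn].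
  - rewrite Rmult_0_l, Rinv_0, Rmult_0_r, Rabs_R0.
    apply Rmult_le_pos; [lra|left; apply Rpower_pos].
  - assert (h : (1 <= Rabs (IZR n))%R).
    { rewrite <- abs_IZR. apply IZR_le. lia. }
    set (x := Rabs (IZR n)) in *.
    assert (E : (IZR n * IZR n = x * x)%R).
    { unfold x. rewrite <- Rabs_mult. symmetry. apply Rabs_pos_eq. nra. }
    rewrite E.
    assert (0 < / (x * x))%R by (apply Rinv_0_lt_compat; nra).
    rewrite Rabs_pos_eq by nra.
    assert (h2 : (Rpower (1 + x) (- (2)) <= Rpower (1 + x) (- (3 / 2)))%R).
    { apply Rle_Rpower; lra. }
    assert (h3 : Rpower (1 + x) (- (2)) = (/ ((1 + x) * (1 + x)))%R).
    { rewrite Rpower_Ropp. f_equal. replace 2%R with (1 + 1)%R by ring.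
      rewrite Rpower_plus, Rpower_1; lra. }
    assert (h4 : (/ (x * x) <= 4 * / ((1 + x) * (1 + x)))%R).
    { apply Rmult_le_reg_r with (x * x)%R; [nra|]. rewrite Rinv_l by nra.
      apply Rmult_le_reg_r with ((1 + x) * (1 + x))%R; [nra|]. field_simplify; nra. }
    nra.
Qed.

(** * Partial fractions of the exponential generating function *)

Lemma csum_geom (x : C) n : (x - 1) * csum (fun l => x ^ l) n = x ^ n - 1.
Proof.
  induction n as [|n IH].
  - unfold csum; simpl. ring.
  - rewrite csum_S. simpl Cpow.
    transitivity ((x - 1) * csum (fun l => x ^ l) n + (x - 1) * x ^ n); [ring|rewrite IH; ring].
Qed.

Lemma csum_swap (f : nat -> nat -> C) m n :
  csum (fun i => csum (fun j => f i j) n) m = csum (fun j => csum (fun i => f i j) m) n.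
Proof.
  induction m as [|m IH].
  - symmetry. now apply csum_0.
  - rewrite csum_S, IH, <- csum_plus. apply csum_ext. intros j _. now rewrite csum_S.
Qed.

Lemma csum_const (c : C) n : csum (fun _ => c) n = INR n * c.
Proof.
  induction n as [|n IH]; [unfold csum; simpl; ring|].
  rewrite csum_S, IH, S_INR, RtoC_plus. ring.
Qed.

Lemma csum_single (f : nat -> C) n i : (i < n)%nat ->
  (forall j, (j < n)%nat -> j <> i -> f j = 0) -> csum f n = f i.
Proof.
  induction n as [|n IH]; intros Hi H; [lia|].
  rewrite csum_S. destruct (Nat.eq_dec i n) as [->|Hne].
  - rewrite csum_0; [ring|]. intros j Hj. apply H; lia.
  - rewrite IH, (H n); [ring|lia|lia|lia|]. intros j Hj. apply H. lia.
Qed.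

Lemma e_nat_mult x n : e (INR n * x) = e x ^ n.
Proof. unfold e. rewrite <- Cexp_nat_mult. f_equal. ring. Qed.

(** Multiplied by [u^N - 1], each fraction becomes a geometric sum in [u e (- x_i / N)]. After
    exchange of the sums, orthogonality of the [N]-th roots of unity keeps only the power [u^j]. The
    indices are any [N] consecutive integers, so that they can be centred at 0. *)
Lemma roots_partial_fractions (u : C) (N j : nat) (m0 : Z) :
  (j < N)%nat -> u ^ N <> 1 ->
  let x i := (m0 + Z.of_nat i)%Z in
  u ^ j / (u ^ N - 1) =
  / INR N * csum (fun i => e (IZR (x i) * INR j / INR N) / (u * e (- (IZR (x i) / INR N)) - 1)) N.
Proof.
  intros Hj Hu x.
  assert (HN : RtoC (INR N) <> 0) by (apply RtoC_neq0, not_0_INR; lia).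
  assert (Hu' : u ^ N - 1 <> 0) by now apply Cminus_eq_contra.
  set (v := fun i => u * e (- (IZR (x i) / INR N))).
  assert (HvN : forall i, v i ^ N = u ^ N).
  { intros i. unfold v. rewrite Cpow_mult_l, <- e_nat_mult.
    replace (INR N * - (IZR (x i) / INR N)) with (RtoC (IZR (- x i))).
    - rewrite e_IZR. ring.
    - rewrite opp_IZR, RtoC_opp. field. auto. }
  assert (Hv1 : forall i, v i - 1 <> 0).
  { intros i H. apply Hu. rewrite <- (HvN i). replace (v i) with (RtoC 1).
    - apply Cpow_1_l.
    - replace (v i) with (v i - 1 + 1) by ring. rewrite H. ring. }
  rewrite (csum_ext _ (fun i => / (u ^ N - 1) *
    csum (fun l => u ^ l * e (IZR (x i) * (INR j - INR l) / INR N)) N)).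
  2:{ intros i _. fold (v i).
    assert (Hg := csum_geom (v i) N). rewrite HvN in Hg.
    rewrite (csum_ext (fun l => u ^ l * e (IZR (x i) * (INR j - INR l) / INR N))
      (fun l => e (IZR (x i) * INR j / INR N) * v i ^ l)).
    - rewrite csum_scal. change (csum (Cpow (v i)) N) with (csum (fun l => v i ^ l) N).
      replace (csum (fun l => v i ^ l) N) with ((u ^ N - 1) / (v i - 1)).
      + field. auto.
      + rewrite <- Hg. field. auto.
    - intros l _. unfold v. rewrite Cpow_mult_l, <- e_nat_mult.
      replace (e (IZR (x i) * (INR j - INR l) / INR N)) with
        (e (IZR (x i) * INR j / INR N) * e (INR l * - (IZR (x i) / INR N))); [ring|].
      rewrite <- e_plus. f_equal. field. auto. }
  rewrite csum_scal, csum_swap.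
  rewrite (csum_single _ N j Hj).
  - rewrite csum_scal, (csum_ext _ (fun _ => 1)), csum_const; [field; auto|].
    intros i _. rewrite <- e_0. f_equal. field. auto.
  - intros l Hl Hlj. rewrite csum_scal.
    set (w := e ((INR j - INR l) / INR N)).
    rewrite (csum_ext _ (fun i => e (IZR m0 * (INR j - INR l) / INR N) * w ^ i)).
    2:{ intros i _. unfold w. rewrite <- e_nat_mult, <- e_plus. f_equal. unfold x.
        rewrite plus_IZR, RtoC_plus, <- INR_IZR_INZ. field. auto. }
    rewrite csum_scal.
    assert (Hw : w <> 1).
    { unfold w. rewrite <- RtoC_minus, <- RtoC_div by (apply not_0_INR; lia). intros H.
      destruct (e_eq_1 _ H) as [z Hz].
      assert (HNp : (0 < INR N)%R) by (apply lt_0_INR; lia).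
      assert (E : (INR j - INR l = IZR z * INR N)%R) by (rewrite <- Hz; field; lra).
      rewrite !INR_IZR_INZ, <- minus_IZR, <- mult_IZR in E. apply eq_IZR in E. 
      destruct (Z.lt_trichotomy z 0) as [h|[->|h]]; nia. }
    assert (HwN : w ^ N = 1).
    { unfold w. rewrite <- e_nat_mult.
      replace (INR N * ((INR j - INR l) / INR N)) with (RtoC (IZR (Z.of_nat j - Z.of_nat l))).
      - apply e_IZR.
      - rewrite minus_IZR, RtoC_minus, <- !INR_IZR_INZ. field. auto. }
    assert (Hg := csum_geom w N). rewrite HwN in Hg.
    assert (Hz : csum (fun i => w ^ i) N = 0).
    { replace (csum (fun i => w ^ i) N) with ((w - 1) * csum (fun i => w ^ i) N / (w - 1)).
      - rewrite Hg. field. now apply Cminus_eq_contra.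
      - field. now apply Cminus_eq_contra. }
    change (csum (Cpow w) N) with (csum (fun i => w ^ i) N). rewrite Hz. ring.
Qed.

(** [sin x >= x - x^3 / 6], and [x^2 / 6 <= 2 / 3] on this interval. *)
Lemma sin_lower x : (0 <= x <= 2)%R -> (x / 3 <= sin x)%R.
Proof.
  intros Hx. assert (hp := PI2_3_2).
  destruct (sin_bound x 0) as [h _]; [lra|lra|].
  unfold sin_approx, sin_term in h. simpl in h. nra.
Qed.

Lemma Cmod_e_minus_1 (x : R) : Cmod (e x - 1) = (2 * Rabs (sin (PI * x)))%R.
Proof.
  rewrite e_real.
  replace (2 * PI * x)%R with (2 * (PI * x))%R by ring.
  rewrite cos_2a_sin, sin_2a.
  set (s := sin (PI * x)). set (c := cos (PI * x)).
  assert (H : (s * s + c * c = 1)%R) by (generalize (sin2_cos2 (PI * x)); unfold Rsqr, s, c; lra).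
  unfold Cmod, Cminus, Cplus, Copp, RtoC; simpl.
  replace (_ + _)%R with ((2 * s) * (2 * s) * (s * s + c * c))%R by ring.
  rewrite H, Rmult_1_r. fold (Rsqr (2 * s)). rewrite sqrt_Rsqr_abs, Rabs_mult.
  rewrite (Rabs_pos_eq 2); lra.
Qed.

(** The chord is [2 |sin (PI x)|]. With [3 < PI <= 4], [sin_lower] applies and yields at least
    [2 PI |x| / 3 >= 2 |x|]. *)
Lemma e_minus_1_lower (x : R) : (Rabs x <= 1 / 2)%R -> (2 * Rabs x <= Cmod (e x - 1))%R.
Proof.
  intros Hx. rewrite Cmod_e_minus_1. assert (hp := PI2_3_2). assert (hp4 := PI_4).
  assert (H : Rabs (sin (PI * x)) = Rabs (sin (PI * Rabs x))).
  { unfold Rabs at 3. destruct Rcase_abs; auto.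
    rewrite Ropp_mult_distr_r_reverse, sin_neg, Rabs_Ropp. easy. }
  rewrite H. assert (h0 := Rabs_pos x).
  assert (h := sin_lower (PI * Rabs x)).
  assert (h1 : (0 <= PI * Rabs x <= 2)%R) by nra. specialize (h h1).
  rewrite (Rabs_pos_eq (sin _)) by lra. nra.
Qed.

Definition pole (m : Z) : C := 2 * PI * Ci * IZR m.

Section PartialFractions.
Context (X : R) (HX : (0 <= X < 1)%R).

(** An odd number of roots makes the index range symmetric, from [-M] to [M]. With
    [u = Cexp (W / NN M)], the power [u ^ jj M] tends to [Cexp (X W)] because [jj M / NN M] tends to
    [X], while [u ^ NN M] is [Cexp W] exactly. *)
Let NN (M : nat) : nat := (2 * M + 1)%nat.
Let jj (M : nat) : nat := Z.to_nat (Int_part (X * INR (NN M))).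

Let NN_pos M : (0 < INR (NN M))%R.
Proof. apply lt_0_INR. unfold NN. lia. Qed.

Let jj_spec M : (INR (jj M) <= X * INR (NN M) < INR (jj M) + 1)%R.
Proof.
  assert (h := base_Int_part (X * INR (NN M))). assert (hN := NN_pos M).
  assert (0 <= Int_part (X * INR (NN M)))%Z.
  { assert (0 <= X * INR (NN M))%R by nra.
    assert (-1 < Int_part (X * INR (NN M)))%Z; [|lia]. apply lt_IZR. simpl. lra. }
  unfold jj. rewrite INR_IZR_INZ, Z2Nat.id by auto. lra.
Qed.

Let jj_lt M : (jj M < NN M)%nat.
Proof.
  assert (h := jj_spec M). assert (hN := NN_pos M).
  apply INR_lt. nra.
Qed.

Let invN_lim : is_lim_seq (fun M => (/ INR (NN M))%R) 0.
Proof.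
  apply (is_lim_seq_le_le (fun _ => 0%R) _ (fun M => (/ INR (S M))%R)).
  - intros M. split; [left; apply Rinv_0_lt_compat, NN_pos|].
    apply Rinv_le_contravar; [apply lt_0_INR; lia|]. apply le_INR. unfold NN. lia.
  - apply is_lim_seq_const.
  - apply (is_lim_seq_incr_1 (fun n => (/ INR n)%R)).
    replace (Finite 0) with (Rbar_inv p_infty) by easy.
    apply is_lim_seq_inv; [apply is_lim_seq_INR|easy].
Qed.

Let ratio_lim : Clim (fun M => RtoC (INR (jj M) / INR (NN M))) (RtoC X).
Proof.
  apply (Clim_squeeze _ _ (fun M => (/ INR (NN M))%R)); [|exact invN_lim].
  intros M. assert (h := jj_spec M). assert (hN := NN_pos M).
  rewrite <- RtoC_minus, Cmod_R. apply Rabs_le.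
  split; apply Rmult_le_reg_r with (INR (NN M)); auto; field_simplify; lra.
Qed.

Let num_lim (W : C) : Clim (fun M => Cexp (W / INR (NN M)) ^ jj M) (Cexp (X * W)).
Proof.
  apply Clim_ext with (fun M => Cexp (W * RtoC (INR (jj M) / INR (NN M)))).
  { intros M. rewrite <- Cexp_nat_mult. f_equal. rewrite RtoC_div; [field|].
    - apply RtoC_neq0. generalize (NN_pos M); lra.
    - generalize (NN_pos M); lra. }
  rewrite (Cmult_comm X). apply Clim_Cexp, Clim_scal, ratio_lim.
Qed.

Let root_lim (m : Z) : Clim (fun M => e (IZR m * INR (jj M) / INR (NN M))) (e (X * IZR m)).
Proof.
  unfold e. apply Clim_Cexp, Clim_scal.
  apply Clim_ext with (fun M => IZR m * RtoC (INR (jj M) / INR (NN M))).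
  { intros M. rewrite RtoC_div; [field|].
    - apply RtoC_neq0. generalize (NN_pos M); lra.
    - generalize (NN_pos M); lra. }
  rewrite (Cmult_comm X). apply Clim_scal, ratio_lim.
Qed.

Let den_lim (v : C) : Clim (fun M => INR (NN M) * (Cexp (v / INR (NN M)) - 1)) v.
Proof.
  intros eps Heps. assert (he := exp_pos 1). assert (hv := Cmod_ge_0 v).
  assert (H := proj2 (is_lim_seq_spec _ _) invN_lim). simpl in H. clear H.
  assert (H := invN_lim). apply is_lim_seq_spec in H.
  assert (hd : (0 < Rmin (/ (Cmod v + 1)) (eps / (exp 1 * (Cmod v * Cmod v) + 1)))%R).
  { apply Rmin_glb_lt; [apply Rinv_0_lt_compat; lra|apply Rdiv_lt_0_compat; nra]. }
  destruct (H (mkposreal _ hd)) as [N HN]. exists N. intros M HM.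
  specialize (HN M HM). simpl in HN. rewrite Rminus_0_r in HN.
  assert (hN := NN_pos M). assert (hNi := Rinv_0_lt_compat _ hN).
  rewrite Rabs_pos_eq in HN by lra.
  assert (h1 : (/ INR (NN M) < / (Cmod v + 1))%R) by (eapply Rlt_le_trans; [apply HN|apply Rmin_l]).
  assert (h2 : (/ INR (NN M) < eps / (exp 1 * (Cmod v * Cmod v) + 1))%R)
    by (eapply Rlt_le_trans; [apply HN|apply Rmin_r]).
  assert (hNc : RtoC (INR (NN M)) <> 0) by (apply RtoC_neq0; lra).
  assert (Ed : Cmod (v / INR (NN M)) = (Cmod v * / INR (NN M))%R).
  { rewrite Cmod_div, Cmod_R, Rabs_pos_eq by (auto; lra). easy. }
  assert (hs : (Cmod (v / INR (NN M)) <= 1)%R).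
  { rewrite Ed. apply Rmult_lt_compat_r with (r := (Cmod v + 1)%R) in h1; [|lra].
    rewrite Rinv_l in h1 by lra. nra. }
  destruct (Cexp_approx _ hs) as [_ h3]. rewrite Ed in h3.
  replace (INR (NN M) * (Cexp (v / INR (NN M)) - 1) - v)
    with (INR (NN M) * (Cexp (v / INR (NN M)) - 1 - v / INR (NN M))) by (field; auto).
  rewrite Cmod_mult, Cmod_R, Rabs_pos_eq by lra.
  apply Rle_lt_trans with (INR (NN M) * (exp 1 * (Cmod v * / INR (NN M) * (Cmod v * / INR (NN M)))))%R.
  { apply Rmult_le_compat_l; lra. }
  replace (INR (NN M) * (exp 1 * (Cmod v * / INR (NN M) * (Cmod v * / INR (NN M)))))%R
    with (/ INR (NN M) * (exp 1 * (Cmod v * Cmod v)))%R by (field; lra).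
  apply Rlt_div_r in h2; [|nra]. nra.
Qed.

Let aa (W : C) (m : Z) (M : nat) : C :=
  / (INR (NN M) * (Cexp ((W - pole m) / INR (NN M)) - 1)).

Let shift_exp (W : C) (m : Z) (M : nat) :
  Cexp (W / INR (NN M)) * e (- (IZR m / INR (NN M))) = Cexp ((W - pole m) / INR (NN M)).
Proof.
  unfold e, pole. rewrite <- Cexp_plus. f_equal. field.
  apply RtoC_neq0. generalize (NN_pos M); lra.
Qed.

Let pole_neq (W : C) (m : Z) : Cexp W <> 1 -> W - pole m <> 0.
Proof.
  intros H E. apply H. replace W with (W - pole m + pole m) by ring. rewrite E.
  replace (0 + pole m) with (2 * PI * Ci * IZR m) by (unfold pole; ring).
  apply (e_IZR m).
Qed.

(** A difference at two points, since for a single point the limiting series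
    [sum e (X m) / (W - pole m)] is not absolutely convergent. The indicator extends the finite sum
    to all of [Z], where [tsum_dominated] applies. *)
Let FF (W W' : C) (M : nat) (m : Z) : C :=
  indic (- Z.of_nat M <= m <= Z.of_nat M)%Z *
  (e (IZR m * INR (jj M) / INR (NN M)) * (aa W m M - aa W' m M)).

Let FF_sum W W' M : Cexp W <> 1 -> Cexp W' <> 1 ->
  summable (FF W W' M) /\ tsum (FF W W' M) =
  Cexp (W / INR (NN M)) ^ jj M / (Cexp W - 1) - Cexp (W' / INR (NN M)) ^ jj M / (Cexp W' - 1).
Proof.
  intros HW HW'.
  set (L := map (fun i => (- Z.of_nat M + Z.of_nat i)%Z) (seq 0 (NN M))).
  assert (HL : NoDup L).
  { apply nodup_map_inj; [|apply seq_NoDup]. intros; lia. }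
  destruct (tsum_fin (FF W W' M) L HL) as [h1 h2].
  { intros m Hm. unfold FF. rewrite indic_false; [ring|]. intros Hr. apply Hm.
    apply in_map_iff. exists (Z.to_nat (m + Z.of_nat M)). split; [lia|].
    apply in_seq. unfold NN. lia. }
  split; auto. rewrite h2. unfold L. rewrite fsum_map. fold (NN M).
  assert (hN := NN_pos M).
  assert (hNc : RtoC (INR (NN M)) <> 0) by (apply RtoC_neq0; lra).
  assert (Epow : forall V, Cexp (V / INR (NN M)) ^ NN M = Cexp V).
  { intros V. rewrite <- Cexp_nat_mult. f_equal. field. auto. }
  assert (HR : forall V, Cexp V <> 1 -> Cexp (V / INR (NN M)) ^ jj M / (Cexp V - 1) =
    csum (fun i => e (IZR (- Z.of_nat M + Z.of_nat i) * INR (jj M) / INR (NN M)) *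
      aa V (- Z.of_nat M + Z.of_nat i) M) (NN M)).
  { intros V HV.
    assert (h := roots_partial_fractions (Cexp (V / INR (NN M))) (NN M) (jj M) (- Z.of_nat M)
      (jj_lt M)). rewrite Epow in h. rewrite (h HV), <- csum_scal. apply csum_ext.
    intros i _. rewrite shift_exp. unfold aa.
    assert (hne : Cexp ((V - pole (- Z.of_nat M + Z.of_nat i)) / INR (NN M)) - 1 <> 0).
    { rewrite <- shift_exp. intros E. apply HV. rewrite <- (Epow V).
      replace (Cexp (V / INR (NN M))) with
        ((Cexp (V / INR (NN M)) * e (- (IZR (- Z.of_nat M + Z.of_nat i) / INR (NN M))))
         * e (IZR (- Z.of_nat M + Z.of_nat i) / INR (NN M))).
      - replace (Cexp (V / INR (NN M)) * e (- (IZR (- Z.of_nat M + Z.of_nat i) / INR (NN M))))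
          with (RtoC 1).
        + rewrite Cmult_1_l, <- e_nat_mult.
          replace (INR (NN M) * (IZR (- Z.of_nat M + Z.of_nat i) / INR (NN M)))
            with (RtoC (IZR (- Z.of_nat M + Z.of_nat i))) by (field; auto).
          apply e_IZR.
        + rewrite <- (Cplus_0_l 1), <- E. ring.
      - rewrite e_opp. field. apply e_neq0. }
    field. auto. }
  rewrite (HR W HW), (HR W' HW').
  unfold Cminus at 1.
  replace (- csum (fun i => e (IZR (- Z.of_nat M + Z.of_nat i) * INR (jj M) / INR (NN M)) *
      aa W' (- Z.of_nat M + Z.of_nat i) M) (NN M))
   with ((-1) * csum (fun i => e (IZR (- Z.of_nat M + Z.of_nat i) * INR (jj M) / INR (NN M)) *
      aa W' (- Z.of_nat M + Z.of_nat i) M) (NN M)) by ring.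
  rewrite <- csum_scal, <- csum_plus. apply csum_ext. intros i Hi.
  unfold FF. rewrite indic_true; [ring|]. unfold NN in Hi. lia.
Qed.

Lemma partial_fractions W W' : Cexp W <> 1 -> Cexp W' <> 1 ->
  summable (fun m => e (X * IZR m) * (/ (W - pole m) - / (W' - pole m))) /\
  tsum (fun m => e (X * IZR m) * (/ (W - pole m) - / (W' - pole m))) =
  Cexp (X * W) / (Cexp W - 1) - Cexp (X * W') / (Cexp W' - 1).
Proof.
  intros HW HW'.
  (* [E1 / NN M] bounds the influence of [W] and [W'] on the denominators. Once [|m| >= E1], the
     chord bound [2 |m| / NN M] for the root of unity leaves [|m| / NN M] for each denominator,
     whence the majorant [E1 / m^2]. *)
  set (E1 := (exp 1 * (Cmod W + Cmod W'))%R).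
  assert (he := exp_pos 1). assert (hw := Cmod_ge_0 W). assert (hw' := Cmod_ge_0 W').
  assert (hE1 : (0 <= E1)%R) by (unfold E1; nra).
  set (K0 := up (E1 + Cmod W + Cmod W')).
  assert (hK0 : (E1 + Cmod W + Cmod W' < IZR K0)%R) by apply archimed.
  set (L0 := map (fun i => (Z.of_nat i - K0)%Z) (seq 0 (Z.to_nat (2 * K0 + 1)))).
  assert (hL0 : forall m, ~ In m L0 -> (IZR K0 <= Rabs (IZR m))%R).
  { intros m Hm. rewrite <- abs_IZR. apply IZR_le.
    destruct (Z_le_dec K0 (Z.abs m)) as [|Hlt]; auto. exfalso. apply Hm.
    apply in_map_iff. exists (Z.to_nat (m + K0)). split; [lia|]. apply in_seq. lia. }
  destruct (tsum_dominated (FF W W')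
    (fun m => e (X * IZR m) * (/ (W - pole m) - / (W' - pole m)))
    (fun m => (E1 * / (IZR m * IZR m))%R) L0 (Z.to_nat K0)) as [h1 h2].
  - now apply summable_Z_sq.
  - intros M. now apply FF_sum.
  - intros m. apply Clim_ext with
      (fun M => indic (- Z.of_nat M <= m <= Z.of_nat M)%Z *
        (e (IZR m * INR (jj M) / INR (NN M)) * (aa W m M + (-1) * aa W' m M))).
    { intros M. unfold FF. ring. }
    replace (e (X * IZR m) * (/ (W - pole m) - / (W' - pole m)))
      with (1 * (e (X * IZR m) * (/ (W - pole m) + (-1) * / (W' - pole m)))) by ring.
    apply Clim_mult.
    + intros eps Heps. exists (Z.to_nat (Z.abs m)). intros n Hn.
      rewrite indic_true by lia. replace (1 - 1) with (RtoC 0) by ring. now rewrite Cmod_0.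
    + apply Clim_mult; [apply root_lim|]. apply Clim_plus; [|apply Clim_scal];
        apply Clim_inv; auto; apply den_lim.
  - intros M m HM Hm. unfold FF.
    destruct (classic (- Z.of_nat M <= m <= Z.of_nat M)%Z) as [Hr|Hr].
    2:{ rewrite indic_false by auto. rewrite Cmult_0_l, Cmod_0.
        destruct (Z.eq_dec m 0) as [->|Hm0].
        - rewrite Rmult_0_l, Rinv_0. lra.
        - apply Rmult_le_pos; auto. left. apply Rinv_0_lt_compat.
          assert (IZR m <> 0)%R by now apply not_0_IZR. nra. }
    rewrite indic_true, Cmult_1_l, Cmod_mult by auto.
    assert (hN := NN_pos M).
    assert (hNc : RtoC (INR (NN M)) <> 0) by (apply RtoC_neq0; lra).
    replace (e (IZR m * INR (jj M) / INR (NN M))) with (e (RtoC (IZR m * INR (jj M) / INR (NN M))))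
      by (rewrite RtoC_div, RtoC_mult; [easy|lra]).
    rewrite Cmod_e, Rmult_1_l.
    assert (hm := hL0 m Hm).
    assert (hMN : (Rabs (IZR m) <= INR (NN M) / 2)%R).
    { rewrite <- abs_IZR. apply Rle_trans with (INR M).
      - rewrite INR_IZR_INZ. apply IZR_le. lia.
      - unfold NN. rewrite plus_INR, mult_INR. simpl. lra. }
    assert (hNW : (Cmod W + Cmod W' <= INR (NN M))%R) by lra.
    assert (hsmall : forall V, (Cmod V <= Cmod W + Cmod W')%R ->
      (Cmod (Cexp (V / INR (NN M)) - 1) <= exp 1 * Cmod V / INR (NN M))%R).
    { intros V HV. eapply Rle_trans; [apply Cexp_approx|];
        rewrite Cmod_div, Cmod_R, (Rabs_pos_eq (INR _)) by (auto; lra).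
      - apply Rle_div_l; lra.
      - right. unfold Rdiv. ring. }
    assert (hlow : forall V, (Cmod V <= Cmod W + Cmod W')%R ->
      (Rabs (IZR m) / INR (NN M) <= Cmod (Cexp ((V - pole m) / INR (NN M)) - 1))%R).
    { intros V HV. rewrite <- shift_exp.
      set (w := e (- (IZR m / INR (NN M)))).
      assert (Ew : w = e (RtoC (- (IZR m / INR (NN M)))))
        by (unfold w; rewrite RtoC_opp, RtoC_div; [easy|lra]).
      assert (Hx : (Rabs (- (IZR m / INR (NN M))) <= 1 / 2)%R).
      { rewrite Rabs_Ropp, Rabs_div, (Rabs_pos_eq (INR _)) by lra. apply Rle_div_l; lra. }
      assert (h3 := e_minus_1_lower _ Hx). rewrite <- Ew in h3.
      rewrite Rabs_Ropp, Rabs_div, (Rabs_pos_eq (INR _)) in h3 by lra.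
      assert (h4 := hsmall V HV).
      assert (Hw1 : Cmod w = 1%R) by (rewrite Ew; apply Cmod_e).
      assert (h5 : (Cmod (w - 1) <= Cmod (Cexp (V / INR (NN M)) * w - 1)
         + Cmod (Cexp (V / INR (NN M)) - 1))%R).
      { replace (Cmod (Cexp (V / INR (NN M)) - 1)) with (Cmod (- (w * (Cexp (V / INR (NN M)) - 1)))).
        - replace (w - 1) with ((Cexp (V / INR (NN M)) * w - 1) + - (w * (Cexp (V / INR (NN M)) - 1)))
            at 1 by ring. apply Cmod_triangle.
        - rewrite Cmod_opp, Cmod_mult, Hw1. ring. }
      assert (h6 : (exp 1 * Cmod V / INR (NN M) <= Rabs (IZR m) / INR (NN M))%R).
      { apply Rmult_le_compat_r; [left; now apply Rinv_0_lt_compat|].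
        apply Rle_trans with E1; [|lra]. unfold E1. apply Rmult_le_compat_l; lra. }
      lra. }
    assert (hm0 : (0 < Rabs (IZR m))%R).
    { assert (IZR m <> 0%R); [|now apply Rabs_pos_lt]. intros E.
      assert (m = 0%Z) by now apply eq_IZR. subst m.
      apply Hm. apply in_map_iff. exists (Z.to_nat K0).
      assert (0 < K0)%Z by (apply lt_IZR; lra).
      split; [lia|]. apply in_seq. lia. }
    assert (l1 := hlow W ltac:(lra)). assert (l2 := hlow W' ltac:(lra)).
    assert (hq : (0 < Rabs (IZR m) / INR (NN M))%R) by now apply Rdiv_lt_0_compat.
    set (D := Cexp ((W - pole m) / INR (NN M)) - 1) in *.
    set (D' := Cexp ((W' - pole m) / INR (NN M)) - 1) in *.
    assert (hD : D <> 0) by (apply Cmod_gt_0; lra).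
    assert (hD' : D' <> 0) by (apply Cmod_gt_0; lra).
    unfold aa. fold D D'.
    replace (/ (INR (NN M) * D) - / (INR (NN M) * D')) with ((D' - D) / (INR (NN M) * (D * D')))
      by (field; auto).
    assert (hDD : (Cmod (D' - D) <= E1 / INR (NN M))%R).
    { unfold D, D'. rewrite <- !shift_exp.
      set (w := e (- (IZR m / INR (NN M)))).
      assert (Hw1 : Cmod w = 1%R).
      { unfold w. replace (- (IZR m / INR (NN M))) with (RtoC (- (IZR m / INR (NN M)))).
        - apply Cmod_e.
        - rewrite RtoC_opp, RtoC_div; [easy|lra]. }
      replace (Cexp (W' / INR (NN M)) * w - 1 - (Cexp (W / INR (NN M)) * w - 1))
        with (w * ((Cexp (W' / INR (NN M)) - 1) + - (Cexp (W / INR (NN M)) - 1))) by ring.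
      rewrite Cmod_mult, Hw1, Rmult_1_l.
      eapply Rle_trans; [apply Cmod_triangle|]. rewrite Cmod_opp.
      assert (s1 := hsmall W ltac:(lra)). assert (s2 := hsmall W' ltac:(lra)).
      unfold E1. unfold Rdiv in *. lra. }
    rewrite Cmod_div, !Cmod_mult, Cmod_R, (Rabs_pos_eq (INR _))
      by (try apply Cmult_neq_0; auto; try apply Cmult_neq_0; auto; lra).
    assert (E2 : (IZR m * IZR m = Rabs (IZR m) * Rabs (IZR m))%R).
    { rewrite <- Rabs_mult. symmetry. apply Rabs_pos_eq. nra. }
    rewrite E2.
    assert (hpos : (0 < INR (NN M) *
      ((Rabs (IZR m) / INR (NN M)) * (Rabs (IZR m) / INR (NN M))))%R).
    { apply Rmult_lt_0_compat; [assumption|]. now apply Rmult_lt_0_compat. }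
    assert (hle : (INR (NN M) * ((Rabs (IZR m) / INR (NN M)) * (Rabs (IZR m) / INR (NN M))) <=
      INR (NN M) * (Cmod D * Cmod D'))%R).
    { apply Rmult_le_compat_l; [lra|]. apply Rmult_le_compat; lra. }
    apply Rle_trans with ((E1 / INR (NN M)) * / (INR (NN M) *
      ((Rabs (IZR m) / INR (NN M)) * (Rabs (IZR m) / INR (NN M)))))%R.
    + apply Rmult_le_compat; auto; [apply Cmod_ge_0| |].
      * left. apply Rinv_0_lt_compat. lra.
      * apply Rinv_le_contravar; assumption.
    + right. field. lra.
  - split; auto.
    eapply Clim_unique; [apply h2|].
    apply Clim_ext with (fun M => / (Cexp W - 1) * Cexp (W / INR (NN M)) ^ jj M
      + (- / (Cexp W' - 1)) * Cexp (W' / INR (NN M)) ^ jj M).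
    { intros M. rewrite (proj2 (FF_sum W W' M HW HW')). unfold Cdiv. ring. }
    replace (Cexp (X * W) / (Cexp W - 1) - Cexp (X * W') / (Cexp W' - 1))
      with (/ (Cexp W - 1) * Cexp (X * W) + (- / (Cexp W' - 1)) * Cexp (X * W'))
      by (unfold Cdiv; ring).
    apply Clim_plus; apply Clim_scal, num_lim.
Qed.

End PartialFractions.

(** * The generating function, its coefficients and its poles *)

Definition gen (X : C) (kappa : R) (z : C) : C :=
  e (X * kappa) * Cexp (X * z) / (e kappa * Cexp z - 1).

Definition bcoef (X : C) (kappa : R) (j : nat) : C := Ccoef j X kappa / INR (fact j).

(** [Ccoef] is chosen by [epsilon], so one convergent expansion shows that the chosen numbers also
    expand the same function; [ps_unique] then identifies the two sequences on a common smaller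
    disc. *)
Lemma Ccoef_unique (X : C) (kappa : R) (b : nat -> C) (r M : R) :
  (0 < r)%R -> psum b r M ->
  (forall z, (0 < Cmod z <= r)%R -> z * gen X kappa z = ps b z) ->
  forall j, bcoef X kappa j = b j.
Proof.
  intros Hr HM Hb.
  assert (Hg : forall z, z * e (X * kappa) * Cexp (X * z) / (e kappa * Cexp z - 1)
    = z * gen X kappa z) by (intros; unfold gen, Cdiv; ring).
  assert (Hex : is_Ccoef X kappa (fun j => b j * INR (fact j))).
  { exists (mkposreal r Hr). simpl. intros z Hz. rewrite Hg, Hb by lra.
    replace (fun j => b j * INR (fact j) / INR (fact j)) with b.
    - eapply ps_is_pseries; [apply HM|lra].
    - apply functional_extensionality; intros j. field. apply INR_fact_neq0. }
  assert (Hs := epsilon_spec (inhabits (fun _ : nat => RtoC 0)) (is_Ccoef X kappa)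
     (ex_intro _ _ Hex)).
  destruct Hs as [rho Hrho].
  fold (Ccoef) in Hrho.
  assert (hrho := cond_pos rho).
  set (d := fun j => Ccoef j X kappa / INR (fact j)).
  assert (Hrho' : forall z, (0 < Cmod z < rho)%R ->
    @is_pseries C_AbsRing C_NormedModule d z (z * gen X kappa z)).
  { intros z Hz. rewrite <- Hg. exact (Hrho z Hz). }
  set (r1 := (Rmin r (rho / 4))%R).
  assert (Hr1 : (0 < r1)%R) by (apply Rmin_glb_lt; lra).
  assert (Hr1r : (r1 <= r)%R) by apply Rmin_l.
  assert (Hr1rho : (r1 <= rho / 4)%R) by apply Rmin_r.
  assert (Cr : Cmod (RtoC (rho / 2)) = (rho / 2)%R) by (rewrite Cmod_R, Rabs_pos_eq; lra).
  destruct (is_pseries_psum d (RtoC (rho / 2)) _ r1 (Hrho' _ ltac:(rewrite Cr; lra)))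
    as [N HN]; [rewrite Cr; lra|].
  intros j. change (d j = b j).
  apply (ps_unique d b r1 N M); auto.
  - eapply psum_shrink; [apply HM|lra].
  - intros eps Heps. exists (RtoC (Rmin eps r1 / 2)).
    assert (h := Rmin_glb_lt eps r1 0 Heps Hr1).
    assert (h1 := Rmin_l eps r1). assert (h2 := Rmin_r eps r1).
    assert (Cz : Cmod (RtoC (Rmin eps r1 / 2)) = (Rmin eps r1 / 2)%R)
      by (rewrite Cmod_R, Rabs_pos_eq; lra).
    split; [rewrite Cz; lra|].
    assert (Hd := is_pseries_ps d r1 N _ _ HN ltac:(rewrite Cz; lra) (Hrho' _ ltac:(rewrite Cz; lra))).
    rewrite <- Hd. apply Hb. rewrite Cz; lra.
Qed.

(** The poles of [gen X kappa], that is, the solutions [z] of [e kappa * Cexp z = 1]. *)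
Definition zeta (kappa : R) (m : Z) : C := 2 * PI * Ci * (IZR m - kappa)%R.

Lemma two_pi_i_neq0 : 2 * PI * Ci <> 0.
Proof.
  assert (h := PI_RGT_0).
  repeat apply Cmult_neq_0; [apply RtoC_neq0; lra|apply RtoC_neq0; lra|apply Ci_nz].
Qed.

Lemma Cmod_zeta kappa m : Cmod (zeta kappa m) = (2 * PI * Rabs (IZR m - kappa))%R.
Proof.
  unfold zeta. assert (h := PI_RGT_0).
  rewrite !Cmod_mult, Cmod_Ci, !Cmod_R, !(Rabs_pos_eq _) by lra. ring.
Qed.

Lemma zeta_eq0 kappa m : zeta kappa m = 0 <-> IZR m = kappa.
Proof.
  split; intros H.
  - apply NNPP; intros Hne. apply (Cmult_neq_0 (2 * PI * Ci) (IZR m - kappa)%R); auto.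
    + apply two_pi_i_neq0.
    + apply RtoC_neq0. lra.
  - unfold zeta. rewrite H, Rminus_diag. ring.
Qed.

Lemma Z_dist_lower (kappa : R) :
  exists d, (0 < d)%R /\ forall m, IZR m <> kappa -> (d <= Rabs (IZR m - kappa))%R.
Proof.
  assert (h := base_Int_part kappa). set (n := Int_part kappa) in *.
  destruct (Req_dec (IZR n) kappa) as [E|E].
  - exists 1%R. split; [lra|]. intros m Hm. rewrite <- E, <- minus_IZR, <- abs_IZR.
    apply IZR_le. assert (m <> n) by congruence. lia.
  - exists (Rmin (kappa - IZR n) (IZR n + 1 - kappa)). split; [apply Rmin_glb_lt; lra|].
    intros m Hm. destruct (Z_le_dec m n) as [Hl|Hl].
    + apply IZR_le in Hl. eapply Rle_trans; [apply Rmin_l|].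
      rewrite Rabs_left1; lra.
    + assert (Hl' : (n + 1 <= m)%Z) by lia. apply IZR_le in Hl'. rewrite plus_IZR in Hl'.
      eapply Rle_trans; [apply Rmin_r|]. rewrite Rabs_pos_eq; lra.
Qed.

Lemma Z_dist_lower_lin (kappa : R) :
  exists c, (0 < c)%R /\ forall m, IZR m <> kappa ->
    (c * (1 + Rabs (IZR m)) <= Rabs (IZR m - kappa))%R.
Proof.
  destruct (Z_dist_lower kappa) as (d & Hd & H).
  assert (hk := Rabs_pos kappa).
  (* With [x] the distance and [1 + |m| <= 1 + |kappa| + x], this constant turns the claim into
     [d (1 + |kappa|) <= x (1 + |kappa|)], which holds as [d <= x]. *)
  exists (d / (1 + Rabs kappa + d))%R. split; [apply Rdiv_lt_0_compat; lra|].
  intros m Hm. specialize (H m Hm).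
  assert (h1 : (Rabs (IZR m) <= Rabs (IZR m - kappa) + Rabs kappa)%R).
  { replace (IZR m) with ((IZR m - kappa) + kappa)%R at 1 by ring. apply Rabs_triang. }
  set (x := Rabs (IZR m - kappa)) in *. set (y := Rabs (IZR m)) in *. set (a := Rabs kappa) in *.
  apply Rle_trans with (d / (1 + a + d) * (1 + (x + a)))%R.
  - apply Rmult_le_compat_l; [left; apply Rdiv_lt_0_compat; lra|lra].
  - apply Rmult_le_reg_r with (1 + a + d)%R; [lra|].
    replace (d / (1 + a + d) * (1 + (x + a)) * (1 + a + d))%R with (d * (1 + (x + a)))%R
      by (field; lra). nra.
Qed.

Lemma zeta_lower (kappa : R) : exists c, (0 < c)%R /\ forall m, zeta kappa m <> 0 ->
  (c * (1 + Rabs (IZR m)) <= Cmod (zeta kappa m))%R.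
Proof.
  destruct (Z_dist_lower_lin kappa) as (c & Hc & H). assert (hp := PI2_3_2).
  exists c. split; auto. intros m Hm. rewrite Cmod_zeta.
  assert (h := H m ltac:(intros E; apply Hm; now apply zeta_eq0)).
  assert (h2 := Rabs_pos (IZR m - kappa)). nra.
Qed.

(** By this convention a lattice point [zeta = 0] drops out of the sums of powers of [/ zeta] and of
    [gterm], whose statements then need no case distinction. *)
Lemma Cinv_0 : / 0 = RtoC 0.
Proof. unfold Cinv; simpl. apply C_ext; simpl; unfold Rdiv; ring. Qed.

Lemma Cmod_Cinv z : Cmod (/ z) = (/ Cmod z)%R.
Proof.
  destruct (classic (z = 0)) as [->|H]; [|now apply Cmod_inv].
  now rewrite Cinv_0, Cmod_0, Rinv_0.
Qed.

(** The indicator is needed because [Rpower], unlike an inverse, does not vanish at 0. *)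
Lemma summable_zeta_inv (kappa s : R) : (3 / 2 <= s)%R ->
  summable (fun m => indic (zeta kappa m <> 0) * RtoC (Rpower (Cmod (zeta kappa m)) (- s))).
Proof.
  intros Hs. destruct (zeta_lower kappa) as (c & Hc & H).
  eapply summable_le; [|apply (summable_scal (RtoC (Rpower c (- s))) _ summable_Z_32)].
  intros m. cbv beta. destruct (classic (zeta kappa m <> 0)) as [Hm|Hm].
  - rewrite indic_true, Cmult_1_l, Cmod_mult, !Cmod_R by auto.
    rewrite !Rabs_pos_eq by (left; apply Rpower_pos).
    specialize (H m Hm). assert (h := Rabs_pos (IZR m)).
    assert (Hp : (0 < c * (1 + Rabs (IZR m)))%R) by nra.
    apply Rle_trans with (Rpower (c * (1 + Rabs (IZR m))) (- s)).
    + rewrite !Rpower_Ropp. apply Rinv_le_contravar; [apply Rpower_pos|].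
      apply Rle_Rpower_l; [lra|split; auto].
    + rewrite <- (Rpower_mult_distr c (1 + Rabs (IZR m))) by lra.
      apply Rmult_le_compat_l; [left; apply Rpower_pos|]. apply Rle_Rpower; lra.
  - rewrite indic_false, Cmult_0_l, Cmod_0 by auto. apply Cmod_ge_0.
Qed.

Lemma zeta_term_le (kappa : R) (m : Z) (K : R) (z : C) :
  (zeta kappa m = 0 -> z = 0) -> (Cmod z <= K * (/ Cmod (zeta kappa m) * / Cmod (zeta kappa m)))%R ->
  (Cmod z <= Cmod (RtoC K * (indic (zeta kappa m <> 0) * RtoC (Rpower (Cmod (zeta kappa m)) (- (2))))))%R.
Proof.
  intros H0 H. destruct (classic (zeta kappa m = 0)) as [E|E].
  - rewrite H0, Cmod_0 by auto. apply Cmod_ge_0.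
  - rewrite indic_true, Cmult_1_l, Cmod_mult, !Cmod_R by auto.
    assert (hp : (0 < Cmod (zeta kappa m))%R) by now apply Cmod_gt_0.
    rewrite (Rabs_pos_eq (Rpower _ _)) by (left; apply Rpower_pos).
    replace (Rpower (Cmod (zeta kappa m)) (- (2))) with (/ Cmod (zeta kappa m) * / Cmod (zeta kappa m))%R.
    + eapply Rle_trans; [apply H|]. apply Rmult_le_compat_r; [|apply Rle_abs].
      left. apply Rmult_lt_0_compat; now apply Rinv_0_lt_compat.
    + rewrite Rpower_Ropp, <- Rinv_mult. f_equal. replace 2%R with (1 + 1)%R by ring.
      rewrite Rpower_plus, Rpower_1; auto.
Qed.

Lemma gen_pole_free (kappa : R) (z : C) (m : Z) : e kappa * Cexp z <> 1 -> z - zeta kappa m <> 0.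
Proof.
  intros H E. apply H. replace z with (z - zeta kappa m + zeta kappa m) by ring. rewrite E.
  unfold e. rewrite <- Cexp_plus. rewrite <- (e_IZR m). unfold e. f_equal. unfold zeta.
  rewrite RtoC_minus. ring.
Qed.

(** Translating both points by [2 PI i kappa] moves the poles of [partial_fractions] to the points
    [zeta kappa m]. *)
Lemma gen_difference (X kappa : R) (z z' : C) : (0 <= X < 1)%R ->
  e kappa * Cexp z <> 1 -> e kappa * Cexp z' <> 1 ->
  summable (fun m => e (X * IZR m) * (/ (z - zeta kappa m) - / (z' - zeta kappa m))) /\
  tsum (fun m => e (X * IZR m) * (/ (z - zeta kappa m) - / (z' - zeta kappa m))) =
  gen X kappa z - gen X kappa z'.
Proof.
  intros HX Hz Hz'.
  assert (E1 : forall w, Cexp (w + 2 * PI * Ci * kappa) = e kappa * Cexp w).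
  { intros w. rewrite Cexp_plus. unfold e. ring. }
  assert (E2 : forall w, Cexp (X * (w + 2 * PI * Ci * kappa)) = e (X * kappa) * Cexp (X * w)).
  { intros w. unfold e. rewrite <- Cexp_plus. f_equal. ring. }
  assert (E3 : forall w m, w + 2 * PI * Ci * kappa - pole m = w - zeta kappa m).
  { intros w m. unfold pole, zeta. rewrite RtoC_minus. ring. }
  destruct (partial_fractions X HX (z + 2 * PI * Ci * kappa) (z' + 2 * PI * Ci * kappa))
    as [h1 h2]; [now rewrite E1|now rewrite E1|].
  rewrite !E1, !E2 in h2.
  assert (E : forall m, e (X * IZR m) *
    (/ (z + 2 * PI * Ci * kappa - pole m) - / (z' + 2 * PI * Ci * kappa - pole m)) =
    e (X * IZR m) * (/ (z - zeta kappa m) - / (z' - zeta kappa m))) by (intros m; now rewrite !E3).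
  split; [eapply summable_ext; [apply E|apply h1]|].
  rewrite <- (tsum_ext _ _ E). exact h2.
Qed.

(** The Mittag-Leffler term [1 / (z - zeta) + 1 / zeta] in a form that shows its quadratic decay. It
    vanishes when [zeta = 0]; that pole is supplied by [polar_term]. *)
Definition gterm (X kappa : R) (z : C) (m : Z) : C :=
  e (X * IZR m) * (z * / zeta kappa m * / (z - zeta kappa m)).

Lemma Cmod_e_mult (x y : R) : Cmod (e (x * y)) = 1%R.
Proof. rewrite <- RtoC_mult. apply Cmod_e. Qed.

(** A geometric series in [z / zeta] of ratio at most 1/2 on the disc; the sum of these ratios is
    the factor 2 in the norm. *)
Lemma gterm_series (X kappa r : R) (m : Z) : (0 < r)%R ->
  (zeta kappa m <> 0 -> (2 * r <= Cmod (zeta kappa m))%R) ->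
  let c n := match n with O => RtoC 0 | S _ => - (e (X * IZR m) * (/ zeta kappa m) ^ (S n)) end in
  psum c r (2 * r * (/ Cmod (zeta kappa m) * / Cmod (zeta kappa m))) /\
  forall z, (Cmod z <= r)%R -> ps c z = gterm X kappa z m.
Proof.
  intros Hr Hz c. set (w := / zeta kappa m).
  destruct (classic (zeta kappa m = 0)) as [E|E].
  - assert (Ew : w = 0) by (unfold w; rewrite E; apply Cinv_0).
    assert (Ec : forall n, c n = 0).
    { intros [|n]; [easy|]. unfold c. fold w. rewrite Ew. simpl. ring. }
    split.
    + rewrite E, Cmod_0, Rinv_0, !Rmult_0_r.
      apply asum_zero. intros n. rewrite Ec. ring.
    + intros z _. unfold gterm. fold w. rewrite Ew. unfold ps.
      rewrite (tsum_ext _ (fun _ => 0)); [rewrite (has_sum_tsum _ _ has_sum_0); ring|].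
      intros n. rewrite Ec. ring.
  - specialize (Hz E). assert (hp : (0 < Cmod (zeta kappa m))%R) by now apply Cmod_gt_0.
    assert (Hw : (r * Cmod w <= / 2)%R).
    { unfold w. rewrite Cmod_Cinv. apply Rmult_le_reg_r with (Cmod (zeta kappa m)); auto.
      rewrite Rmult_assoc, Rinv_l; lra. }
    assert (Hw0 := Cmod_ge_0 w).
    assert (HP : psum c r (2 * r * (/ Cmod (zeta kappa m) * / Cmod (zeta kappa m)))).
    { unfold psum. rewrite <- Cmod_Cinv. fold w.
      apply (asum_inj_inv S (fun a b => eq_add_S a b)).
      - intros [|n] Hn; [exfalso; apply Hn; simpl; ring|now exists n].
      - eapply asum_weaken; [eapply asum_le; [|apply (asum_scal (r * (w * w)) _ _ (asum_geom (/ 2) ltac:(lra)))]|].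
        + intros n. unfold c. fold w.
          rewrite !Cmod_mult, Cmod_opp, Cmod_mult, Cmod_e_mult, !Cmod_pow, !Cmod_R.
          rewrite (Rabs_pos_eq r), (Rabs_pos_eq ((/ 2) ^ n)) by (try apply pow_le; lra).
          simpl pow. rewrite Rmult_1_l.
          replace (Cmod w * (Cmod w * Cmod w ^ n) * (r * r ^ n))%R
            with (r * (Cmod w * Cmod w) * (r * Cmod w) ^ n)%R by (rewrite Rpow_mult_distr; ring).
          apply Rmult_le_compat_l; [nra|]. apply pow_incr. nra.
        + rewrite !Cmod_mult, Cmod_R, Rabs_pos_eq by lra. right. field. }
    split; auto. intros z Hzr.
    assert (Hzw : (Cmod (z * w) <= / 2)%R) by (rewrite Cmod_mult; generalize (Cmod_ge_0 z); nra).
    assert (hne : z - zeta kappa m <> 0).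
    { intros Eq. assert (z = zeta kappa m).
      { replace z with (z - zeta kappa m + zeta kappa m) by ring. rewrite Eq. ring. }
      subst z. lra. }
    set (u := ps c z).
    (* Multiplying by [1 - z/zeta] telescopes the geometric series. *)
    set (c' := fun n => c (S n)).
    destruct (ps_Sl c r _ z HP Hr Hzr) as [h1 h2].
    destruct (ps_Sl _ r _ z h1 Hr Hzr) as [h3 h4].
    assert (E3 : ps (fun n => c (S (S n))) z = w * ps (fun n => c (S n)) z).
    { rewrite <- (ps_scal w _ r _ z h1 Hzr). unfold ps. apply tsum_ext. intros n.
      unfold c. fold w. simpl Cpow. ring. }
    rewrite E3 in h4. fold u in h2.
    set (v := ps (fun n => c (S n)) z) in *.
    assert (Ev : v * (1 - z * w) = - (e (X * IZR m) * (w * w))).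
    { replace (v * (1 - z * w)) with (v - z * (w * v)) by ring. rewrite h4 at 1.
      unfold c. fold w. simpl Cpow. ring. }
    assert (hzw : 1 - z * w <> 0).
    { intros Eq. assert (z * w = 1).
      { replace (z * w) with (1 - (1 - z * w)) by ring. rewrite Eq. ring. }
      rewrite H, Cmod_1 in Hzw. lra. }
    rewrite h2. unfold gterm. fold w.
    replace v with (v * (1 - z * w) / (1 - z * w)) by (field; auto). rewrite Ev.
    unfold c, w. unfold w in hzw. field. repeat split; auto.
    intros Eq. apply hne. replace (z - zeta kappa m) with (- (zeta kappa m - z)) by ring.
    rewrite Eq. ring.
Qed.

Lemma delta_true (x : R) (n : Z) : x = IZR n -> delta x = 1.
Proof. intros H. unfold delta. destruct excluded_middle_informative as [|Hn]; auto. exfalso; eauto. Qed.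

Lemma delta_false (x : R) : (~ exists n, x = IZR n) -> delta x = 0.
Proof. intros H. unfold delta. now destruct excluded_middle_informative. Qed.

Lemma gen_small_regular (kappa r : R) (z : C) :
  (forall m, zeta kappa m <> 0 -> (2 * r <= Cmod (zeta kappa m))%R) ->
  (0 < Cmod z <= r)%R -> e kappa * Cexp z <> 1.
Proof.
  intros Hr Hz H. unfold e in H. rewrite <- Cexp_plus in H.
  destruct (Cexp_eq_1 _ H) as [n Hn].
  assert (E : z = zeta kappa n).
  { unfold zeta. replace z with (2 * PI * Ci * kappa + z - 2 * PI * Ci * kappa) by ring.
    rewrite Hn, RtoC_minus. ring. }
  assert (Hne : zeta kappa n <> 0) by (rewrite <- E; apply Cmod_gt_0; lra).
  specialize (Hr n Hne). rewrite <- E in Hr. lra.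
Qed.

(* The pole of [gen] at 0 is carried by the unique m with zeta m = 0, if any. *)
Lemma polar_term (X kappa : R) (w : C) :
  summable (fun m => indic (zeta kappa m = 0) * (e (X * IZR m) * w)) /\
  tsum (fun m => indic (zeta kappa m = 0) * (e (X * IZR m) * w)) = delta kappa * e (X * kappa) * w.
Proof.
  destruct (classic (exists n, kappa = IZR n)) as [[n Hn]|Hn].
  - destruct (tsum_single (fun m => indic (zeta kappa m = 0) * (e (X * IZR m) * w)) n) as [h1 h2].
    + intros m Hm. rewrite indic_false; [ring|]. rewrite zeta_eq0, Hn. intros H.
      now apply Hm, eq_IZR.
    + split; auto. rewrite h2, indic_true, (delta_true _ _ Hn), Hn; [ring|].
      now rewrite zeta_eq0.
  - assert (E : forall m, indic (zeta kappa m = 0) * (e (X * IZR m) * w) = 0).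
    { intros m. rewrite indic_false; [ring|]. rewrite zeta_eq0. intros H. apply Hn. now exists m. }
    rewrite (delta_false _ Hn). split.
    + exists 0%R. now apply asum_zero.
    + rewrite (tsum_ext _ _ E), (has_sum_tsum _ _ has_sum_0). ring.
Qed.

(** Comparison with a fixed regular point gives the Mittag-Leffler expansion up to a constant.
    Summing the power series of the [gterm] then gives an expansion of [z * gen], and uniqueness
    reads off the coefficients: lattice sums from index 2 on, the polar coefficient at index 0, and
    at index 1 the constant itself, for which no absolutely convergent lattice sum is at hand. *)
Theorem gen_partial_fractions (X kappa : R) : (0 <= X < 1)%R ->
  (exists r M, (0 < r)%R /\ psum (bcoef X kappa) r M /\
     forall z, (0 < Cmod z <= r)%R ->
       e kappa * Cexp z <> 1 /\ z * gen X kappa z = ps (bcoef X kappa) z) /\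
  bcoef X kappa 0 = delta kappa * e (X * kappa) /\
  (forall j, (2 <= j)%nat -> summable (fun m => e (X * IZR m) * (/ zeta kappa m) ^ j) /\
     bcoef X kappa j = - tsum (fun m => e (X * IZR m) * (/ zeta kappa m) ^ j)) /\
  (forall z : C, z <> 0 -> e kappa * Cexp z <> 1 -> summable (gterm X kappa z) /\
     gen X kappa z = bcoef X kappa 0 * / z + bcoef X kappa 1 + tsum (gterm X kappa z)).
Proof.
  intros HX.
  destruct (zeta_lower kappa) as (c & Hc & Hlow).
  set (r := (c / 2)%R).
  assert (Hr : (0 < r)%R) by (unfold r; lra).
  assert (H2r : forall m, zeta kappa m <> 0 -> (2 * r <= Cmod (zeta kappa m))%R).
  { intros m Hm. specialize (Hlow m Hm). assert (h := Rabs_pos (IZR m)). unfold r. nra. }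
  set (cc := fun m n => match n with O => RtoC 0 | S _ => - (e (X * IZR m) * (/ zeta kappa m) ^ (S n)) end).
  set (MM := fun m => (2 * r * (/ Cmod (zeta kappa m) * / Cmod (zeta kappa m)))%R).
  assert (HMM : summable (fun m => RtoC (MM m))).
  { eapply summable_le; [|apply (summable_scal (RtoC (2 * r)) _ (summable_zeta_inv kappa 2 ltac:(lra)))].
    intros m. apply zeta_term_le.
    - intros E. unfold MM. rewrite E, Cmod_0, Rinv_0, !Rmult_0_r. easy.
    - unfold MM. rewrite Cmod_R, Rabs_pos_eq; [lra|]. rewrite <- Cmod_Cinv.
      assert (h := Cmod_ge_0 (/ zeta kappa m)). nra. }
  destruct HMM as [B HB].
  destruct (ps_tsum cc r MM B) as (k1 & k2 & k3).
  { lra. } { intros m. apply (gterm_series X kappa r m Hr (H2r m)). } { exact HB. }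
  set (dd := fun n => tsum (fun m => cc m n)) in *.
  assert (Hgt : forall z, (Cmod z <= r)%R -> summable (gterm X kappa z) /\
     tsum (gterm X kappa z) = ps dd z).
  { intros z Hz. destruct (k2 z Hz) as [s1 s2].
    assert (E : forall m, ps (cc m) z = gterm X kappa z m).
    { intros m. now apply (gterm_series X kappa r m Hr (H2r m)). }
    split; [eapply summable_ext; [apply E|apply s1]|]. now rewrite <- (tsum_ext _ _ E). }
  assert (Cr : Cmod (RtoC r) = r) by (rewrite Cmod_R, Rabs_pos_eq; lra).
  assert (Hreg_r : e kappa * Cexp r <> 1) by (apply (gen_small_regular kappa r); auto; rewrite Cr; lra).
  set (c0 := delta kappa * e (X * kappa)).
  (* The base point [r] fixes the constant; it is recognized as [bcoef X kappa 1] only after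
     comparison of coefficients. *)
  set (c1 := gen X kappa r - c0 * / r - tsum (gterm X kappa r)).
  assert (Hr0 : RtoC r <> 0) by (apply RtoC_neq0; lra).
  assert (PF : forall z : C, z <> 0 -> e kappa * Cexp z <> 1 -> summable (gterm X kappa z) /\
     gen X kappa z = c0 * / z + c1 + tsum (gterm X kappa z)).
  { intros z Hz Hreg.
    destruct (gen_difference X kappa z r HX Hreg Hreg_r) as [d1 d2].
    destruct (Hgt r ltac:(lra)) as [t1 _].
    destruct (polar_term X kappa (/ z - / r)) as [q1 q2].
    assert (E : forall m, gterm X kappa z m =
      e (X * IZR m) * (/ (z - zeta kappa m) - / (r - zeta kappa m))
      - indic (zeta kappa m = 0) * (e (X * IZR m) * (/ z - / r)) + gterm X kappa r m).
    { intros m. unfold gterm. destruct (classic (zeta kappa m = 0)) as [E|E].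
      - rewrite E, indic_true, Cinv_0 by auto.
        replace (z - 0) with z by ring. replace (r - 0) with (RtoC r) by ring. ring.
      - rewrite indic_false by auto.
        assert (n1 := gen_pole_free kappa z m Hreg). assert (n2 := gen_pole_free kappa r m Hreg_r).
        field. auto. }
    assert (S1 := summable_minus _ _ d1 q1).
    assert (S2 := summable_plus _ _ S1 t1).
    split; [eapply summable_ext; [intros m; symmetry; apply E|apply S2]|].
    rewrite (tsum_ext _ _ E), (tsum_plus _ _ S1 t1), (tsum_minus _ _ d1 q1), d2, q2.
    unfold c1. fold c0. ring. }
  (* Multiplication by [z] moves [dd n] to index [n + 1]; since [dd 0 = 0], index 1 is left to the
     constant [c1]. *)
  set (b := fun j => match j with O => c0 | S O => c1 | S (S n) => dd (S n) end).
  assert (Hdd0 : dd 0%nat = 0).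
  { unfold dd. cbn [cc]. apply (has_sum_tsum _ _ has_sum_0). }
  assert (Hb : exists N, psum b r N).
  { (* [b n r^n = c0, c1 r, then r * (dd (n-1) r^(n-1))] *)
    destruct (tsum_fin (fun n => match n with O => c0 | S O => c1 * RtoC r | _ => RtoC 0 end)
      (cons 0%nat (cons 1%nat nil))) as [[N1 HN1] _].
    { constructor; [simpl; intuition lia|constructor; [auto|constructor]]. }
    { intros [|[|n]] Hn; auto; exfalso; apply Hn; simpl; auto. }
    set (sh := fun n => match n with O => RtoC 0 | S m => dd m * r ^ m end).
    assert (Hsh : asum sh B).
    { apply (asum_inj_inv S (fun a b => eq_add_S a b)).
      - intros [|n] Hn; [now exfalso; apply Hn|now exists n].
      - exact k1. }
    exists (N1 + Cmod r * B)%R. unfold psum.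
    eapply asum_le; [|apply (asum_plus _ _ _ _ HN1 (asum_scal (RtoC r) _ _ Hsh))].
    intros n. right. cbv beta. f_equal. unfold sh. destruct n as [|[|n]]; simpl; try ring.
    rewrite Hdd0. ring. }
  destruct Hb as [N HN].
  assert (Hps : forall z, (Cmod z <= r)%R -> ps b z = c0 + z * (c1 + ps dd z)).
  { intros z Hz. destruct (ps_Sl b r N z HN Hr Hz) as [u1 ->].
    destruct (ps_Sl _ r _ z u1 Hr Hz) as [_ ->].
    destruct (ps_Sl dd r _ z k1 Hr Hz) as [_ ->]. rewrite Hdd0. unfold b. ring. }
  assert (Hgen : forall z, (0 < Cmod z <= r)%R -> z * gen X kappa z = ps b z).
  { intros z Hz. assert (hz : z <> 0) by (apply Cmod_gt_0; lra).
    assert (hreg := gen_small_regular kappa r z H2r Hz).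
    rewrite Hps by lra. destruct (Hgt z ltac:(lra)) as [_ <-].
    rewrite (proj2 (PF z hz hreg)). field. auto. }
  assert (HU := Ccoef_unique X kappa b r N Hr HN Hgen).
  assert (Eb : bcoef X kappa = b) by (apply functional_extensionality; auto).
  rewrite Eb.
  split; [|split; [easy|split]].
  - exists r, N. split; [auto|split; [auto|]]. intros z Hz. split; auto.
    now apply (gen_small_regular kappa r).
  - intros [|[|n]] Hn; try lia. cbn [b]. unfold dd. cbn [cc].
    assert (S1 := k3 Hr (S n)). cbn [cc] in S1.
    assert (S2 : summable (fun m => e (X * IZR m) * (/ zeta kappa m) ^ S (S n))).
    { eapply summable_ext; [|apply (summable_opp _ S1)]. intros m. cbv beta. ring. }
    split; auto. rewrite <- tsum_opp; auto.
  - exact PF.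
Qed.

(** * Reciprocity for k >= 2 *)

Lemma reg_of_Re (kappa : R) (z : C) : Re z <> 0%R -> e kappa * Cexp z <> 1.
Proof.
  intros Hz H. assert (h : Cmod (e kappa * Cexp z) = 1%R) by now rewrite H, Cmod_1.
  rewrite Cmod_mult, Cmod_e, Cmod_Cexp, Rmult_1_l, <- exp_0 in h. now apply exp_inv in h.
Qed.

Lemma csum_geom2 (x y : C) n :
  (x - y) * csum (fun i => x ^ i * y ^ (n - 1 - i)) n = x ^ n - y ^ n.
Proof.
  induction n as [|n IH]; [unfold csum; simpl; ring|].
  rewrite csum_S. replace (S n - 1 - n)%nat with 0%nat by lia.
  rewrite (csum_ext _ (fun i => y * (x ^ i * y ^ (n - 1 - i)))).
  - rewrite csum_scal.
    transitivity (y * ((x - y) * csum (fun i => x ^ i * y ^ (n - 1 - i)) n) + (x - y) * x ^ n);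
      [simpl; ring|rewrite IH; simpl; ring].
  - intros i Hi. replace (S n - 1 - i)%nat with (S (n - 1 - i)) by lia. simpl. ring.
Qed.

Section Reciprocity.
Context (X Y mu nu : R) (HX : (0 <= X < 1)%R) (HY : (0 <= Y < 1)%R)
  (tau : C) (Htau : (0 < Re tau)%R).

Let t : C := Ci * tau.
(** [et n] and [ze m] are the poles of [gen X mu] and [gen Y nu]. The first sum evaluates [gen Y nu]
    at [t * et n], the second [gen X mu] at [ze m / t]; off 0 these points have nonzero real part,
    so no pole is met. *)
Let et (n : Z) : C := zeta mu n.
Let ze (m : Z) : C := zeta nu m.
Let a := bcoef X mu.
Let b := bcoef Y nu.

Lemma tau_neq0 : tau <> 0.
Proof. intros H. rewrite H in Htau. simpl in Htau. lra. Qed.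

Let t_neq0 : t <> 0.
Proof. apply Cmult_neq_0; [apply Ci_nz|apply tau_neq0]. Qed.

Let t_et n : t * et n = RtoC (- (2 * PI * (IZR n - mu))) * tau.
Proof.
  unfold t, et, zeta.
  replace (Ci * tau * (2 * PI * Ci * (IZR n - mu)%R)) with
    (Ci * Ci * (2 * PI * (IZR n - mu)%R) * tau) by ring.
  rewrite Ci2, RtoC_opp, !RtoC_mult. ring.
Qed.

Let Re_t_et n : et n <> 0 -> Re (t * et n) <> 0%R.
Proof.
  intros Hn. rewrite t_et, re_scal_l. assert (hp := PI_RGT_0).
  assert (IZR n - mu <> 0)%R. { intros E. apply Hn, zeta_eq0. lra. }
  apply Rmult_integral_contrapositive. split; [|lra].
  apply Ropp_neq_0_compat. repeat apply Rmult_integral_contrapositive; split; lra.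
Qed.

Let ze_t m : ze m / t = RtoC (2 * PI * (IZR m - nu)) * / tau.
Proof.
  unfold t, ze, zeta. rewrite !RtoC_mult. field. split; [apply tau_neq0|apply Ci_nz].
Qed.

Let Re_inv_tau : (0 < Re (/ tau))%R.
Proof.
  unfold Cinv; simpl. apply Rdiv_lt_0_compat; auto.
  assert (0 < fst tau ^ 2)%R by (apply pow_lt; apply Htau).
  assert (0 <= snd tau ^ 2)%R by apply pow2_ge_0. simpl in *. lra.
Qed.

Let Re_ze_t m : ze m <> 0 -> Re (ze m / t) <> 0%R.
Proof.
  intros Hm. rewrite ze_t, re_scal_l. assert (hp := PI_RGT_0).
  assert (IZR m - nu <> 0)%R. { intros E. apply Hm, zeta_eq0. lra. }
  apply Rmult_integral_contrapositive. split; [|generalize Re_inv_tau; lra].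
  repeat apply Rmult_integral_contrapositive; split; lra.
Qed.

(* [t et n] is off the line carrying the [ze m], hence the two lattices are separated. *)
Let separation : exists c, (0 < c)%R /\ forall n m,
  (c * (Rpower (Cmod (et n)) (/ 2) * Rpower (Cmod (ze m)) (/ 2)) <= Cmod (t * et n - ze m))%R
  \/ et n = 0 \/ ze m = 0.
Proof.
  assert (Ht : (0 < Cmod t)%R) by now apply Cmod_gt_0.
  (* [ze m] is purely imaginary, while the real part of [t * et n] has modulus [Re tau * |et n|];
     this gives [c1]. The triangle inequality turns it into a bound by [c2 |ze m|], and the
     geometric mean of [|et n|] and [|ze m|] is below their maximum. *)
  set (c1 := Re tau). set (c2 := (c1 / (c1 + Cmod t))%R).
  assert (hc1 : (0 < c1)%R) by exact Htau.
  assert (hc2 : (0 < c2)%R) by (apply Rdiv_lt_0_compat; lra).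
  exists (Rmin c1 c2). split; [now apply Rmin_glb_lt|].
  intros n m. destruct (classic (et n = 0)) as [E|E]; [auto|].
  destruct (classic (ze m = 0)) as [F|F]; [auto|]. left.
  assert (h1 : (c1 * Cmod (et n) <= Cmod (t * et n - ze m))%R).
  { eapply Rle_trans; [|apply re_le_Cmod].
    replace (Re (t * et n - ze m)) with (Re (t * et n)).
    - rewrite t_et, re_scal_l, Rabs_mult, Rabs_Ropp, (Rabs_pos_eq (Re tau)) by lra.
      unfold et. rewrite Cmod_zeta. rewrite !Rabs_mult, (Rabs_pos_eq 2), (Rabs_pos_eq PI)
        by (generalize PI_RGT_0; lra). unfold c1. lra.
    - unfold ze, zeta. reim. ring. }
  assert (h2 : (c2 * Cmod (ze m) <= Cmod (t * et n - ze m))%R).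
  { assert (Cmod (ze m) <= Cmod (t * et n - ze m) + Cmod t * Cmod (et n))%R.
    { rewrite <- Cmod_mult, <- (Cmod_opp (t * et n - ze m)).
      replace (ze m) with (- (t * et n - ze m) + t * et n) at 1 by ring. apply Cmod_triangle. }
    unfold c2. apply Rmult_le_reg_r with (c1 + Cmod t)%R; [lra|].
    replace (c1 / (c1 + Cmod t) * Cmod (ze m) * (c1 + Cmod t))%R with (c1 * Cmod (ze m))%R
      by (field; lra). nra. }
  set (x := Cmod (et n)) in *. set (y := Cmod (ze m)) in *.
  assert (hx : (0 < x)%R) by now apply Cmod_gt_0.
  assert (hy : (0 < y)%R) by now apply Cmod_gt_0.
  rewrite Rpower_mult_distr, Rpower_sqrt by nra.
  assert (hs : (sqrt (x * y) <= Rmax x y)%R).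
  { rewrite <- (sqrt_square (Rmax x y)).
    - apply sqrt_le_1_alt. apply Rmult_le_compat; try lra; [apply Rmax_l|apply Rmax_r].
    - eapply Rle_trans; [|apply Rmax_l]. lra. }
  assert (hs0 := sqrt_pos (x * y)).
  assert (m1 := Rmin_l c1 c2). assert (m2 := Rmin_r c1 c2).
  assert (m0 : (0 < Rmin c1 c2)%R) by now apply Rmin_glb_lt.
  destruct (Rle_dec x y) as [Hxy|Hxy].
  - rewrite Rmax_right in hs by auto. nra.
  - rewrite Rmax_left in hs by lra. nra.
Qed.

(** General terms of the two double series: in each single sum [gen] is replaced by one term of its
    expansion, the polar part and the constant being left aside. *)
Let DA (k : nat) (n m : Z) : C :=
  e (X * IZR n) * (/ et n) ^ k * gterm Y nu (t * et n) m.
Let DB (k : nat) (n m : Z) : C :=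
  e (Y * IZR m) * (/ ze m) ^ k * gterm X mu (ze m / t) n.

Let sep_neq n m : et n <> 0 -> ze m <> 0 -> t * et n - ze m <> 0.
Proof.
  intros Hn Hm E. destruct separation as (c & Hc & H).
  destruct (H n m) as [h|[h|h]]; auto. rewrite E, Cmod_0 in h.
  assert (0 < Rpower (Cmod (et n)) (/ 2) * Rpower (Cmod (ze m)) (/ 2))%R
    by (apply Rmult_lt_0_compat; apply Rpower_pos). nra.
Qed.

(** With [P = / et n] and [Q = / ze m], both terms have denominator [P - t Q], and the numerators
    add up to a multiple of [P^K - (t Q)^K]. The quotient is a sum of [K] products of separate
    functions of [n] and [m], whose exponents [2 + i] and [K + 1 - i] are at least 2, so that every
    factor is summable. *)
Let DA_DB K n m :
  DA (S (S K)) n m + t ^ S K * DB (S (S K)) n m =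
  - csum (fun i => t ^ (K - i) * (e (X * IZR n) * (/ et n) ^ (2 + i))
            * (e (Y * IZR m) * (/ ze m) ^ (K + 1 - i))) K.
Proof.
  unfold DA, DB, gterm. fold (et n) (ze m).
  set (P := / et n). set (Q := / ze m).
  destruct (classic (et n = 0)) as [E|E].
  { assert (HP : P = 0) by (unfold P; rewrite E; apply Cinv_0).
    rewrite HP, csum_0; [simpl; ring|]. intros i _. simpl. ring. }
  destruct (classic (ze m = 0)) as [F|F].
  { assert (HQ : Q = 0) by (unfold Q; rewrite F; apply Cinv_0).
    rewrite HQ, csum_0; [simpl; ring|]. intros i Hi.
    replace (K + 1 - i)%nat with (S (K - i)) by lia. simpl. ring. }
  assert (HP : P <> 0).
  { intros H. apply C1_nz. rewrite <- (Cinv_r _ E). fold P. rewrite H. ring. }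
  assert (HQ : Q <> 0).
  { intros H. apply C1_nz. rewrite <- (Cinv_r _ F). fold Q. rewrite H. ring. }
  assert (Hs := sep_neq n m E F).
  assert (Eet : et n = / P) by (unfold P; field; auto).
  assert (Eze : ze m = / Q) by (unfold Q; field; auto).
  rewrite Eet, Eze in *.
  assert (HD : P - t * Q <> 0).
  { intros H. apply Hs. replace (t * / P - / Q) with (- (P - t * Q) / (P * Q)) by (field; auto).
    rewrite H. unfold Cdiv. ring. }
  assert (HD' : t * Q - P <> 0).
  { intros H. apply HD. replace (P - t * Q) with (- (t * Q - P)) by ring. rewrite H. ring. }
  rewrite (csum_ext _ (fun i => (e (X * IZR n) * e (Y * IZR m) * (t * P * P * Q * Q)) *
    (P ^ i * (t * Q) ^ (K - 1 - i)))).
  2:{ intros i Hi. rewrite Cpow_mult_l. replace (K - i)%nat with (S (K - 1 - i)) by lia.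
      replace (K + 1 - i)%nat with (S (S (K - 1 - i))) by lia. simpl. ring. }
  rewrite csum_scal.
  replace (csum (fun i => P ^ i * (t * Q) ^ (K - 1 - i)) K)
    with ((P ^ K - (t * Q) ^ K) / (P - t * Q)).
  2:{ rewrite <- csum_geom2. field. auto. }
  rewrite Cpow_mult_l. simpl Cpow. field. repeat split; auto.
Qed.

Let A_sum j : (2 <= j)%nat -> summable (fun n => e (X * IZR n) * (/ et n) ^ j) /\
  tsum (fun n => e (X * IZR n) * (/ et n) ^ j) = - a j.
Proof.
  intros Hj. destruct (gen_partial_fractions X mu HX) as (_ & _ & H & _).
  destruct (H j Hj) as [h1 h2]. split; auto. unfold a. rewrite h2. unfold et. ring.
Qed.

Let B_sum j : (2 <= j)%nat -> summable (fun m => e (Y * IZR m) * (/ ze m) ^ j) /\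
  tsum (fun m => e (Y * IZR m) * (/ ze m) ^ j) = - b j.
Proof.
  intros Hj. destruct (gen_partial_fractions Y nu HY) as (_ & _ & H & _).
  destruct (H j Hj) as [h1 h2]. split; auto. unfold b. rewrite h2. unfold ze. ring.
Qed.

(** [separation] makes the mixed denominator worth an extra exponent 1/2 in each variable, to be
    added to the exponents [K + 1] of [et n] and 1 of [ze m]. *)
Let DA_summable K : summable (fun p : Z * Z => DA (S (S K)) (fst p) (snd p)).
Proof.
  destruct separation as (c & Hc & Hsep).
  assert (S1 := summable_zeta_inv mu (INR K + 3 / 2) ltac:(generalize (pos_INR K); lra)).
  assert (S2 := summable_zeta_inv nu (3 / 2) ltac:(lra)).
  eapply summable_le; [|apply (summable_scal (RtoC (Cmod t / c)) _ (summable_prod_mult _ _ S1 S2))].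
  intros [n m]. cbn [fst snd]. fold (et n) (ze m).
  unfold DA, gterm. fold (ze m).
  destruct (classic (et n = 0)) as [E|E].
  { rewrite E, Cinv_0. simpl. rewrite !Cmult_0_l, !Cmult_0_r, !Cmult_0_l, Cmod_0. apply Cmod_ge_0. }
  destruct (classic (ze m = 0)) as [F|F].
  { rewrite F, Cinv_0. rewrite !Cmult_0_r, !Cmult_0_l, !Cmult_0_r, Cmod_0. apply Cmod_ge_0. }
  rewrite !indic_true, !Cmult_1_l by auto.
  destruct (Hsep n m) as [h|[h|h]]; [|easy|easy].
  assert (hx : (0 < Cmod (et n))%R) by now apply Cmod_gt_0.
  assert (hy : (0 < Cmod (ze m))%R) by now apply Cmod_gt_0.
  assert (hq := sep_neq n m E F).
  assert (hqp : (0 < Cmod (t * et n - ze m))%R) by now apply Cmod_gt_0.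
  replace (e (X * IZR n) * (/ et n) ^ S (S K) *
     (e (Y * IZR m) * (t * et n * / ze m * / (t * et n - ze m)))) with
    (e (X * IZR n) * e (Y * IZR m) * (t * ((/ et n) ^ S K * / ze m * / (t * et n - ze m))))
    by (simpl; field; auto).
  rewrite !Cmod_mult, !Cmod_e_mult, Cmod_pow, !Cmod_Cinv, !Cmod_R, !Rmult_1_l.
  set (x := Cmod (et n)) in *. set (y := Cmod (ze m)) in *.
  rewrite !(Rabs_pos_eq (Rpower _ _)) by (left; apply Rpower_pos).
  assert (htc : (0 < Cmod t)%R) by now apply Cmod_gt_0.
  rewrite (Rabs_pos_eq (Cmod t / c)) by (left; now apply Rdiv_lt_0_compat).
  unfold Rdiv at 1. rewrite (Rmult_assoc (Cmod t) (/ c)). apply Rmult_le_compat_l; [lra|].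
  replace (Rpower x (- (INR K + 3 / 2))) with ((/ x) ^ S K * / Rpower x (/ 2))%R.
  2:{ rewrite <- Rpower_pow, Rpower_Ropp, <- Rpower_Ropp by now apply Rinv_0_lt_compat.
      unfold Rpower. rewrite ln_Rinv by auto. rewrite <- exp_Ropp, <- exp_plus. f_equal.
      rewrite S_INR. field. }
  replace (Rpower y (- (3 / 2))) with (/ y * / Rpower y (/ 2))%R.
  2:{ rewrite <- (Rpower_1 y) at 1 by auto. rewrite <- !Rpower_Ropp, <- Rpower_plus. f_equal. field. }
  assert (hd : (0 < Rpower x (/ 2) * Rpower y (/ 2))%R) by (apply Rmult_lt_0_compat; apply Rpower_pos).
  replace (/ c * ((/ x) ^ S K * / Rpower x (/ 2) * (/ y * / Rpower y (/ 2))))%R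
    with ((/ x) ^ S K * / y * / (c * (Rpower x (/ 2) * Rpower y (/ 2))))%R.
  2:{ field. repeat split; try lra; apply Rgt_not_eq, Rpower_pos. }
  apply Rmult_le_compat_l.
  - apply Rmult_le_pos; [apply pow_le|]; left; now apply Rinv_0_lt_compat.
  - apply Rinv_le_contravar; auto. now apply Rmult_lt_0_compat.
Qed.

(** [t ^ k * (/ t) ^ j] stands for [t^(k - j)], whose exponent is -1 for [j = k + 1]. *)
Definition recip_sum (k : nat) : C :=
  csum (fun j => t ^ k * (/ t) ^ j * a j * b (k + 1 - j)%nat) (k + 2).

(** The terms [2 <= j <= k - 1] of [recip_sum] come from [DA_DB]. The four extreme ones come from
    what [DA] and [DB] leave out: [j = k + 1] and [j = k] from the polar part and constant of
    [gen Y nu], [j = 0] and [j = 1] from those of [gen X mu]. *)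
Lemma reciprocity_ge2 K : let k := S (S K) in
  summable (fun n => e (X * IZR n) * (/ zeta mu n) ^ k * gen Y nu (t * zeta mu n)) /\
  summable (fun m => e (Y * IZR m) * (/ zeta nu m) ^ k * gen X mu (zeta nu m / t)) /\
  tsum (fun n => e (X * IZR n) * (/ zeta mu n) ^ k * gen Y nu (t * zeta mu n)) +
  t ^ S K * tsum (fun m => e (Y * IZR m) * (/ zeta nu m) ^ k * gen X mu (zeta nu m / t))
  = - recip_sum k.
Proof.
  intros k.
  destruct (gen_partial_fractions X mu HX) as (_ & _ & _ & PX).
  destruct (gen_partial_fractions Y nu HY) as (_ & _ & _ & PY).
  assert (SA := DA_summable K). fold k in SA.
  set (corr := fun i (p : Z * Z) => (e (X * IZR (fst p)) * (/ et (fst p)) ^ (2 + i))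
            * (e (Y * IZR (snd p)) * (/ ze (snd p)) ^ (K + 1 - i))).
  assert (SC : forall i, (i < K)%nat -> summable (corr i) /\
     tsum (corr i) = a (2 + i)%nat * b (K + 1 - i)%nat).
  { intros i Hi. destruct (A_sum (2 + i)) as [s1 e1]; [lia|].
    destruct (B_sum (K + 1 - i)) as [s2 e2]; [lia|].
    assert (s := summable_prod_mult _ _ s1 s2). split; [exact s|].
    rewrite (proj2 (tsum_prod (corr i) s)). unfold corr. cbn [fst snd].
    rewrite (tsum_ext _ (fun n => (- b (K + 1 - i)%nat) * (e (X * IZR n) * (/ et n) ^ (2 + i)))).
    - rewrite tsum_scal, e1 by auto. ring.
    - intros n. rewrite tsum_scal, e2 by auto. ring. }
  assert (SCs : forall N, (N <= K)%nat ->
    summable (fun p => csum (fun i => t ^ (K - i) * corr i p) N) /\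
    tsum (fun p => csum (fun i => t ^ (K - i) * corr i p) N) =
    csum (fun i => t ^ (K - i) * (a (2 + i)%nat * b (K + 1 - i)%nat)) N).
  { induction N as [|N IH]; intros HN.
    - split; [|apply (has_sum_tsum _ _ has_sum_0)]. exists 0%R.
      now apply asum_zero.
    - destruct IH as [i1 i2]; [lia|]. destruct (SC N) as [c1 c2]; [lia|].
      assert (c3 := summable_scal (t ^ (K - N)) _ c1).
      assert (EN : forall p, csum (fun i => t ^ (K - i) * corr i p) N + t ^ (K - N) * corr N p =
        csum (fun i => t ^ (K - i) * corr i p) (S N)) by (intros; now rewrite csum_S).
      split; [eapply summable_ext; [apply EN|now apply summable_plus]|].
      rewrite <- (tsum_ext _ _ EN), tsum_plus, i2, tsum_scal, c2, csum_S by auto. easy. }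
  destruct (SCs K (le_n _)) as [SK EK].
  assert (ED : forall p : Z * Z, DB k (fst p) (snd p) =
     / t ^ S K * (- csum (fun i => t ^ (K - i) * corr i p) K - DA k (fst p) (snd p))).
  { intros [n m]. cbn [fst snd].
    replace (csum (fun i => t ^ (K - i) * corr i (n, m)) K) with
      (csum (fun i => t ^ (K - i) * (e (X * IZR n) * (/ et n) ^ (2 + i))
            * (e (Y * IZR m) * (/ ze m) ^ (K + 1 - i))) K)
      by (apply csum_ext; intros i _; unfold corr; cbn [fst snd]; ring).
    rewrite <- DA_DB. fold k. field. now apply Cpow_nz. }
  assert (Sd := summable_minus _ _ (summable_opp _ SK) SA).
  assert (SB : summable (fun p : Z * Z => DB k (fst p) (snd p))).
  { eapply summable_ext; [intros p; symmetry; apply ED|]. now apply summable_scal. }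
  assert (EB : t ^ S K * tsum (fun p : Z * Z => DB k (fst p) (snd p)) =
    - csum (fun i => t ^ (K - i) * (a (2 + i)%nat * b (K + 1 - i)%nat)) K
    - tsum (fun p : Z * Z => DA k (fst p) (snd p))).
  { rewrite (tsum_ext _ _ ED), (tsum_scal _ _ Sd), (tsum_minus _ _ (summable_opp _ SK) SA),
      (tsum_opp _ SK), EK. field. now apply Cpow_nz. }
  destruct (tsum_prod _ SA) as [SA1 SA2]. cbn [fst snd] in SA1, SA2.
  assert (SB' : summable (fun p : Z * Z => DB k (snd p) (fst p))).
  { assert (hi : forall q q' : Z * Z, (snd q, fst q) = (snd q', fst q') -> q = q').
    { intros [x1 x2] [y1 y2]; simpl; congruence. }
    exact (summable_inj (fun q : Z * Z => (snd q, fst q)) hi _ SB). }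
  destruct (tsum_prod _ SB') as [SB1 _]. cbn [fst snd] in SB1.
  assert (SB2 : tsum (fun p : Z * Z => DB k (fst p) (snd p)) =
     tsum (fun m => tsum (fun n => DB k n m))).
  { rewrite (proj2 (tsum_prod _ SB)). cbn [fst snd]. now apply tsum_swap. }
  destruct (A_sum (S k)) as [sa1 ea1]; [unfold k; lia|].
  destruct (A_sum k) as [sa2 ea2]; [unfold k; lia|].
  destruct (B_sum (S k)) as [sb1 eb1]; [unfold k; lia|].
  destruct (B_sum k) as [sb2 eb2]; [unfold k; lia|].
  assert (EF : forall n, e (X * IZR n) * (/ zeta mu n) ^ k * gen Y nu (t * zeta mu n) =
    (b 0%nat * / t) * (e (X * IZR n) * (/ et n) ^ S k)
    + b 1%nat * (e (X * IZR n) * (/ et n) ^ k) + tsum (fun m => DA k n m)).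
  { intros n. fold (et n). destruct (classic (et n = 0)) as [E|E].
    - rewrite (tsum_ext _ (fun _ => 0)).
      + rewrite (has_sum_tsum _ _ has_sum_0), E, Cinv_0. unfold k; simpl. ring.
      + intros m. unfold DA. rewrite E, Cinv_0. unfold k; simpl. ring.
    - assert (hne : t * et n <> 0) by now apply Cmult_neq_0.
      destruct (PY (t * et n) hne (reg_of_Re _ _ (Re_t_et n E))) as [p1 ->].
      unfold DA. rewrite (tsum_scal _ _ p1). fold b. simpl Cpow. field. auto. }
  assert (EG : forall m, e (Y * IZR m) * (/ zeta nu m) ^ k * gen X mu (zeta nu m / t) =
    (a 0%nat * t) * (e (Y * IZR m) * (/ ze m) ^ S k)
    + a 1%nat * (e (Y * IZR m) * (/ ze m) ^ k) + tsum (fun n => DB k n m)).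
  { intros m. fold (ze m). destruct (classic (ze m = 0)) as [E|E].
    - rewrite (tsum_ext _ (fun _ => 0)).
      + rewrite (has_sum_tsum _ _ has_sum_0), E, Cinv_0. unfold k; simpl. ring.
      + intros n. unfold DB. rewrite E, Cinv_0. unfold k; simpl. ring.
    - assert (hne : ze m / t <> 0).
      { intros H. apply E. replace (ze m) with (ze m / t * t) by (field; auto). rewrite H. ring. }
      destruct (PX (ze m / t) hne (reg_of_Re _ _ (Re_ze_t m E))) as [p1 ->].
      unfold DB. rewrite (tsum_scal _ _ p1). fold a. simpl Cpow. field. auto. }
  assert (sA := summable_plus _ _ (summable_scal (b 0%nat * / t) _ sa1) (summable_scal (b 1%nat) _ sa2)).
  assert (sB := summable_plus _ _ (summable_scal (a 0%nat * t) _ sb1) (summable_scal (a 1%nat) _ sb2)).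
  split; [|split].
  - eapply summable_ext; [intros n; symmetry; apply EF|]. now apply summable_plus.
  - eapply summable_ext; [intros n; symmetry; apply EG|]. now apply summable_plus.
  - rewrite (tsum_ext _ _ EF), (tsum_ext _ _ EG).
    rewrite !tsum_plus, !tsum_scal, ea1, ea2, eb1, eb2, <- SA2, <- SB2
      by (auto; apply summable_scal; auto).
    rewrite !Cmult_plus_distr_l, EB.
    unfold recip_sum. replace (k + 2)%nat with (S (S (S (S K)))) by (unfold k; lia).
    rewrite csum_S, csum_S, csum_Sl, csum_Sl.
    rewrite (csum_ext (fun i => t ^ k * (/ t) ^ S (S i) * a (S (S i)) * b (k + 1 - S (S i))%nat)
      (fun i => t ^ (K - i) * (a (2 + i)%nat * b (K + 1 - i)%nat))).
    2:{ intros i Hi. replace (k + 1 - S (S i))%nat with (K + 1 - i)%nat by (unfold k; lia).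
        replace (t ^ k) with (t ^ (K - i) * t ^ S (S i)).
        - rewrite Cpow_inv by auto. simpl (2 + i)%nat. field. now apply Cpow_nz.
        - rewrite <- Cpow_add_r. f_equal. unfold k; lia. }
    replace (k + 1 - 0)%nat with (S k) by lia.
    replace (k + 1 - 1)%nat with k by lia.
    replace (k + 1 - S (S K))%nat with 1%nat by (unfold k; lia).
    replace (k + 1 - S (S (S K)))%nat with 0%nat by (unfold k; lia).
    rewrite !Cpow_inv by auto. unfold k. simpl Cpow. field. repeat split; auto. now apply Cpow_nz.
Qed.

End Reciprocity.

(** * Lambert series as sums over the integers *)

Definition least_pos (gamma : R) : R := (gamma + IZR (up (- gamma)))%R.

Lemma least_pos_bounds gamma : (0 < least_pos gamma <= 1)%R.
Proof. unfold least_pos. destruct (archimed (- gamma)). lra. Qed.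

Lemma up_unique (r : R) (z : Z) : (r < IZR z)%R -> (IZR z <= r + 1)%R -> up r = z.
Proof. intros H1 H2. symmetry. now apply tech_up. Qed.

Lemma up_IZR (n : Z) : up (IZR n) = (n + 1)%Z.
Proof. apply up_unique; rewrite plus_IZR; lra. Qed.

Definition is_int (x : R) : Prop := exists n : Z, x = IZR n.

Lemma frac_part_int n : frac_part (IZR n) = 0%R.
Proof. unfold frac_part, Int_part. rewrite up_IZR, minus_IZR, plus_IZR. ring. Qed.

Lemma frac_part_eq0 x : frac_part x = 0%R <-> is_int x.
Proof.
  split; [|intros [n ->]; apply frac_part_int].
  intros H. exists (Int_part x). unfold frac_part in H. lra.
Qed.

Lemma least_pos_neg beta : least_pos (- beta) = (1 - frac_part beta)%R.
Proof. unfold least_pos, frac_part, Int_part. rewrite Ropp_involutive, minus_IZR. ring. Qed.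

Lemma least_pos_int beta : is_int beta -> least_pos beta = 1%R.
Proof.
  intros [n ->]. unfold least_pos. rewrite <- opp_IZR, up_IZR, plus_IZR, opp_IZR. ring.
Qed.

Lemma least_pos_frac beta : ~ is_int beta -> least_pos beta = frac_part beta.
Proof.
  intros H. unfold least_pos. replace (up (- beta)) with (- Int_part beta)%Z.
  - unfold frac_part. rewrite opp_IZR. ring.
  - symmetry. assert (h := base_Int_part beta). apply up_unique; rewrite opp_IZR; [|lra].
    destruct h as [h1 h2]. destruct (Rle_lt_or_eq_dec _ _ h1) as [h|h]; [lra|].
    exfalso. apply H. exists (Int_part beta). lra.
Qed.

(** The integers above [mu] start at [up mu], those below end at [- up (- mu)]. An integral [mu]
    lies in neither range, hence the vanishing hypothesis. *)
Lemma tsum_Z_sign (f : Z -> C) (mu : R) : (forall n, IZR n = mu -> f n = 0) ->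
  (summable (fun i : nat => f (up mu + Z.of_nat i)%Z) ->
   summable (fun i : nat => f (- up (- mu) - Z.of_nat i)%Z) -> summable f) /\
  (summable f -> tsum f = tsum (fun i : nat => f (up mu + Z.of_nat i)%Z)
                        + tsum (fun i : nat => f (- up (- mu) - Z.of_nat i)%Z)).
Proof.
  intros H0. destruct (classic (is_int mu)) as [[n Hn]|Hn].
  - assert (E1 : up mu = (n + 1)%Z) by (rewrite Hn; apply up_IZR).
    assert (E2 : (- up (- mu))%Z = (n - 1)%Z) by (rewrite Hn, <- opp_IZR, up_IZR; lia).
    rewrite E1, E2. set (g := fun i : nat => f (n + 1 - 1 - Z.of_nat i)%Z).
    assert (Eg : forall i, g (S i) = f (n - 1 - Z.of_nat i)%Z) by (intros i; unfold g; f_equal; lia).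
    assert (Rg : forall i, g i <> 0 -> exists j, S j = i).
    { intros [|i] Hi; [|now exists i]. exfalso. apply Hi. unfold g. apply H0.
      rewrite Hn. f_equal. lia. }
    split.
    + intros h1 h2. apply (summable_Z_split f (n + 1)); auto.
      apply (summable_inj_inv S (fun a b => eq_add_S a b) g Rg).
      eapply summable_ext; [|apply h2]. intros i. now rewrite Eg.
    + intros h. rewrite (tsum_Z_split f (n + 1) h). f_equal. fold g.
      rewrite (tsum_inj S (fun a b => eq_add_S a b) g Rg).
      * apply tsum_ext, Eg.
      * exact (summable_inj _ (Z_shift_inj' (n + 1)) f h).
  - assert (E : (- up (- mu))%Z = (up mu - 1)%Z).
    { assert (h := archimed mu). assert (h' := archimed (- mu)).
      assert (IZR (up mu) <> mu + 1)%R.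
      { intros E. apply Hn. exists (up mu - 1)%Z. rewrite minus_IZR. lra. }
      assert (up (- mu) = 1 - up mu)%Z; [|lia].
      apply up_unique; rewrite minus_IZR; lra. }
    rewrite E. split.
    + intros h1 h2. now apply (summable_Z_split f (up mu)).
    + intros h. now apply tsum_Z_split.
Qed.

Lemma up_sub mu (i : nat) : (IZR (up mu + Z.of_nat i) - mu)%R = (least_pos (- mu) + INR i)%R.
Proof. unfold least_pos. rewrite Ropp_involutive, plus_IZR, <- INR_IZR_INZ. ring. Qed.

Lemma down_sub mu (i : nat) : (IZR (- up (- mu) - Z.of_nat i) - mu)%R = (- (least_pos mu + INR i))%R.
Proof. unfold least_pos. rewrite minus_IZR, opp_IZR, <- INR_IZR_INZ. ring. Qed.

Lemma tsum_geom (q : C) : (Cmod q < 1)%R ->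
  summable (fun n => q ^ n) /\ tsum (fun n => q ^ n) = / (1 - q).
Proof.
  intros Hq. assert (h0 := Cmod_ge_0 q).
  set (r := ((1 + Cmod q) / 2)%R).
  assert (Hr : (0 < r < 1)%R) by (unfold r; lra).
  assert (HP : psum (fun _ => 1) r (/ (1 - r))).
  { eapply asum_le; [|apply (asum_geom r); lra]. intros n. rewrite Cmult_1_l, RtoC_pow. lra. }
  assert (hqr : (Cmod q <= r)%R) by (unfold r; lra).
  destruct (ps_Sl _ r _ q HP ltac:(lra) hqr) as [_ E].
  assert (hs := psum_summable _ _ _ _ HP hqr).
  split; [eapply summable_ext; [|apply hs]; intros; cbv beta; ring|].
  assert (hq1 : 1 - q <> 0).
  { intros H. assert (q = 1) by (replace q with (1 - (1 - q)) by ring; rewrite H; ring).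
    subst q. rewrite Cmod_1 in Hq. lra. }
  replace (tsum (fun n => q ^ n)) with (ps (fun _ => 1) q)
    by (apply tsum_ext; intros; ring).
  set (s := ps (fun _ => 1) q) in *.
  replace s with ((s - q * s) / (1 - q)) by (field; auto).
  replace (s - q * s) with (RtoC 1); [field; auto|]. rewrite E at 1. ring.
Qed.

Lemma Czpow_neq0 (z : C) k : z <> 0 -> Czpow z k <> 0.
Proof.
  intros H. destruct k as [|p|p]; simpl; [exact C1_nz|now apply Cpow_nz|].
  intros E. apply C1_nz. rewrite <- (Cinv_r (z ^ Pos.to_nat p)); [rewrite E; ring|now apply Cpow_nz].
Qed.

Lemma Cinv_inv z : / / z = z.
Proof.
  destruct (classic (z = 0)) as [->|H]; [now rewrite !Cinv_0|].
  assert (/ z <> 0). { intros E. apply C1_nz. rewrite <- (Cinv_r z H), E. ring. }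
  field. auto.
Qed.

Lemma Czpow_of_nat z n : Czpow z (Z.of_nat n) = z ^ n.
Proof. destruct n as [|n]; [easy|]. simpl Z.of_nat. unfold Czpow. now rewrite SuccNat2Pos.id_succ. Qed.

Lemma Czpow_opp_of_nat z n : Czpow z (- Z.of_nat n) = / z ^ n.
Proof.
  destruct n as [|n]; [simpl; field|].
  simpl Z.of_nat. unfold Czpow; simpl Z.opp. cbv iota. now rewrite SuccNat2Pos.id_succ.
Qed.

Lemma Czpow_succ (z : C) k : z <> 0 -> Czpow z (k + 1) = z * Czpow z k.
Proof.
  intros Hz. destruct (Z_le_dec 0 k) as [H|H].
  - rewrite <- (Z2Nat.id k H). replace (Z.of_nat (Z.to_nat k) + 1)%Z with (Z.of_nat (S (Z.to_nat k))) by lia.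
    rewrite !Czpow_of_nat. reflexivity.
  - replace k with (- Z.of_nat (S (Z.to_nat (- k - 1))))%Z by lia.
    replace (- Z.of_nat (S (Z.to_nat (- k - 1))) + 1)%Z with (- Z.of_nat (Z.to_nat (- k - 1)))%Z by lia.
    rewrite !Czpow_opp_of_nat. simpl. field. split; auto. now apply Cpow_nz.
Qed.

Lemma Cpow_m1_sq n : (-1) ^ n * (-1) ^ n = RtoC 1.
Proof. rewrite <- Cpow_mult_l. replace ((-1) * (-1)) with (RtoC 1) by ring. apply Cpow_1_l. Qed.

Lemma Czpow_mult (z w : C) k : z <> 0 -> w <> 0 -> Czpow (z * w) k = Czpow z k * Czpow w k.
Proof.
  intros Hz Hw. destruct k as [|p|p]; simpl; [ring|apply Cpow_mult_l|].
  rewrite Cpow_mult_l. field. split; now apply Cpow_nz.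
Qed.

Lemma Czpow_m1_inv k : / Czpow (-1) k = Czpow (-1) k.
Proof.
  assert (H : forall n, / (-1) ^ n = (-1) ^ n).
  { intros n. assert (h := Cpow_m1_sq n). assert ((-1) ^ n <> 0).
    { intros E. apply C1_nz. rewrite <- h, E. ring. }
    replace (/ (-1) ^ n) with (/ (-1) ^ n * ((-1) ^ n * (-1) ^ n)) by (rewrite h; ring).
    field. auto. }
  destruct k as [|p|p]; simpl; [field|apply H|]. now rewrite Cinv_inv, H.
Qed.

Lemma m1_neq0 : RtoC (-1) <> 0.
Proof. apply RtoC_neq0; lra. Qed.

(** This accounts for the sign [(-1)^(k-1)] in the theorem: with it, the second Lambert series
    continues the terms of the first to negative [y]. *)
Lemma Czpow_sign (z : C) k : z <> 0 -> Czpow (-1) (k - 1) * / Czpow z k = - / Czpow (- z) k.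
Proof.
  intros Hz. replace (- z) with ((-1) * z) by ring.
  rewrite Czpow_mult by (auto; exact m1_neq0).
  assert (h1 := Czpow_neq0 z k Hz). assert (h2 := Czpow_neq0 (-1) k m1_neq0).
  replace (/ (Czpow (-1) k * Czpow z k)) with (/ Czpow (-1) k * / Czpow z k) by (field; auto).
  rewrite Czpow_m1_inv. replace k with (k - 1 + 1)%Z at 3 by ring.
  rewrite Czpow_succ by exact m1_neq0. ring.
Qed.

Lemma Rcpow_Czpow (y : R) (k : Z) : (0 < y)%R -> Rcpow y (- IZR k) = / Czpow y k.
Proof.
  intros Hy.
  assert (HN : forall n, Cexp (INR n * ln y) = y ^ n).
  { intros n. rewrite Cexp_nat_mult, Cexp_RtoC, exp_ln; auto. }
  assert (hy : RtoC y <> 0) by (apply RtoC_neq0; lra).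
  unfold Rcpow. destruct (Z_le_dec 0 k) as [H|H].
  - rewrite <- (Z2Nat.id k H), Czpow_of_nat, <- INR_IZR_INZ, <- HN, <- Cexp_opp. f_equal. ring.
  - replace k with (- Z.of_nat (Z.to_nat (- k)))%Z by lia.
    rewrite Czpow_opp_of_nat, opp_IZR, <- INR_IZR_INZ, Cinv_inv, <- HN. f_equal.
    rewrite RtoC_opp. ring.
Qed.

Lemma pow_exp_bound (x : R) n : (0 <= x)%R -> (x ^ n / INR (fact n) <= exp x)%R.
Proof.
  intros Hx. assert (h := asum_pw (RtoC x) (cons n nil) ltac:(repeat constructor; auto)).
  cbn [nsum] in h. unfold pw in h.
  rewrite Cmod_div, <- RtoC_pow, !Cmod_R in h by apply INR_fact_neq0.
  rewrite (Rabs_pos_eq x), (Rabs_pos_eq (x ^ n)), (Rabs_pos_eq (INR _)) in h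
    by (try apply pow_le; auto; apply pos_INR). lra.
Qed.

(** For [k < 0] the power grows and is absorbed by [(eps y)^n / n! <= exp (eps y)]; for [k > 0] the
    lower bound [a] of [y] matters. *)
Lemma Czpow_inv_bound (k : Z) (a eps : R) : (0 < a)%R -> (0 < eps)%R ->
  exists K, (0 <= K)%R /\ forall y, (a <= y)%R -> (Cmod (/ Czpow (RtoC y) k) <= K * exp (eps * y))%R.
Proof.
  intros Ha He. destruct k as [|p|p].
  - exists 1%R. split; [lra|]. intros y Hy. simpl. rewrite Cmod_Cinv, Cmod_1, Rinv_1.
    assert (h := exp_ineq1_le (eps * y)). nra.
  - exists ((/ a) ^ Pos.to_nat p)%R. split; [apply pow_le; left; now apply Rinv_0_lt_compat|].
    intros y Hy. simpl. rewrite Cmod_Cinv, Cmod_pow, Cmod_R, Rabs_pos_eq, <- pow_inv by lra.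
    apply Rle_trans with ((/ a) ^ Pos.to_nat p * 1)%R.
    + rewrite Rmult_1_r. apply pow_incr. split; [left; apply Rinv_0_lt_compat; lra|].
      apply Rinv_le_contravar; lra.
    + apply Rmult_le_compat_l; [apply pow_le; left; now apply Rinv_0_lt_compat|].
      assert (h := exp_ineq1_le (eps * y)). nra.
  - set (n := Pos.to_nat p). exists (INR (fact n) * (/ eps) ^ n)%R.
    assert (hf := INR_fact_lt_0 n). split.
    + apply Rmult_le_pos; [lra|]. apply pow_le. left. now apply Rinv_0_lt_compat.
    + intros y Hy. simpl. fold n. rewrite Cinv_inv, Cmod_pow, Cmod_R, Rabs_pos_eq by lra.
      assert (h := pow_exp_bound (eps * y) n ltac:(nra)).
      apply Rle_div_l in h; [|lra].
      replace (y ^ n)%R with ((/ eps) ^ n * (eps * y) ^ n)%R.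
      * rewrite (Rmult_comm (INR _)), Rmult_assoc, (Rmult_comm (INR _)).
        apply Rmult_le_compat_l; auto. apply pow_le. left. now apply Rinv_0_lt_compat.
      * rewrite <- Rpow_mult_distr. f_equal. field. lra.
Qed.

Lemma summable_exp_nat (d a : R) : (0 < d)%R ->
  summable (fun i : nat => RtoC (exp (- d * (a + INR i)))).
Proof.
  intros Hd.
  assert (Hq : (0 <= exp (- d) < 1)%R).
  { split; [left; apply exp_pos|]. rewrite <- exp_0. apply exp_increasing. lra. }
  eapply summable_ext; [|apply (summable_scal (RtoC (exp (- d * a))) _ (ex_intro _ _ (asum_geom _ Hq)))].
  intros i. cbv beta. rewrite <- RtoC_mult. f_equal.
  rewrite <- Rpower_pow by apply exp_pos. unfold Rpower. rewrite ln_exp, <- exp_plus. f_equal. ring.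
Qed.

Lemma summable_exp_Z (d mu : R) : (0 < d)%R ->
  summable (fun n : Z => RtoC (exp (- d * Rabs (IZR n - mu)))).
Proof.
  intros Hd.
  apply (summable_le _ (fun n => indic (IZR n <> mu) * RtoC (exp (- d * Rabs (IZR n - mu)))
    + indic (IZR n = mu) * (e (0 * IZR n) * 1))).
  - intros n. destruct (classic (IZR n = mu)) as [E|E].
    + rewrite indic_false, indic_true by (auto; tauto).
      replace (0 * RtoC (exp (- d * Rabs (IZR n - mu))) + 1 * (e (0 * IZR n) * 1)) with (RtoC 1).
      * rewrite E, Rminus_diag, Rabs_R0, Rmult_0_r, exp_0. lra.
      * replace (0 * IZR n) with (RtoC 0) by ring. rewrite e_0. ring.
    + rewrite indic_true, indic_false by auto. right. f_equal. ring.
  - apply summable_plus.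
    + assert (H0 : forall n, IZR n = mu ->
        indic (IZR n <> mu) * RtoC (exp (- d * Rabs (IZR n - mu))) = 0).
      { intros n E. rewrite indic_false; [ring|tauto]. }
      apply (proj1 (tsum_Z_sign _ mu H0)).
      * eapply summable_le; [|apply (summable_exp_nat d (least_pos (- mu)) Hd)].
        intros i. cbv beta. rewrite up_sub. eapply Rle_trans; [apply Cmod_indic_le|].
        assert (h := least_pos_bounds (- mu)). assert (h' := pos_INR i).
        rewrite (Rabs_pos_eq (least_pos _ + _)) by lra. lra.
      * eapply summable_le; [|apply (summable_exp_nat d (least_pos mu) Hd)].
        intros i. cbv beta. rewrite down_sub. eapply Rle_trans; [apply Cmod_indic_le|].
        assert (h := least_pos_bounds mu). assert (h' := pos_INR i).
        rewrite Rabs_Ropp, (Rabs_pos_eq (least_pos _ + _)) by lra. lra.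
    (* With [X = 0] and [w = 1], [polar_term] is the summability of the indicator of the single
       possible index [n = mu]. *)
    + eapply summable_ext; [|apply (proj1 (polar_term 0 mu 1))].
      intros n. cbv beta. f_equal. destruct (classic (zeta mu n = 0)) as [E|E].
      * rewrite !indic_true; auto. now apply zeta_eq0.
      * rewrite !indic_false; auto. intros E'. apply E. now apply zeta_eq0.
Qed.

Section Lambert.
Context (tau : C) (Htau : (0 < Re tau)%R).

Lemma Cmod_Cexp_tau (s : R) : Cmod (Cexp (- (2 * PI) * tau * s)) = exp (- (2 * PI * Re tau) * s).
Proof.
  rewrite Cmod_Cexp. f_equal. rewrite <- !RtoC_mult, <- RtoC_opp, (Cmult_comm _ tau).
  rewrite <- Cmult_assoc, <- RtoC_mult, re_scal_r. ring.
Qed.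

(** For fixed [y > 0] the inner series is geometric, with ratio of modulus [exp (- c y) < 1]. The
    factor left from its first term makes the outer series decay exponentially. *)
Lemma lambert_geom (k : Z) (gamma dlt kappa lambda : R) :
  let F (l : nat) : C := let y := (least_pos dlt + INR l)%R in
    e (y * lambda) * / Czpow y k *
    (e (least_pos gamma * kappa) * Cexp (- (2 * PI) * tau * (least_pos gamma * y)) /
     (1 - e kappa * Cexp (- (2 * PI) * tau * y))) in
  summable F /\ lambert (IZR k) gamma dlt kappa lambda tau = tsum F.
Proof.
  intros F. assert (hp := PI2_3_2).
  set (c := (2 * PI * Re tau)%R). assert (hc : (0 < c)%R) by (unfold c; nra).
  assert (hd := least_pos_bounds dlt). assert (hg := least_pos_bounds gamma).
  assert (hq : forall y, (0 < y)%R ->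
    Cmod (e kappa * Cexp (- (2 * PI) * tau * y)) = exp (- c * y)).
  { intros y Hy. rewrite Cmod_mult, Cmod_e, Cmod_Cexp_tau, Rmult_1_l. easy. }
  assert (hq1 : forall y, (0 < y)%R -> (exp (- c * y) < 1)%R).
  { intros y Hy. rewrite <- exp_0. apply exp_increasing. nra. }
  assert (Hinner : forall l : nat, let y := (least_pos dlt + INR l)%R in
    let f (j : nat) := e ((least_pos gamma + INR j)%R * kappa + y * lambda) * Rcpow y (- IZR k)
      * Cexp (- (2 * PI) * tau * ((least_pos gamma + INR j)%R * y)) in
    summable f /\ tsum f = F l).
  { intros l y f. assert (hl := pos_INR l). assert (hy : (0 < y)%R) by (unfold y; lra).
    set (q := e kappa * Cexp (- (2 * PI) * tau * y)).
    destruct (tsum_geom q) as [g1 g2]; [unfold q; rewrite hq; auto|].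
    assert (E : forall j, (e (y * lambda) * / Czpow y k *
      (e (least_pos gamma * kappa) * Cexp (- (2 * PI) * tau * (least_pos gamma * y)))) * q ^ j = f j).
    { intros j. unfold f, q. rewrite Rcpow_Czpow, Cpow_mult_l, <- e_nat_mult, <- Cexp_nat_mult by auto.
      rewrite e_plus, RtoC_plus.
      replace ((least_pos gamma + INR j) * kappa) with (least_pos gamma * kappa + INR j * kappa) by ring.
      replace (- (2 * PI) * tau * ((least_pos gamma + INR j) * y)) with
        (- (2 * PI) * tau * (least_pos gamma * y) + INR j * (- (2 * PI) * tau * y)) by ring.
      rewrite e_plus, Cexp_plus. ring. }
    split; [eapply summable_ext; [apply E|exact (summable_scal _ (fun j => q ^ j) g1)]|].
    rewrite <- (tsum_ext _ _ E), (tsum_scal _ (fun j => q ^ j) g1), g2. unfold F. fold y q. unfold Cdiv. ring. }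
  assert (HF : summable F).
  (* Half of the exponential decay pays for the power of [y], whatever the sign of [k]; [Q] bounds
     the inverse denominators by the value at the least [y]. *)
  { destruct (Czpow_inv_bound k (least_pos dlt) (c * least_pos gamma / 2)) as (K & HK & HKb); [lra|nra|].
    set (Q := (/ (1 - exp (- c * least_pos dlt)))%R).
    assert (hQ : (0 < Q)%R) by (apply Rinv_0_lt_compat; specialize (hq1 (least_pos dlt)); lra).
    assert (hd2 : (0 < c * least_pos gamma / 2)%R) by nra.
    eapply summable_le; [|apply (summable_scal (RtoC (K * Q)) _ (summable_exp_nat _ (least_pos dlt) hd2))].
    intros l. cbv beta. unfold F. set (y := (least_pos dlt + INR l)%R).
    assert (hl := pos_INR l). assert (hy : (least_pos dlt <= y)%R) by (unfold y; lra).
    specialize (HKb y hy). specialize (hq1 y ltac:(lra)).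
    assert (hden : (/ Q <= Cmod (1 - e kappa * Cexp (- (2 * PI) * tau * y)))%R).
    { unfold Q. rewrite Rinv_inv.
      apply Rle_trans with (1 - exp (- c * y))%R.
      - assert (exp (- c * y) <= exp (- c * least_pos dlt))%R; [|lra].
        destruct (Req_dec y (least_pos dlt)) as [->|Hne]; [lra|]. left. apply exp_increasing. nra.
      - rewrite <- hq by lra.
        assert (Cmod 1 <= Cmod (1 - e kappa * Cexp (- (2 * PI) * tau * y)) +
          Cmod (e kappa * Cexp (- (2 * PI) * tau * y)))%R; [|rewrite Cmod_1 in *; lra].
        replace (RtoC 1) with ((1 - e kappa * Cexp (- (2 * PI) * tau * y)) +
          e kappa * Cexp (- (2 * PI) * tau * y)) at 1 by ring. apply Cmod_triangle. }
    assert (hQi : (0 < / Q)%R) by now apply Rinv_0_lt_compat.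
    unfold Cdiv. rewrite <- (RtoC_mult (least_pos gamma) y).
    rewrite !Cmod_mult, (Cmod_Cinv (1 - _)), !Cmod_e_mult, Cmod_Cexp_tau, !Cmod_R, !Rmult_1_l.
    rewrite (Rabs_pos_eq (K * Q)), (Rabs_pos_eq (exp _)) by (try (left; apply exp_pos); nra).
    fold c.
    replace (K * Q * exp (- (c * least_pos gamma / 2) * y))%R with
      ((K * exp (c * least_pos gamma / 2 * y)) * (exp (- c * (least_pos gamma * y)) * Q))%R.
    - apply Rmult_le_compat; [apply Cmod_ge_0| |auto|].
      + apply Rmult_le_pos; [left; apply exp_pos|]. left. apply Rinv_0_lt_compat. lra.
      + apply Rmult_le_compat_l; [left; apply exp_pos|].
        rewrite <- (Rinv_inv Q). apply Rinv_le_contravar; auto.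
    - replace (- (c * least_pos gamma / 2) * y)%R with (c * least_pos gamma / 2 * y + - c * (least_pos gamma * y))%R by field.
      rewrite exp_plus. ring. }
  split; auto.
  unfold lambert, shifted_sum.
  assert (El : forall l : nat, (dlt + IZR (up (- dlt) + Z.of_nat l))%R = (least_pos dlt + INR l)%R).
  { intros l. unfold least_pos. rewrite plus_IZR, <- INR_IZR_INZ. ring. }
  assert (Ej : forall j : nat, (gamma + IZR (up (- gamma) + Z.of_nat j))%R = (least_pos gamma + INR j)%R).
  { intros j. unfold least_pos. rewrite plus_IZR, <- INR_IZR_INZ. ring. }
  transitivity (CSeries F); [|now apply CSeries_tsum].
  f_equal. apply functional_extensionality. intros l. rewrite El.
  destruct (Hinner l) as [i1 <-]. rewrite <- (CSeries_tsum _ i1).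
  f_equal. apply functional_extensionality. intros j. now rewrite Ej.
Qed.

End Lambert.

(* By geometric summation over x, the Lambert series over y > 0 and y < 0 have the general terms
   [e (y alpha) * y ^ (-k) * gzb nu beta tau y]. When [beta] is an integer the series over y > 0
   starts at x = 1, so that the term x = 0 has to be removed from [gz]. *)
Definition gz (nu X : R) (tau : C) (y : R) : C := - gen X nu (- (2 * PI) * tau * y).

Definition pos_ind (y : R) : C := if Rlt_dec 0 y then 1 else 0.

Definition gzb (nu beta : R) (tau : C) (y : R) : C :=
  gz nu (frac_part beta) tau y - delta beta * pos_ind y.

Definition bsum (k : Z) (alpha beta mu nu : R) (tau : C) : C :=
  lambert (IZR k) beta (- mu) nu alpha tau
  + Czpow (-1) (k - 1) * lambert (IZR k) (- beta) mu (- nu) (- alpha) tau.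

Section LambertZ.
Context (tau : C) (Htau : (0 < Re tau)%R).

Lemma gz_regular (nu y : R) : y <> 0%R -> e nu * Cexp (- (2 * PI) * tau * y) <> 1.
Proof.
  intros Hy. apply reg_of_Re. assert (hp := PI_RGT_0).
  replace (Re (- (2 * PI) * tau * y)) with (- (2 * PI * Re tau * y))%R by (reim; ring).
  assert (0 < 2 * PI * Re tau)%R by nra.
  apply Ropp_neq_0_compat, Rmult_integral_contrapositive. split; lra.
Qed.

(** For [y < 0] the second series starts at [1 - <beta>] for every [beta]; after multiplication of
    numerator and denominator by [e nu * Cexp z] it becomes the same quotient at [y]. Only the half
    [y > 0] therefore needs the correction in [gzb]. *)
Lemma bsum_Z (k : Z) (alpha beta mu nu : R) :
  let T (n : Z) : C := let y := (IZR n - mu)%R in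
    indic (y <> 0%R) * (e (y * alpha) * / Czpow y k * gzb nu beta tau y) in
  summable T /\ tsum T = bsum k alpha beta mu nu tau.
Proof.
  intros T.
  destruct (lambert_geom tau Htau k beta (- mu) nu alpha) as [s1 e1].
  destruct (lambert_geom tau Htau k (- beta) mu (- nu) (- alpha)) as [s2 e2].
  set (F1 := fun l => _) in s1, e1. set (F2 := fun l => _) in s2, e2.
  assert (T0 : forall n, IZR n = mu -> T n = 0).
  { intros n Hn. unfold T. rewrite indic_false; [ring|]. rewrite Hn. lra. }
  assert (Tup : forall i, F1 i = T (up mu + Z.of_nat i)%Z).
  { intros i. unfold T, F1. rewrite up_sub.
    set (y := (least_pos (- mu) + INR i)%R).
    assert (hy : (0 < y)%R) by (unfold y; generalize (least_pos_bounds (- mu)) (pos_INR i); lra).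
    rewrite indic_true by lra. rewrite Cmult_1_l. f_equal.
    unfold gzb, gz, gen, pos_ind. destruct Rlt_dec as [_|]; [|lra].
    assert (hreg := gz_regular nu y ltac:(lra)).
    set (z := - (2 * PI) * tau * y) in *.
    assert (hd : 1 - e nu * Cexp z <> 0).
    { intros E. apply hreg. replace (e nu * Cexp z) with (1 - (1 - e nu * Cexp z)) by ring.
      rewrite E. ring. }
    assert (hd' : e nu * Cexp z - 1 <> 0) by now apply Cminus_eq_contra.
    destruct (classic (is_int beta)) as [Hb|Hb].
    - rewrite (least_pos_int _ Hb), (proj2 (frac_part_eq0 beta) Hb).
      destruct Hb as [n Hn]. rewrite (delta_true _ _ Hn).
      replace (- (2 * PI) * tau * (1 * y)) with z by (unfold z; ring).
      replace (0 * nu) with (RtoC 0) by ring. replace (0 * z) with (RtoC 0) by ring.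
      replace (1 * nu) with (RtoC nu) by ring.
      rewrite e_0, Cexp_0. field. auto.
    - rewrite (least_pos_frac _ Hb), (delta_false _ Hb).
      replace (- (2 * PI) * tau * (frac_part beta * y)) with (frac_part beta * z) by (unfold z; ring).
      field. auto. }
  assert (Tdown : forall i, Czpow (-1) (k - 1) * F2 i = T (- up (- mu) - Z.of_nat i)%Z).
  { intros i. unfold T, F2. rewrite down_sub.
    set (y := (least_pos mu + INR i)%R).
    assert (hy : (0 < y)%R) by (unfold y; generalize (least_pos_bounds mu) (pos_INR i); lra).
    rewrite indic_true by lra. rewrite Cmult_1_l.
    unfold gzb, gz, gen, pos_ind. destruct Rlt_dec as [|_]; [lra|].
    assert (hreg := gz_regular nu (- y) ltac:(lra)).
    set (z := - (2 * PI) * tau * (- y)%R) in *.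
    assert (hd : e nu * Cexp z - 1 <> 0) by now apply Cminus_eq_contra.
    rewrite least_pos_neg. set (X := frac_part beta).
    replace (e (y * (- alpha)%R)) with (e ((- y)%R * alpha)) by (f_equal; rewrite !RtoC_opp; ring).
    replace (- (2 * PI) * tau * ((1 - X)%R * y)) with (- z + X * z)
      by (unfold z; rewrite RtoC_opp, RtoC_minus; ring).
    replace (- (2 * PI) * tau * y) with (- z) by (unfold z; rewrite RtoC_opp; ring).
    replace ((1 - X)%R * (- nu)%R) with (- nu + X * nu) by (rewrite RtoC_opp, RtoC_minus; ring).
    rewrite !RtoC_opp, !e_plus, !Cexp_plus, !e_opp, !Cexp_opp.
    transitivity (e (- y * alpha) * (Czpow (-1) (k - 1) * / Czpow y k) *
      (e (X * nu) * Cexp (X * z) / (e nu * Cexp z - 1))).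
    - assert (h1 := e_neq0 nu). assert (h2 := Cexp_neq0 z).
      assert (h3 := Czpow_neq0 y k (RtoC_neq0 y ltac:(lra))).
      assert (hd1 : 1 - / e nu * / Cexp z <> 0).
      { intros E. apply hd. replace (e nu * Cexp z - 1) with (e nu * Cexp z * (1 - / e nu * / Cexp z))
          by (field; auto). rewrite E. ring. }
      field. repeat split; auto.
    - rewrite Czpow_sign by (apply RtoC_neq0; lra). unfold Cdiv. ring. }
  destruct (tsum_Z_sign T mu T0) as [z1 z2].
  assert (S2' : summable (fun i => Czpow (-1) (k - 1) * F2 i)) by now apply summable_scal.
  assert (ST : summable T).
  { apply z1; [eapply summable_ext; [apply Tup|exact s1]|eapply summable_ext; [apply Tdown|exact S2']]. }
  split; auto.
  rewrite (z2 ST), <- (tsum_ext _ _ Tup), <- (tsum_ext _ _ Tdown), tsum_scal by auto.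
  unfold bsum. now rewrite e1, e2.
Qed.

End LambertZ.

(** The character is taken at [n] and not at [n - mu], so that the term depends on [alpha] modulo 1
    only; the discrepancy is the factor [e (alpha mu)] of the theorem. There is no correction at
    positive [y] here: for integral [beta] it is what the psi term restores. *)
Definition ms (k : nat) (alpha X mu nu : R) (tau : C) (n : Z) : C :=
  let y := (IZR n - mu)%R in
  indic (y <> 0%R) * (e (alpha * IZR n) * (/ y) ^ k * gz nu X tau y).

Lemma Re_Cinv_pos tau : (0 < Re tau)%R -> (0 < Re (/ tau))%R.
Proof.
  intros H. unfold Cinv; simpl. apply Rdiv_lt_0_compat; auto.
  assert (0 < fst tau ^ 2)%R by (apply pow_lt; apply H).
  assert (0 <= snd tau ^ 2)%R by apply pow2_ge_0. simpl in *. lra.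
Qed.

Section MS.
Context (mu nu : R) (tau : C) (Htau : (0 < Re tau)%R).
Let t : C := Ci * tau.

Let tau0 : tau <> 0.
Proof. apply (tau_neq0 tau Htau). Qed.

Let t0 : t <> 0.
Proof. apply Cmult_neq_0; [apply Ci_nz|apply tau0]. Qed.

(** [reciprocity_ge2] with powers of [2 PI i] extracted. In the dual sum [m] is replaced by [-m],
    because [zeta nu m / t] equals [- 2 PI (1 / tau)] times [-(m - nu)]; this explains the
    parameters [- Y] and [- nu]. *)
Lemma ms_reciprocity_ge2 (X Y : R) (K : nat) : (0 <= X < 1)%R -> (0 <= Y < 1)%R ->
  let k := S (S K) in
  summable (ms k X Y mu nu tau) /\ summable (ms k (- Y) X (- nu) mu (/ tau)) /\
  tsum (ms k X Y mu nu tau) + (-1) ^ k * t ^ S K * tsum (ms k (- Y) X (- nu) mu (/ tau))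
  = (2 * PI * Ci) ^ k * recip_sum X Y mu nu tau k.
Proof.
  intros HX HY k.
  destruct (reciprocity_ge2 X Y mu nu HX HY tau Htau K) as (s1 & s2 & E). fold k t in s1, s2, E.
  set (q := 2 * PI * Ci). assert (hq : q <> 0) by apply two_pi_i_neq0.
  assert (E1 : forall n, - q ^ k * (e (X * IZR n) * (/ zeta mu n) ^ k * gen Y nu (t * zeta mu n))
    = ms k X Y mu nu tau n).
  { intros n. unfold ms, gz. destruct (Req_dec (IZR n - mu) 0) as [Hn|Hn].
    - rewrite indic_false by lra. unfold zeta. rewrite Hn, Cmult_0_r, Cinv_0. unfold k. simpl. ring.
    - rewrite indic_true by auto.
      replace (t * zeta mu n) with (- (2 * PI) * tau * (IZR n - mu)%R).
      + unfold zeta. fold q. replace (/ (q * (IZR n - mu)%R)) with (/ q * / (IZR n - mu)%R)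
          by (field; split; auto; now apply RtoC_neq0).
        rewrite Cpow_mult_l, (Cpow_inv q) by auto. field. now apply Cpow_nz.
      + unfold t, zeta. replace (Ci * tau * (2 * PI * Ci * (IZR n - mu)%R))
          with (Ci * Ci * (2 * PI) * tau * (IZR n - mu)%R) by ring. rewrite Ci2. ring. }
  assert (E2 : forall m, - ((-1) ^ k * q ^ k) *
    (e (Y * IZR m) * (/ zeta nu m) ^ k * gen X mu (zeta nu m / t))
    = ms k (- Y) X (- nu) mu (/ tau) (- m)%Z).
  { intros m. unfold ms, gz.
    replace (IZR (- m) - - nu)%R with (- (IZR m - nu))%R by (rewrite opp_IZR; ring).
    destruct (Req_dec (IZR m - nu) 0) as [Hn|Hn].
    - rewrite indic_false by lra. unfold zeta. rewrite Hn, Cmult_0_r, Cinv_0. unfold k. simpl. ring.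
    - rewrite indic_true by lra.
      replace ((- Y)%R * IZR (- m)) with (Y * IZR m) by (rewrite opp_IZR, !RtoC_opp; ring).
      replace (zeta nu m / t) with (- (2 * PI) * / tau * (- (IZR m - nu))%R).
      + unfold zeta. fold q. rewrite RtoC_opp.
        replace (/ (q * (IZR m - nu)%R)) with ((-1) * (/ q * / - (IZR m - nu)%R))
          by (field; split; auto; now apply RtoC_neq0).
        rewrite !Cpow_mult_l, (Cpow_inv q) by auto.
        transitivity (- ((-1) ^ k * (-1) ^ k) * (q ^ k * / q ^ k) * (e (Y * IZR m) *
          (/ - (IZR m - nu)%R) ^ k * gen X mu (- (2 * PI) * / tau * - (IZR m - nu)%R))); [ring|].
        rewrite Cpow_m1_sq, Cinv_r by now apply Cpow_nz. ring.
      + unfold t, zeta. rewrite RtoC_opp. field. split; [auto|apply Ci_nz]. }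
  assert (S1 : summable (ms k X Y mu nu tau)).
  { eapply summable_ext; [apply E1|now apply summable_scal]. }
  assert (S2 : summable (fun m => ms k (- Y) X (- nu) mu (/ tau) (- m)%Z)).
  { eapply summable_ext; [apply E2|now apply summable_scal]. }
  assert (hi : forall x y : Z, (- x = - y)%Z -> x = y) by (intros; lia).
  assert (S2' : summable (ms k (- Y) X (- nu) mu (/ tau))).
  { apply (summable_inj_inv _ hi); auto. intros n _. exists (- n)%Z. lia. }
  split; [auto|split; [auto|]].
  rewrite (tsum_inj _ hi (ms k (- Y) X (- nu) mu (/ tau))); auto.
  2:{ intros n _. exists (- n)%Z. lia. }
  rewrite <- (tsum_ext _ _ E1), <- (tsum_ext _ _ E2), !tsum_scal by auto.
  transitivity (- q ^ k * (tsum (fun n => e (X * IZR n) * (/ zeta mu n) ^ k * gen Y nu (t * zeta mu n))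
    + ((-1) ^ k * (-1) ^ k) * (t ^ S K *
      tsum (fun m => e (Y * IZR m) * (/ zeta nu m) ^ k * gen X mu (zeta nu m / t))))); [ring|].
  rewrite Cpow_m1_sq, Cmult_1_l, E. fold k. ring.
Qed.

End MS.

(** The two generating functions differ by the factor [e (h kappa) Cexp (h z)]. *)
Lemma bcoef_shift (X h kappa : R) (j : nat) : (0 <= X < 1)%R -> (0 <= X + h < 1)%R ->
  bcoef (X + h)%R kappa j = e (h * kappa) * conv (pw h) (bcoef X kappa) j.
Proof.
  intros HX Hh.
  destruct (gen_partial_fractions X kappa HX) as ((r & M & Hr & HM & Hg) & _).
  assert (H1 := psum_Cexp h r (Rlt_le _ _ Hr)).
  assert (H2 := psum_conv _ _ _ _ _ H1 HM).
  assert (H3 := psum_scal (e (h * kappa)) _ _ _ H2).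
  apply (Ccoef_unique _ _ (fun j => e (h * kappa) * conv (pw h) (bcoef X kappa) j) r _ Hr H3).
  intros z Hz. destruct (Hg z Hz) as [_ E].
  rewrite (ps_scal _ _ r _ z H2), (ps_conv _ _ r _ _ z H1 HM), ps_Cexp, <- E by lra.
  unfold gen. rewrite RtoC_plus.
  replace ((X + h) * kappa) with (h * kappa + X * kappa) by ring.
  replace ((X + h) * z) with (h * z + X * z) by ring.
  rewrite e_plus, Cexp_plus. unfold Cdiv. ring.
Qed.

(** Since [y] keeps a distance [d] from 0, [|w - 1|] is at least [D * max 1 |w|] with
    [D = 1 - exp (- c d)]. The numerator has modulus [|w|^X], which leaves the rate [X] for [y > 0]
    and [1 - X] for [y < 0]. For [X = 0] the limit at plus infinity is 1 and must be subtracted. *)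
Lemma gz_decay (nu mu X : R) (tau : C) (Htau : (0 < Re tau)%R) : (0 <= X < 1)%R ->
  exists K, (0 <= K)%R /\ forall n, let y := (IZR n - mu)%R in y <> 0%R ->
    ((0 < X)%R -> (Cmod (gz nu X tau y) <=
       K * exp (- (2 * PI * Re tau * Rmin X (1 - X)) * Rabs y))%R) /\
    (X = 0%R -> (Cmod (gz nu X tau y - pos_ind y) <= K * exp (- (2 * PI * Re tau) * Rabs y))%R).
Proof.
  intros HX. destruct (Z_dist_lower mu) as (d & Hd & Hdist).
  assert (hp := PI2_3_2). set (c := (2 * PI * Re tau)%R). assert (hc : (0 < c)%R) by (unfold c; nra).
  set (D := (1 - exp (- c * d))%R).
  assert (hD : (0 < D)%R).
  { unfold D. assert (exp (- c * d) < 1)%R; [|lra]. rewrite <- exp_0. apply exp_increasing. nra. }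
  exists (/ D)%R. split; [left; now apply Rinv_0_lt_compat|].
  intros n y Hy. assert (hyd : (d <= Rabs y)%R) by (apply Hdist; unfold y in Hy; lra).
  set (z := - (2 * PI) * tau * y). set (w := e nu * Cexp z).
  assert (hreg : w <> 1) by now apply gz_regular.
  assert (hzX : Cmod (e (X * nu) * Cexp (X * z)) = exp (- c * X * y)).
  { rewrite Cmod_mult, Cmod_e_mult, Rmult_1_l, Cmod_Cexp. f_equal. unfold z, c. reim. ring. }
  assert (hw : Cmod w = exp (- c * y)).
  { unfold w. rewrite Cmod_mult, Cmod_e, Rmult_1_l, Cmod_Cexp. f_equal. unfold z, c. reim. ring. }
  assert (hden : (D * Rmax 1 (exp (- c * y)) <= Cmod (w - 1))%R).
  { assert (t1 : (Cmod 1 <= Cmod w + Cmod (w - 1))%R).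
    { rewrite <- (Cmod_opp (w - 1)). replace (RtoC 1) with (w + - (w - 1)) at 1 by ring.
      apply Cmod_triangle. }
    assert (t2 : (Cmod w <= Cmod 1 + Cmod (w - 1))%R).
    { replace w with (1 + (w - 1)) at 1 by ring. apply Cmod_triangle. }
    rewrite Cmod_1 in t1, t2. rewrite hw in t1, t2.
    assert (hmono : (exp (- c * Rabs y) <= exp (- c * d))%R).
    { destruct (Req_dec d (Rabs y)) as [<-|Hne]; [lra|]. left. apply exp_increasing. nra. }
    destruct (Rle_dec 0 y) as [Hy0|Hy0].
    - rewrite Rabs_pos_eq in hmono by auto.
      assert (exp (- c * y) <= 1)%R.
      { rewrite <- exp_0. destruct Hy0 as [Hy0|Hy0]; [|lra]. left. apply exp_increasing. nra. }
      rewrite Rmax_left by auto. unfold D. lra.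
    - rewrite Rabs_left in hmono by lra.
      assert (1 <= exp (- c * y))%R.
      { rewrite <- exp_0. left. apply exp_increasing. nra. }
      rewrite Rmax_right by auto.
      assert (E : (exp (- c * y) * exp (- c * - y) = 1)%R).
      { rewrite <- exp_plus, <- exp_0. f_equal. ring. }
      unfold D. nra. }
  assert (hm1 := Rmax_l 1 (exp (- c * y))). assert (hm2 := Rmax_r 1 (exp (- c * y))).
  assert (hwd : w - 1 <> 0) by now apply Cminus_eq_contra.
  assert (gen_bound : forall (num : C) (s : R), (Cmod num <= exp (- s * Rabs y) * Rmax 1 (exp (- c * y)))%R ->
     (Cmod (num / (w - 1)) <= / D * exp (- s * Rabs y))%R).
  { intros num s Hnum. rewrite Cmod_div by auto.
    apply Rle_div_l; [apply Rlt_gt, Cmod_gt_0; auto|].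
    eapply Rle_trans; [apply Hnum|].
    replace (exp (- s * Rabs y) * Rmax 1 (exp (- c * y)))%R with
      (/ D * exp (- s * Rabs y) * (D * Rmax 1 (exp (- c * y))))%R by (field; lra).
    apply Rmult_le_compat_l; auto.
    apply Rmult_le_pos; [left; now apply Rinv_0_lt_compat|left; apply exp_pos]. }
  split; intros HX0.
  - unfold gz. rewrite Cmod_opp. unfold gen. fold z w. apply gen_bound. rewrite hzX.
    set (m := Rmin X (1 - X)). assert (m1 := Rmin_l X (1 - X)). assert (m2 := Rmin_r X (1 - X)).
    assert (m0 : (0 < m)%R) by (apply Rmin_glb_lt; lra). fold m in m1, m2.
    destruct (Rle_dec 0 y) as [Hy0|Hy0].
    + rewrite (Rabs_pos_eq y) by auto.
      apply Rle_trans with (exp (- (c * m) * y) * 1)%R.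
      * rewrite Rmult_1_r. destruct (Req_dec X m) as [<-|Hne]; [right; f_equal; ring|].
        left. apply exp_increasing. assert (0 < y)%R by lra. assert (m < X)%R by lra.
        assert (0 < c * y)%R by nra. nra.
      * apply Rmult_le_compat_l; [left; apply exp_pos|auto].
    + rewrite (Rabs_left y) by lra.
      apply Rle_trans with (exp (- (c * m) * - y) * exp (- c * y))%R.
      * rewrite <- exp_plus. destruct (Req_dec (1 - X) m) as [Hm|Hne]; [right; f_equal; nra|].
        left. apply exp_increasing. assert (0 < - y)%R by lra. assert (m < 1 - X)%R by lra.
        assert (0 < c * - y)%R by nra. nra.
      * apply Rmult_le_compat_l; [left; apply exp_pos|auto].
  - unfold gz, gen. fold z w. rewrite HX0.
    replace (0 * nu) with (RtoC 0) by ring. replace (0 * z) with (RtoC 0) by ring.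
    rewrite e_0, Cexp_0. unfold pos_ind. destruct Rlt_dec as [Hy0|Hy0].
    + replace (- (1 * 1 / (w - 1)) - 1) with (- w / (w - 1)) by (field; auto).
      apply gen_bound. rewrite Cmod_opp, hw, (Rabs_pos_eq y) by lra.
      replace (exp (- c * y)) with (exp (- c * y) * 1)%R at 1 by ring.
      apply Rmult_le_compat_l; [left; apply exp_pos|auto].
    + replace (- (1 * 1 / (w - 1)) - 0) with (- (1) / (w - 1)) by (field; auto).
      apply gen_bound. rewrite Cmod_opp, Cmod_1, (Rabs_left y) by lra.
      replace 1%R with (exp (- c * - y) * exp (- c * y))%R at 1.
      * apply Rmult_le_compat_l; [left; apply exp_pos|auto].
      * rewrite <- exp_plus, <- exp_0. f_equal. ring.
Qed.

(** * Reciprocity for k = 1 and k = 0 in the open square *)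

Lemma exp_le_mono (x y : R) : (x <= y)%R -> (exp x <= exp y)%R.
Proof. intros [H| ->]; [left; now apply exp_increasing|lra]. Qed.

Lemma ms_exp_summable (alpha X mu nu : R) (tau s : C) : (0 < Re tau)%R -> (0 < X < 1)%R ->
  exists r0, (0 < r0)%R /\ forall r, (0 < r <= r0)%R ->
    summable (fun n => ms 2 alpha X mu nu tau n * RtoC (exp (r * Cmod (s * (IZR n - mu)%R)))).
Proof.
  intros Htau HX.
  destruct (gz_decay nu mu X tau Htau ltac:(lra)) as (K & HK & Hdec).
  destruct (Z_dist_lower mu) as (d & Hd & Hdist).
  assert (hp := PI2_3_2).
  set (c := (2 * PI * Re tau * Rmin X (1 - X))%R).
  assert (hm : (0 < Rmin X (1 - X))%R) by (apply Rmin_glb_lt; lra).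
  assert (hc : (0 < c)%R) by (unfold c; apply Rmult_lt_0_compat; [nra|lra]).
  assert (hs := Cmod_ge_0 s).
  (* Then [r |s| <= c / 2], and the exponential weight uses at most half of the decay. *)
  exists (c / (2 * (Cmod s + 1)))%R. split; [apply Rdiv_lt_0_compat; lra|].
  intros r Hr.
  assert (hrs : (r * Cmod s <= c / 2)%R).
  { destruct Hr as [h1 h2]. apply Rle_div_r in h2; [|lra]. nra. }
  eapply summable_le; [|apply (summable_scal (RtoC ((/ d) ^ 2 * K)) _ (summable_exp_Z (c / 2) mu ltac:(lra)))].
  intros n. cbv beta. unfold ms. destruct (Req_dec (IZR n - mu) 0) as [Hn|Hn].
  - rewrite indic_false by lra. rewrite !Cmult_0_l, Cmod_0. apply Cmod_ge_0.
  - rewrite indic_true, Cmult_1_l by auto.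
    destruct (Hdec n Hn) as [Hd1 _]. specialize (Hd1 ltac:(lra)). fold c in Hd1.
    set (y := (IZR n - mu)%R) in *.
    assert (hy : (d <= Rabs y)%R) by (apply Hdist; unfold y in Hn; lra).
    rewrite !Cmod_mult, Cmod_e_mult, Rmult_1_l, Cmod_pow, Cmod_Cinv, !Cmod_R.
    rewrite !(Rabs_pos_eq (exp _)) by (left; apply exp_pos).
    rewrite (Rabs_pos_eq ((/ d) ^ 2 * K)).
    2:{ apply Rmult_le_pos; auto. apply pow_le. left. now apply Rinv_0_lt_compat. }
    replace ((/ d) ^ 2 * K * exp (- (c / 2) * Rabs y))%R with
      ((/ d) ^ 2 * (K * exp (- c * Rabs y)) * exp (c / 2 * Rabs y))%R.
    + apply Rmult_le_compat; [|left; apply exp_pos| |].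
      * apply Rmult_le_pos; [|apply Cmod_ge_0]. apply pow_le. left. apply Rinv_0_lt_compat. lra.
      * apply Rmult_le_compat; [|apply Cmod_ge_0| |exact Hd1].
        -- apply pow_le. left. apply Rinv_0_lt_compat. lra.
        -- apply pow_incr. split; [left; apply Rinv_0_lt_compat; lra|].
           apply Rinv_le_contravar; lra.
      * apply exp_le_mono. rewrite <- Rmult_assoc. apply Rmult_le_compat_r; [apply Rabs_pos|auto].
    + replace (- (c / 2) * Rabs y)%R with (- c * Rabs y + c / 2 * Rabs y)%R by field.
      rewrite exp_plus. ring.
Qed.

Lemma conv_0_3 (f g : nat -> C) :
  conv f g 0 = f 0%nat * g 0%nat /\
  conv f g 1 = f 0%nat * g 1%nat + f 1%nat * g 0%nat /\
  conv f g 2 = f 0%nat * g 2%nat + f 1%nat * g 1%nat + f 2%nat * g 0%nat /\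
  conv f g 3 = f 0%nat * g 3%nat + f 1%nat * g 2%nat + f 2%nat * g 1%nat + f 3%nat * g 0%nat.
Proof. unfold conv, csum; simpl. repeat split; ring. Qed.

Lemma INR_fact_2 : RtoC (INR (fact 2)) = 2.
Proof. f_equal; simpl; ring. Qed.

Lemma INR_fact_3 : RtoC (INR (fact 3)) = 6.
Proof. f_equal; simpl; ring. Qed.

Lemma pw_1 z : pw z 1 = z.
Proof. unfold pw. simpl. field. Qed.

Section OpenSquare.
Context (mu nu : R) (tau : C) (Htau : (0 < Re tau)%R)
  (X Y : R) (HX : (0 < X < 1)%R) (HY : (0 < Y < 1)%R).
Let t : C := Ci * tau.

Let tau0 : tau <> 0.
Proof. apply (tau_neq0 tau Htau). Qed.

Let t0 : t <> 0.
Proof. apply Cmult_neq_0; [apply Ci_nz|apply tau0]. Qed.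

Let q : C := 2 * PI * Ci.
Let q0 : q <> 0.
Proof. apply two_pi_i_neq0. Qed.

Let y (n : Z) : C := (IZR n - mu)%R.
Let y' (n : Z) : C := (IZR n - - nu)%R.
(** Replacing [X] by [X + h] multiplies the [n]-th term by [e (h mu)] times [Cexp (lam n * h)] in
    the first sum, where [X] sits in the character, and times [Cexp (lam' n * h)] in the dual one,
    where it sits in [gen]. *)
Let lam (n : Z) : C := q * y n.
Let lam' (n : Z) : C := - (2 * PI) * / tau * y' n.

(** A factor [lam n] lowers [k] by one, so the Taylor coefficients in [h] of the sums with [k = 2]
    are, up to constants, the sums with [k = 1] and [k = 0]. *)
Let ms_lam k n : ms (S k) X Y mu nu tau n * lam n = q * ms k X Y mu nu tau n.
Proof.
  unfold ms, lam, y. destruct (Req_dec (IZR n - mu) 0) as [E|E].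
  - rewrite indic_false by lra. ring.
  - simpl. field. now apply RtoC_neq0.
Qed.

Let ms_lam' k n : ms (S k) (- Y) X (- nu) mu (/ tau) n * lam' n =
  - (q / t) * ms k (- Y) X (- nu) mu (/ tau) n.
Proof.
  unfold ms, lam', y', q, t. destruct (Req_dec (IZR n - - nu) 0) as [E|E].
  - rewrite indic_false by lra. ring.
  - simpl. field. repeat split; try exact tau0; try apply Ci_nz; now apply RtoC_neq0.
Qed.

Let rs (a : nat -> C) : C :=
  let b := bcoef Y nu in
  t * t * a 0%nat * b 3%nat + t * a 1%nat * b 2%nat + a 2%nat * b 1%nat + / t * a 3%nat * b 0%nat.

Let recip_sum_2 X' : recip_sum X' Y mu nu tau 2 = rs (bcoef X' mu).
Proof.
  unfold recip_sum, rs, csum. simpl. fold t. field. exact t0.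
Qed.

(** Taylor coefficients of [rs (conv (pw h) (bcoef X mu))], a polynomial of degree 3 in [h]. Orders
    1 and 2 are [recip_sum] for [k = 1] and half of [recip_sum] for [k = 0]. *)
Let pp (i : nat) : C :=
  let a := bcoef X mu in let b := bcoef Y nu in
  match i with
  | 0 => rs a
  | 1 => t * a 0%nat * b 2%nat + a 1%nat * b 1%nat + / t * a 2%nat * b 0%nat
  | 2 => / 2 * (a 0%nat * b 1%nat + / t * a 1%nat * b 0%nat)
  | 3 => / 6 * (/ t * a 0%nat * b 0%nat)
  | _ => 0
  end.

(** By [bcoef_shift] the factor [e (h mu)] is common to both sides and cancels. The identity is
    known only for real [h] with [0 < h < 1 - X], which is enough for [ps_unique]; orders 1 and 2 in
    [h] are the two claims. *)
Lemma ms_open_square :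
  (summable (ms 1 X Y mu nu tau) /\ summable (ms 1 (- Y) X (- nu) mu (/ tau)) /\
   tsum (ms 1 X Y mu nu tau) - tsum (ms 1 (- Y) X (- nu) mu (/ tau))
     = 2 * PI * Ci * recip_sum X Y mu nu tau 1) /\
  (summable (ms 0 X Y mu nu tau) /\ summable (ms 0 (- Y) X (- nu) mu (/ tau)) /\
   tsum (ms 0 X Y mu nu tau) + / (Ci * tau) * tsum (ms 0 (- Y) X (- nu) mu (/ tau))
     = recip_sum X Y mu nu tau 0).
Proof.
  fold t q.
  destruct (ms_exp_summable X Y mu nu tau q Htau HY) as (r1 & Hr1 & S1).
  destruct (ms_exp_summable (- Y) X (- nu) mu (/ tau) (- (2 * PI) * / tau) (Re_Cinv_pos _ Htau) HX)
    as (r2 & Hr2 & S2).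
  set (r := Rmin r1 r2).
  assert (Hr : (0 < r)%R) by now apply Rmin_glb_lt.
  destruct (S1 r) as [B1 HB1]; [split; [auto|apply Rmin_l]|].
  destruct (S2 r) as [B2 HB2]; [split; [auto|apply Rmin_r]|].
  set (c := ms 2 X Y mu nu tau) in *. set (c' := ms 2 (- Y) X (- nu) mu (/ tau)) in *.
  destruct (exp_sum c lam r B1 Hr HB1) as (f1 & f2 & f3).
  destruct (exp_sum c' lam' r B2 Hr HB2) as (g1 & g2 & g3).
  set (F := fun i => tsum (fun n => c n * pw (lam n) i)) in *.
  set (G := fun i => tsum (fun n => c' n * pw (lam' n) i)) in *.
  assert (Hid : forall h : R, (0 < h < 1 - X)%R -> (h <= r)%R ->
     ps F h + t * ps G h = q * q * rs (conv (pw h) (bcoef X mu))).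
  { intros h Hh Hhr.
    assert (hc : (Cmod (RtoC h) <= r)%R) by (rewrite Cmod_R, Rabs_pos_eq; lra).
    destruct (ms_reciprocity_ge2 mu nu tau Htau (X + h) Y 0 ltac:(lra) ltac:(lra)) as (_ & _ & E).
    rewrite recip_sum_2 in E. fold t q in E.
    destruct (f2 h hc) as [u1 <-]. destruct (g2 h hc) as [u2 <-].
    assert (E1 : forall n, e (h * mu) * (c n * Cexp (lam n * h)) = ms 2 (X + h) Y mu nu tau n).
    { intros n. unfold c, ms. destruct (Req_dec (IZR n - mu) 0) as [Hn|Hn].
      - rewrite indic_false by lra. ring.
      - replace (e ((X + h)%R * IZR n)) with (e (X * IZR n) * e (h * mu) * Cexp (lam n * h)); [ring|].
        rewrite <- e_plus. unfold e. rewrite <- Cexp_plus. f_equal. unfold lam, y, q.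
        rewrite RtoC_minus, RtoC_plus. ring. }
    assert (E2 : forall n, e (h * mu) * (c' n * Cexp (lam' n * h)) = ms 2 (- Y) (X + h) (- nu) mu (/ tau) n).
    { intros n. unfold c', ms. destruct (Req_dec (IZR n - - nu) 0) as [Hn|Hn].
      - rewrite indic_false by lra. ring.
      - replace (gz mu (X + h) (/ tau) (IZR n - - nu)) with
          (gz mu X (/ tau) (IZR n - - nu) * e (h * mu) * Cexp (lam' n * h)); [ring|].
        unfold gz, gen, lam', y'. set (z := - (2 * PI) * / tau * (IZR n - - nu)%R).
        rewrite RtoC_plus.
        replace ((X + h) * mu) with (X * mu + h * mu) by ring.
        replace ((X + h) * z) with (X * z + z * h) by ring.
        rewrite e_plus, Cexp_plus. unfold Cdiv. ring. }
    rewrite <- (tsum_ext _ _ E1), <- (tsum_ext _ _ E2), !tsum_scal in E by auto.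
    assert (Esh : rs (bcoef (X + h)%R mu) = e (h * mu) * rs (conv (pw h) (bcoef X mu))).
    { unfold rs. rewrite !(bcoef_shift X h mu) by lra. ring. }
    rewrite Esh in E. assert (he := e_neq0 (h * mu)).
    replace (tsum (fun n => c n * Cexp (lam n * h)) + t * tsum (fun n => c' n * Cexp (lam' n * h)))
      with ((e (h * mu) * tsum (fun n => c n * Cexp (lam n * h)) +
        (-1) ^ 2 * t ^ 1 * (e (h * mu) * tsum (fun n => c' n * Cexp (lam' n * h)))) / e (h * mu))
      by (simpl; field; auto).
    rewrite E. simpl. field. auto. }
  assert (Hpp0 : forall (h : C) n, (4 <= n)%nat -> pp n * h ^ n = 0).
  { intros h [|[|[|[|n]]]] Hn; try lia. unfold pp. ring. }
  assert (Hp : forall h : C, ps pp h = rs (conv (pw h) (bcoef X mu))).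
  { intros h. unfold ps. rewrite (proj2 (tsum_csum (fun n => pp n * h ^ n) 4 (Hpp0 h))).
    unfold rs at 1. destruct (conv_0_3 (pw h) (bcoef X mu)) as (-> & -> & -> & ->).
    rewrite !pw_0, !pw_1. unfold pw. rewrite INR_fact_2, INR_fact_3.
    unfold csum. cbn [seq fsum pp Cpow]. unfold rs. field. exact t0. }
  assert (Hps : exists N, psum pp r N).
  { destruct (tsum_csum (fun n => pp n * RtoC r ^ n) 4 (Hpp0 r)) as [[N HN] _]. now exists N. }
  destruct Hps as [N HN].
  assert (PL := psum_plus _ _ _ _ _ f1 (psum_scal t _ _ _ g1)).
  assert (PR := psum_scal (q * q) _ _ _ HN).
  assert (HU := ps_unique _ _ r _ _ PL PR Hr).
  assert (U : forall i, F i + t * G i = q * q * pp i).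
  { intros i. apply HU. intros eps Heps.
    set (h := (Rmin (Rmin eps (1 - X)) r / 2)%R).
    assert (h1 := Rmin_l (Rmin eps (1 - X)) r). assert (h2 := Rmin_r (Rmin eps (1 - X)) r).
    assert (h3 := Rmin_l eps (1 - X)). assert (h4 := Rmin_r eps (1 - X)).
    assert (h5 : (0 < Rmin (Rmin eps (1 - X)) r)%R) by (repeat apply Rmin_glb_lt; lra).
    assert (hh : (0 < h)%R /\ (h < eps)%R /\ (h < 1 - X)%R /\ (h <= r)%R) by (unfold h; lra).
    exists (RtoC h). assert (hc : Cmod (RtoC h) = h) by (rewrite Cmod_R, Rabs_pos_eq; lra).
    split; [rewrite hc; lra|].
    rewrite (ps_plus _ _ r _ _ _ f1 (psum_scal t _ _ _ g1)), (ps_scal t _ r _ _ g1),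
      (ps_scal (q * q) _ r _ _ HN) by lra.
    rewrite Hp. apply Hid; lra. }
  assert (l1 : forall n, c n * pw (lam n) 1 = q * ms 1 X Y mu nu tau n).
  { intros n. rewrite pw_1. apply ms_lam. }
  assert (l1' : forall n, c' n * pw (lam' n) 1 = - (q / t) * ms 1 (- Y) X (- nu) mu (/ tau) n).
  { intros n. rewrite pw_1. unfold c'. rewrite ms_lam'. ring. }
  assert (l2 : forall n, c n * pw (lam n) 2 = / 2 * (q * q) * ms 0 X Y mu nu tau n).
  { intros n. unfold pw. rewrite INR_fact_2.
    transitivity (/ 2 * (c n * lam n * lam n)); [simpl; field|].
    unfold c. rewrite ms_lam. rewrite <- Cmult_assoc, ms_lam. ring. }
  assert (l2' : forall n, c' n * pw (lam' n) 2 = / 2 * (q / t * (q / t)) * ms 0 (- Y) X (- nu) mu (/ tau) n).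
  { intros n. unfold pw. rewrite INR_fact_2.
    transitivity (/ 2 * (c' n * lam' n * lam' n)); [simpl; field|].
    unfold c'. rewrite ms_lam'.
    transitivity (/ 2 * (- (q / t)) * (ms 1 (- Y) X (- nu) mu (/ tau) n * lam' n)); [ring|].
    rewrite ms_lam'. ring. }
  assert (qt0 : q / t <> 0). { intros H. apply q0. replace q with (q / t * t) by (field; auto). rewrite H. ring. }
  assert (two0 : RtoC 2 <> 0) by (apply RtoC_neq0; lra).
  assert (T1 : summable (ms 1 X Y mu nu tau)).
  { eapply summable_ext; [|apply (summable_scal (/ q) _ (f3 1%nat))].
    intros n. cbv beta. rewrite l1. field. auto. }
  assert (T1' : summable (ms 1 (- Y) X (- nu) mu (/ tau))).
  { eapply summable_ext; [|apply (summable_scal (/ (- (q / t))) _ (g3 1%nat))].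
    intros n. cbv beta. rewrite l1'. field. auto. }
  assert (T2 : summable (ms 0 X Y mu nu tau)).
  { eapply summable_ext; [|apply (summable_scal (/ (/ 2 * (q * q))) _ (f3 2%nat))].
    intros n. cbv beta. rewrite l2. field. auto. }
  assert (T2' : summable (ms 0 (- Y) X (- nu) mu (/ tau))).
  { eapply summable_ext; [|apply (summable_scal (/ (/ 2 * (q / t * (q / t)))) _ (g3 2%nat))].
    intros n. cbv beta. rewrite l2'. field. auto. }
  assert (U1 := U 1%nat). assert (U2 := U 2%nat). unfold F, G in U1, U2.
  rewrite (tsum_ext _ _ l1), (tsum_ext _ _ l1'), !tsum_scal in U1 by auto.
  rewrite (tsum_ext _ _ l2), (tsum_ext _ _ l2'), !tsum_scal in U2 by auto.
  set (s1 := tsum (ms 1 X Y mu nu tau)) in *. set (s1' := tsum (ms 1 (- Y) X (- nu) mu (/ tau))) in *.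
  set (s2 := tsum (ms 0 X Y mu nu tau)) in *. set (s2' := tsum (ms 0 (- Y) X (- nu) mu (/ tau))) in *.
  split; (split; [assumption|split; [assumption|]]).
  - replace (s1 - s1') with (/ q * (q * s1 + t * (- (q / t) * s1'))) by (field; auto).
    rewrite U1. unfold recip_sum, csum, pp. simpl. fold t. field. auto.
  - replace (s2 + / t * s2') with (/ (/ 2 * (q * q)) * (/ 2 * (q * q) * s2 + t * (/ 2 * (q / t * (q / t)) * s2')))
      by (field; auto).
    rewrite U2. unfold recip_sum, csum, pp. simpl. fold t. field. auto.
Qed.

End OpenSquare.

(** * Continuation of psi *)

Lemma tsum_Sl (f : nat -> C) : summable f ->
  summable (fun n => f (S n)) /\ tsum f = f 0%nat + tsum (fun n => f (S n)).
Proof.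
  intros H. assert (HS := summable_inj S (fun a b => eq_add_S a b) f H). split; auto.
  assert (HP : psum f 1 (Cmod (tsum (fun n => RtoC (Cmod (f n)))))).
  { eapply asum_le; [|apply (asum_tsum_norm f H)]. intros n.
    rewrite Cpow_1_l, Cmult_1_r. lra. }
  destruct (ps_Sl f 1 _ 1 HP Rlt_0_1 ltac:(rewrite Cmod_1; lra)) as [_ E].
  unfold ps in E. rewrite Cmult_1_l in E.
  rewrite (tsum_ext f (fun n => f n * 1 ^ n)), E.
  - f_equal. apply tsum_ext. intros n. rewrite Cpow_1_l. ring.
  - intros n. rewrite Cpow_1_l. ring.
Qed.

(* The binomial coefficient of [-s] over [j]. *)
Fixpoint neg_binom (s : C) (j : nat) : C :=
  match j with
  | O => 1
  | S i => neg_binom s i * (- (s + INR i) / INR (S i))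
  end.

(** The coefficients of [(1 - u)^(-x)], which dominate those of [(1 + u)^(-s)] when [|s| <= x]. *)
Fixpoint neg_binom_bound (x : R) (j : nat) : R :=
  match j with
  | O => 1
  | S i => neg_binom_bound x i * ((x + INR i) / INR (S i))
  end%R.

Lemma neg_binom_bound_pos x j : (0 < x)%R -> (0 < neg_binom_bound x j)%R.
Proof.
  intros Hx. induction j as [|j IH]; [simpl; lra|].
  cbn [neg_binom_bound]. apply Rmult_lt_0_compat; auto.
  apply Rdiv_lt_0_compat; [generalize (pos_INR j); lra|apply lt_0_INR; lia].
Qed.

Lemma neg_binom_le s x j : (Cmod s <= x)%R -> (0 < x)%R -> (Cmod (neg_binom s j) <= neg_binom_bound x j)%R.
Proof.
  intros Hs Hx. induction j as [|j IH]; [simpl; rewrite Cmod_1; lra|].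
  cbn [neg_binom neg_binom_bound]. rewrite Cmod_mult, Cmod_div, Cmod_opp by apply RtoC_S_neq0.
  assert (hj := pos_INR j). assert (hj' : (0 < INR (S j))%R) by (apply lt_0_INR; lia).
  apply Rmult_le_compat; auto; [apply Cmod_ge_0| |].
  - apply Rdiv_le_0_compat; [apply Cmod_ge_0|]. rewrite Cmod_R, Rabs_pos_eq; lra.
  - rewrite (Cmod_R (INR (S j))), (Rabs_pos_eq (INR (S j))) by lra.
    apply Rmult_le_compat_r; [left; now apply Rinv_0_lt_compat|].
    eapply Rle_trans; [apply Cmod_triangle|]. rewrite Cmod_R, Rabs_pos_eq; lra.
Qed.

Lemma neg_binom_bound_summable (x r : R) : (0 < x)%R -> (0 < r < 1)%R ->
  summable (fun j => RtoC (neg_binom_bound x j * r ^ j)).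
Proof.
  intros Hx Hr.
  assert (hpos : forall j, (0 < neg_binom_bound x j * r ^ j)%R).
  { intros j. apply Rmult_lt_0_compat; [now apply neg_binom_bound_pos|apply pow_lt; lra]. }
  apply ex_series_summable; [intros j; left; apply hpos|].
  apply (ex_series_ext (fun j => Rabs (neg_binom_bound x j * r ^ j))).
  { intros j. apply Rabs_pos_eq. left. apply hpos. }
  apply (ex_series_DAlembert _ r); [lra|intros j; apply Rgt_not_eq, hpos|].
  apply (is_lim_seq_ext (fun j => (r + r * (x - 1) * / INR (S j))%R)).
  { intros j. assert (h := hpos j). assert (h' := hpos (S j)).
    assert (hj : (0 < INR (S j))%R) by (apply lt_0_INR; lia).
    assert (hj0 := pos_INR j). assert (hb := neg_binom_bound_pos x j Hx).
    rewrite Rabs_pos_eq by (left; now apply Rdiv_lt_0_compat).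
    cbn [neg_binom_bound pow]. rewrite S_INR in *. field.
    repeat split; try lra; apply Rgt_not_eq; auto; apply pow_lt; lra. }
  replace (Finite r) with (Finite (r + r * (x - 1) * 0)) by (f_equal; ring).
  apply (is_lim_seq_plus' _ _ r (r * (x - 1) * 0)%R); [apply is_lim_seq_const|].
  apply (is_lim_seq_scal_l _ (r * (x - 1)) 0).
  apply (is_lim_seq_incr_1 (fun n => (/ INR n)%R)).
  replace (Finite 0) with (Rbar_inv p_infty) by easy.
  apply is_lim_seq_inv; [apply is_lim_seq_INR|easy].
Qed.

Lemma psum_neg_binom s r : (0 < r < 1)%R -> exists M, psum (neg_binom s) r M.
Proof.
  intros Hr. assert (hs := Cmod_ge_0 s).
  destruct (neg_binom_bound_summable (Cmod s + 1) r ltac:(lra) Hr) as [M HM].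
  exists M. eapply asum_le; [|apply HM]. intros j.
  rewrite Cmod_mult, RtoC_mult, Cmod_mult, <- RtoC_pow. apply Rmult_le_compat_r; [apply Cmod_ge_0|].
  rewrite Cmod_R, Rabs_pos_eq by (left; apply neg_binom_bound_pos; lra). apply neg_binom_le; lra.
Qed.

(** Coefficientwise, the derivative of [(1 + u)^(-s)] is [- s (1 + u)^(-s-1)]. *)
Lemma neg_binom_derive s j : INR (S j) * neg_binom s (S j) = - s * neg_binom (s + 1) j.
Proof.
  induction j as [|j IH].
  - simpl. field.
  - assert (h := RtoC_S_neq0 (S j)). assert (h' := RtoC_S_neq0 j).
    cbn [neg_binom] in *.
    transitivity (- (s + INR (S j)) * (neg_binom s j * (- (s + INR j) / INR (S j)))); [field; auto|].
    replace (neg_binom s j * (- (s + INR j) / INR (S j))) with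
      (/ INR (S j) * (INR (S j) * (neg_binom s j * (- (s + INR j) / INR (S j))))) by (field; auto).
    rewrite IH. rewrite S_INR, RtoC_plus in *. field. auto.
Qed.

(** Coefficientwise, [(1 + u)] times [(1 + u)^(-s-1)] is [(1 + u)^(-s)]. *)
Lemma neg_binom_pascal s j : neg_binom (s + 1) (S j) + neg_binom (s + 1) j = neg_binom s (S j).
Proof.
  assert (h := neg_binom_derive s j). assert (hj := RtoC_S_neq0 j).
  replace (neg_binom s (S j)) with (/ INR (S j) * (INR (S j) * neg_binom s (S j))) by (field; auto).
  rewrite h. cbn [neg_binom]. rewrite S_INR, RtoC_plus in *. field. auto.
Qed.

(** The variable is real and the two parts are differentiated separately, so that the constancy of
    functions with zero derivative is available for each. *)
Definition is_C_derive (f : R -> C) (u : R) (l : C) : Prop :=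
  is_derive (fun v => Re (f v)) u (Re l) /\ is_derive (fun v => Im (f v)) u (Im l).

Lemma is_derive_Rmult (f g : R -> R) (x df dg : R) : is_derive f x df -> is_derive g x dg ->
  is_derive (fun v => f v * g v)%R x (df * g x + f x * dg)%R.
Proof. intros Hf Hg. exact (is_derive_mult (K := R_AbsRing) f g x df dg Hf Hg Rmult_comm). Qed.

Lemma is_C_derive_mult f g u f' g' : is_C_derive f u f' -> is_C_derive g u g' ->
  is_C_derive (fun v => f v * g v) u (f' * g u + f u * g').
Proof.
  intros [f1 f2] [g1 g2]. split.
  - replace (Re (f' * g u + f u * g')) with
      (minus (Re f' * Re (g u) + Re (f u) * Re g') (Im f' * Im (g u) + Im (f u) * Im g'))%R
      by (unfold minus, plus, opp; reim; simpl; ring).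
    apply (is_derive_minus (fun v => Re (f v) * Re (g v))%R (fun v => Im (f v) * Im (g v))%R);
      now apply is_derive_Rmult.
  - replace (Im (f' * g u + f u * g')) with
      (plus (Re f' * Im (g u) + Re (f u) * Im g') (Im f' * Re (g u) + Im (f u) * Re g'))%R
      by (unfold plus; reim; simpl; ring).
    apply (is_derive_plus (fun v => Re (f v) * Im (g v))%R (fun v => Im (f v) * Re (g v))%R);
      now apply is_derive_Rmult.
Qed.

Lemma ps_parts c r M (u : R) : psum c r M -> (Rabs u <= r)%R ->
  Re (ps c u) = PSeries (fun n => Re (c n)) u /\ Im (ps c u) = PSeries (fun n => Im (c n)) u.
Proof.
  intros H Hu.
  assert (hs := psum_summable c r M u H ltac:(now rewrite Cmod_R)).
  destruct (is_series_C_parts _ _ (tsum_is_series _ hs)) as [h1 h2].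
  unfold PSeries. split; symmetry; apply is_series_unique.
  - eapply is_series_ext; [|apply h1]. intros n. cbv beta. rewrite <- RtoC_pow. apply re_scal_r.
  - eapply is_series_ext; [|apply h2]. intros n. cbv beta. rewrite <- RtoC_pow. apply im_scal_r.
Qed.

Lemma CV_radius_psum (a : nat -> R) c r M : psum c r M -> (0 <= r)%R ->
  (forall n, (Rabs (a n) <= Cmod (c n))%R) -> Rbar_le r (CV_radius a).
Proof.
  intros H Hr Ha. apply (CV_radius_bounded a). exists M. intros n.
  rewrite Rabs_mult. eapply Rle_trans; [|apply (H (cons n nil)); repeat constructor; auto].
  cbn [nsum]. rewrite Cmod_mult, <- RtoC_pow, Cmod_R, Rplus_0_r.
  apply Rmult_le_compat_r; [apply Rabs_pos|apply Ha].
Qed.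

Lemma is_C_derive_ps c d r M N (u : R) : psum c r M -> psum d r N -> (Rabs u < r)%R ->
  (forall n, INR (S n) * c (S n) = d n) -> is_C_derive (fun v => ps c v) u (ps d u).
Proof.
  intros Hc Hd Hu E. assert (hu := Rabs_pos u).
  assert (Hloc : locally u (fun v => (Rabs v <= r)%R)).
  { exists (mkposreal (r - Rabs u) ltac:(lra)). intros v Hv.
    unfold ball in Hv; simpl in Hv. unfold AbsRing_ball, abs, minus, plus, opp in Hv; simpl in Hv.
    replace v with ((v + - u) + u)%R by ring. eapply Rle_trans; [apply Rabs_triang|lra]. }
  destruct (ps_parts d r N u Hd ltac:(lra)) as [d1 d2].
  split.
  - apply (is_derive_ext_loc (PSeries (fun n => Re (c n)))).
    + apply (filter_imp _ _ (fun v Hv => eq_sym (proj1 (ps_parts c r M v Hc Hv))) Hloc).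
    + rewrite d1. replace (PSeries (fun n => Re (d n)) u) with (PSeries (PS_derive (fun n => Re (c n))) u).
      * apply is_derive_PSeries. eapply Rbar_lt_le_trans; [|apply (CV_radius_psum _ c r M Hc)].
        -- exact Hu.
        -- lra.
        -- intros n. apply re_le_Cmod.
      * apply PSeries_ext. intros n. unfold PS_derive. now rewrite <- E, re_scal_l.
  - apply (is_derive_ext_loc (PSeries (fun n => Im (c n)))).
    + apply (filter_imp _ _ (fun v Hv => eq_sym (proj2 (ps_parts c r M v Hc Hv))) Hloc).
    + rewrite d2. replace (PSeries (fun n => Im (d n)) u) with (PSeries (PS_derive (fun n => Im (c n))) u).
      * apply is_derive_PSeries. eapply Rbar_lt_le_trans; [|apply (CV_radius_psum _ c r M Hc)].
        -- exact Hu.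
        -- lra.
        -- intros n. eapply Rle_trans; [|apply Rmax_Cmod]. apply Rmax_r.
      * apply PSeries_ext. intros n. unfold PS_derive. now rewrite <- E, im_scal_l.
Qed.

Lemma is_C_derive_power (s : C) (u : R) : (-1 < u)%R ->
  is_C_derive (fun v => Cexp (s * ln (1 + v))) u (s * / (1 + u)%R * Cexp (s * ln (1 + u))).
Proof.
  intros Hu. rewrite <- RtoC_inv by lra. unfold is_C_derive.
  assert (E1 : forall v, Re (Cexp (s * ln (1 + v))) = (exp (Re s * ln (1 + v)) * cos (Im s * ln (1 + v)))%R).
  { intros v. unfold Cexp. rewrite re_scal_r, im_scal_r. easy. }
  assert (E2 : forall v, Im (Cexp (s * ln (1 + v))) = (exp (Re s * ln (1 + v)) * sin (Im s * ln (1 + v)))%R).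
  { intros v. unfold Cexp. rewrite re_scal_r, im_scal_r. easy. }
  split.
  - apply (is_derive_ext _ _ _ _ (fun v => eq_sym (E1 v))).
    rewrite !Re_mult, !Im_mult, E1, E2, !Re_RtoC, !Im_RtoC. auto_derive; [lra|field; lra].
  - apply (is_derive_ext _ _ _ _ (fun v => eq_sym (E2 v))).
    rewrite !Im_mult, !Re_mult, E1, E2, !Re_RtoC, !Im_RtoC. auto_derive; [lra|field; lra].
Qed.

(* [(1 + u)^s sum_j binom(-s, j) u^j] has zero derivative. *)
Lemma binomial_series (s : C) (u : R) : (0 < u < 1)%R ->
  ps (neg_binom s) u = Cexp (- s * ln (1 + u)).
Proof.
  intros Hu. set (r := ((1 + u) / 2)%R). assert (Hr : (0 < r < 1)%R) by (unfold r; lra).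
  destruct (psum_neg_binom s r Hr) as [M HM].
  destruct (psum_neg_binom (s + 1) r Hr) as [N HN].
  assert (HN' := psum_scal (- s) _ _ _ HN).
  set (H := fun v : R => ps (neg_binom s) v * Cexp (s * ln (1 + v))).
  assert (Hpas : forall v : R, (0 <= v <= u)%R -> (1 + v)%R * ps (neg_binom (s + 1)) v = ps (neg_binom s) v).
  { intros v Hv. assert (hc : (Cmod (RtoC v) <= r)%R) by (rewrite Cmod_R, Rabs_pos_eq; unfold r; lra).
    destruct (ps_Sl _ r _ v HM ltac:(lra) hc) as [k1 ->].
    destruct (ps_Sl _ r _ v HN ltac:(lra) hc) as [k2 E2].
    assert (EE : ps (fun n => neg_binom s (S n)) v =
      ps (fun n => neg_binom (s + 1) (S n)) v + ps (neg_binom (s + 1)) v).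
    { rewrite <- (ps_plus _ _ r _ _ v k2 HN hc). apply tsum_ext. intros n. f_equal.
      symmetry. apply neg_binom_pascal. }
    rewrite EE, RtoC_plus, Cmult_plus_distr_r, Cmult_1_l. rewrite E2 at 1. cbn [neg_binom]. ring. }
  assert (HD : forall v, (0 <= v <= u)%R -> is_C_derive H v 0).
  { intros v Hv. unfold H.
    assert (hv : (Rabs v < r)%R) by (rewrite Rabs_pos_eq; unfold r; lra).
    assert (D1 := is_C_derive_ps _ _ r _ _ v HM HN' hv (neg_binom_derive s)).
    assert (D2 := is_C_derive_power s v ltac:(lra)).
    assert (D := is_C_derive_mult _ _ _ _ _ D1 D2).
    replace (RtoC 0) with (ps (fun n => - s * neg_binom (s + 1) n) v * Cexp (s * ln (1 + v)) +
      ps (neg_binom s) v * (s * / (1 + v)%R * Cexp (s * ln (1 + v)))); [exact D|].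
    rewrite (ps_scal _ _ r _ v HN) by (rewrite Cmod_R; lra).
    rewrite <- Hpas by auto. field. apply RtoC_neq0. lra. }
  assert (H0 : H 0%R = 1).
  { unfold H. rewrite ps_at_0, Rplus_0_r, ln_1, Cmult_0_r, Cexp_0. simpl. ring. }
  assert (Hu1 : H u = 1).
  { rewrite <- H0. apply C_ext; symmetry.
    - apply (eq_is_derive (fun v => Re (H v)) 0 u); [|lra]. intros v Hv. apply (HD v Hv).
    - apply (eq_is_derive (fun v => Im (H v)) 0 u); [|lra]. intros v Hv. apply (HD v Hv). }
  unfold H in Hu1. assert (he := Cexp_neq0 (s * ln (1 + u))).
  replace (- s * ln (1 + u)) with (- (s * ln (1 + u))) by ring. rewrite Cexp_opp.
  replace (ps (neg_binom s) u) with (ps (neg_binom s) u * Cexp (s * ln (1 + u)) / Cexp (s * ln (1 + u)))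
    by (field; auto). rewrite Hu1. field. auto.
Qed.

(* The fixed radius 1 makes the norm [M] behave well under unit translations. *)
Definition disc_series (f : C -> C) (z0 : C) (M : R) : Prop :=
  exists c, psum c 1 M /\ forall z, (Cmod (z - z0) <= 1)%R -> f z = ps c (z - z0).

Definition entire (f : C -> C) : Prop := forall z0, exists M, disc_series f z0 M.

Lemma disc_series_ext f g z0 M : (forall z, (Cmod (z - z0) <= 1)%R -> f z = g z) -> disc_series f z0 M -> disc_series g z0 M.
Proof. intros H (c & Hc & E). exists c. split; auto. intros z Hz. rewrite <- H; auto. Qed.

Lemma disc_series_weaken f z0 M M' : disc_series f z0 M -> (M <= M')%R -> disc_series f z0 M'.
Proof. intros (c & Hc & E) HM. exists c. split; auto. eapply asum_weaken; eauto. Qed.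

Lemma disc_series_ge0 f z0 M : disc_series f z0 M -> (0 <= M)%R.
Proof. intros (c & Hc & _). eapply asum_ge0, Hc. Qed.

Lemma disc_series_plus f g z0 M N : disc_series f z0 M -> disc_series g z0 N -> disc_series (fun z => f z + g z) z0 (M + N).
Proof.
  intros (c & Hc & Ec) (d & Hd & Ed). exists (fun n => c n + d n). split.
  - now apply psum_plus.
  - intros z Hz. rewrite (ps_plus _ _ 1 M N), Ec, Ed; auto.
Qed.

Lemma disc_series_mult f g z0 M N : disc_series f z0 M -> disc_series g z0 N -> disc_series (fun z => f z * g z) z0 (M * N).
Proof.
  intros (c & Hc & Ec) (d & Hd & Ed). exists (conv c d). split.
  - now apply psum_conv.
  - intros z Hz. rewrite (ps_conv _ _ 1 M N), Ec, Ed; auto.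
Qed.

Lemma disc_series_scal a f z0 M : disc_series f z0 M -> disc_series (fun z => a * f z) z0 (Cmod a * M).
Proof.
  intros (c & Hc & Ec). exists (fun n => a * c n). split.
  - now apply psum_scal.
  - intros z Hz. rewrite (ps_scal _ _ 1 M), Ec; auto.
Qed.

Lemma disc_series_linear w z0 : disc_series (fun z => z + w) z0 (Cmod (z0 + w) + 1).
Proof.
  set (c := fun n => match n with O => z0 + w | S O => 1 | _ => RtoC 0 end).
  assert (H : forall (h : C) n, (2 <= n)%nat -> c n * h ^ n = 0).
  { intros h [|[|n]] Hn; try lia. unfold c. ring. }
  exists c. split.
  - unfold psum. eapply asum_weaken; [apply (asum_fin _ (cons 0%nat (cons 1%nat nil)))|].
    + constructor; [simpl; intuition lia|constructor; [auto|constructor]].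
    + intros n Hn. apply H. destruct n as [|[|n]]; [| |lia]; exfalso; apply Hn; simpl; auto.
    + cbn [nsum c]. rewrite !Cpow_1_l, !Cmult_1_r, Cmod_1. lra.
  - intros z Hz. unfold ps. rewrite (proj2 (tsum_csum _ 2 (H (z - z0)))).
    unfold csum. cbn [seq fsum c Cpow]. ring.
Qed.

Lemma disc_series_const a z0 : disc_series (fun _ => a) z0 (Cmod a).
Proof.
  apply (disc_series_ext (fun z => a * Cexp (0 * z))).
  { intros z _. rewrite Cmult_0_l, Cexp_0. ring. }
  replace (Cmod a) with (Cmod a * exp (1 * Cmod 0))%R
    by (rewrite Cmod_0, Rmult_0_r, exp_0; ring).
  apply disc_series_scal. exists (pw 0). split; [apply psum_Cexp; lra|].
  intros z _. rewrite ps_Cexp. f_equal. ring.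
Qed.

Lemma disc_series_Cexp (lam z0 : C) : disc_series (fun z => Cexp (lam * z)) z0 (exp (Re (lam * z0) + Cmod lam)).
Proof.
  apply (disc_series_ext (fun z => Cexp (lam * z0) * Cexp (lam * (z - z0)))).
  { intros z _. rewrite <- Cexp_plus. f_equal. ring. }
  rewrite exp_plus, <- Cmod_Cexp. apply disc_series_scal.
  exists (pw lam). split.
  - rewrite <- (Rmult_1_l (Cmod lam)). apply psum_Cexp; lra.
  - intros z _. now rewrite ps_Cexp.
Qed.

Lemma disc_series_shift f z0 w M : disc_series f (z0 + w) M -> disc_series (fun z => f (z + w)) z0 M.
Proof.
  intros (c & Hc & E). exists c. split; auto. intros z Hz.
  rewrite E.
  - f_equal. ring.
  - replace (z + w - (z0 + w)) with (z - z0) by ring. auto.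
Qed.

Lemma disc_series_tsum {I : Type} (f : I -> C -> C) z0 (M : I -> R) B :
  (forall i, disc_series (f i) z0 (M i)) -> asum (fun i => RtoC (M i)) B ->
  disc_series (fun z => tsum (fun i => f i z)) z0 B /\
  forall z, (Cmod (z - z0) <= 1)%R -> summable (fun i => f i z).
Proof.
  intros H HB.
  set (c := fun i => epsilon (inhabits (fun _ : nat => RtoC 0)) (fun c => psum c 1 (M i) /\
     forall z, (Cmod (z - z0) <= 1)%R -> f i z = ps c (z - z0))).
  assert (Hc : forall i, psum (c i) 1 (M i) /\
     forall z, (Cmod (z - z0) <= 1)%R -> f i z = ps (c i) (z - z0)).
  { intros i. unfold c. apply epsilon_spec. exact (H i). }
  destruct (ps_tsum c 1 M B ltac:(lra) (fun i => proj1 (Hc i)) HB) as (k1 & k2 & _).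
  split.
  - exists (fun n => tsum (fun i => c i n)). split; auto. intros z Hz.
    destruct (k2 _ Hz) as [_ <-]. apply tsum_ext. intros i. now apply (proj2 (Hc i)).
  - intros z Hz. destruct (k2 _ Hz) as [k3 _]. eapply summable_ext; [|apply k3].
    intros i. symmetry. now apply (proj2 (Hc i)).
Qed.

(** * Continuation through a functional equation with unit shifts *)

Section Continuation.
Context (F0 b : C -> C) (p : nat -> C -> C) (x : R) (Hx : (0 < x < 1)%R).
Context (Hb : entire b).
Context (Hp : forall z0, exists P : nat -> R, (forall i, disc_series (p i) z0 (P i)) /\
  summable (fun i => RtoC (P i * x ^ i))).
Context (HF0 : forall z0, (2 < Re z0)%R -> exists K, forall i, disc_series F0 (z0 + INR i) (K * x ^ i)).
Context (FE : forall s, (1 < Re s)%R -> F0 s = b s + tsum (fun i => p i s * F0 (s + INR (S i)))).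

(** [Fm m] arises from [m] applications of the functional equation and represents the continuation
    for [Re s > 1 - m]. The weights [x ^ i] balance the growth of the norms of [p i] against the
    decay of [F0] along unit translates. *)
Fixpoint Fm (m : nat) (s : C) : C :=
  match m with
  | O => F0 s
  | S m' => b s + tsum (fun i => p i s * Fm m' (s + INR (S i)))
  end.

Let Re_shift s i : Re (s + INR i) = (Re s + INR i)%R.
Proof. reflexivity. Qed.

Let Fm_stable m : forall s, (1 - INR m < Re s)%R -> Fm (S m) s = Fm m s.
Proof.
  induction m as [|m IH]; intros s Hs.
  - cbn [Fm]. symmetry. apply FE. simpl in Hs. lra.
  - change (b s + tsum (fun i => p i s * Fm (S m) (s + INR (S i)))
      = b s + tsum (fun i => p i s * Fm m (s + INR (S i)))).
    f_equal. apply tsum_ext. intros i. f_equal. apply IH.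
    rewrite Re_shift. rewrite S_INR in *. generalize (pos_INR i). lra.
Qed.

Let Fm_step m z0 K : (forall i, disc_series (Fm m) (z0 + 1 + INR i) (K * x ^ i)) ->
  (exists M, disc_series (Fm (S m)) z0 M) /\
  summable (fun i => p i z0 * Fm m (z0 + INR (S i))).
Proof.
  intros H. destruct (Hb z0) as [Mb HMb]. destruct (Hp z0) as (P & HP & [B HB]).
  assert (HK : (0 <= K)%R).
  { assert (h := disc_series_ge0 _ _ _ (H 0%nat)). simpl in h. lra. }
  destruct (disc_series_tsum (fun i z => p i z * Fm m (z + INR (S i))) z0
    (fun i => (P i * (K * x ^ i))%R) (Cmod K * B)) as [h1 h2].
  - intros i. apply disc_series_mult; auto. apply disc_series_shift.
    replace (z0 + INR (S i)) with (z0 + 1 + INR i) by (rewrite S_INR, RtoC_plus; ring).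
    apply H.
  - eapply asum_le; [|apply (asum_scal (RtoC K) _ _ HB)].
    intros i. cbv beta. rewrite <- RtoC_mult. right. do 2 f_equal. ring.
  - split.
    + eexists. apply disc_series_plus; [apply HMb|apply h1].
    + apply h2. replace (z0 - z0) with (RtoC 0) by ring. rewrite Cmod_0. lra.
Qed.

(** The half-plane starts at [2 - m], one unit inside the domain of [Fm m], because norms are taken
    on discs of radius 1. On the translates by [S i] stability allows [Fm m] in place of [Fm (S m)],
    so only the disc at [z0] itself uses [Fm_step]. *)
Let Fm_bound m : forall z0, (2 - INR m < Re z0)%R ->
  exists K, forall i, disc_series (Fm m) (z0 + INR i) (K * x ^ i).
Proof.
  induction m as [|m IH]; intros z0 Hz.
  - cbn [Fm]. apply HF0. simpl in Hz. lra.
  - rewrite S_INR in Hz.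
    destruct (IH (z0 + 1)) as [K HK].
    { rewrite Re_plus, Re_RtoC. lra. }
    destruct (Fm_step m z0 K HK) as [[M HM] _].
    assert (HK0 : (0 <= K)%R).
    { assert (h := disc_series_ge0 _ _ _ (HK 0%nat)). simpl in h. lra. }
    exists (Rmax M (K / x))%R. intros [|i].
    + replace (z0 + INR 0) with z0 by (simpl; ring).
      eapply disc_series_weaken; [apply HM|]. simpl. rewrite Rmult_1_r. apply Rmax_l.
    + apply (disc_series_ext (Fm m)).
      * intros z Hzz. symmetry. apply Fm_stable.
        assert (h := re_le_Cmod (z - (z0 + INR (S i)))).
        assert (h' := Rle_trans _ _ _ h Hzz). apply Rabs_le_between in h'.
        unfold Cminus in h'. rewrite Re_plus, Re_opp, Re_shift, S_INR in h'.
        generalize (pos_INR i). lra.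
      * replace (z0 + INR (S i)) with (z0 + 1 + INR i) by (rewrite S_INR, RtoC_plus; ring).
        eapply disc_series_weaken; [apply HK|].
        apply Rle_trans with (K / x * x ^ S i)%R.
        -- right. simpl. field. lra.
        -- apply Rmult_le_compat_r; [apply pow_le; lra|apply Rmax_r].
Qed.

Lemma continuation : exists F, entire F /\ (forall s, (1 < Re s)%R -> F s = F0 s) /\
  forall s, summable (fun i => p i s * F (s + INR (S i))) /\
    F s = b s + tsum (fun i => p i s * F (s + INR (S i))).
Proof.
  (* [N s] applications of the equation reach [s]; by stability, any larger number gives the same
     value. *)
  set (N := fun s : C => Z.to_nat (up (1 - Re s))).
  assert (HN : forall s, (1 - INR (N s) < Re s)%R).
  { intros s. unfold N. destruct (archimed (1 - Re s)) as [h _].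
    assert (h2 : (up (1 - Re s) <= Z.of_nat (Z.to_nat (up (1 - Re s))))%Z) by lia.
    apply IZR_le in h2. rewrite <- INR_IZR_INZ in h2. lra. }
  assert (Hge : forall m m' s, (m <= m')%nat -> (1 - INR m < Re s)%R -> Fm m' s = Fm m s).
  { intros m m' s Hm. induction Hm as [|m' Hm IH]; intros Hs; auto.
    rewrite Fm_stable; auto. apply le_INR in Hm. lra. }
  set (F := fun s => Fm (N s) s).
  assert (HF : forall m s, (1 - INR m < Re s)%R -> F s = Fm m s).
  { intros m s Hs. unfold F. destruct (Nat.le_ge_cases m (N s)) as [h|h].
    - now apply Hge.
    - symmetry. apply Hge; auto. }
  exists F. split; [|split].
  - intros z0. set (m := S (N z0)).
    destruct (Fm_bound m z0) as [K HK].
    { unfold m. rewrite S_INR. specialize (HN z0). lra. }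
    exists (K * x ^ 0)%R. specialize (HK 0%nat).
    replace (z0 + INR 0) with z0 in HK by (simpl; ring).
    apply (disc_series_ext (Fm (S m))).
    + intros z Hz. symmetry. apply HF.
      assert (h := re_le_Cmod (z - z0)). assert (h' := Rle_trans _ _ _ h Hz).
      apply Rabs_le_between in h'. unfold Cminus in h'. rewrite Re_plus, Re_opp in h'.
      specialize (HN z0). unfold m. rewrite !S_INR. lra.
    + apply (disc_series_ext (Fm m)); auto. intros z Hz. symmetry. apply Fm_stable.
      assert (h := re_le_Cmod (z - z0)). assert (h' := Rle_trans _ _ _ h Hz).
      apply Rabs_le_between in h'. unfold Cminus in h'. rewrite Re_plus, Re_opp in h'.
      specialize (HN z0). unfold m. rewrite !S_INR. lra.
  - intros s Hs. rewrite (HF 0%nat) by (simpl; lra). reflexivity.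
  - intros s. set (m := N s).
    destruct (Fm_bound m (s + 1)) as [K HK].
    { rewrite Re_plus, Re_RtoC. specialize (HN s). unfold m. lra. }
    destruct (Fm_step m s K HK) as [_ h].
    assert (E : forall i, p i s * Fm m (s + INR (S i)) = p i s * F (s + INR (S i))).
    { intros i. f_equal. symmetry. apply HF. rewrite Re_shift. specialize (HN s).
      assert (hi := pos_INR (S i)). unfold m. lra. }
    split; [eapply summable_ext; [apply E|apply h]|].
    rewrite <- (tsum_ext _ _ E). rewrite (HF (S m)).
    + reflexivity.
    + specialize (HN s). unfold m. rewrite S_INR. lra.
Qed.

End Continuation.

Lemma Cmod_Rcpow (x : R) (s : C) : Cmod (Rcpow x (- s)) = Rpower x (- Re s).
Proof. unfold Rcpow. rewrite Cmod_Cexp, re_scal_r. reflexivity. Qed.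

Lemma Rcpow_shift (x : R) (s : C) j : (0 < x)%R ->
  Rcpow x (- (s + INR j)) = Rcpow x (- s) * RtoC (/ x) ^ j.
Proof.
  intros Hx. unfold Rcpow.
  replace (RtoC (/ x)) with (Cexp (RtoC (- ln x))) by (rewrite Cexp_RtoC, exp_Ropp, exp_ln; auto).
  rewrite <- Cexp_nat_mult, <- Cexp_plus. f_equal.
  rewrite RtoC_opp. ring.
Qed.

Lemma Rcpow_succ (x : R) (s : C) : (1 < x)%R ->
  Rcpow (x + 1) (- s) = Rcpow x (- s) * ps (neg_binom s) (RtoC (/ x)).
Proof.
  intros Hx. rewrite binomial_series.
  - unfold Rcpow. rewrite <- Cexp_plus. f_equal.
    replace (1 + / x)%R with ((x + 1) * / x)%R by (field; lra).
    rewrite ln_mult, ln_Rinv by (try apply Rinv_0_lt_compat; lra).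
    rewrite RtoC_plus, RtoC_opp. ring.
  - split; [apply Rinv_0_lt_compat; lra|]. rewrite <- Rinv_1. apply Rinv_lt_contravar; lra.
Qed.

Lemma neg_binom_bound_summable_S (x r : R) : (0 < x)%R -> (0 < r < 1)%R ->
  summable (fun i => RtoC (neg_binom_bound x (S i) * r ^ i)).
Proof.
  intros Hx Hr.
  assert (h := summable_inj S (fun a b => eq_add_S a b) _ (neg_binom_bound_summable x r Hx Hr)).
  eapply summable_ext; [|apply (summable_scal (RtoC (/ r)) _ h)].
  intros i. cbv beta. rewrite <- RtoC_mult. f_equal. cbn [pow]. field_simplify_eq; [ring|lra].
Qed.

(** * The Dirichlet series and its functional equations *)

Section Dirichlet.
Context (a : R) (Ha : (1 < a)%R) (q : C) (Hq : Cmod q = 1%R).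

Let xn (n : nat) : R := (a + INR n)%R.
Let xn_ge n : (a <= xn n)%R.
Proof. unfold xn. generalize (pos_INR n). lra. Qed.

(** A Lerch zeta function. The condition [1 < a] keeps [/ (a + n)] below [/ a < 1], inside the range
    of the binomial series; for this reason the first term of psi, at a point of [(0, 1]], is kept
    apart later. *)
Definition dser (s : C) : C := tsum (fun n => q ^ n * Rcpow (a + INR n) (- s)).

Let qn n : Cmod (q ^ n) = 1%R.
Proof. rewrite Cmod_pow, Hq. apply pow1. Qed.

Lemma dser_summable s : (1 < Re s)%R -> summable (fun n => q ^ n * Rcpow (a + INR n) (- s)).
Proof.
  intros Hs. eapply summable_dom; [|eexists; apply (asum_Rpower a (Re s)); lra].
  intros n. cbv beta. rewrite Cmod_mult, qn, Cmod_Rcpow. lra.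
Qed.

(** On a disc of radius 1 the norm of [x^(-s)] costs one unit of the exponent, so [Re z0 - 1 > 1] is
    required for convergence. Each unit translation gains a factor at most [/ a]. *)
Lemma dser_disc_series z0 : (2 < Re z0)%R -> exists K, (0 <= K)%R /\
  forall i, disc_series dser (z0 + INR i) (K * (/ a) ^ i).
Proof.
  intros Hz.
  assert (HK := asum_Rpower a (Re z0 - 1) ltac:(lra) ltac:(lra)).
  set (K := (Rpower a (- (Re z0 - 1)) + Rpower a (1 - (Re z0 - 1)) / (Re z0 - 1 - 1))%R) in HK.
  exists K. split; [apply (asum_ge0 _ _ HK)|]. intros i.
  apply (disc_series_tsum (fun n s => q ^ n * Rcpow (a + INR n) (- s)) (z0 + INR i)
    (fun n => ((/ a) ^ i * Rpower (a + INR n) (- (Re z0 - 1)))%R)).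
  - intros n. apply (disc_series_weaken _ _ (Cmod (q ^ n) * exp (Re (- ln (xn n) * (z0 + INR i)) + Cmod (- ln (xn n))))).
    + apply disc_series_scal. apply (disc_series_ext (fun z => Cexp (- ln (xn n) * z))); [|apply disc_series_Cexp].
      intros z _. unfold Rcpow, xn. f_equal. ring.
    + rewrite qn, Rmult_1_l. assert (hx := xn_ge n).
      assert (hl : (0 <= ln (xn n))%R) by (rewrite <- ln_1; apply ln_le; lra).
      replace (- ln (xn n)) with (RtoC (- ln (xn n))) by (now rewrite RtoC_opp).
      rewrite re_scal_l, Cmod_R, Rabs_Ropp, (Rabs_pos_eq _ hl), Re_plus, Re_RtoC.
      fold (xn n).
      replace (- ln (xn n) * (Re z0 + INR i) + ln (xn n))%R with
        (INR i * - ln (xn n) + - (Re z0 - 1) * ln (xn n))%R by ring.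
      rewrite exp_plus. apply Rmult_le_compat_r; [left; apply exp_pos|].
      rewrite <- Rpower_pow by (apply Rinv_0_lt_compat; lra).
      apply exp_le_mono. apply Rmult_le_compat_l; [apply pos_INR|].
      rewrite ln_Rinv by lra. apply Ropp_le_contravar. apply ln_le; lra.
  - eapply asum_weaken; [eapply asum_le; [|apply (asum_scal (RtoC ((/ a) ^ i)) _ _ HK)]|].
    + intros n. cbv beta. rewrite RtoC_mult. lra.
    + rewrite Cmod_R, Rabs_pos_eq by (apply pow_le; left; apply Rinv_0_lt_compat; lra).
      right. ring.
Qed.

(** Each difference is expanded by [Rcpow_succ] and the sums are exchanged. The leading term
    cancels, so the exponents begin at [Re s + 1] and the double series converges already for
    [Re s > 0]. *)
Lemma dser_difference s : (0 < Re s)%R ->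
  summable (fun i => neg_binom s (S i) * dser (s + INR (S i))) /\
  summable (fun n => q ^ n * (Rcpow (a + INR (S n)) (- s) - Rcpow (a + INR n) (- s))) /\
  tsum (fun n => q ^ n * (Rcpow (a + INR (S n)) (- s) - Rcpow (a + INR n) (- s))) =
  tsum (fun i => neg_binom s (S i) * dser (s + INR (S i))).
Proof.
  intros Hs. assert (hs := Cmod_ge_0 s).
  assert (hia : (0 < / a < 1)%R).
  { split; [apply Rinv_0_lt_compat; lra|]. rewrite <- Rinv_1. apply Rinv_lt_contravar; lra. }
  set (G := fun p : nat * nat => q ^ fst p * (neg_binom s (S (snd p)) * Rcpow (xn (fst p)) (- (s + INR (S (snd p)))))).
  assert (SG : summable G).
  { assert (S1 : summable (fun n => RtoC (Rpower (a + INR n) (- (Re s + 1)))))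
      by (eexists; apply (asum_Rpower a (Re s + 1)); lra).
    assert (S2 := neg_binom_bound_summable_S (Cmod s + 1) (/ a) ltac:(lra) hia).
    eapply summable_le; [|apply (summable_prod_mult _ _ S1 S2)].
    intros [n i]. unfold G. cbn [fst snd]. fold (xn n).
    rewrite !Cmod_mult, qn, Rmult_1_l, Cmod_Rcpow, !Cmod_R.
    rewrite (Rabs_pos_eq (Rpower _ _)) by (left; apply Rpower_pos).
    assert (hb := neg_binom_bound_pos (Cmod s + 1) (S i) ltac:(lra)).
    assert (hpw : (0 <= (/ a) ^ i)%R) by (apply pow_le; lra).
    rewrite (Rabs_pos_eq (_ * _)) by (apply Rmult_le_pos; lra).
    replace (- Re (s + INR (S i)))%R with (- (Re s + 1) + - INR i)%R
      by (rewrite Re_plus, Re_RtoC, S_INR; ring).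
    rewrite Rpower_plus.
    replace (Rpower (xn n) (- INR i)) with ((/ xn n) ^ i)%R.
    2:{ assert (h := xn_ge n). rewrite <- Rpower_pow by (apply Rinv_0_lt_compat; lra). unfold Rpower.
        rewrite ln_Rinv by lra. f_equal. ring. }
    rewrite (Rmult_comm (Cmod (neg_binom _ _))), Rmult_assoc.
    apply Rmult_le_compat_l; [left; apply Rpower_pos|].
    rewrite Rmult_comm. apply Rmult_le_compat; [apply Cmod_ge_0| | |].
    - apply pow_le. left. apply Rinv_0_lt_compat. generalize (xn_ge n). lra.
    - apply neg_binom_le; lra.
    - apply pow_incr. assert (h := xn_ge n). split; [left; apply Rinv_0_lt_compat; lra|].
      apply Rinv_le_contravar; lra. }
  assert (Ein : forall i, tsum (fun n => G (n, i)) = neg_binom s (S i) * dser (s + INR (S i))).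
  { intros i. unfold G, dser. cbn [fst snd]. rewrite <- tsum_scal.
    - apply tsum_ext. intros n. unfold xn. ring.
    - apply dser_summable. rewrite Re_plus, Re_RtoC, S_INR. generalize (pos_INR i). lra. }
  assert (Eout : forall n, tsum (fun i => G (n, i)) =
    q ^ n * (Rcpow (a + INR (S n)) (- s) - Rcpow (a + INR n) (- s))).
  { intros n. assert (hx := xn_ge n).
    assert (hxi : (0 < / xn n < 1)%R).
    { split; [apply Rinv_0_lt_compat; lra|]. rewrite <- Rinv_1. apply Rinv_lt_contravar; lra. }
    destruct (psum_neg_binom s (/ xn n) hxi) as [M HM].
    assert (hc : (Cmod (RtoC (/ xn n)) <= / xn n)%R) by (rewrite Cmod_R, Rabs_pos_eq; lra).
    assert (hsum := psum_summable _ _ _ _ HM hc).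
    destruct (tsum_Sl _ hsum) as [h1 h2].
    replace (a + INR (S n))%R with (xn n + 1)%R by (unfold xn; rewrite S_INR; ring).
    fold (xn n). rewrite Rcpow_succ by lra. unfold ps. rewrite h2. cbn [neg_binom Cpow].
    transitivity (q ^ n * (Rcpow (xn n) (- s) * tsum (fun i => neg_binom s (S i) * RtoC (/ xn n) ^ S i))); [|cbn [neg_binom Cpow]; ring].
    rewrite <- !tsum_scal; auto.
    - apply tsum_ext. intros i. unfold G. cbn [fst snd]. rewrite Rcpow_shift by lra. ring.
    - now apply summable_scal. }
  destruct (tsum_prod G SG) as [g1 g2].
  assert (SG' : summable (fun p : nat * nat => G (snd p, fst p))).
  { assert (hi : forall u v : nat * nat, (snd u, fst u) = (snd v, fst v) -> u = v).
    { intros [u1 u2] [v1 v2]; simpl; congruence. }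
    exact (summable_inj (fun u : nat * nat => (snd u, fst u)) hi G SG). }
  destruct (tsum_prod _ SG') as [g3 _]. cbn [fst snd] in g3.
  split; [eapply summable_ext; [apply Ein|exact g3]|].
  split; [eapply summable_ext; [apply Eout|exact g1]|].
  rewrite <- (tsum_ext _ _ Eout), <- (tsum_ext _ _ Ein).
  apply (tsum_swap (fun n i => G (n, i))).
  eapply summable_ext; [|apply SG]. now intros [n i].
Qed.

(** Shifting the index in [dser] gives [q] times the series up to its first term; what remains is
    [q] times the sum of differences. *)
Lemma dser_FE s : (1 < Re s)%R ->
  (1 - q) * dser s = Rcpow a (- s) + q * tsum (fun i => neg_binom s (S i) * dser (s + INR (S i))).
Proof.
  intros Hs. destruct (dser_difference s ltac:(lra)) as (_ & h2 & <-).
  assert (hd := dser_summable s Hs). destruct (tsum_Sl _ hd) as [h3 h4].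
  rewrite <- tsum_scal by auto.
  rewrite (tsum_ext _ (fun n => q ^ S n * Rcpow (a + INR (S n)) (- s) - q * (q ^ n * Rcpow (a + INR n) (- s))))
    by (intros n; simpl; ring).
  assert (hqd := summable_scal q _ hd).
  rewrite tsum_minus, tsum_scal by auto. fold (dser s).
  replace (tsum (fun n => q ^ S n * Rcpow (a + INR (S n)) (- s)))
    with (dser s - q ^ 0 * Rcpow (a + INR 0) (- s)).
  - simpl INR. rewrite Rplus_0_r. simpl. ring.
  - unfold dser. rewrite h4. ring.
Qed.

End Dirichlet.

Lemma tsum_telescope (v : nat -> C) : summable (fun n => v (S n) - v n) -> Clim v 0 ->
  tsum (fun n => v (S n) - v n) = - v 0%nat.
Proof.
  intros HS Hv.
  apply (Clim_unique (fun n => v (S n) - v 0%nat)).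
  - intros eps Heps. destruct (is_series_C_inv _ _ (tsum_is_series _ HS) eps Heps) as [N HN].
    exists N. intros n Hn. specialize (HN n Hn).
    replace (v (S n) - v 0%nat) with (sum_n (fun n => v (S n) - v n) n); auto.
    clear. induction n as [|n IH]; [now rewrite sum_O|].
    rewrite sum_Sn, IH. change ((v (S n) - v 0%nat) + (v (S (S n)) - v (S n)) = v (S (S n)) - v 0%nat). ring.
  - replace (- v 0%nat) with (0 + - v 0%nat) by ring.
    apply Clim_plus; [|apply Clim_const].
    intros eps Heps. destruct (Hv eps Heps) as [N HN]. exists N. intros n Hn. apply HN. lia.
Qed.

Lemma Clim_Rcpow (a : R) (s : C) : (1 < a)%R -> (0 < Re s)%R ->
  Clim (fun n => Rcpow (a + INR n) (- s)) 0.
Proof.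
  intros Ha Hs eps Heps.
  set (X := exp (- ln eps / Re s)).
  destruct (archimed X) as [h _].
  exists (Z.to_nat (up X)). intros n Hn.
  replace (Rcpow (a + INR n) (- s) - 0) with (Rcpow (a + INR n) (- s)) by ring.
  rewrite Cmod_Rcpow.
  assert (hX : (0 < X)%R) by apply exp_pos.
  assert (hn : (X < a + INR n)%R).
  { assert (h1 : (up X <= Z.of_nat n)%Z) by lia. apply IZR_le in h1.
    rewrite <- INR_IZR_INZ in h1. lra. }
  assert (hl : (ln X < ln (a + INR n))%R) by (apply ln_increasing; auto).
  unfold X in hl. rewrite ln_exp in hl.
  apply Rmult_lt_compat_l with (r := Re s) in hl; auto.
  replace (Re s * (- ln eps / Re s))%R with (- ln eps)%R in hl by (field; lra).
  apply Rlt_le_trans with (exp (ln eps)); [apply exp_increasing; lra|rewrite exp_ln; lra].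
Qed.

(** For [q = 1] the differences telescope. The equation at [s] no longer involves [dser] at [s]: its
    first unknown is [- s * dser a 1 (s + 1)], which is why it is applied one unit to the left,
    within [Re s > 0]. *)
Lemma dser_FE_1 (a : R) (s : C) : (1 < a)%R -> (0 < Re s)%R ->
  summable (fun i => neg_binom s (S i) * dser a 1 (s + INR (S i))) /\
  tsum (fun i => neg_binom s (S i) * dser a 1 (s + INR (S i))) = - Rcpow a (- s).
Proof.
  intros Ha Hs. destruct (dser_difference a Ha 1 Cmod_1 s Hs) as (h1 & h2 & <-).
  split; auto.
  assert (E : forall n, 1 ^ n * (Rcpow (a + INR (S n)) (- s) - Rcpow (a + INR n) (- s)) =
    Rcpow (a + INR (S n)) (- s) - Rcpow (a + INR n) (- s)).
  { intros n. rewrite Cpow_1_l. ring. }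
  rewrite (tsum_ext _ _ E), (tsum_telescope (fun n => Rcpow (a + INR n) (- s))).
  - simpl INR. now rewrite Rplus_0_r.
  - eapply summable_ext; [apply E|exact h2].
  - now apply Clim_Rcpow.
Qed.

Lemma disc_series_neg_binom j z0 : disc_series (fun s => neg_binom s j) z0 (neg_binom_bound (Cmod z0 + 1) j).
Proof.
  induction j as [|j IH].
  - cbn [neg_binom neg_binom_bound]. eapply disc_series_weaken; [apply disc_series_const|rewrite Cmod_1; lra].
  - cbn [neg_binom neg_binom_bound]. apply disc_series_mult; auto.
    assert (hj : (0 < INR (S j))%R) by (apply lt_0_INR; lia). assert (hj0 := pos_INR j).
    apply (disc_series_ext (fun s => (- / INR (S j)) * (s + INR j))).
    { intros s _. field. apply RtoC_S_neq0. }
    eapply disc_series_weaken; [apply disc_series_scal, disc_series_linear|].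
    rewrite Cmod_opp, Cmod_Cinv, Cmod_R, Rabs_pos_eq by lra. unfold Rdiv.
    rewrite Rmult_comm. apply Rmult_le_compat_r; [left; now apply Rinv_0_lt_compat|].
    assert (h := Cmod_triangle z0 (INR j)). rewrite Cmod_R, Rabs_pos_eq in h; lra.
Qed.

Lemma disc_series_Rcpow (a : R) z0 : exists M, disc_series (fun s => Rcpow a (- s)) z0 M.
Proof.
  eexists. apply (disc_series_ext (fun z => Cexp (- ln a * z))); [|apply disc_series_Cexp].
  intros z _. unfold Rcpow. f_equal. ring.
Qed.

Lemma inv_lt_1 (a : R) : (1 < a)%R -> (0 < / a < 1)%R.
Proof.
  intros Ha. split; [apply Rinv_0_lt_compat; lra|]. rewrite <- Rinv_1.
  apply Rinv_lt_contravar; lra.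
Qed.

Lemma dser_continuation (a : R) (q : C) : (1 < a)%R -> Cmod q = 1%R -> q <> 1 ->
  exists F, entire F /\ (forall s, (1 < Re s)%R -> F s = dser a q s) /\
    forall s, summable (fun i => neg_binom s (S i) * F (s + INR (S i))) /\
      (1 - q) * F s = Rcpow a (- s) + q * tsum (fun i => neg_binom s (S i) * F (s + INR (S i))).
Proof.
  intros Ha Hq Hq1.
  assert (hq : 1 - q <> 0).
  { intros E. apply Hq1. replace q with (1 - (1 - q)) by ring. rewrite E. ring. }
  assert (hq0 : q <> 0).
  { intros E. rewrite E, Cmod_0 in Hq. lra. }
  assert (hx := inv_lt_1 a Ha).
  set (k := q / (1 - q)).
  assert (hk : k <> 0).
  { intros E. apply hq0. replace q with (k * (1 - q)) by (unfold k; field; auto). rewrite E. ring. }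
  destruct (continuation (dser a q) (fun s => / (1 - q) * Rcpow a (- s))
    (fun i s => k * neg_binom s (S i)) (/ a) hx) as (F & F1 & F2 & F3).
  - intros z0. destruct (disc_series_Rcpow a z0) as [M HM]. eexists. apply disc_series_scal, HM.
  - intros z0. exists (fun i => (Cmod k * neg_binom_bound (Cmod z0 + 1) (S i))%R). split.
    + intros i. apply disc_series_scal, disc_series_neg_binom.
    + assert (h := Cmod_ge_0 z0).
      eapply summable_ext; [|apply (summable_scal (RtoC (Cmod k)) _
        (neg_binom_bound_summable_S (Cmod z0 + 1) (/ a) ltac:(lra) hx))].
      intros i. cbv beta. rewrite <- RtoC_mult. f_equal. ring.
  - intros z0 Hz. destruct (dser_disc_series a Ha q Hq z0 Hz) as (K & _ & HK). eauto.
  - intros s Hs. assert (E := dser_FE a Ha q Hq s Hs).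
    destruct (dser_difference a Ha q Hq s ltac:(lra)) as (h1 & _ & _).
    rewrite (tsum_ext _ (fun i => k * (neg_binom s (S i) * dser a q (s + INR (S i))))) by (intros; ring).
    rewrite tsum_scal by auto.
    replace (dser a q s) with ((1 - q) * dser a q s / (1 - q)) at 1 by (field; auto).
    rewrite E. unfold k. field. auto.
  - exists F. split; [auto|split; [auto|]]. intros s. destruct (F3 s) as [h1 h2].
    assert (h3 : summable (fun i => neg_binom s (S i) * F (s + INR (S i)))).
    { eapply summable_ext; [|apply (summable_scal (/ k) _ h1)]. intros i. cbv beta. field. auto. }
    split; auto. rewrite h2.
    rewrite (tsum_ext _ (fun i => k * (neg_binom s (S i) * F (s + INR (S i))))) by (intros; ring).
    rewrite tsum_scal by auto. unfold k. field. auto.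
Qed.

(* For [q = 1] the pole at 1 is removed by the factor [s - 1]. *)
Lemma dser_continuation_1 (a : R) : (1 < a)%R ->
  exists E, entire E /\ (forall s, (1 < Re s)%R -> E s = (s - 1) * dser a 1 s) /\
    forall s, E s = Rcpow a (- (s - 1)) +
      tsum (fun i => - / INR (S (S i)) * neg_binom (s - 1) (S i) * E (s + INR (S i))).
Proof.
  intros Ha. assert (hx := inv_lt_1 a Ha). set (x := (/ a)%R) in *.
  (* The factor [s - 1] grows linearly along the translates; the ratio is relaxed from [x] to a [y]
     strictly between [x] and 1 to absorb this growth. *)
  set (y := ((1 + x) / 2)%R). assert (hy : (0 < y < 1)%R) by (unfold y; lra).
  destruct (continuation (fun s => (s - 1) * dser a 1 s) (fun s => Rcpow a (- (s - 1)))
    (fun i s => - / INR (S (S i)) * neg_binom (s - 1) (S i)) y hy) as (F & F1 & F2 & F3).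
  - intros z0. destruct (disc_series_Rcpow a (z0 - 1)) as [M HM]. exists M.
    apply (disc_series_shift (fun s => Rcpow a (- s)) z0 (- (1)) M HM).
  - intros z0. exists (fun i => neg_binom_bound (Cmod (z0 - 1) + 1) (S i)). split.
    + intros i. assert (hi : (1 <= INR (S (S i)))%R).
      { rewrite <- INR_1. apply le_INR. lia. }
      apply (disc_series_weaken _ _ (Cmod (- / INR (S (S i))) * neg_binom_bound (Cmod (z0 - 1) + 1) (S i))).
      * apply disc_series_scal. apply (disc_series_shift (fun s => neg_binom s (S i)) z0 (- (1))), disc_series_neg_binom.
      * rewrite Cmod_opp, Cmod_Cinv, Cmod_R, Rabs_pos_eq by lra.
        rewrite <- (Rmult_1_l (neg_binom_bound _ _)) at 2. apply Rmult_le_compat_r.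
        -- left. apply neg_binom_bound_pos. generalize (Cmod_ge_0 (z0 - 1)); lra.
        -- rewrite <- Rinv_1. apply Rinv_le_contravar; lra.
    + apply neg_binom_bound_summable_S; auto. generalize (Cmod_ge_0 (z0 - 1)); lra.
  - intros z0 Hz. destruct (dser_disc_series a Ha 1 Cmod_1 z0 Hz) as (K & HK0 & HK).
    set (d := (y / x - 1)%R).
    assert (hd : (0 < d)%R).
    { unfold d, y. assert (1 < (1 + x) / 2 / x)%R; [|lra].
      apply Rlt_div_r; lra. }
    set (m := (Cmod (z0 - 1) + 1)%R). assert (hm : (1 <= m)%R) by (unfold m; generalize (Cmod_ge_0 (z0 - 1)); lra).
    set (A := Rmax m (/ d)).
    assert (hA1 : (m <= A)%R) by apply Rmax_l. assert (hA2 : (/ d <= A)%R) by apply Rmax_r.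
    exists (A * K)%R. intros i.
    apply (disc_series_weaken _ _ ((m + INR i) * (K * x ^ i))).
    + apply disc_series_mult; [|apply HK].
      eapply disc_series_weaken; [apply (disc_series_linear (- (1)))|]. unfold m.
      assert (h := Cmod_triangle (z0 - 1) (INR i)). rewrite (Cmod_R (INR i)), Rabs_pos_eq in h by apply pos_INR.
      replace (z0 + INR i + - (1)) with (z0 - 1 + INR i) by ring. lra.
    (* Bernoulli's inequality, with [1 + d = y / x]. *)
    + assert (h1 := poly i d hd). replace (1 + d)%R with (y / x)%R in h1 by (unfold d; ring).
      assert (h2 : (m + INR i <= A * (y / x) ^ i)%R).
      { apply Rle_trans with (A * (1 + INR i * d))%R; [|apply Rmult_le_compat_l; lra].
        rewrite Rmult_plus_distr_l, Rmult_1_r. apply Rplus_le_compat; auto.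
        assert (hi := pos_INR i).
        apply Rle_trans with (/ d * (INR i * d))%R; [right; field; lra|].
        apply Rmult_le_compat_r; [nra|auto]. }
      apply Rle_trans with (A * (y / x) ^ i * (K * x ^ i))%R.
      * apply Rmult_le_compat_r; auto. apply Rmult_le_pos; auto. apply pow_le; lra.
      * right. unfold Rdiv. rewrite Rpow_mult_distr, pow_inv. field. apply pow_nonzero. lra.
  - intros s Hs.
    destruct (dser_FE_1 a (s - 1) Ha) as [h1 h2].
    { unfold Cminus. rewrite Re_plus, Re_opp, Re_RtoC. lra. }
    destruct (tsum_Sl _ h1) as [h3 h4]. rewrite h2 in h4.
    replace (s - 1 + INR 1) with s in h4 by (simpl; ring).
    assert (e1 : neg_binom (s - 1) 1 = - (s - 1)) by (simpl; field).
    rewrite e1 in h4.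
    transitivity (Rcpow a (- (s - 1)) + tsum (fun i => neg_binom (s - 1) (S (S i)) * dser a 1 (s - 1 + INR (S (S i))))).
    + replace (tsum (fun i => neg_binom (s - 1) (S (S i)) * dser a 1 (s - 1 + INR (S (S i))))) with
        (- Rcpow a (- (s - 1)) - - (s - 1) * dser a 1 s) by (rewrite h4; ring). ring.
    + f_equal. apply tsum_ext. intros i.
      replace (s - 1 + INR (S (S i))) with (s + INR (S i)) by (rewrite (S_INR (S i)), RtoC_plus; ring).
      change (neg_binom (s - 1) (S (S i))) with
        (neg_binom (s - 1) (S i) * (- (s - 1 + INR (S i)) / INR (S (S i)))).
      field. apply RtoC_S_neq0.
  - exists F. split; [auto|split; [auto|]]. intros s. apply F3.
Qed.

(** At [s = - K] these are the ordinary binomial coefficients, zero beyond [K], so the functional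
    equations become finite recurrences there. *)
Lemma neg_binom_neg (K j : nat) : neg_binom (- INR K) j =
  if le_dec j K then RtoC (INR (fact K)) * / (INR (fact j) * INR (fact (K - j))) else 0.
Proof.
  induction j as [|j IH].
  - cbn [neg_binom]. destruct le_dec; [|lia]. rewrite Nat.sub_0_r. simpl (INR (fact 0)). field.
    apply INR_fact_neq0.
  - cbn [neg_binom]. rewrite IH.
    destruct (le_dec j K) as [h1|h1]; destruct (le_dec (S j) K) as [h2|h2]; try lia; [| |ring].
    + replace (K - j)%nat with (S (K - S j)) by lia.
      rewrite !fact_simpl, !mult_INR, !RtoC_mult.
      replace (- (- INR K + INR j)) with (RtoC (INR (S (K - S j)))).
      * field. repeat split; try apply INR_fact_neq0; apply RtoC_S_neq0.
      * replace (S (K - S j)) with (K - j)%nat by lia. rewrite minus_INR, RtoC_minus by lia. ring.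
    + replace j with K by lia. replace (- INR K + INR K) with (RtoC 0) by ring.
      unfold Cdiv. ring.
Qed.

Definition mono (N : nat) (n : nat) : C := if Nat.eq_dec n N then 1 else 0.

Lemma psum_mono N r : exists M, psum (mono N) r M.
Proof.
  exists (nsum (fun n => mono N n * RtoC r ^ n) (cons N nil)).
  apply asum_fin; [repeat constructor; auto|].
  intros n Hn. unfold mono. destruct Nat.eq_dec as [->|]; [|ring].
  exfalso. apply Hn. simpl; auto.
Qed.

Lemma ps_mono N z : ps (mono N) z = z ^ N.
Proof.
  unfold ps. destruct (tsum_single (fun n => mono N n * z ^ n) N) as [_ ->].
  - intros n Hn. unfold mono. destruct Nat.eq_dec; [easy|ring].
  - unfold mono. destruct Nat.eq_dec; [ring|easy].
Qed.

Lemma conv_mono N f n : conv (mono N) f n = if le_dec N n then f (n - N)%nat else 0.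
Proof.
  unfold conv. destruct le_dec as [h|h].
  - rewrite (csum_single _ _ N); [|lia|].
    + unfold mono. destruct Nat.eq_dec; [ring|easy].
    + intros j _ Hj. unfold mono. destruct Nat.eq_dec; [easy|ring].
  - apply csum_0. intros j Hj. unfold mono. destruct Nat.eq_dec; [lia|ring].
Qed.

(** The expansion for [X = 0] multiplied by [e (X kappa) Cexp (X z)]. This frees [X] from the
    interval [[0, 1)] needed by the partial fractions; values up to 2 occur below. *)
Lemma gen_series (X : C) (kappa : R) :
  (exists r M, (0 < r)%R /\ psum (bcoef X kappa) r M /\
     forall z, (0 < Cmod z <= r)%R ->
       e kappa * Cexp z <> 1 /\ z * gen X kappa z = ps (bcoef X kappa) z) /\
  bcoef X kappa 0 = delta kappa * e (X * kappa).
Proof.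
  destruct (gen_partial_fractions 0 kappa ltac:(lra)) as ((r & M & Hr & HM & Hg) & H0 & _).
  assert (H1 := psum_Cexp X r (Rlt_le _ _ Hr)).
  assert (H2 := psum_conv _ _ _ _ _ H1 HM).
  assert (H3 := psum_scal (e (X * kappa)) _ _ _ H2).
  assert (E : forall z, (0 < Cmod z <= r)%R ->
    z * gen X kappa z = ps (fun j => e (X * kappa) * conv (pw X) (bcoef 0 kappa) j) z).
  { intros z Hz. destruct (Hg z Hz) as [_ E].
    rewrite (ps_scal _ _ r _ z H2), (ps_conv _ _ r _ _ z H1 HM), ps_Cexp, <- E by lra.
    unfold gen. rewrite !Cmult_0_l, e_0, Cexp_0. unfold Cdiv. ring. }
  assert (HU := Ccoef_unique X kappa _ r _ Hr H3 E).
  assert (Eb : bcoef X kappa = fun j => e (X * kappa) * conv (pw X) (bcoef 0 kappa) j)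
    by (apply functional_extensionality; auto).
  split.
  - rewrite Eb. eexists r, _. split; [auto|split; [apply H3|]].
    intros z Hz. split; [apply (Hg z Hz)|apply (E z Hz)].
  - rewrite HU. destruct (conv_0_3 (pw X) (bcoef 0 kappa)) as (-> & _).
    rewrite H0, pw_0, Cmult_0_l, e_0. ring.
Qed.

(** The coefficient of order [m + 1] in [(e kappa * Cexp z - 1)] times [z * gen X kappa z], which is
    [z e (X kappa) Cexp (X z)]. *)
Lemma gen_recurrence (X : C) (kappa : R) (m : nat) :
  e kappa * conv (pw 1) (bcoef X kappa) (S m) - bcoef X kappa (S m) = e (X * kappa) * pw X m.
Proof.
  destruct (gen_series X kappa) as ((r & M & Hr & HM & Hg) & _).
  assert (H1 := psum_Cexp 1 r (Rlt_le _ _ Hr)).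
  assert (H2 := psum_conv _ _ _ _ _ H1 HM).
  assert (H3 := psum_plus _ _ _ _ _ (psum_scal (e kappa) _ _ _ H2) (psum_scal (-1) _ _ _ HM)).
  destruct (psum_mono 1 r) as [N1 HN1].
  assert (H4 := psum_Cexp X r (Rlt_le _ _ Hr)).
  assert (H5 := psum_conv _ _ _ _ _ HN1 H4).
  assert (H6 := psum_scal (e (X * kappa)) _ _ _ H5).
  assert (U := ps_unique _ _ r _ _ H3 H6 Hr).
  assert (E : e kappa * conv (pw 1) (bcoef X kappa) (S m) + (-1) * bcoef X kappa (S m)
    = e (X * kappa) * conv (mono 1) (pw X) (S m)).
  { apply U. intros eps Heps. set (h := (Rmin eps r / 2)%R).
    assert (h1 := Rmin_l eps r). assert (h2 := Rmin_r eps r).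
    assert (h3 : (0 < Rmin eps r)%R) by (apply Rmin_glb_lt; lra).
    exists (RtoC h). assert (hc : Cmod (RtoC h) = h) by (rewrite Cmod_R, Rabs_pos_eq; unfold h; lra).
    assert (hh : (0 < h)%R /\ (h < eps)%R /\ (h <= r)%R) by (unfold h; lra).
    split; [rewrite hc; lra|].
    destruct (Hg (RtoC h) ltac:(rewrite hc; lra)) as [g1 g2].
    rewrite (ps_plus _ _ r _ _ _ (psum_scal (e kappa) _ _ _ H2) (psum_scal (-1) _ _ _ HM)),
      (ps_scal _ _ r _ _ H2), (ps_scal _ _ r _ _ HM), (ps_conv _ _ r _ _ _ H1 HM),
      (ps_scal _ _ r _ _ H5), (ps_conv _ _ r _ _ _ HN1 H4), ps_mono, !ps_Cexp, <- g2 by lra.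
    unfold gen. rewrite Cmult_1_l. simpl Cpow. field. now apply Cminus_eq_contra. }
  rewrite conv_mono in E. destruct le_dec; [|lia]. simpl (S m - 1)%nat in E.
  rewrite Nat.sub_0_r in E. rewrite <- E. ring.
Qed.

(** The generating functions differ by [z e (a0 kappa) Cexp (a0 z)]; in psi this is the term at the
    first point [a0]. *)
Lemma bcoef_succ (a0 kappa : R) (K : nat) :
  bcoef (a0 + 1)%R kappa (S K) = bcoef a0 kappa (S K) + e (a0 * kappa) * pw a0 K.
Proof.
  destruct (gen_series a0 kappa) as ((r & M & Hr & HM & Hg) & _).
  destruct (psum_mono 1 r) as [N1 HN1].
  assert (H4 := psum_Cexp a0 r (Rlt_le _ _ Hr)).
  assert (H5 := psum_conv _ _ _ _ _ HN1 H4).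
  assert (H6 := psum_scal (e (a0 * kappa)) _ _ _ H5).
  assert (H7 := psum_plus _ _ _ _ _ HM H6).
  rewrite (Ccoef_unique (a0 + 1)%R kappa _ r _ Hr H7).
  - rewrite conv_mono. destruct le_dec; [|lia]. simpl (S K - 1)%nat. now rewrite Nat.sub_0_r.
  - intros z Hz. destruct (Hg z Hz) as [g1 g2].
    rewrite (ps_plus _ _ r _ _ _ HM H6), (ps_scal _ _ r _ _ H5), (ps_conv _ _ r _ _ _ HN1 H4),
      ps_mono, ps_Cexp, <- g2 by lra.
    unfold gen. rewrite RtoC_plus.
    replace ((a0 + 1) * kappa) with (a0 * kappa + kappa) by ring.
    replace ((a0 + 1) * z) with (a0 * z + z) by ring.
    rewrite e_plus, Cexp_plus. simpl Cpow. field. now apply Cminus_eq_contra.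
Qed.

Lemma Rcpow_nat (a : R) (K : nat) : (0 < a)%R -> Rcpow a (INR K) = RtoC a ^ K.
Proof. intros Ha. unfold Rcpow. rewrite Cexp_nat_mult, Cexp_RtoC, exp_ln; auto. Qed.

(** Since [e kappa <> 1], [gen] has no pole at 0 and [bcoef a kappa 0 = 0]. The functional equation
    at [- K] and [gen_recurrence] are then the same recurrence, solved for its newest term by
    division by [1 - e kappa]. *)
Lemma continuation_value (a kappa : R) (F : C -> C) : (1 < a)%R -> e kappa <> 1 ->
  (forall s, (1 - e kappa) * F s = Rcpow a (- s) +
     e kappa * tsum (fun i => neg_binom s (S i) * F (s + INR (S i)))) ->
  forall K, e (a * kappa) * F (- INR K) = - INR (fact K) * bcoef a kappa (S K).
Proof.
  intros Ha Hq HF K. induction K as [K IH] using (well_founded_induction lt_wf).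
  assert (hq : 1 - e kappa <> 0).
  { intros E. apply Hq. replace (e kappa) with (1 - (1 - e kappa)) by ring. rewrite E. ring. }
  assert (hd : delta kappa = 0).
  { apply delta_false. intros [n Hn]. apply Hq. rewrite Hn. apply e_IZR. }
  assert (h0 : bcoef a kappa 0 = 0).
  { destruct (gen_series a kappa) as [_ ->]. rewrite hd. ring. }
  assert (R1 := gen_recurrence a kappa K).
  unfold conv in R1. rewrite csum_S, csum_Sl, Nat.sub_diag, h0, pw_0, Nat.sub_0_r in R1.
  assert (E := HF (- INR K)).
  destruct (tsum_csum (fun i => neg_binom (- INR K) (S i) * F (- INR K + INR (S i))) K) as [_ Et].
  { intros i Hi. rewrite neg_binom_neg. destruct le_dec; [lia|ring]. }
  rewrite Et in E.
  replace (- - INR K) with (RtoC (INR K)) in E by ring. rewrite Rcpow_nat in E by lra.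
  set (S1 := csum (fun i => pw 1 (S i) * bcoef a kappa (S K - S i)) K) in R1.
  assert (Es : e (a * kappa) * csum (fun i => neg_binom (- INR K) (S i) * F (- INR K + INR (S i))) K
    = - INR (fact K) * S1).
  { unfold S1. rewrite <- !csum_scal. apply csum_ext. intros i Hi.
    replace (- INR K + INR (S i)) with (- INR (K - S i)) by (rewrite minus_INR, RtoC_minus by lia; ring).
    transitivity (neg_binom (- INR K) (S i) * (e (a * kappa) * F (- INR (K - S i)))); [ring|].
    rewrite IH by lia. rewrite neg_binom_neg. destruct le_dec; [|lia].
    replace (S K - S i)%nat with (S (K - S i)) by lia.
    unfold pw. rewrite Cpow_1_l. field. split; apply INR_fact_neq0. }
  assert (E2 : (1 - e kappa) * (e (a * kappa) * F (- INR K)) =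
    (1 - e kappa) * (- INR (fact K) * bcoef a kappa (S K))).
  { transitivity (e (a * kappa) * ((1 - e kappa) * F (- INR K))); [ring|]. rewrite E.
    transitivity (e (a * kappa) * RtoC a ^ K + e kappa * (e (a * kappa) *
      csum (fun i => neg_binom (- INR K) (S i) * F (- INR K + INR (S i))) K)); [ring|]. rewrite Es.
    replace (e (a * kappa) * RtoC a ^ K) with (INR (fact K) * (e (a * kappa) * pw a K))
      by (unfold pw; field; apply INR_fact_neq0).
    rewrite <- R1. ring. }
  replace (e (a * kappa) * F (- INR K)) with
    (/ (1 - e kappa) * ((1 - e kappa) * (e (a * kappa) * F (- INR K)))) by (field; auto).
  rewrite E2. field. auto.
Qed.

(** With [e kappa = 1] the newest coefficient cancels in [gen_recurrence], which now determines the
    one before it. This drop of the index matches the factor [s - 1] in [E], and the values are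
    taken at [1 - m]. *)
Lemma continuation_value_1 (a kappa : R) (E : C -> C) : (1 < a)%R -> e kappa = 1 ->
  (forall s, E s = Rcpow a (- (s - 1)) +
      tsum (fun i => - / INR (S (S i)) * neg_binom (s - 1) (S i) * E (s + INR (S i)))) ->
  forall m, e (a * kappa) * E (1 - INR m) = INR (fact m) * bcoef a kappa m.
Proof.
  intros Ha Hq HE m. induction m as [m IH] using (well_founded_induction lt_wf).
  assert (R1 := gen_recurrence a kappa m).
  unfold conv in R1. rewrite csum_Sl, Nat.sub_0_r, pw_0, Hq in R1.
  rewrite csum_Sl in R1.
  assert (F := HE (1 - INR m)).
  replace (1 - INR m - 1) with (- INR m) in F by ring.
  destruct (tsum_csum (fun i => - / INR (S (S i)) * neg_binom (- INR m) (S i) * E (1 - INR m + INR (S i))) m)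
    as [_ Et].
  { intros i Hi. rewrite neg_binom_neg. destruct le_dec; [lia|ring]. }
  rewrite Et in F.
  replace (- - INR m) with (RtoC (INR m)) in F by ring. rewrite Rcpow_nat in F by lra.
  set (S1 := csum (fun i => pw 1 (S (S i)) * bcoef a kappa (S m - S (S i))) m) in R1.
  assert (Es : e (a * kappa) * csum (fun i => - / INR (S (S i)) * neg_binom (- INR m) (S i) * E (1 - INR m + INR (S i))) m
    = - INR (fact m) * S1).
  { unfold S1. rewrite <- !csum_scal. apply csum_ext. intros i Hi.
    replace (1 - INR m + INR (S i)) with (1 - INR (m - S i)) by (rewrite minus_INR, RtoC_minus by lia; ring).
    transitivity (- / INR (S (S i)) * neg_binom (- INR m) (S i) * (e (a * kappa) * E (1 - INR (m - S i)))); [ring|].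
    rewrite IH by lia. rewrite neg_binom_neg. destruct le_dec; [|lia].
    replace (S m - S (S i))%nat with (m - S i)%nat by lia.
    unfold pw. rewrite Cpow_1_l, (fact_simpl (S i)), mult_INR, RtoC_mult. field.
    repeat split; try apply INR_fact_neq0. apply RtoC_S_neq0. }
  rewrite F, Cmult_plus_distr_l, Es.
  replace (e (a * kappa) * RtoC a ^ m) with (INR (fact m) * (e (a * kappa) * pw a m))
    by (unfold pw; field; apply INR_fact_neq0).
  rewrite <- R1. replace (S m - 1)%nat with m by lia.
  rewrite pw_1. ring.
Qed.

(** * Meromorphic functions and the values of psi *)

(** A local form of [entire] with free radius, as needed for the factor [/ (s - 1)] close to its
    pole. *)
Definition regular (f : C -> C) (z0 : C) : Prop :=
  exists r c M, (0 < r)%R /\ psum c r M /\ forall z, (Cmod (z - z0) <= r)%R -> f z = ps c (z - z0).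

Lemma entire_regular f z0 : entire f -> regular f z0.
Proof.
  intros H. destruct (H z0) as (M & c & Hc & E). exists 1%R, c, M.
  split; [lra|split; auto].
Qed.

Lemma regular_plus f g z0 : regular f z0 -> regular g z0 -> regular (fun z => f z + g z) z0.
Proof.
  intros (r & c & M & Hr & Hc & Ec) (s & d & N & Hs & Hd & Ed).
  assert (h1 := Rmin_l r s). assert (h2 := Rmin_r r s).
  assert (h3 : (0 < Rmin r s)%R) by (apply Rmin_glb_lt; lra).
  assert (Hc' := psum_shrink _ _ (Rmin r s) _ Hc ltac:(lra)).
  assert (Hd' := psum_shrink _ _ (Rmin r s) _ Hd ltac:(lra)).
  exists (Rmin r s), (fun n => c n + d n), (M + N)%R. split; [auto|split; [now apply psum_plus|]].
  intros z Hz. rewrite (ps_plus _ _ _ _ _ _ Hc' Hd' Hz), Ec, Ed by lra. easy.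
Qed.

Lemma regular_mult f g z0 : regular f z0 -> regular g z0 -> regular (fun z => f z * g z) z0.
Proof.
  intros (r & c & M & Hr & Hc & Ec) (s & d & N & Hs & Hd & Ed).
  assert (h1 := Rmin_l r s). assert (h2 := Rmin_r r s).
  assert (h3 : (0 < Rmin r s)%R) by (apply Rmin_glb_lt; lra).
  assert (Hc' := psum_shrink _ _ (Rmin r s) _ Hc ltac:(lra)).
  assert (Hd' := psum_shrink _ _ (Rmin r s) _ Hd ltac:(lra)).
  exists (Rmin r s), (conv c d), (M * N)%R. split; [auto|split; [now apply psum_conv|]].
  intros z Hz. rewrite (ps_conv _ _ _ _ _ _ Hc' Hd' Hz), Ec, Ed by lra. easy.
Qed.

Lemma regular_const a z0 : regular (fun _ => a) z0.
Proof. apply entire_regular. intros z. eexists. apply disc_series_const. Qed.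

Lemma regular_Rcpow (a : R) z0 : regular (fun s => Rcpow a (- s)) z0.
Proof. apply entire_regular. intros z. apply disc_series_Rcpow. Qed.

Lemma regular_linear w z0 : regular (fun z => z + w) z0.
Proof. apply entire_regular. intros z. eexists. apply disc_series_linear. Qed.

Lemma regular_inv (z0 : C) : z0 <> 1 -> regular (fun z => / (z - 1)) z0.
Proof.
  intros Hz0. assert (h0 : z0 - 1 <> 0) by now apply Cminus_eq_contra.
  assert (hp : (0 < Cmod (z0 - 1))%R) by now apply Cmod_gt_0.
  set (r := (Cmod (z0 - 1) / 2)%R). assert (hr : (0 < r)%R) by (unfold r; lra).
  set (w := - / (z0 - 1)).
  assert (hw : (Cmod w * r = / 2)%R).
  { unfold w, r. rewrite Cmod_opp, Cmod_Cinv. field. lra. }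
  set (c := fun n => / (z0 - 1) * w ^ n).
  exists r, c, (Cmod (/ (z0 - 1)) * / (1 - / 2))%R.
  split; auto. split.
  - eapply asum_le; [|apply (asum_scal (/ (z0 - 1)) _ _ (asum_geom (/ 2) ltac:(lra)))].
    intros n. unfold c. rewrite !Cmod_mult, !Cmod_pow, Rmult_assoc, <- Rpow_mult_distr.
    rewrite (Cmod_R r), (Rabs_pos_eq r), hw, Cmod_R by lra.
    rewrite (Rabs_pos_eq ((/ 2) ^ n)) by (apply pow_le; lra). lra.
  - intros z Hz. set (h := z - z0).
    assert (hwh : (Cmod (w * h) < 1)%R).
    { rewrite Cmod_mult. fold h in Hz. generalize (Cmod_ge_0 w) (Cmod_ge_0 h). nra. }
    destruct (tsum_geom (w * h) hwh) as [g1 g2].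
    unfold ps. rewrite (tsum_ext _ (fun n => / (z0 - 1) * (w * h) ^ n))
      by (intros n; unfold c; rewrite Cpow_mult_l; ring).
    rewrite (tsum_scal _ (fun n => (w * h) ^ n) g1), g2.
    assert (E : 1 - w * h = (z - 1) * / (z0 - 1)) by (unfold w, h; field; auto).
    assert (hne : z - 1 <> 0).
    { intros Ez. rewrite Ez in E. assert (w * h = 1).
      { replace (w * h) with (1 - (1 - w * h)) by ring. rewrite E. ring. }
      rewrite H, Cmod_1 in hwh. lra. }
    rewrite E. field. auto.
Qed.

Definition laurent (f : C -> C) (z0 : C) (N : nat) (c : nat -> C) (r : R) : Prop :=
  (0 < r)%R /\ (exists M, psum c r M) /\
  (forall z, (0 < Cmod (z - z0) <= r)%R -> (z - z0) ^ N * f z = ps c (z - z0)) /\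
  (N = 0%nat -> f z0 = c 0%nat) /\ (N <> 0%nat -> c 0%nat <> 0).

Lemma meromorphic_laurent f z0 : meromorphic f -> exists N c r, laurent f z0 N c r.
Proof.
  intros H. destruct (H z0) as (N & c & rho & H1 & H2 & H3).
  assert (hrho := cond_pos rho).
  assert (hz : Cmod (z0 + (rho / 2)%R - z0) = (rho / 2)%R).
  { replace (z0 + (rho / 2)%R - z0) with (RtoC (rho / 2)) by ring. rewrite Cmod_R, Rabs_pos_eq; lra. }
  exists N, c, (rho / 4)%R.
  destruct (is_pseries_psum c (z0 + (rho / 2)%R - z0) _ (rho / 4)
    (H1 (z0 + (rho / 2)%R) ltac:(rewrite hz; lra)) ltac:(rewrite hz; lra)) as [M HM].
  split; [lra|]. split; [now exists M|]. split; [|auto].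
  intros z Hz. apply (is_pseries_ps c (rho / 4) M _ _ HM); [lra|]. apply H1. lra.
Qed.

Lemma laurent_is_pseries f z0 N c r : laurent f z0 N c r ->
  exists rho : posreal, (forall z : C, (0 < Cmod (z - z0) < rho)%R ->
       @is_pseries C_AbsRing C_NormedModule c (z - z0) ((z - z0) ^ N * f z)) /\
    (N = 0%nat -> f z0 = c 0%nat) /\ (N <> 0%nat -> c 0%nat <> 0).
Proof.
  intros (Hr & [M HM] & H1 & H2 & H3). exists (mkposreal r Hr). split; [|auto].
  simpl. intros z Hz. rewrite H1 by lra. eapply ps_is_pseries; [apply HM|lra].
Qed.

Lemma regular_laurent f z0 : regular f z0 -> exists c r, laurent f z0 0 c r.
Proof.
  intros (r & c & M & Hr & Hc & E). exists c, r. split; [auto|]. split; [now exists M|].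
  split; [|split; [|easy]].
  - intros z Hz. rewrite E by lra. simpl. ring.
  - intros _. rewrite E; replace (z0 - z0) with (RtoC 0) by ring; [apply ps_at_0|].
    rewrite Cmod_0. lra.
Qed.

(** Multiplication by [(z - z0)^(N + N')] turns both functions into power series that agree at
    points tending to [z0]. *)
Lemma laurent_identity f g z0 N c r N' c' r' : laurent f z0 N c r -> laurent g z0 N' c' r' ->
  (forall eps, (0 < eps)%R -> exists z, (0 < Cmod (z - z0) < eps)%R /\ f z = g z) ->
  (forall n, conv (mono N') c n = conv (mono N) c' n) /\
  exists eps, (0 < eps)%R /\ forall z, (0 < Cmod (z - z0) < eps)%R -> f z = g z.
Proof.
  intros (Hr & [M HM] & H1 & _) (Hr' & [M' HM'] & H1' & _) Hfreq.
  set (s := Rmin r r').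
  assert (s1 := Rmin_l r r'). assert (s2 := Rmin_r r r').
  assert (s0 : (0 < Rmin r r')%R) by (apply Rmin_glb_lt; lra). fold s in s0, s1, s2.
  assert (Hc := psum_shrink _ _ s _ HM ltac:(lra)).
  assert (Hc' := psum_shrink _ _ s _ HM' ltac:(lra)).
  destruct (psum_mono N s) as [B HB]. destruct (psum_mono N' s) as [B' HB'].
  assert (P := psum_conv _ _ _ _ _ HB' Hc). assert (P' := psum_conv _ _ _ _ _ HB Hc').
  assert (E : forall z, (0 < Cmod (z - z0) <= s)%R ->
    ps (conv (mono N') c) (z - z0) = (z - z0) ^ N' * (z - z0) ^ N * f z /\
    ps (conv (mono N) c') (z - z0) = (z - z0) ^ N' * (z - z0) ^ N * g z).
  { intros z Hz. rewrite (ps_conv _ _ _ _ _ _ HB' Hc), (ps_conv _ _ _ _ _ _ HB Hc'), !ps_mono by lra.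
    rewrite <- H1, <- H1' by lra. split; ring. }
  assert (U : forall n, conv (mono N') c n = conv (mono N) c' n).
  { apply (ps_unique _ _ s _ _ P P' s0). intros eps Heps.
    destruct (Hfreq (Rmin eps s)) as (z & Hz & Ez); [now apply Rmin_glb_lt|].
    assert (e1 := Rmin_l eps s). assert (e2 := Rmin_r eps s).
    exists (z - z0). split; [lra|]. destruct (E z ltac:(lra)) as [-> ->]. now rewrite Ez. }
  split; auto. exists s. split; auto. intros z Hz.
  destruct (E z ltac:(lra)) as [E1 E2].
  assert (Eq : conv (mono N') c = conv (mono N) c') by (apply functional_extensionality; auto).
  rewrite Eq, E2 in E1.
  assert (hz : z - z0 <> 0) by (apply Cmod_gt_0; lra).
  assert (hz1 := Cpow_nz _ N hz). assert (hz2 := Cpow_nz _ N' hz).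
  replace (f z) with (/ ((z - z0) ^ N' * (z - z0) ^ N) * ((z - z0) ^ N' * (z - z0) ^ N * f z))
    by (field; auto). rewrite <- E1. field. auto.
Qed.

Definition agree_near (f g : C -> C) (z0 : C) : Prop :=
  exists eps, (0 < eps)%R /\ forall z, (0 < Cmod (z - z0) < eps)%R -> f z = g z.

(** A supremum argument along the real axis, which contains all the points where psi is evaluated.
    If [S] is the supremum of the bad points, the points to its right are good; their agreement
    accumulates at [S], so [S] is good, and with it an interval to its left. *)
Lemma meromorphic_agree_real f g : meromorphic f -> meromorphic g ->
  (forall s, (1 < Re s)%R -> f s = g s) -> forall t : R, agree_near f g t.
Proof.
  intros Hf Hg Hfg.
  assert (step : forall t : R, (forall eps, (0 < eps)%R -> exists z, (0 < Cmod (z - t) < eps)%R /\ f z = g z) ->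
    agree_near f g t).
  { intros t Ht. destruct (meromorphic_laurent f t Hf) as (N & c & r & L).
    destruct (meromorphic_laurent g t Hg) as (N' & c' & r' & L').
    apply (laurent_identity _ _ _ _ _ _ _ _ _ L L' Ht). }
  assert (near : forall t u : R, agree_near f g t -> t <> u ->
    forall eps, (0 < eps)%R -> (Rabs (t - u) < eps)%R -> exists z, (0 < Cmod (z - u) < eps)%R /\ f z = g z).
  { intros t u (d & Hd & H) Htu eps Heps Hlt.
    assert (hp : (0 < Rabs (t - u))%R) by (apply Rabs_pos_lt; lra).
    set (h := (Rmin (Rmin d (Rabs (t - u))) (eps - Rabs (t - u)) / 2)%R).
    assert (m1 := Rmin_l (Rmin d (Rabs (t - u))) (eps - Rabs (t - u))).
    assert (m2 := Rmin_r (Rmin d (Rabs (t - u))) (eps - Rabs (t - u))).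
    assert (m3 := Rmin_l d (Rabs (t - u))). assert (m4 := Rmin_r d (Rabs (t - u))).
    assert (m0 : (0 < Rmin (Rmin d (Rabs (t - u))) (eps - Rabs (t - u)))%R)
      by (repeat apply Rmin_glb_lt; lra).
    assert (hh : (0 < h /\ h < d /\ h < Rabs (t - u) /\ h < eps - Rabs (t - u))%R) by (unfold h; lra).
    exists (RtoC (t + h)). rewrite <- RtoC_minus, Cmod_R. split.
    - split.
      + apply Rabs_pos_lt. intros E. assert (t - u = - h)%R by lra.
        rewrite H0, Rabs_Ropp, Rabs_pos_eq in hh; lra.
      + replace (t + h - u)%R with ((t - u) + h)%R by ring.
        eapply Rle_lt_trans; [apply Rabs_triang|]. rewrite (Rabs_pos_eq h); lra.
    - apply H. rewrite <- RtoC_minus, Cmod_R. replace (t + h - t)%R with h by ring.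
      rewrite Rabs_pos_eq; lra. }
  assert (far : forall t : R, (1 < t)%R -> agree_near f g t).
  { intros t Ht. exists (t - 1)%R. split; [lra|]. intros z Hz. apply Hfg.
    assert (h := re_le_Cmod (z - t)). unfold Cminus in h at 1. rewrite Re_plus, Re_opp, Re_RtoC in h.
    assert (h' : (Rabs (Re z + - t) < t - 1)%R) by lra. apply Rabs_lt_between in h'. lra. }
  intros t. apply NNPP; intros Hbad.
  destruct (completeness (fun u => ~ agree_near f g u)) as [S [HS1 HS2]].
  { exists 2%R. intros u Hu. apply Rnot_lt_le; intros Hlt. apply Hu, far. lra. }
  { now exists t. }
  assert (HSa : agree_near f g S).
  { apply step. intros eps Heps.
    assert (Ha : agree_near f g (S + eps / 2)%R).
    { apply NNPP; intros Hn. specialize (HS1 _ Hn). lra. }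
    apply (near (S + eps / 2)%R S Ha); [lra|auto|].
    replace (S + eps / 2 - S)%R with (eps / 2)%R by ring. rewrite Rabs_pos_eq; lra. }
  destruct HSa as (d & Hd & HSd).
  assert (S <= S - d)%R; [|lra]. apply HS2. intros u Hu.
  apply Rnot_lt_le; intros Hlt. apply Hu.
  destruct (Req_dec u S) as [->|Hne]; [exists d; auto|].
  assert (huS : (u < S)%R). { specialize (HS1 u Hu). lra. }
  exists (Rmin (d - (S - u)) (S - u)). split; [apply Rmin_glb_lt; lra|].
  assert (m1 := Rmin_l (d - (S - u)) (S - u)). assert (m2 := Rmin_r (d - (S - u)) (S - u)).
  intros z Hz. apply HSd.
  assert (t1 : (Cmod (z - S) <= Cmod (z - u) + (S - u))%R).
  { replace (S - u)%R with (Cmod (RtoC (u - S))) by (rewrite Cmod_R, Rabs_left; lra).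
    replace (z - S) with ((z - u) + RtoC (u - S)) by (rewrite RtoC_minus; ring). apply Cmod_triangle. }
  assert (t2 : (S - u <= Cmod (z - S) + Cmod (z - u))%R).
  { replace (S - u)%R with (Cmod (RtoC (S - u))) by (rewrite Cmod_R, Rabs_pos_eq; lra).
    rewrite <- (Cmod_opp (z - S)).
    replace (RtoC (S - u)) with (- (z - S) + (z - u)) by (rewrite RtoC_minus; ring). apply Cmod_triangle. }
  lra.
Qed.

(** The exclusion of removable singularities in [meromorphic] is decisive: a positive order [N']
    would force [c' 0 = 0], so the order is 0 and the value of [g] is the constant coefficient. *)
Lemma regular_value f g (t : R) : meromorphic g -> regular f t -> agree_near f g t -> g t = f t.
Proof.
  intros Hg Hf (d & Hd & Ha).
  destruct (regular_laurent f t Hf) as (c & r & L).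
  destruct (meromorphic_laurent g t Hg) as (N' & c' & r' & L').
  destruct (laurent_identity _ _ _ _ _ _ _ _ _ L L') as [U _].
  { intros eps Heps. assert (m0 : (0 < Rmin d eps)%R) by now apply Rmin_glb_lt.
    assert (m1 := Rmin_l d eps). assert (m2 := Rmin_r d eps).
    exists (RtoC (t + Rmin d eps / 2)).
    assert (E : Cmod (RtoC (t + Rmin d eps / 2) - t) = (Rmin d eps / 2)%R).
    { rewrite <- RtoC_minus, Cmod_R. replace (t + Rmin d eps / 2 - t)%R with (Rmin d eps / 2)%R by ring.
      rewrite Rabs_pos_eq; lra. }
    split; [rewrite E; lra|]. apply Ha. rewrite E; lra. }
  specialize (U 0%nat). rewrite !conv_mono in U. simpl in U.
  destruct L as (_ & _ & _ & Lf & _). destruct L' as (_ & _ & _ & Lg & Lg').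
  destruct N' as [|N']; simpl in U.
  - now rewrite Lg, Lf by easy.
  - exfalso. now apply Lg'.
Qed.

(** * Existence, uniqueness and special values of psi *)

Lemma shifted_sum_dirichlet (gamma kappa : R) (s : C) : (1 < Re s)%R ->
  shifted_sum gamma (fun x => e (x * kappa) * Rcpow x (- s)) =
  e (least_pos gamma * kappa) * Rcpow (least_pos gamma) (- s)
  + e ((least_pos gamma + 1)%R * kappa) * dser (least_pos gamma + 1) (e kappa) s.
Proof.
  intros Hs. assert (hl := least_pos_bounds gamma). unfold shifted_sum.
  set (f := fun i : nat => e ((least_pos gamma + INR i)%R * kappa) * Rcpow (least_pos gamma + INR i) (- s)).
  transitivity (CSeries f).
  { f_equal. apply functional_extensionality. intros i. unfold f.
    replace (gamma + IZR (up (- gamma) + Z.of_nat i))%R with (least_pos gamma + INR i)%R; [easy|].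
    unfold least_pos. rewrite plus_IZR, <- INR_IZR_INZ. ring. }
  assert (Hf : summable f).
  { eapply summable_dom; [|eexists; apply (asum_Rpower (least_pos gamma) (Re s)); lra].
    intros n. cbv beta. unfold f. rewrite Cmod_mult, Cmod_e_mult, Cmod_Rcpow. lra. }
  rewrite CSeries_tsum by auto. destruct (tsum_Sl f Hf) as [h1 ->].
  f_equal.
  - unfold f. simpl INR. now rewrite Rplus_0_r.
  - unfold dser. rewrite <- tsum_scal.
    + apply tsum_ext. intros n. unfold f. rewrite Cmult_assoc, <- e_nat_mult, <- e_plus.
      rewrite !S_INR. f_equal.
      * f_equal. rewrite !RtoC_plus. ring.
      * f_equal. ring.
    + apply dser_summable; [lra|apply Cmod_e|auto].
Qed.

Lemma psi_continuation_exists (gamma kappa : R) : exists f,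
  is_psi_continuation gamma kappa f /\ forall K : nat, regular f (- INR K)%R /\
    f (- INR K)%R = - INR (fact K) * bcoef (least_pos gamma) kappa (S K).
Proof.
  assert (hl := least_pos_bounds gamma). set (a0 := least_pos gamma) in *. set (a := (a0 + 1)%R).
  assert (Ha : (1 < a)%R) by (unfold a; lra).
  (* Adding the first term of the series moves the argument of [bcoef] from [a0 + 1] back to [a0],
     by [bcoef_succ]. *)
  assert (Hval : forall (K : nat) v, v = - INR (fact K) * bcoef a kappa (S K) ->
    e (a0 * kappa) * Rcpow a0 (- (- INR K)%R) + v = - INR (fact K) * bcoef a0 kappa (S K)).
  { intros K v ->. unfold a. rewrite bcoef_succ, RtoC_opp.
    replace (- - INR K) with (RtoC (INR K)) by ring. rewrite Rcpow_nat by lra.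
    unfold pw. field. apply INR_fact_neq0. }
  destruct (classic (e kappa = 1)) as [Hq|Hq].
  - destruct (dser_continuation_1 a Ha) as (E & E1 & E2 & E3).
    assert (EV := continuation_value_1 a kappa E Ha Hq E3).
    set (f := fun s => e (a0 * kappa) * Rcpow a0 (- s) + e (a * kappa) * (E s * / (s - 1))).
    assert (Hreg : forall z0 : C, z0 <> 1 -> regular f z0).
    { intros z0 Hz0. unfold f. apply regular_plus; apply regular_mult; try apply regular_const.
      - apply regular_Rcpow.
      - apply regular_mult; [now apply entire_regular|now apply regular_inv]. }
    exists f. split; [split|].
    + intros z0. destruct (classic (z0 = 1)) as [->|Hz0].
      (* [g] is [(s - 1) f]. Its value at 1 is [e (a * kappa)], by [continuation_value_1] with
         [m = 0], and is not 0; so the order of the pole is exactly 1, as [meromorphic] demands. *)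
      * set (g := fun s => e (a0 * kappa) * ((s + - (1)) * Rcpow a0 (- s)) + e (a * kappa) * E s).
        assert (Hg : regular g 1).
        { unfold g. apply regular_plus; apply regular_mult; try apply regular_const.
          - apply regular_mult; [apply regular_linear|apply regular_Rcpow].
          - now apply entire_regular. }
        destruct Hg as (r & c & M & Hr & Hc & Ec).
        exists 1%nat, c. apply (laurent_is_pseries f 1 1 c r).
        split; [auto|split; [now exists M|]]. split; [|split; [easy|]].
        -- intros z Hz. rewrite <- Ec by lra. unfold f, g.
           assert (hz : z - 1 <> 0) by (apply Cmod_gt_0; lra). simpl. field. auto.
        -- intros _. assert (h := Ec 1). replace (1 - 1) with (RtoC 0) in h by ring.
           rewrite ps_at_0 in h. rewrite <- h by (rewrite Cmod_0; lra).
           assert (v := EV 0%nat). simpl INR in v. replace (1 - 0) with (RtoC 1) in v by ring.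
           unfold g. rewrite v. destruct (gen_series a kappa) as [_ ->].
           assert (hd : delta kappa = 1).
           { destruct (e_eq_1 kappa Hq) as [n Hn]. now apply (delta_true _ n). }
           rewrite hd. replace (1 + - (1)) with (RtoC 0) by ring.
           replace (e (a0 * kappa) * (0 * Rcpow a0 (- (1))) + 1 * (1 * e (a * kappa)))
             with (e (a * kappa)) by ring. apply e_neq0.
      * destruct (regular_laurent f z0 (Hreg z0 Hz0)) as (c & r & L).
        exists 0%nat, c. now apply (laurent_is_pseries f z0 0 c r).
    + intros s Hs. rewrite shifted_sum_dirichlet by auto. fold a0 a. rewrite Hq.
      unfold f. rewrite E2 by auto. f_equal.
      assert (hs : s - 1 <> 0).
      { apply Cminus_eq_contra. intros ->. simpl in Hs. lra. }
      field. auto.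
    + intros K.
      assert (hK : (0 < INR (S K))%R) by (apply lt_0_INR; lia). rewrite S_INR in hK.
      assert (hne : RtoC (- INR K) <> 1) by (intros H; apply RtoC_inj in H; lra).
      split; [now apply Hreg|].
      unfold f. apply Hval.
      assert (v := EV (S K)). rewrite S_INR, RtoC_plus in v.
      replace (1 - (INR K + 1)) with (RtoC (- INR K)) in v by (rewrite RtoC_opp; ring).
      transitivity ((e (a * kappa) * E (- INR K)%R) / ((- INR K)%R - 1)); [unfold Cdiv; ring|].
      rewrite v, fact_simpl, mult_INR, S_INR, RtoC_mult, RtoC_plus, RtoC_opp. field.
      rewrite <- RtoC_opp. now apply Cminus_eq_contra.
  - destruct (dser_continuation a (e kappa) Ha (Cmod_e kappa) Hq) as (F & F1 & F2 & F3).
    assert (FV := continuation_value a kappa F Ha Hq (fun s => proj2 (F3 s))).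
    set (f := fun s => e (a0 * kappa) * Rcpow a0 (- s) + e (a * kappa) * F s).
    assert (Hreg : forall z0, regular f z0).
    { intros z0. unfold f. apply regular_plus; apply regular_mult; try apply regular_const.
      - apply regular_Rcpow.
      - now apply entire_regular. }
    exists f. split; [split|].
    + intros z0. destruct (regular_laurent f z0 (Hreg z0)) as (c & r & L).
      exists 0%nat, c. now apply (laurent_is_pseries f z0 0 c r).
    + intros s Hs. rewrite shifted_sum_dirichlet by auto. fold a0 a.
      unfold f. now rewrite F2 by auto.
    + intros K. split; [apply Hreg|]. unfold f. apply Hval. rewrite <- FV.
      now rewrite RtoC_opp.
Qed.

Lemma psi_spec gamma kappa : is_psi_continuation gamma kappa (fun r => psi r gamma kappa).
Proof.
  destruct (psi_continuation_exists gamma kappa) as (f & Hf & _).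
  exact (epsilon_spec (inhabits (fun _ : C => RtoC 0)) (is_psi_continuation gamma kappa)
    (ex_intro _ f Hf)).
Qed.

(** [psi] is an arbitrary choice among continuations. It agrees with the constructed one near every
    real point, and where the latter is regular the value is forced. *)
Lemma psi_neg (gamma kappa : R) (K : nat) :
  psi (- INR K)%R gamma kappa = - INR (fact K) * bcoef (least_pos gamma) kappa (S K).
Proof.
  destruct (psi_continuation_exists gamma kappa) as (f & [Hf1 Hf2] & Hf3).
  destruct (psi_spec gamma kappa) as [Hp1 Hp2]. destruct (Hf3 K) as [Hreg Hval].
  rewrite <- Hval. apply (regular_value f (fun r => psi r gamma kappa)); auto.
  apply meromorphic_agree_real; auto. intros s Hs. now rewrite Hf2, Hp2.
Qed.

Lemma psi_ge2 (gamma kappa : R) (k : Z) : (2 <= k)%Z ->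
  summable (fun i : nat => e ((least_pos gamma + INR i)%R * kappa) * / Czpow (least_pos gamma + INR i)%R k) /\
  psi (IZR k) gamma kappa =
    tsum (fun i : nat => e ((least_pos gamma + INR i)%R * kappa) * / Czpow (least_pos gamma + INR i)%R k).
Proof.
  intros Hk. assert (hl := least_pos_bounds gamma).
  assert (hk : (1 < Re (IZR k))%R) by (simpl; apply IZR_le in Hk; lra).
  set (f := fun i : nat => e ((least_pos gamma + INR i)%R * kappa) * Rcpow (least_pos gamma + INR i) (- IZR k)).
  assert (E : forall i, f i = e ((least_pos gamma + INR i)%R * kappa) * / Czpow (least_pos gamma + INR i)%R k).
  { intros i. unfold f. rewrite Rcpow_Czpow; [easy|]. generalize (pos_INR i). lra. }
  assert (Hf : summable f).
  { eapply summable_dom; [|eexists; apply (asum_Rpower (least_pos gamma) (Re (IZR k))); lra].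
    intros n. cbv beta. unfold f. rewrite Cmod_mult, Cmod_e_mult, Cmod_Rcpow. lra. }
  split; [eapply summable_ext; [apply E|auto]|].
  rewrite <- (tsum_ext _ _ E), <- CSeries_tsum by auto.
  destruct (psi_spec gamma kappa) as [_ Hp2]. rewrite Hp2 by auto.
  unfold shifted_sum. f_equal. apply functional_extensionality. intros i. unfold f.
  replace (gamma + IZR (up (- gamma) + Z.of_nat i))%R with (least_pos gamma + INR i)%R; [easy|].
  unfold least_pos. rewrite plus_IZR, <- INR_IZR_INZ. ring.
Qed.

(** * Reciprocity for k <= 0 *)

(** The correction in [gzb] removes exactly the limit 1 found for integral [beta], so the decay is
    exponential in both directions in every case. *)
Lemma gzb_decay (nu mu beta : R) (tau : C) : (0 < Re tau)%R ->
  exists K d, (0 <= K)%R /\ (0 < d)%R /\ forall n, let y := (IZR n - mu)%R in y <> 0%R ->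
    (Cmod (gzb nu beta tau y) <= K * exp (- d * Rabs y))%R.
Proof.
  intros Htau. assert (hp := PI_RGT_0). destruct (base_fp beta) as [h1 h2].
  destruct (gz_decay nu mu (frac_part beta) tau Htau ltac:(lra)) as (K & HK & H).
  assert (hc : (0 < 2 * PI * Re tau)%R) by nra.
  destruct (classic (is_int beta)) as [Hb|Hb].
  - exists K, (2 * PI * Re tau)%R. split; [auto|split; [auto|]]. intros n y Hy.
    destruct (H n Hy) as [_ H2]. destruct Hb as [m Hm]. unfold gzb. rewrite (delta_true _ _ Hm), Cmult_1_l.
    apply H2. apply frac_part_eq0. now exists m.
  - exists K, (2 * PI * Re tau * Rmin (frac_part beta) (1 - frac_part beta))%R.
    assert (hX : (0 < frac_part beta)%R).
    { destruct (Req_dec (frac_part beta) 0) as [E|E]; [|lra]. now apply frac_part_eq0 in E. }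
    split; [auto|split; [apply Rmult_lt_0_compat; [auto|apply Rmin_glb_lt; lra]|]]. intros n y Hy.
    destruct (H n Hy) as [H1 _]. unfold gzb. rewrite (delta_false _ Hb).
    replace (gz nu (frac_part beta) tau y - 0 * pos_ind y) with (gz nu (frac_part beta) tau y) by ring.
    now apply H1.
Qed.

(** The content of the braces in the theorem. The braces on the other side are the same expression
    at [(- beta, alpha, - nu, mu)], so each formula relates two values of one function. *)
Definition brace (k : Z) (alpha beta mu nu : R) (tau : C) : C :=
  delta beta * psi (IZR k) (- mu) alpha + bsum k alpha beta mu nu tau.

(** Summing [y^K (2 PI i z)^K / K!] over [K] gives [e (y z)]: the values at all [k = - K] are packed
    into one displacement of [alpha] by the complex number [z]. *)
Lemma bsum_series (alpha beta mu nu : R) (tau : C) : (0 < Re tau)%R ->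
  exists r M, (0 < r)%R /\
    psum (fun K => pw (2 * PI * Ci) K * bsum (- Z.of_nat K) alpha beta mu nu tau) r M /\
    forall z, (Cmod z <= r)%R ->
      let f := fun n => let y := (IZR n - mu)%R in
        indic (y <> 0%R) * (e (y * (alpha + z)) * gzb nu beta tau y) in
      summable f /\
      tsum f = ps (fun K => pw (2 * PI * Ci) K * bsum (- Z.of_nat K) alpha beta mu nu tau) z.
Proof.
  intros Htau. assert (hp := PI_RGT_0).
  destruct (gzb_decay nu mu beta tau Htau) as (K & d & HK & Hd & H).
  set (y := fun n => (IZR n - mu)%R).
  set (c := fun n => indic (y n <> 0%R) * (e (y n * alpha) * gzb nu beta tau (y n))).
  set (lam := fun n => 2 * PI * Ci * y n).
  set (r := (d / (4 * PI))%R). assert (hr : (0 < r)%R) by (apply Rdiv_lt_0_compat; lra).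
  assert (Hlam : forall n, Cmod (lam n) = (2 * PI * Rabs (y n))%R).
  { intros n. unfold lam. rewrite !Cmod_mult, Cmod_Ci, !Cmod_R, (Rabs_pos_eq 2), (Rabs_pos_eq PI) by lra. ring. }
  assert (HS : summable (fun n => c n * RtoC (exp (r * Cmod (lam n))))).
  { eapply summable_le; [|apply (summable_scal (RtoC K) _ (summable_exp_Z (d / 2) mu ltac:(lra)))].
    intros n. cbv beta. fold (y n). rewrite Hlam. unfold c.
    destruct (Req_dec (y n) 0) as [Hn|Hn].
    - rewrite indic_false by lra. rewrite !Cmult_0_l, Cmod_0. apply Cmod_ge_0.
    - rewrite indic_true, Cmult_1_l by auto. specialize (H n Hn). fold (y n) in H.
      rewrite !Cmod_mult, Cmod_e_mult, Rmult_1_l, !Cmod_R.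
      rewrite !(Rabs_pos_eq (exp _)) by (left; apply exp_pos). rewrite (Rabs_pos_eq K) by auto.
      replace (exp (- (d / 2) * Rabs (y n)))%R with (exp (- d * Rabs (y n)) * exp (r * (2 * PI * Rabs (y n))))%R.
      + rewrite <- (Rmult_assoc K). apply Rmult_le_compat_r; [left; apply exp_pos|exact H].
      + rewrite <- exp_plus. f_equal. unfold r. field. lra. }
  destruct HS as [B HB]. destruct (exp_sum c lam r B hr HB) as (f1 & f2 & f3).
  assert (EF : (fun K => tsum (fun n => c n * pw (lam n) K)) =
    (fun K => pw (2 * PI * Ci) K * bsum (- Z.of_nat K) alpha beta mu nu tau)).
  { apply functional_extensionality. intros m.
    destruct (bsum_Z tau Htau (- Z.of_nat m) alpha beta mu nu) as [s1 <-].
    rewrite <- tsum_scal by auto. apply tsum_ext. intros n. cbv beta. fold (y n). unfold c, lam.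
    rewrite Czpow_opp_of_nat, Cinv_inv. unfold pw. rewrite Cpow_mult_l. unfold Cdiv. ring. }
  rewrite EF in f1. exists r, B. split; [auto|split; [auto|]]. intros z Hz f.
  destruct (f2 z Hz) as [u1 u2]. rewrite EF in u2.
  assert (E : forall n, c n * Cexp (lam n * z) = f n).
  { intros n. unfold c, f, lam. fold (y n).
    replace (Cexp (2 * PI * Ci * y n * z)) with (e (y n * z)) by (unfold e; f_equal; ring).
    rewrite Cmult_plus_distr_l, e_plus. ring. }
  split; [eapply summable_ext; [apply E|exact u1]|]. now rewrite <- u2, <- (tsum_ext _ _ E).
Qed.

(** [psi_neg] makes the values at [- K] the coefficients of [- gen] in the variable [2 PI i z]; the
    term of [gen] with [bcoef] of index 0 is the polar part shown separately. *)
Lemma psi_series (gamma kappa : R) :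
  exists r M, (0 < r)%R /\
    psum (fun K => pw (2 * PI * Ci) K * psi (IZR (- Z.of_nat K)) gamma kappa) r M /\
    forall z, (0 < Cmod z <= r)%R ->
      e (kappa + z) <> 1 /\
      e (least_pos gamma * (kappa + z)) / (1 - e (kappa + z)) =
      - delta kappa * e (least_pos gamma * kappa) / (2 * PI * Ci * z)
      + ps (fun K => pw (2 * PI * Ci) K * psi (IZR (- Z.of_nat K)) gamma kappa) z.
Proof.
  assert (hp := PI_RGT_0). set (q := 2 * PI * Ci).
  assert (q0 : q <> 0) by apply two_pi_i_neq0.
  destruct (gen_series (least_pos gamma) kappa) as [(r & M & Hr & HM & H) H0].
  set (d := bcoef (least_pos gamma) kappa) in *.
  assert (hq : (0 < Cmod q)%R) by now apply Cmod_gt_0.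
  set (r1 := (r / Cmod q)%R). assert (hr1 : (0 < r1)%R) by now apply Rdiv_lt_0_compat.
  assert (hqr : (r1 * Cmod q = r)%R) by (unfold r1; field; lra).
  assert (EF : forall K, pw q K * psi (IZR (- Z.of_nat K)) gamma kappa = - (d (S K) * q ^ K)).
  { intros K. rewrite opp_IZR, <- INR_IZR_INZ, psi_neg. fold d. unfold pw. field. apply INR_fact_neq0. }
  destruct (ps_Sl d r M 0 HM Hr) as [HS _]; [rewrite Cmod_0; lra|].
  assert (HP : psum (fun K => - (d (S K) * q ^ K)) r1 (M / r)).
  { eapply asum_le; [|exact HS]. intros n. cbv beta.
    rewrite !Cmod_mult, Cmod_opp, !Cmod_mult, !Cmod_pow, !Cmod_R, !Rabs_pos_eq by lra.
    rewrite <- hqr, Rpow_mult_distr. right. ring. }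
  exists r1, (M / r)%R. split; [auto|]. split.
  { eapply asum_le; [|exact HP]. intros n. cbv beta. rewrite EF. lra. }
  intros z Hz.
  assert (hqz : (0 < Cmod (q * z) <= r)%R) by (rewrite Cmod_mult; nra).
  assert (hz0 : z <> 0) by (apply Cmod_gt_0; lra).
  destruct (H (q * z) hqz) as [h1 h2].
  assert (E : e (kappa + z) = e kappa * Cexp (q * z)) by (rewrite e_plus; unfold e, q; reflexivity).
  rewrite E. split; [auto|].
  destruct (ps_Sl d r M (q * z) HM Hr ltac:(lra)) as [_ h3].
  rewrite h3, H0 in h2.
  assert (E2 : e (least_pos gamma * (kappa + z)) = e (least_pos gamma * kappa) * Cexp (least_pos gamma * (q * z))).
  { rewrite Cmult_plus_distr_l, e_plus. f_equal. unfold e, q. f_equal. ring. }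
  rewrite E2.
  assert (E3 : ps (fun K => pw q K * psi (IZR (- Z.of_nat K)) gamma kappa) z =
    - ps (fun n => d (S n)) (q * z)).
  { unfold ps. rewrite <- tsum_opp.
    - apply tsum_ext. intros n. rewrite EF, Cpow_mult_l. ring.
    - exists (M / r)%R. apply (psum_asum _ r); [auto|lra]. }
  rewrite E3.
  assert (h4 : e kappa * Cexp (q * z) - 1 <> 0) by now apply Cminus_eq_contra.
  assert (h5 : 1 - e kappa * Cexp (q * z) <> 0).
  { intros h. apply h4. transitivity (- (1 - e kappa * Cexp (q * z))); [ring|rewrite h; ring]. }
  assert (h6 : ps (fun n => d (S n)) (q * z) =
    (q * z * gen (least_pos gamma) kappa (q * z) - delta kappa * e (least_pos gamma * kappa)) / (q * z)).
  { rewrite h2. field. auto. }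
  rewrite h6. unfold gen. field. auto.
Qed.

Lemma positive_sum (G : R -> C) (mu : R) : summable (fun i => G (least_pos (- mu) + INR i)%R) ->
  let g := fun n => let y := (IZR n - mu)%R in indic (y <> 0%R) * (G y * pos_ind y) in
  summable g /\ tsum g = tsum (fun i => G (least_pos (- mu) + INR i)%R).
Proof.
  intros HG g.
  assert (g0 : forall n, IZR n = mu -> g n = 0).
  { intros n Hn. unfold g. rewrite indic_false; [ring|]. rewrite Hn. lra. }
  assert (Eup : forall i, G (least_pos (- mu) + INR i)%R = g (up mu + Z.of_nat i)%Z).
  { intros i. unfold g. rewrite up_sub. assert (h1 := least_pos_bounds (- mu)). assert (h2 := pos_INR i).
    rewrite indic_true by lra. unfold pos_ind. destruct Rlt_dec; [ring|lra]. }
  assert (Edn : forall i, g (- up (- mu) - Z.of_nat i)%Z = 0).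
  { intros i. unfold g. rewrite down_sub. assert (h1 := least_pos_bounds mu). assert (h2 := pos_INR i).
    unfold pos_ind. destruct Rlt_dec; [lra|ring]. }
  destruct (tsum_Z_sign g mu g0) as [t1 t2].
  assert (Sg : summable g).
  { apply t1; [eapply summable_ext; [apply Eup|exact HG]|]. exists 0%R. now apply asum_zero. }
  split; auto. rewrite (t2 Sg), <- (tsum_ext _ _ Eup), (tsum_ext _ _ Edn).
  replace (tsum (fun _ : nat => RtoC 0)) with (RtoC 0) by (symmetry; apply has_sum_tsum, has_sum_0).
  ring.
Qed.

(** For [Im w > 0] the sum over positive [y] converges and is geometric. This gives the generating
    function of the divergent series behind [psi (- K)] as an honest sum. *)
Lemma positive_exp_sum (mu : R) (w : C) : (0 < Im w)%R ->
  let g := fun n => let y := (IZR n - mu)%R in indic (y <> 0%R) * (e (y * w) * pos_ind y) in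
  summable g /\ tsum g = e (least_pos (- mu) * w) / (1 - e w).
Proof.
  intros Hw. assert (hp := PI_RGT_0).
  assert (hq : (Cmod (e w) < 1)%R).
  { unfold e. rewrite Cmod_Cexp, <- exp_0. apply exp_increasing. reim. nra. }
  destruct (tsum_geom (e w) hq) as [s1 s2].
  assert (E : forall i, e (least_pos (- mu) * w) * e w ^ i = e ((least_pos (- mu) + INR i)%R * w)).
  { intros i. now rewrite RtoC_plus, Cmult_plus_distr_r, e_plus, e_nat_mult. }
  destruct (positive_sum (fun y => e (y * w)) mu) as [u1 u2].
  { eapply summable_ext; [apply E|]. exact (summable_scal _ (fun n => e w ^ n) s1). }
  split; [exact u1|].
  rewrite u2, <- (tsum_ext _ _ E), (tsum_scal _ (fun n => e w ^ n) s1), s2. reflexivity.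
Qed.

(** The displacement [h] in the second argument of [gz] yields [e (y t h)], which merges with
    [e (y u)] into [e (y z)]. The term missing in [gzb] for integral [beta] gives the sum over
    positive [y], convergent because [Im z = h Re tau > 0]; it contributes the psi values and the
    pole. *)
Lemma ms0_expansion (alpha beta mu nu : R) (tau : C) : (0 < Re tau)%R ->
  exists r M, (0 < r)%R /\
    psum (fun K => pw (2 * PI * Ci) K * brace (- Z.of_nat K) alpha beta mu nu tau) r M /\
    forall u h : R, let z := u + Ci * tau * h in
      (0 < h)%R -> (Cmod z <= r)%R ->
      tsum (ms 0 (alpha + u) (frac_part beta + h) mu nu tau) =
      e (alpha * mu + u * mu + h * nu) *
        (ps (fun K => pw (2 * PI * Ci) K * brace (- Z.of_nat K) alpha beta mu nu tau) z
         - delta beta * delta alpha * e (least_pos (- mu) * alpha) / (2 * PI * Ci * z)).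
Proof.
  intros Htau. assert (hp := PI_RGT_0).
  destruct (bsum_series alpha beta mu nu tau Htau) as (r1 & M1 & Hr1 & P1 & H1).
  destruct (psi_series (- mu) alpha) as (r2 & M2 & Hr2 & P2 & H2).
  set (F1 := fun K => _) in P1. set (F2 := fun K => _) in P2. fold F1 in H1. fold F2 in H2.
  set (r := Rmin r1 r2). assert (hr : (0 < r)%R) by now apply Rmin_glb_lt.
  assert (hl := Rmin_l r1 r2). assert (hrr := Rmin_r r1 r2). fold r in hl, hrr.
  assert (EF : (fun K => pw (2 * PI * Ci) K * brace (- Z.of_nat K) alpha beta mu nu tau) =
    (fun K => F1 K + delta beta * F2 K)).
  { apply functional_extensionality. intros K. unfold brace, F1, F2. ring. }
  rewrite EF.
  assert (Q1 := psum_shrink _ _ r _ P1 ltac:(lra)). assert (Q2 := psum_shrink _ _ r _ P2 ltac:(lra)).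
  assert (Q3 := psum_scal (delta beta) _ _ _ Q2).
  exists r, (M1 + Cmod (delta beta) * M2)%R. split; [auto|]. split; [now apply psum_plus|].
  intros u h z Hh Hz.
  assert (hIm : Im z = (h * Re tau)%R) by (unfold z; reim; ring).
  assert (hz0 : z <> 0) by (intros E; rewrite E in hIm; simpl in hIm; nra).
  assert (hzp : (0 < Cmod z <= r2)%R) by (split; [now apply Cmod_gt_0|lra]).
  destruct (H1 z ltac:(lra)) as [u1 u2]. set (f := fun n => _) in u1, u2.
  destruct (H2 z hzp) as [_ v].
  destruct (positive_exp_sum mu (alpha + z)) as [w1 w2].
  { rewrite Im_plus, hIm, Im_RtoC. nra. }
  set (g := fun n => _) in w1, w2.
  rewrite (ps_plus F1 (fun K => delta beta * F2 K) r _ _ z Q1 Q3 Hz), (ps_scal _ F2 r _ z Q2 Hz).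
  rewrite <- u2.
  set (Y := frac_part beta).
  assert (E : forall n, e (alpha * mu + u * mu + h * nu) * (f n + delta beta * g n) =
    ms 0 (alpha + u) (Y + h) mu nu tau n).
  { intros n. unfold ms, f, g. set (y := (IZR n - mu)%R).
    destruct (Req_dec y 0) as [Hy|Hy]; [rewrite !indic_false by lra; ring|].
    rewrite !indic_true by auto.
    assert (E1 : gz nu (Y + h) tau y = e (h * nu) * e (y * (Ci * tau * h)) *
      (gzb nu beta tau y + delta beta * pos_ind y)).
    { unfold gzb. fold Y.
      replace (gz nu Y tau y - delta beta * pos_ind y + delta beta * pos_ind y) with (gz nu Y tau y) by ring.
      unfold gz, gen. rewrite RtoC_plus.
      replace ((Y + h) * nu) with (h * nu + Y * nu) by ring.
      replace ((Y + h) * (- (2 * PI) * tau * y)) with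
        (2 * PI * Ci * (y * (Ci * tau * h)) + Y * (- (2 * PI) * tau * y)).
      - rewrite e_plus, Cexp_plus. fold (e (y * (Ci * tau * h))). unfold Cdiv. ring.
      - transitivity ((Ci * Ci) * (2 * PI * tau * y * h) + Y * (- (2 * PI) * tau * y)); [ring|].
        rewrite Ci2. ring. }
    rewrite E1.
    replace (e ((alpha + u)%R * IZR n)) with (e (alpha * mu + u * mu) * e (y * (alpha + u))).
    - unfold z. rewrite (e_plus (alpha * mu + u * mu)).
      replace (y * (alpha + (u + Ci * tau * h))) with (y * (alpha + u) + y * (Ci * tau * h)) by ring.
      rewrite (e_plus (y * (alpha + u))). simpl Cpow. ring.
    - rewrite <- e_plus. f_equal. unfold y. rewrite RtoC_minus, RtoC_plus. ring. }
  rewrite <- (tsum_ext _ _ E), tsum_scal.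
  2:{ apply summable_plus; [exact u1|]. now apply summable_scal. }
  rewrite tsum_plus, tsum_scal, w2, v by (try apply summable_scal; auto).
  unfold Cdiv. ring.
Qed.

Lemma ms_int_shift (k : nat) (alpha alpha' X mu nu : R) (tau : C) (m : Z) : alpha = (alpha' + IZR m)%R ->
  forall n, ms k alpha X mu nu tau n = ms k alpha' X mu nu tau n.
Proof.
  intros -> n. unfold ms. do 3 f_equal.
  rewrite RtoC_plus, Cmult_plus_distr_r, e_plus, <- (RtoC_mult (IZR m)), <- mult_IZR, e_IZR. ring.
Qed.

Lemma delta_opp beta : delta (- beta) = delta beta.
Proof.
  destruct (classic (is_int beta)) as [[n Hn]|Hn].
  - rewrite (delta_true beta n Hn). apply (delta_true _ (- n)). rewrite opp_IZR. lra.
  - rewrite (delta_false _ Hn). apply delta_false. intros [n Hm]. apply Hn. exists (- n)%Z.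
    rewrite opp_IZR. lra.
Qed.

Lemma e_least_pos (x gamma : R) : is_int x -> e (least_pos gamma * x) = e (gamma * x).
Proof.
  intros [n ->]. unfold least_pos. rewrite RtoC_plus, Cmult_plus_distr_r, e_plus, <- (RtoC_mult (IZR _) (IZR n)),
    <- mult_IZR, e_IZR. ring.
Qed.

(** For integral [alpha] and [beta] the shift hidden in [least_pos] is invisible to the character,
    and the exponentials cancel on each side. This equality makes the two poles at [z = 0]
    cancel. *)
Lemma kronecker_poles (alpha beta mu nu : R) :
  delta beta * delta alpha * e (beta * nu) * e (least_pos (- - nu) * (- beta)%R) =
  delta beta * delta alpha * e (alpha * mu) * e (least_pos (- mu) * alpha).
Proof.
  destruct (classic (is_int alpha)) as [Ha|Ha]; [|rewrite (delta_false _ Ha); ring].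
  destruct (classic (is_int beta)) as [[n Hb]|Hb]; [|rewrite (delta_false _ Hb); ring].
  rewrite (e_least_pos alpha) by auto.
  rewrite (e_least_pos (- beta)) by (exists (- n)%Z; rewrite opp_IZR; lra).
  rewrite <- !Cmult_assoc, <- !e_plus. do 3 f_equal. rewrite Ropp_involutive, !RtoC_opp. ring.
Qed.

(** In the displaced reciprocity term of order 0 the increments of the two coefficients of index 1
    combine to a multiple of [h (1 + t)]: apart from a common exponential it is [R0 + R1 z]. This is
    why nothing remains on the right for [K >= 2]. *)
Lemma kronecker (alpha beta mu nu : R) (tau : C) (K : nat) : (0 < Re tau)%R ->
  e (alpha * mu) * brace (- Z.of_nat K) alpha beta mu nu tau
  + / (Ci * tau) * (- / (Ci * tau)) ^ K *
    (e (beta * nu) * brace (- Z.of_nat K) (- beta) alpha (- nu) mu (/ tau)) =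
  / pw (2 * PI * Ci) K *
  match K with
  | 0 => recip_sum (frac_part alpha) (frac_part beta) mu nu tau 0
  | 1 => / (Ci * tau) * bcoef (frac_part alpha) mu 0 * bcoef (frac_part beta) nu 0
  | _ => 0
  end.
Proof.
  intros Htau. assert (hp := PI_RGT_0).
  set (t := Ci * tau). set (q := 2 * PI * Ci).
  assert (ht : t <> 0).
  { intros E. assert (E' : Im t = 0%R) by now rewrite E. unfold t in E'. revert E'. reim. lra. }
  assert (q0 : q <> 0) by apply two_pi_i_neq0.
  set (X := frac_part alpha). set (Y := frac_part beta).
  destruct (base_fp alpha) as [hX1 hX2]. destruct (base_fp beta) as [hY1 hY2].
  fold X in hX1, hX2. fold Y in hY1, hY2.
  destruct (ms0_expansion alpha beta mu nu tau Htau) as (r1 & M1 & Hr1 & P1 & H1).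
  destruct (ms0_expansion (- beta) alpha (- nu) mu (/ tau) (Re_Cinv_pos _ Htau)) as (r2 & M2 & Hr2 & P2 & H2).
  fold q in P1, H1, P2, H2.
  set (F1 := fun K => _) in P1. set (F2 := fun K => _) in P2. fold F1 in H1. fold F2 in H2.
  fold Y in H1. fold X in H2. fold t in H1.
  set (c := - / t). assert (hc : c <> 0).
  { unfold c. intros E. apply C1_nz. transitivity (- (t * - / t)); [field; auto|rewrite E; ring]. }
  assert (hcc : (0 < Cmod c)%R) by now apply Cmod_gt_0.
  set (r := Rmin r1 (r2 / Cmod c)).
  assert (hr : (0 < r)%R) by (apply Rmin_glb_lt; [auto|now apply Rdiv_lt_0_compat]).
  assert (hl := Rmin_l r1 (r2 / Cmod c)). assert (hrr := Rmin_r r1 (r2 / Cmod c)). fold r in hl, hrr.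
  assert (hrc : (r * Cmod c <= r2)%R) by (apply Rle_div_r in hrr; auto).
  assert (PC : psum (fun n => F2 n * c ^ n) r M2).
  { eapply asum_le; [|apply (psum_asum _ _ _ (r * c) P2)].
    - intros n. cbv beta. rewrite Cpow_mult_l. right. f_equal. ring.
    - rewrite Cmod_mult, Cmod_R, Rabs_pos_eq by lra. auto. }
  assert (EC : forall z, ps (fun n => F2 n * c ^ n) z = ps F2 (c * z)).
  { intros z. apply tsum_ext. intros n. rewrite Cpow_mult_l. ring. }
  assert (Q1 := psum_shrink _ _ r _ P1 ltac:(lra)).
  assert (L1 := psum_scal (e (alpha * mu)) _ _ _ Q1).
  assert (L2 := psum_scal (/ t * e (beta * nu)) _ _ _ PC).
  assert (LL := psum_plus _ _ _ _ _ L1 L2).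
  set (R0 := recip_sum X Y mu nu tau 0). set (R1 := / t * bcoef X mu 0 * bcoef Y nu 0).
  destruct (psum_mono 0 r) as [N0 HN0]. destruct (psum_mono 1 r) as [N1 HN1].
  assert (G0 := psum_scal R0 _ _ _ HN0). assert (G1 := psum_scal R1 _ _ _ HN1).
  assert (GG := psum_plus _ _ _ _ _ G0 G1).
  assert (U := ps_unique _ _ r _ _ LL GG hr).
  cbv beta in U.
  assert (UK : e (alpha * mu) * F1 K + / t * e (beta * nu) * (F2 K * c ^ K) = R0 * mono 0 K + R1 * mono 1 K).
  { apply U. clear U. intros eps Heps.
    (* The displacement is [u = h] on the left and [u = - h] on the dual side. The two expansion
       variables are then [z = h (1 + t)] and [c z] with [c = - / t], and both sides become series
       in the same [z]. *)
    set (s := 1 + t).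
    assert (hs : s <> 0).
    { intros E. assert (E' : Im s = 0%R) by now rewrite E. unfold s, t in E'. revert E'. reim. lra. }
    assert (hsp : (0 < Cmod s)%R) by now apply Cmod_gt_0.
    (* This keeps [X + h] and [Y + h] below 1 and [|z| = h |s|] below both [eps] and the radius. *)
    set (h := (Rmin (Rmin (1 - X) (1 - Y)) (Rmin eps r / Cmod s) / 2)%R).
    assert (k1 := Rmin_l (Rmin (1 - X) (1 - Y)) (Rmin eps r / Cmod s)).
    assert (k2 := Rmin_r (Rmin (1 - X) (1 - Y)) (Rmin eps r / Cmod s)).
    assert (k3 := Rmin_l (1 - X) (1 - Y)). assert (k4 := Rmin_r (1 - X) (1 - Y)).
    assert (k5 := Rmin_l eps r). assert (k6 := Rmin_r eps r).
    assert (k7 : (0 < Rmin eps r)%R) by now apply Rmin_glb_lt.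
    assert (k8 : (0 < Rmin (Rmin (1 - X) (1 - Y)) (Rmin eps r / Cmod s))%R).
    { repeat apply Rmin_glb_lt; try lra. now apply Rdiv_lt_0_compat. }
    assert (hh : (0 < h)%R /\ (X + h < 1)%R /\ (Y + h < 1)%R /\ (h < Rmin eps r / Cmod s)%R)
      by (unfold h; lra).
    destruct hh as (hh0 & hh1 & hh2 & hh3).
    assert (hh4 : (h * Cmod s < Rmin eps r)%R) by (apply Rlt_div_r in hh3; auto).
    set (z := h * s).
    assert (hz : Cmod z = (h * Cmod s)%R) by (unfold z; rewrite Cmod_mult, Cmod_R, Rabs_pos_eq by lra; auto).
    assert (hzp : (0 < Cmod z)%R) by (rewrite hz; nra).
    assert (hz0 : z <> 0) by now apply Cmod_gt_0.
    exists z. split; [lra|].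
    assert (hzr : (Cmod z <= r)%R) by lra.
    rewrite (ps_plus _ _ r _ _ z L1 L2 hzr), (ps_plus _ _ r _ _ z G0 G1 hzr).
    rewrite (ps_scal _ _ r _ z Q1 hzr), (ps_scal _ _ r _ z PC hzr), (ps_scal _ _ r _ z HN0 hzr),
      (ps_scal _ _ r _ z HN1 hzr), !ps_mono, EC.
    destruct (ms_open_square mu nu tau Htau (X + h) (Y + h) ltac:(lra) ltac:(lra)) as [_ (_ & _ & E)].
    specialize (H1 h h hh0). specialize (H2 (- h)%R h hh0). cbv zeta in H1, H2.
    assert (htau : tau <> 0) by (intros e0; apply ht; unfold t; rewrite e0; ring).
    assert (hCi : Ci <> 0) by (intros e0; apply ht; unfold t; rewrite e0; ring).
    assert (ht' : Ci * / tau = - / t).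
    { transitivity (Ci * Ci * / t); [unfold t; field; auto|]. rewrite Ci2. ring. }
    replace (h + t * h) with z in H1 by (unfold z, s; ring).
    replace ((- h)%R + Ci * / tau * h) with (c * z) in H2
      by (rewrite ht', RtoC_opp; unfold c, z, s; field; auto).
    specialize (H1 ltac:(lra)).
    specialize (H2 ltac:(rewrite Cmod_mult; eapply Rle_trans; [|exact hrc]; rewrite Rmult_comm;
      apply Rmult_le_compat_r; lra)).
    rewrite (tsum_ext _ _ (ms_int_shift 0 (alpha + h) (X + h) (Y + h) mu nu tau (Int_part alpha)
      ltac:(unfold X, frac_part; ring))) in H1.
    rewrite (tsum_ext _ _ (ms_int_shift 0 (- beta + - h) (- (Y + h)) (X + h) (- nu) mu (/ tau)
      (- Int_part beta) ltac:(rewrite opp_IZR; unfold Y, frac_part; ring))) in H2.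
    fold t in E. rewrite H1, H2 in E. clear H1 H2.
    assert (ER : recip_sum (X + h) (Y + h) mu nu tau 0 = e (h * mu) * e (h * nu) * (R0 + R1 * z)).
    { unfold R0, R1, recip_sum, csum. cbn [seq fsum Nat.add Nat.sub Cpow]. fold t.
      rewrite !(bcoef_shift X h mu), !(bcoef_shift Y h nu) by lra.
      destruct (conv_0_3 (pw h) (bcoef X mu)) as (-> & -> & _).
      destruct (conv_0_3 (pw h) (bcoef Y nu)) as (-> & -> & _).
      rewrite !pw_0, !pw_1. unfold z, s. field. auto. }
    rewrite ER in E.
    assert (hp1 := e_neq0 (h * mu)). assert (hp2 := e_neq0 (h * nu)).
    rewrite !e_plus in E.
    replace (- beta * (- nu)%R) with (beta * nu) in E by (rewrite RtoC_opp; ring).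
    replace ((- beta)%R * (- nu)%R) with (beta * nu) in E by (rewrite !RtoC_opp; ring).
    replace ((- h)%R * (- nu)%R) with (h * nu) in E by (rewrite !RtoC_opp; ring).
    assert (EP := kronecker_poles alpha beta mu nu).
    set (p1 := e (h * mu)) in *. set (p2 := e (h * nu)) in *.
    set (A := ps F1 z) in *. set (B := ps F2 (c * z)) in *.
    set (x1 := e (least_pos (- mu) * alpha)) in *. set (x2 := e (least_pos (- - nu) * (- beta)%R)) in *.
    assert (red : forall u v : C, p1 * p2 * u = p1 * p2 * v -> u = v).
    { intros u v huv. transitivity (/ (p1 * p2) * (p1 * p2 * u)); [field; auto|rewrite huv; field; auto]. }
    apply red.
    transitivity (p1 * p2 * (R0 + R1 * z)); [|simpl; ring].
    rewrite <- E. unfold c.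
    transitivity (p1 * p2 * (e (alpha * mu) * A + / t * e (beta * nu) * B
       + / (q * z) * (delta beta * delta alpha * e (beta * nu) * x2 -
                      delta beta * delta alpha * e (alpha * mu) * x1))).
    { rewrite EP. ring. }
    rewrite delta_opp. field. auto. }
  unfold mono in UK. unfold F1, F2 in UK.
  assert (hK : pw q K <> 0).
  { intros E. apply (Cpow_nz q K q0). transitivity (pw q K * INR (fact K)); [|rewrite E; ring].
    unfold pw. field. apply INR_fact_neq0. }
  match goal with |- ?L = _ => transitivity (/ pw q K * (pw q K * L)); [field; auto|] end.
  f_equal.
  transitivity (R0 * (if Nat.eq_dec K 0 then 1 else 0) + R1 * (if Nat.eq_dec K 1 then 1 else 0)).
  - rewrite <- UK. fold c. ring.
  - destruct K as [|[|K]]; simpl; ring.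
Qed.

(** The psi term restores the part at positive [y] that [gzb] subtracts for integral [beta]. The
    condition on [m] makes that term either a convergent series or zero. *)
Lemma brace_ms (m : nat) (alpha beta mu nu : R) (tau : C) : (0 < Re tau)%R ->
  (2 <= m)%nat \/ ~ is_int beta ->
  e (alpha * mu) * brace (Z.of_nat m) alpha beta mu nu tau =
  tsum (ms m alpha (frac_part beta) mu nu tau).
Proof.
  intros Htau Hm.
  destruct (bsum_Z tau Htau (Z.of_nat m) alpha beta mu nu) as [s1 s2].
  set (T := fun n => _) in s1, s2.
  set (G := fun y : R => e (y * alpha) * / Czpow y (Z.of_nat m)).
  set (g := fun n => let y := (IZR n - mu)%R in indic (y <> 0%R) * (G y * pos_ind y)).
  assert (hg : summable (fun n => delta beta * g n) /\
    delta beta * psi (IZR (Z.of_nat m)) (- mu) alpha = tsum (fun n => delta beta * g n)).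
  { destruct (classic (is_int beta)) as [Hb|Hb].
    - destruct (psi_ge2 (- mu) alpha (Z.of_nat m)) as [u1 u2]; [destruct Hm; [lia|tauto]|].
      destruct (positive_sum G mu u1) as [v1 v2]. fold g in v1, v2.
      split; [now apply summable_scal|]. rewrite tsum_scal by auto. now rewrite v2, u2.
    - rewrite (delta_false _ Hb). assert (Hz : forall n, 0 * g n = 0) by (intros; ring).
      split; [exists 0%R; now apply asum_zero|].
      rewrite (tsum_ext _ (fun _ => RtoC 0)) by exact Hz.
      rewrite (has_sum_tsum _ _ has_sum_0). ring. }
  destruct hg as [g1 g2]. unfold brace.
  rewrite g2, <- s2, <- tsum_plus, <- tsum_scal by (try apply summable_plus; auto).
  apply tsum_ext. intros n. unfold g, T, G, ms. set (y := (IZR n - mu)%R).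
  destruct (Req_dec y 0) as [Hy|Hy]; [rewrite !indic_false by lra; ring|].
  rewrite !indic_true by auto.
  replace (e (alpha * IZR n)) with (e (alpha * mu) * e (y * alpha)).
  - rewrite Czpow_of_nat, Cpow_inv by now apply RtoC_neq0. unfold gzb. ring.
  - rewrite <- e_plus. f_equal. unfold y. rewrite RtoC_minus. ring.
Qed.

(** * Assembly of the two formulas *)

Definition reciprocity_term (X Y mu nu : R) (tau : C) (k : Z) (j : nat) : C :=
  (- Ci) ^ j * Ccoef j X mu * Ccoef (Z.to_nat (k + 1) - j) Y nu
  / (INR (fact j) * INR (fact (Z.to_nat (k + 1) - j))) * Czpow tau (k - Z.of_nat j).

Lemma sum_upto_csum (m : nat) a : sum_upto (Z.of_nat m) a = csum a (S m).
Proof.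
  unfold sum_upto. destruct Z_lt_dec; [lia|]. rewrite Nat2Z.id. apply sum_n_fsum.
Qed.

Lemma m_Ci_Ci_pow m : (- Ci) ^ m * Ci ^ m = 1.
Proof.
  rewrite <- Cpow_mult_l.
  replace (- Ci * Ci) with (RtoC 1) by (transitivity (- (Ci * Ci)); [rewrite Ci2; ring|ring]).
  apply Cpow_1_l.
Qed.

Lemma Czpow_sub_nat (z : C) (k : Z) (j : nat) : z <> 0 ->
  Czpow z (k - Z.of_nat j) = Czpow z k * / z ^ j.
Proof.
  intros Hz. induction j as [|j IH].
  - replace (k - Z.of_nat 0)%Z with k by lia. simpl. field.
  - replace (k - Z.of_nat j)%Z with (k - Z.of_nat (S j) + 1)%Z in IH by lia.
    rewrite Czpow_succ in IH by auto.
    transitivity (/ z * (z * Czpow z (k - Z.of_nat (S j)))); [field; auto|].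
    rewrite IH. simpl. field. split; auto. now apply Cpow_nz.
Qed.

(** With [t = i tau], [(2 PI i)^m t^m = (-2 PI)^m tau^m] and [/ t = - i / tau]. *)
Lemma recip_sum_sum_upto (X Y mu nu : R) (tau : C) (m : nat) : tau <> 0 ->
  Czpow (- (2 * PI)) (Z.of_nat m) * sum_upto (Z.of_nat m + 1) (reciprocity_term X Y mu nu tau (Z.of_nat m)) =
  (2 * PI * Ci) ^ m * recip_sum X Y mu nu tau m.
Proof.
  intros Ht. replace (Z.of_nat m + 1)%Z with (Z.of_nat (S m)) by lia.
  rewrite sum_upto_csum. unfold recip_sum. replace (m + 2)%nat with (S (S m)) by lia.
  rewrite <- !csum_scal. apply csum_ext. intros j Hj.
  unfold reciprocity_term, bcoef. replace (Z.to_nat (Z.of_nat m + 1)) with (m + 1)%nat by lia.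
  assert (hi := Ci_nz).
  rewrite Czpow_sub_nat, !Czpow_of_nat by auto.
  replace ((2 * PI * Ci) ^ m) with ((- (2 * PI)) ^ m * (- Ci) ^ m).
  2:{ rewrite <- Cpow_mult_l. f_equal. ring. }
  replace (/ (Ci * tau)) with (- Ci * / tau).
  2:{ transitivity (- (Ci * Ci) / (Ci * tau)); [field; auto|]. rewrite Ci2. field. auto. }
  rewrite !Cpow_mult_l, Cpow_inv by auto.
  transitivity ((- (2 * PI)) ^ m * tau ^ m * ((- Ci) ^ m * Ci ^ m) * (- Ci) ^ j * / tau ^ j
    * (Ccoef j X mu / INR (fact j)) * (Ccoef (m + 1 - j) Y nu / INR (fact (m + 1 - j)))); [|ring].
  rewrite m_Ci_Ci_pow. field. repeat split; try apply INR_fact_neq0. now apply Cpow_nz.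
Qed.

Lemma first_formula (alpha beta mu nu : R) (tau : C) (k : Z) : (0 < Re tau)%R ->
  (k = 1%Z -> ~ is_int alpha /\ ~ is_int beta) ->
  e (alpha * mu) * brace k alpha beta mu nu tau -
    Czpow (- (2 * PI)) k *
    sum_upto (k + 1) (reciprocity_term (frac_part alpha) (frac_part beta) mu nu tau k) =
  e (beta * nu) * Czpow (- Ci * tau) (k - 1) * brace k (- beta) alpha (- nu) mu (/ tau).
Proof.
  intros Htau Hk. assert (hp := PI_RGT_0).
  assert (ht : tau <> 0) by (intros E; rewrite E in Htau; simpl in Htau; lra).
  assert (hi := Ci_nz).
  assert (hmi : - Ci <> 0) by (intros E; apply hi; transitivity (- - Ci); [ring|rewrite E; ring]).
  destruct (Z_le_gt_dec k 0) as [Hle|Hgt].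
  - set (K := Z.to_nat (- k)). assert (EK : k = (- Z.of_nat K)%Z) by lia.
    assert (E := kronecker alpha beta mu nu tau K Htau). rewrite <- EK in E.
    assert (EP : Czpow (- Ci * tau) (k - 1) = - (/ (Ci * tau) * (- / (Ci * tau)) ^ K)).
    { replace (k - 1)%Z with (- Z.of_nat (S K))%Z by lia. rewrite Czpow_opp_of_nat.
      rewrite <- Cpow_inv by (now apply Cmult_neq_0).
      replace (/ (- Ci * tau)) with (- / (Ci * tau)).
      - simpl. ring.
      - field. repeat split; auto. }
    rewrite EP.
    match type of E with _ = ?R => replace (Czpow _ k * sum_upto _ _) with R end.
    { rewrite <- E. ring. }
    (* The sum over [j] has two terms for [k = 0], the single term [j = 0] for [k = -1], and none
       below; these are the three cases on the right of [kronecker]. *)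
    destruct K as [|[|K]].
    + replace k with (Z.of_nat 0) by lia. rewrite recip_sum_sum_upto by auto. unfold pw. simpl. field.
    + replace k with (-1)%Z by lia. unfold sum_upto, reciprocity_term, bcoef, pw. destruct Z_lt_dec; [lia|].
      simpl. rewrite sum_O. simpl.
      assert (hPI : RtoC PI <> 0) by (apply RtoC_neq0; lra).
      set (c := Ccoef 0 (frac_part alpha) mu). set (c' := Ccoef 0 (frac_part beta) nu).
      transitivity (/ (2 * PI * (Ci * Ci) * tau) * c * c'); [field; auto|]. rewrite Ci2. field. auto.
    + unfold sum_upto. destruct Z_lt_dec; [ring|lia].
  - set (m := Z.to_nat k). assert (Em : k = Z.of_nat m) by lia. clearbody m. subst k.
    rewrite recip_sum_sum_upto by auto.
    set (X := frac_part alpha). set (Y := frac_part beta).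
    destruct (base_fp alpha) as [hX1 hX2]. destruct (base_fp beta) as [hY1 hY2].
    fold X in hX1, hX2. fold Y in hY1, hY2.
    assert (hm : (2 <= m)%nat \/ ~ is_int beta) by (destruct (Nat.eq_dec m 1); [right; apply Hk; lia|left; lia]).
    assert (hm' : (2 <= m)%nat \/ ~ is_int alpha) by (destruct (Nat.eq_dec m 1); [right; apply Hk; lia|left; lia]).
    assert (E1 := brace_ms m alpha beta mu nu tau Htau hm).
    assert (E2 := brace_ms m (- beta) alpha (- nu) mu (/ tau) (Re_Cinv_pos _ Htau) hm').
    fold X in E2. fold Y in E1.
    replace ((- beta)%R * (- nu)%R) with (beta * nu) in E2 by (rewrite !RtoC_opp; ring).
    rewrite (tsum_ext _ _ (ms_int_shift m alpha X Y mu nu tau (Int_part alpha)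
      ltac:(unfold X, frac_part; ring))) in E1.
    rewrite (tsum_ext _ _ (ms_int_shift m (- beta) (- Y) X (- nu) mu (/ tau)
      (- Int_part beta) ltac:(rewrite opp_IZR; unfold Y, frac_part; ring))) in E2.
    replace (e (beta * nu) * Czpow (- Ci * tau) (Z.of_nat m - 1) * brace (Z.of_nat m) (- beta) alpha (- nu) mu (/ tau))
      with (Czpow (- Ci * tau) (Z.of_nat m - 1) * tsum (ms m (- Y) X (- nu) mu (/ tau))) by (rewrite <- E2; ring).
    rewrite E1.
    replace (Z.of_nat m - 1)%Z with (Z.of_nat (m - 1)) by lia. rewrite Czpow_of_nat.
    destruct m as [|[|K]]; [lia| |].
    + destruct (Hk eq_refl) as [Ha Hb].
      assert (hX : X <> 0%R) by (intros E; apply Ha; now apply frac_part_eq0).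
      assert (hY : Y <> 0%R) by (intros E; apply Hb; now apply frac_part_eq0).
      destruct (ms_open_square mu nu tau Htau X Y ltac:(lra) ltac:(lra)) as [(_ & _ & E) _].
      simpl Nat.sub. cbn [Cpow]. rewrite Cmult_1_r, <- E. ring.
    + destruct (ms_reciprocity_ge2 mu nu tau Htau X Y K ltac:(lra) ltac:(lra)) as (_ & _ & E).
      rewrite <- E. replace (S (S K) - 1)%nat with (S K) by lia.
      replace (- Ci * tau) with (-1 * (Ci * tau)) by ring. rewrite (Cpow_mult_l (-1)).
      cbn [Cpow]. ring.
Qed.

(** Up to sign [Carg z] is an [acos], so the bound makes its cosine [Re z / Cmod z] positive. *)
Lemma Re_pos_of_Carg (z : C) : z <> 0 -> (Rabs (Carg z) < PI / 2)%R -> (0 < Re z)%R.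
Proof.
  intros Hz H. assert (hm := Cmod_gt_0 z). apply hm in Hz as hz. clear hm.
  set (x := (Re z / Cmod z)%R).
  assert (hr : (Rabs (Re z) <= Cmod z)%R) by (eapply Rle_trans; [apply Rmax_l|apply Rmax_Cmod]).
  assert (hx : (-1 <= x <= 1)%R).
  { apply Rabs_le_between in hr. unfold x. split; [apply Rle_div_r|apply Rle_div_l]; lra. }
  assert (ha : (Rabs (acos x) < PI / 2)%R).
  { revert H. unfold Carg. fold x. destruct Rlt_dec; [now rewrite Rabs_Ropp|auto]. }
  apply Rabs_def2 in ha. assert (hc : (0 < cos (acos x))%R) by (apply cos_gt_0; lra).
  rewrite cos_acos in hc by auto.
  replace (Re z) with (x * Cmod z)%R by (unfold x; field; lra). now apply Rmult_lt_0_compat.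
Qed.

Lemma Czpow_1 k : Czpow 1 k = 1.
Proof. destruct k; simpl; rewrite ?Cpow_1_l; [auto|auto|]. now field. Qed.

Lemma Cinv_neq0 (z : C) : z <> 0 -> / z <> 0.
Proof. intros Hz E. apply C1_nz. transitivity (z * / z); [field; auto|rewrite E; ring]. Qed.

Lemma m_Ci_neq0 : - Ci <> 0.
Proof. intros E. apply Ci_nz. transitivity (- - Ci); [ring|rewrite E; ring]. Qed.

Lemma csum_rev (f : nat -> C) (n : nat) : csum (fun i => f (n - i)%nat) (S n) = csum f (S n).
Proof.
  induction n as [|n IH]; [reflexivity|].
  rewrite (csum_Sl (fun i => f (S n - i)%nat)), (csum_S f (S n)), <- IH. apply Cplus_comm.
Qed.

(** The sum is reversed by [j -> k + 1 - j]; the powers then combine through [(i tau)^(k-1) (-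
    i)^(k+1-j) tau^(1-j) = - i^j tau^(k-j)], which is where the minus sign comes from. *)
Lemma sum_upto_inv (X Y mu nu : R) (tau : C) (k : Z) : tau <> 0 ->
  Czpow (Ci * tau) (k - 1) * sum_upto (k + 1) (reciprocity_term X Y mu nu (/ tau) k) =
  - sum_upto (k + 1) (fun j =>
     Ci ^ j * Ccoef j Y nu * Ccoef (Z.to_nat (k + 1) - j) X mu
     / (INR (fact j) * INR (fact (Z.to_nat (k + 1) - j))) * Czpow tau (k - Z.of_nat j)).
Proof.
  intros Ht. assert (hi := Ci_nz).
  destruct (Z_lt_dec (k + 1) 0) as [Hn|Hn].
  { unfold sum_upto. destruct Z_lt_dec; [ring|lia]. }
  set (m := Z.to_nat (k + 1)). replace (k + 1)%Z with (Z.of_nat m) by lia.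
  rewrite !sum_upto_csum, <- (csum_rev (reciprocity_term X Y mu nu (/ tau) k)), <- csum_scal.
  replace (- csum _ (S m)) with (-1 * csum (fun j => Ci ^ j * Ccoef j Y nu * Ccoef (m - j) X mu
     / (INR (fact j) * INR (fact (m - j))) * Czpow tau (k - Z.of_nat j)) (S m)) by ring.
  rewrite <- csum_scal. apply csum_ext. intros j Hj. unfold reciprocity_term.
  replace (Z.to_nat (k + 1) - (m - j))%nat with j by lia. fold m.
  assert (hb : Czpow (Ci * tau) (k - 1) * ((- Ci) ^ (m - j) * Czpow (/ tau) (k - Z.of_nat (m - j))) =
    - (Ci ^ j * Czpow tau (k - Z.of_nat j))).
  { replace (k - Z.of_nat (m - j))%Z with (Z.of_nat j - 1)%Z by lia.
    rewrite Czpow_mult by auto.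
    replace (k - 1)%Z with (Z.of_nat m - Z.of_nat 2)%Z at 1 by lia.
    replace (k - 1)%Z with (k - Z.of_nat 1)%Z by lia. replace (Z.of_nat j - 1)%Z with (Z.of_nat j - Z.of_nat 1)%Z by lia.
    rewrite !Czpow_sub_nat, !Czpow_of_nat by (auto; now apply Cinv_neq0).
    rewrite (Cpow_inv tau j) by auto.
    transitivity (- (/ (Ci * Ci) * - ((- Ci) ^ (m - j) * Ci ^ m)) * (Czpow tau k * / tau ^ j)).
    - simpl. field. repeat split; auto; now apply Cpow_nz.
    - replace (Ci ^ m) with (Ci ^ (m - j) * Ci ^ j) by (rewrite <- Cpow_add_r; f_equal; lia).
      rewrite (Cmult_assoc ((- Ci) ^ _)), m_Ci_Ci_pow, Ci2. field. now apply Cpow_nz. }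
  transitivity (Czpow (Ci * tau) (k - 1) * ((- Ci) ^ (m - j) * Czpow (/ tau) (k - Z.of_nat (m - j)))
    * (Ccoef j Y nu * Ccoef (m - j) X mu / (INR (fact j) * INR (fact (m - j))))).
  - unfold Cdiv. rewrite (Cmult_comm (RtoC (INR (fact j)))). ring.
  - rewrite hb. unfold Cdiv. ring.
Qed.

Theorem theorem4 (tau : C) (alpha beta mu nu : R) (k : Z)
  (tau_neq0 : tau <> 0) (arg_tau : (Rabs (Carg tau) < PI / 2)%R)
  (k1 : k = 1%Z ->
        (~ exists n : Z, alpha = IZR n) /\ (~ exists n : Z, beta = IZR n)) :
  (e (alpha * mu) *
     (delta beta * psi (IZR k) (- mu) alpha
      + lambert (IZR k) beta (- mu) nu alpha tau
      + Czpow (-1) (k - 1) * lambert (IZR k) (- beta) mu (- nu) (- alpha) tau)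
   - Czpow (- (2 * PI)) k *
     sum_upto (k + 1) (fun j =>
       (- Ci) ^ j * Ccoef j (frac_part alpha) mu
       * Ccoef (Z.to_nat (k + 1) - j) (frac_part beta) nu
       / (INR (fact j) * INR (fact (Z.to_nat (k + 1) - j)))
       * Czpow tau (k - Z.of_nat j))
   = e (beta * nu) * Czpow (- Ci * tau) (k - 1) *
     (delta alpha * psi (IZR k) nu (- beta)
      + lambert (IZR k) alpha nu mu (- beta) (/ tau)
      + Czpow (-1) (k - 1) * lambert (IZR k) (- alpha) (- nu) (- mu) beta (/ tau)))
  /\
  (e (beta * nu) *
     (delta alpha * psi (IZR k) nu (- beta)
      + lambert (IZR k) alpha nu mu (- beta) tau
      + Czpow (-1) (k - 1) * lambert (IZR k) (- alpha) (- nu) (- mu) beta tau)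
   - Czpow (- (2 * PI)) k *
     sum_upto (k + 1) (fun j =>
       Ci ^ j * Ccoef j (frac_part beta) nu
       * Ccoef (Z.to_nat (k + 1) - j) (frac_part alpha) mu
       / (INR (fact j) * INR (fact (Z.to_nat (k + 1) - j)))
       * Czpow tau (k - Z.of_nat j))
   = e (alpha * mu) * Czpow (Ci * tau) (k - 1) *
     (delta beta * psi (IZR k) (- mu) alpha
      + lambert (IZR k) beta (- mu) nu alpha (/ tau)
      + Czpow (-1) (k - 1) * lambert (IZR k) (- beta) mu (- nu) (- alpha) (/ tau))).
Proof.
  assert (Htau := Re_pos_of_Carg tau tau_neq0 arg_tau). assert (hi := Ci_nz).
  assert (B1 : forall T, brace k alpha beta mu nu T =
    delta beta * psi (IZR k) (- mu) alpha + lambert (IZR k) beta (- mu) nu alpha T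
    + Czpow (-1) (k - 1) * lambert (IZR k) (- beta) mu (- nu) (- alpha) T).
  { intros T. unfold brace, bsum. apply Cplus_assoc. }
  assert (B2 : forall T, brace k (- beta) alpha (- nu) mu T =
    delta alpha * psi (IZR k) nu (- beta) + lambert (IZR k) alpha nu mu (- beta) T
    + Czpow (-1) (k - 1) * lambert (IZR k) (- alpha) (- nu) (- mu) beta T).
  { intros T. unfold brace, bsum. rewrite !Ropp_involutive. apply Cplus_assoc. }
  rewrite <- !B1, <- !B2. split.
  - exact (first_formula alpha beta mu nu tau k Htau k1).
  - assert (E := first_formula alpha beta mu nu (/ tau) k (Re_Cinv_pos _ Htau) k1).
    rewrite Cinv_inv in E.
    (* Multiplying the first formula at [/ tau] by [(i tau)^(k-1)] cancels the power on its
       right-hand side and leaves the braces at [tau] there; the result is then read from right to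
       left. *)
    assert (hI : Czpow (Ci * tau) (k - 1) * Czpow (- Ci * / tau) (k - 1) = 1).
    { rewrite <- Czpow_mult by (try apply Cmult_neq_0; auto; try apply m_Ci_neq0; now apply Cinv_neq0).
      replace (Ci * tau * (- Ci * / tau)) with (RtoC 1); [apply Czpow_1|].
      transitivity (- (Ci * Ci)); [rewrite Ci2; ring|field; auto]. }
    assert (S := sum_upto_inv (frac_part alpha) (frac_part beta) mu nu tau k tau_neq0).
    set (P := sum_upto (k + 1) (fun j => _)).
    match type of S with _ = - ?Q => change Q with P in S end.
    set (b1 := brace k alpha beta mu nu (/ tau)) in *. set (b2 := brace k (- beta) _ _ _ tau) in *.
    set (c := Czpow (- (2 * PI)) k) in *. set (d := Czpow (Ci * tau) (k - 1)) in *.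
    set (P' := sum_upto _ _) in E, S.
    transitivity (d * (e (alpha * mu) * b1 - c * P') + c * (d * P')).
    + rewrite E, S.
      transitivity (e (beta * nu) * b2 * (d * Czpow (- Ci * / tau) (k - 1)) - c * P); [rewrite hI|]; ring.
    + ring.
Qed.
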